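(* Let $L=L(q;p_1,\dots,p_n)$ be a lens space. The systole of $L$, i.e. the length of its shortest non-contractible closed geodesic, lies in the singular support of the wave trace $\operatorname{trace}(\exp(-it\sqrt{\Delta_g}))$ of $L$.
   Context: Lens spaces: let $S^{2n-1}$ carry the metric of constant sectional curvature $1$. Fix an integer $q>2$ and integers $p_1,\dots,p_n$ with $p_1=1$ and each $p_i$ relatively prime to $q$. Let $T\in\mathrm{SO}(2n)$ be the block diagonal matrix with $2\times2$ blocks $$\begin{pmatrix}\cos(2\pi p_i/q)&-\sin(2\pi p_i/q)\\ \sin(2\pi p_i/q)&\cos(2\pi p_i/q)\end{pmatrix},\qquad i=1,\dots,n.$$ $T$ generates a cyclic group of order $q$ acting freely by isometries on $S^{2n-1}$, and $L(q;p_1,\dots,p_n)=S^{2n-1}/\langle T\rangle$ with the quotient Riemannian metric. For a closed Riemannian manifold $(M,g)$ with Laplace-Beltrami operator $\Delta_g$ and eigenvalues $0=\lambda_0<\lambda_1\le\lambda_2\le\dots$ (with multiplicity), the wave trace is the tempered distribution on $\mathbb{R}$ $$\operatorname{trace}(\exp(-it\sqrt{\Delta_g}))=\sum_{j=0}^\infty \exp(-it\sqrt{\lambda_j}).$$ *)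

(* Defs.v *)
From HB Require Import structures.
From mathcomp Require Import all_boot all_order all_algebra generic_quotient.
From mathcomp Require Import complex.
From mathcomp Require Import all_classical all_reals all_analysis.

Set Implicit Arguments.
Unset Strict Implicit.
Unset Printing Implicit Defensive.

Import Order.TTheory GRing.Theory Num.Theory.
Import numFieldNormedType.Exports.

Local Open Scope classical_set_scope.
Local Open Scope ring_scope.
Local Open Scope complex_scope.
Local Open Scope quotient_scope.

Section MultivariateCalculus.
Context {R : realType} {m : nat}.
Implicit Types (F : 'cV[R]_m -> R) (U : set 'cV[R]_m).

Definition partial (j : 'I_m) F (x : 'cV[R]_m) : R := 'D_(delta_mx j 0) F x.

Definition smooth_on U F := forall (s : seq 'I_m) x, U x ->
  let G := foldr partial F s in
  {for x, continuous G} /\ forall j, derivable G x (delta_mx j 0).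

Definition sqnorm (x : 'cV[R]_m) : R := \sum_i x i 0 ^+ 2.

End MultivariateCalculus.

(* With n : nat, the sphere below is the unit sphere S^(2n+1) of R^(2n+2): there
   are n + 1 >= 1 coordinate planes, hence n + 1 parameters p_i. *)
Section Sphere.
Context {R : realType} {n : nat}.

Local Notation vec := 'cV[R]_(\sum_(i < n.+1) 2)%N.

Definition sphere : Type := set_type [set x : vec | sqnorm x = 1].
HB.instance Definition _ := Choice.on sphere.
HB.instance Definition _ := Topological.on sphere.

Implicit Types (f : sphere -> R) (X : sphere -> vec).

(* The extension of f to the punctured space that is constant along rays,
   x |-> f (x / |x|), with the value 0 at the origin. *)
Definition radial_ext f (x : vec) : R :=
  oapp f 0 (insub ((Num.sqrt (sqnorm x))^-1 *: x)).

(* f is smooth on the sphere iff it has a smooth extension to a neighbourhood of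
   it, iff its radial extension is smooth. *)
Definition sphere_smooth f := smooth_on [set x : vec | x != 0] (radial_ext f).

(* Orthogonal projection onto the tangent space at x.  The Levi-Civita
   connection of the sphere is the tangential part of the Euclidean one, so for
   any extensions of the function f and of the tangent field X to the ambient
   space the Riemannian gradient of f is the tangential part of the Euclidean
   gradient, and the Riemannian divergence of X is the trace of the tangential
   part of the Euclidean differential. *)
Definition tangent_proj (x : sphere) : 'M[R]_(\sum_(i < n.+1) 2)%N :=
  1%:M - val x *m (val x)^T.

Definition sphere_grad f (x : sphere) : vec :=
  tangent_proj x *m \col_j partial j (radial_ext f) (val x).

Definition sphere_div X (x : sphere) : R :=
  \tr (tangent_proj x *m
       \matrix_(i, j) partial j (radial_ext (fun y => X y i 0)) (val x)).

Definition sphere_laplacian f (x : sphere) : R :=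
  - sphere_div (sphere_grad f) x.

(* Unit-speed geodesics: the covariant acceleration vanishes. *)
Definition sphere_geodesic (gamma : R -> sphere) :=
  let g : R -> vec := fun t => val (gamma t) in
  forall t, [/\ derivable g t 1, derivable (derive1 g) t 1,
                sqnorm (derive1 g t) = 1 &
                tangent_proj (gamma t) *m derive1n 2 g t = 0].

End Sphere.
Arguments sphere : clear implicits.

Definition has_dim {R : realType} {T : Type} (E : set (T -> R)) (d : nat) :=
  exists b : 'I_d -> T -> R, (forall i, E (b i)) /\
    forall f, E f ->
      exists! c : {ffun 'I_d -> R}, forall y, f y = \sum_i c i * b i y.

Section LensSpace.
Context (R : realType) (n q : nat) (p : 'I_n.+1 -> int).

Definition rotation (theta : R) : 'M[R]_2 :=
  \matrix_(i, j) if i == j then cos theta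
                 else if i == 0 then - sin theta else sin theta.

Definition lens_generator : 'M[R]_(\sum_(i < n.+1) 2)%N :=
  \mxdiag_(i < n.+1) rotation (2 * pi * (p i)%:~R / q%:R).

Local Notation T := lens_generator.

Definition same_orbit (x y : sphere R n) : bool :=
  `[< exists k : nat, val y = T ^+ k *m val x >].

Lemma rotationD a b : rotation a *m rotation b = rotation (a + b).
Proof.
apply/matrixP => i j; rewrite !mxE !big_ord_recl big_ord0 !mxE /= addr0.
case: i => [[|[|//]] ?]; case: j => [[|[|//]] ?] /=;
  rewrite ?eqxx /= ?sinD ?cosD ?mulNr ?mulrN ?opprD //.
- by rewrite addrC.
- by rewrite addrC.
Qed.

Lemma cos_sin_int (m : int) :
  cos (2 * pi * m%:~R : R) = 1 /\ sin (2 * pi * m%:~R : R) = 0.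
Proof.
have H (k : nat) : cos (2 * pi * k%:R : R) = 1 /\ sin (2 * pi * k%:R : R) = 0.
  elim: k => [|k [c s]]; first by rewrite mulr0 cos0 sin0.
  rewrite -[k.+1%:R]natr1 mulrDr mulr1 cosD sinD c s.
  have -> : 2 * pi = pi *+ 2 :> R by rewrite mulr_natl.
  by rewrite cos2pi sin2pi !(mulr1, mulr0, subr0, addr0).
case: m => k; first exact: H.
by rewrite NegzE mulrNz mulrN cosN sinN; have [-> ->] := H k.+1; rewrite oppr0.
Qed.

Lemma generatorX k :
  T ^+ k = \mxdiag_(i < n.+1) rotation (k%:R * (2 * pi * (p i)%:~R / q%:R)).
Proof.
have rot0 : rotation 0 = 1%:M.
  apply/matrixP => i j; rewrite !mxE cos0 sin0 oppr0.
  by case: eqP => // _; case: ifP.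
elim: k => [|k IH].
  rewrite expr0 -[1]/(1%:M) -mxdiagZ; apply/eq_mxdiag => i.
  by rewrite mul0r rot0.
rewrite exprS IH -[LHS]/(T *m _) /lens_generator.
rewrite {2}/mxdiag mul_mxdiag_mxblock; apply/eq_mxblock => i j.
case: eqP => [e|_]; last by rewrite mulmx0.
subst j; rewrite !conform_mx_id rotationD; congr rotation.
by rewrite -[k.+1%:R]natr1 [RHS]mulrDl [1 * _]mul1r [LHS]addrC.
Qed.
Lemma same_orbit_refl : reflexive same_orbit.
Proof. by move=> x; apply/asboolP; exists 0; rewrite expr0 mul1mx. Qed.

Lemma mulTX j k (v : 'cV[R]_(\sum_(i < n.+1) 2)%N) :
  T ^+ j *m (T ^+ k *m v) = T ^+ (j + k) *m v.
Proof. by rewrite mulmxA exprD. Qed.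

Lemma generator_order : exists2 m, (0 < m)%N & T ^+ m = 1.
Proof.
exists (if q == 0 then 1 else q)%N; first by case: q.
rewrite generatorX -[RHS]/(1%:M) -mxdiagZ; apply/eq_mxdiag => i.
suff [c s] : cos ((if q == 0 then 1 else q)%:R * (2 * pi * (p i)%:~R / q%:R)) = 1 :> R
  /\ sin ((if q == 0 then 1 else q)%:R * (2 * pi * (p i)%:~R / q%:R)) = 0 :> R.
  apply/matrixP => a b; rewrite !mxE c s oppr0.
  by case: eqP => // _; case: ifP.
case: eqVneq => [->|q0]; first by rewrite invr0 !mulr0 cos0 sin0.
by rewrite mulrC divfK ?pnatr_eq0//; exact: cos_sin_int.
Qed.

Lemma same_orbit_trans : transitive same_orbit.
Proof.
move=> y x z /asboolP[j ej] /asboolP[k ek]; apply/asboolP.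
by exists (k + j)%N; rewrite ek ej mulTX.
Qed.

Lemma same_orbit_sym : symmetric same_orbit.
Proof.
suff H x y : same_orbit x y -> same_orbit y x by move=> x y; apply/idP/idP => /H.
move=> /asboolP[k e]; apply/asboolP; have [m m0 Tm] := generator_order.
exists (m * k - k)%N; rewrite e mulTX subnK ?leq_pmull//.
by rewrite exprM Tm expr1n mul1mx.
Qed.

Canonical same_orbit_equiv :=
  EquivRel same_orbit same_orbit_refl same_orbit_sym same_orbit_trans.

Definition lens_space : Type := quotient_topology {eq_quot same_orbit_equiv}.
HB.instance Definition _ := Quotient.on lens_space.
HB.instance Definition _ := Topological.on lens_space.

Definition lens_proj (x : sphere R n) : lens_space := \pi_lens_space x.

(* The projection from the sphere is a Riemannian covering: functions on the
   lens space are smooth iff their lifts are, and it intertwines the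
   Laplacians.  Real and complex eigenspaces have the same dimension. *)
Definition laplace_eigenspace (mu : R) : set (lens_space -> R) :=
  [set f : lens_space -> R | sphere_smooth (f \o lens_proj) /\
           forall x, sphere_laplacian (f \o lens_proj) x = mu * f (lens_proj x)].

(* lam_0 <= lam_1 <= ... lists the eigenvalues with multiplicity. *)
Definition is_spectrum (lam : nat -> R) :=
  nondecreasing_seq lam /\
  forall mu, exists d, has_dim (laplace_eigenspace mu) d /\
                       ([set j | lam j = mu] #= `I_d)%card.

(* Every geodesic of the lens space lifts to the sphere.  Since c has unit speed,
   ell is the length of the closed geodesic c; periodicity for all t forces the
   velocities at 0 and ell to agree. *)
Definition closed_geodesic (c : R -> lens_space) (ell : R) :=
  [/\ 0 < ell,
      exists2 gamma : R -> sphere R n, sphere_geodesic gamma &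
        c = lens_proj \o gamma
    & forall t, c (t + ell) = c t].

(* Free homotopy of the loop c on [0, ell], through loops, to a constant. *)
Definition contractible_loop (c : R -> lens_space) (ell : R) :=
  exists (H : R * R -> lens_space) (y : lens_space),
    [/\ {within `[0, 1] `*` `[0, ell], continuous H},
        forall t, 0 <= t <= ell -> H (0, t) = c t,
        forall t, 0 <= t <= ell -> H (1, t) = y
      & forall s, 0 <= s <= 1 -> H (s, 0) = H (s, ell)].

Definition noncontractible_lengths : set R :=
  [set ell | exists2 c, closed_geodesic c ell & ~ contractible_loop c ell].

Definition is_systole (ell : R) :=
  noncontractible_lengths ell /\ lbound noncontractible_lengths ell.

End LensSpace.

Section Distributions.
Context {R : realType}.
Implicit Types (f phi : R -> R[i]) (U : set R).

Definition expi (theta : R) : R[i] := cos theta +i* sin theta.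

Definition cintegral f : R[i] :=
  (\int[lebesgue_measure]_t complex.Re (f t)) +i*
  (\int[lebesgue_measure]_t complex.Im (f t)).

Definition climit (u : nat -> R[i]) : R[i] :=
  lim ((fun N => complex.Re (u N)) @ \oo) +i*
  lim ((fun N => complex.Im (u N)) @ \oo).

Definition csmooth_on U f := forall k x, U x ->
  derivable (derive1n k (fun t => complex.Re (f t))) x 1 /\
  derivable (derive1n k (fun t => complex.Im (f t))) x 1.

Definition test_function U phi :=
  [/\ csmooth_on setT phi, compact (closure [set t | phi t != 0]) &
      closure [set t | phi t != 0] `<=` U].

(* A distribution is given by its values on test functions. *)
Definition singular_support (u : (R -> R[i]) -> R[i]) : set R :=
  ~` [set t | exists U f, [/\ open U, U t, csmooth_on U f &
        forall phi, test_function U phi ->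
          u phi = cintegral (fun s => f s * phi s)]].

(* trace(exp(-it sqrt Delta)) = sum_j exp(-it sqrt lam_j); the series converges
   in the sense of tempered distributions. *)
Definition wave_trace (lam : nat -> R) (phi : R -> R[i]) : R[i] :=
  climit (fun N => \sum_(j < N)
    cintegral (fun t => expi (- (t * Num.sqrt (lam j))) * phi t)).

End Distributions.

(* Main.v *)
From HB Require Import structures.
From mathcomp Require Import all_boot all_order all_algebra generic_quotient.
From mathcomp Require Import complex.
From mathcomp Require Import all_classical all_reals all_analysis.
From mathcomp Require Import ring lra zify.
From mathcomp Require mpoly.
Import -(notations) mpoly.
Require Import Defs.

Set Implicit Arguments.
Unset Strict Implicit.
Unset Printing Implicit Defensive.
Import Order.TTheory GRing.Theory Num.Theory.
Import numFieldNormedType.Exports.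
Local Open Scope quotient_scope.
Local Open Scope classical_set_scope.
Local Open Scope ring_scope.
Local Open Scope complex_scope.
Import ComplexField.Normc.
Local Notation Re := complex.Re.
Local Notation Im := complex.Im.

(** The lens space has systole [ell = 2 pi / q]: a closed geodesic lifts to an arc
    of a great circle joining [x] to [T^k x], and the distance between these points
    is at least [ell] when [T^k <> 1]; the arc from [e1] to [T e1] has length
    [ell], and it is not contractible, because a homotopy, cut into a fine grid,
    has a well-defined holonomy in the deck group Z/q.

    The spectrum consists of [k (k + 2 n)] with the multiplicity [d k], the number
    of invariant reduced monomials of degree [k].  The generating function
    [sum_k d k z^k] is rational with its poles at [q]-th roots of unity; it is an
    average over the group, and the group elements that give the pole of maximal
    order at [exp (- i ell)] contribute positive multiples of one nonzero number,
    so they do not cancel.  Write [sqrt (k (k + 2 n)) = k + n - delta k], where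
    [exp (i t delta k)] has an expansion in powers of [1 / (k + n)].  If the wave
    trace were a smooth [f] near [ell], then, with [D] the common denominator of
    the generating function, multiplication by [D (exp (- i t))] would turn it
    into an absolutely convergent series with the continuous sum [G], so
    [G = f D (exp (- i t))] would vanish at [ell].  In [G ell] the corrections in
    negative powers of [k + n] sum to zero by telescoping, and what remains is
    the nonzero value of the numerator at [exp (- i ell)]. *)

(** * Harmonic polynomials in complex coordinates *)

(** The spectrum is only given as a list whose multiplicities are dimensions of eigenspaces of
    smooth functions, so it has to be shown that spherical harmonics exhaust these eigenspaces. This
    is done without a measure on the sphere: the mean of a polynomial is an algebraic functional,
    its positivity and the orthogonality of eigenfunctions come from the maximum principle for the
    resolvent, and a smooth function is paired with polynomials through uniform approximation.
    Complex coordinates are dictated by the group, which acts diagonally on monomials in the [z_i]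
    and their conjugates. The monomials without the factor [z_0 zb_0] index a basis of harmonic
    forms consisting of common eigenvectors, so invariance becomes a condition on exponents. The
    order of the pole at [exp (- i ell)] depends on the [p_i] and is never computed: multiplication
    by the full denominator brings every correction term down to [k ^ -2], whatever that order is.
    Applying all factors but one leaves [k ^ -1], and the last factor then telescopes at [ell]. *)

Section Ladder.
Variables (C : numFieldType) (A : comAlgType C) (L E : {linear A -> A}).
Variables (r : A) (c : C).
Hypothesis Lr : forall p, L (r * p) = r * L p + c *: p + E p.
Hypothesis Er : forall p, E (r * p) = 2 *: (r * p) + r * E p.

Lemma ladderE a h s : E h = a *: h -> E (r ^+ s * h) = (s.*2%:R + a) *: (r ^+ s * h).
Proof.
move=> Eh; elim: s => [|s IH]; first by rewrite expr0 !mul1r add0r.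
rewrite exprS -mulrA Er IH -scalerAr -scalerDl doubleS -addn2 natrD.
by congr (_ *: _); ring.
Qed.

(** The hypotheses are the commutation relations of [sl_2]: [L] lowers, multiplication by [r]
    raises, [E] measures the weight. A vector killed by [L] generates a string on which [L] acts by
    these scalars. *)
Lemma ladderL a h s : L h = 0 -> E h = a *: h ->
  L (r ^+ s.+1 * h) = (s.+1%:R * (s%:R + c + a)) *: (r ^+ s * h).
Proof.
move=> Lh Eh; elim: s => [|s IH].
  by rewrite expr1 expr0 mul1r Lr Lh Eh mulr0 !add0r mul1r scalerDl.
rewrite exprS -mulrA Lr IH (ladderE _ Eh) -scalerAr mulrA -exprS -!scalerDl.
congr (_ *: _); rewrite -muln2 natrM -[s.+2%:R]natr1 -[s.+1%:R]natr1; ring.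
Qed.
End Ladder.

Section BigradedPolynomials.
Variables (C : numFieldType) (n : nat).
Local Notation K := n.+1.
Local Notation N := (K + K)%N.
Local Notation A := (mpoly N C).
Local Notation "''X_' v" := (@mpolyX N C (mnm1 v)) (at level 8, v at level 2, format "''X_' v").
Local Notation mon m := (@mpolyX N C m).
Local Notation "p @_ m" := (@mcoeff N C m p) (at level 3, m at level 2, format "p @_ m").
Implicit Types (p q h g : A) (m : multinom N) (v : 'I_N) (P Q : pred 'I_K).

(** [z_i] and its conjugate are independent variables, indexed by [lshift] and [rshift]. With these
    conventions [lap predT] is a quarter of the Euclidean Laplacian and [rho predT] the squared
    norm. The predicate [P] selects planes: the harmonic completion separates plane [0] from the
    others. *)
Definition dz (i : 'I_K) p : A := mderiv (lshift K i) p.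
Definition dzb (i : 'I_K) p : A := mderiv (rshift K i) p.
Definition zz (i : 'I_K) : A := 'X_(lshift K i).
Definition zb (i : 'I_K) : A := 'X_(rshift K i).
Definition lap P p : A := \sum_(i | P i) dz i (dzb i p).
Definition eul (w : 'I_N -> C) p : A := \sum_v w v *: ('X_v * mderiv v p).
Definition rho P : A := \sum_(i | P i) zz i * zb i.
Definition wof P (v : 'I_N) : C :=
  match fintype.split v with inl i => (P i)%:R | inr i => (P i)%:R end.

Lemma dz_is_linear i : linear (dz i). Proof. exact: linearP. Qed.
HB.instance Definition _ i := GRing.isLinear.Build C A A _ (dz i) (dz_is_linear i).
Lemma dzb_is_linear i : linear (dzb i). Proof. exact: linearP. Qed.
HB.instance Definition _ i := GRing.isLinear.Build C A A _ (dzb i) (dzb_is_linear i).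

Lemma lap_is_linear P : linear (lap P).
Proof.
move=> a p q; rewrite /lap scaler_sumr -big_split /=.
by apply: eq_bigr => i _; rewrite !linearP.
Qed.
HB.instance Definition _ P := GRing.isLinear.Build C A A _ (lap P) (lap_is_linear P).

Lemma eul_is_linear w : linear (eul w).
Proof.
move=> a p q; rewrite /eul scaler_sumr -big_split /=.
apply: eq_bigr => i _; rewrite linearP mulrDr scalerDr; congr (_ + _).
by rewrite -scalerAr !scalerA mulrC.
Qed.
HB.instance Definition _ w := GRing.isLinear.Build C A A _ (eul w) (eul_is_linear w).

Lemma mderivXU v u : mderiv v ('X_u : A) = (v == u)%:R.
Proof.
rewrite mderivX mnm1E eq_sym; case: eqVneq => [->|_]; last by rewrite scale0r.
by rewrite scale1r -[X in mnm_sub X _]add0m addmK mpolyX0.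
Qed.

Lemma lapM P p q : lap P (p * q) = p * lap P q + q * lap P p +
  \sum_(i | P i) (dz i p * dzb i q + dzb i p * dz i q).
Proof.
rewrite /lap !mulr_sumr -!big_split /=; apply: eq_bigr => i _.
by rewrite /dz /dzb !mderivM mderivD !mderivM; ring.
Qed.

Lemma eulM w p q : eul w (p * q) = eul w p * q + p * eul w q.
Proof.
rewrite /eul mulr_suml mulr_sumr -big_split /=; apply: eq_bigr => v _.
by rewrite mderivM -scalerAl -scalerAr -scalerDr; congr (_ *: _); ring.
Qed.

Definition wdeg (w : 'I_N -> C) m : C := \sum_v w v * (m v)%:R.

Lemma eul_mon w m : eul w (mon m) = wdeg w m *: mon m.
Proof.
rewrite /eul /wdeg scaler_suml; apply: eq_bigr => v _.
rewrite mderivX -scalerAr scalerA; case: (posnP (m v)) => [->|mv].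
  by rewrite mulr0 !scale0r.
by rewrite -mpolyXD addmC submK // lep1mP -lt0n.
Qed.

Lemma mcoeff_eul w p m : (eul w p)@_m = wdeg w m * p@_m.
Proof.
elim/mpolyind: p => [|a m' p _ _ IH]; first by rewrite !raddf0 mulr0.
rewrite linearP /= eul_mon !mcoeffD IH !mcoeffZ mulrDr !mcoeffX.
by case: eqVneq => [->|_]; rewrite ?mulr0 //; ring.
Qed.

Lemma eul_var w v : eul w 'X_v = w v *: 'X_v.
Proof.
rewrite eul_mon /wdeg (bigD1 v) //= big1 ?mnm1E ?eqxx ?mulr1 ?addr0 // => u nuv.
by rewrite mnm1E eq_sym (negPf nuv) mulr0.
Qed.

Lemma eul_mderiv w v p : eul w (mderiv v p) = mderiv v (eul w p) - w v *: mderiv v p.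
Proof.
apply/mpolyP => m; rewrite mcoeff_eul mcoeffB mcoeffZ !mcoeff_deriv mcoeff_eul.
rewrite -mulrnAr -mulrBl; congr (_ * _).
suff -> : wdeg w (mnm_add m (mnm1 v)) = wdeg w m + w v by rewrite addrK.
rewrite /wdeg (bigD1 v) //= [in RHS](bigD1 v) //= !mnmDE mnm1E eqxx addn1 -natr1.
under eq_bigr => u nuv do rewrite mnmDE mnm1E eq_sym (negPf nuv) addn0.
by ring.
Qed.

(** The hypothesis covers the degree, with [a = 2], and the gradings that the Laplacian preserves,
    such as the winding number in one plane, with [a = 0]. *)
Lemma eul_lap w P a p : (forall i, P i -> w (lshift K i) + w (rshift K i) = a) ->
  eul w (lap P p) = lap P (eul w p) - a *: lap P p.
Proof.
move=> wP; rewrite /lap raddf_sum scaler_sumr -sumrB /=; apply: eq_bigr => i Pi.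
by rewrite /dz /dzb !eul_mderiv mderivB mderivZ -addrA -opprD -scalerDl addrC -(wP i Pi) addrC [_ + w (rshift _ _)]addrC.
Qed.

Lemma lap_mderiv P v p : lap P (mderiv v p) = mderiv v (lap P p).
Proof.
rewrite /lap raddf_sum; apply: eq_bigr => i _ /=; rewrite /dz /dzb.
by rewrite (mderiv_comm v (rshift K i)) (mderiv_comm v (lshift K i)).
Qed.

Lemma lap_comm P Q p : lap P (lap Q p) = lap Q (lap P p).
Proof.
by rewrite {2}/lap raddf_sum; apply: eq_bigr => i _; rewrite /= /dz /dzb !lap_mderiv.
Qed.

Lemma dz_zz i j : dz i (zz j) = (i == j)%:R.
Proof. by rewrite /dz /zz mderivXU eq_lshift. Qed.
Lemma dz_zb i j : dz i (zb j) = 0.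
Proof. by rewrite /dz /zb mderivXU eq_lrshift. Qed.
Lemma dzb_zz i j : dzb i (zz j) = 0.
Proof. by rewrite /dzb /zz mderivXU eq_rlshift. Qed.
Lemma dzb_zb i j : dzb i (zb j) = (i == j)%:R.
Proof. by rewrite /dzb /zb mderivXU eq_rshift. Qed.

Lemma sum_delta (B : pzRingType) P (F : 'I_K -> B) i :
  \sum_(j | P j) (i == j)%:R * F j = (P i)%:R * F i.
Proof.
case Pi : (P i).
  rewrite (bigD1 i) //= eqxx big1 ?addr0 // => j /andP[_ nji].
  by rewrite eq_sym (negPf nji) mul0r.
rewrite big1 ?mul0r // => j Pj; case: eqVneq => [eij|_]; last by rewrite mul0r.
by rewrite eij Pj in Pi.
Qed.

Lemma dz_rho P i : dz i (rho P) = (P i)%:R * zb i.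
Proof.
rewrite /rho raddf_sum -sum_delta /=; apply: eq_bigr => j _.
by rewrite [dz _ _]mderivM -/(dz _ _) -/(dz _ _) dz_zz dz_zb mulr0 addr0.
Qed.
Lemma dzb_rho P i : dzb i (rho P) = (P i)%:R * zz i.
Proof.
rewrite /rho raddf_sum -sum_delta /=; apply: eq_bigr => j _.
by rewrite [dzb _ _]mderivM -/(dzb _ _) -/(dzb _ _) dzb_zz dzb_zb mul0r add0r mulrC.
Qed.

Lemma wof_l P i : wof P (lshift K i) = (P i)%:R.
Proof. by rewrite /wof (unsplitK (inl i : 'I_K + 'I_K)). Qed.
Lemma wof_r P i : wof P (rshift K i) = (P i)%:R.
Proof. by rewrite /wof (unsplitK (inr i : 'I_K + 'I_K)). Qed.

Lemma eul_wofE P p : eul (wof P) p = \sum_(i | P i) (zz i * dz i p + zb i * dzb i p).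
Proof.
rewrite /eul big_split_ord /= -big_split [RHS]big_mkcond /=; apply: eq_bigr => i _.
by rewrite wof_l wof_r; case: (P i); rewrite ?scale1r ?scale0r ?addr0.
Qed.

Lemma lap_rho P p : lap P (rho P * p) = rho P * lap P p + #|P|%:R *: p + eul (wof P) p.
Proof.
rewrite lapM -!addrA; congr (_ + _).
have -> : lap P (rho P) = #|P|%:R.
  rewrite /lap -sum1_card natr_sum; apply: eq_bigr => i Pi.
  by rewrite dzb_rho Pi mul1r dz_zz eqxx.
rewrite mulr_natr scaler_nat; congr (_ + _); rewrite eul_wofE.
by apply: eq_bigr => i Pi; rewrite dz_rho dzb_rho Pi !mul1r addrC.
Qed.

Lemma eul_rho w P a p : (forall i, P i -> w (lshift K i) + w (rshift K i) = a) ->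
  eul w (rho P * p) = a *: (rho P * p) + rho P * eul w p.
Proof.
move=> wP; rewrite eulM; congr (_ + _); rewrite scalerAl; congr (_ * _).
rewrite /rho raddf_sum scaler_sumr; apply: eq_bigr => i Pi /=.
by rewrite eulM !eul_var -(wP i Pi) -scalerAl -scalerAr scalerDl.
Qed.

Lemma wofD P i : P i -> wof P (lshift K i) + wof P (rshift K i) = 2.
Proof. by move=> Pi; rewrite wof_l wof_r Pi. Qed.

Lemma lap_rhoX P a h s : lap P h = 0 -> eul (wof P) h = a *: h ->
  lap P (rho P ^+ s.+1 * h) = (s.+1%:R * (s%:R + #|P|%:R + a)) *: (rho P ^+ s * h).
Proof.
apply: (@ladderL C A (lap P) (eul (wof P)) (rho P) #|P|%:R); first exact: lap_rho.
by move=> p; apply: eul_rho; apply: wofD.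
Qed.

Lemma eul_rhoX P a h s : eul (wof P) h = a *: h ->
  eul (wof P) (rho P ^+ s * h) = (s.*2%:R + a) *: (rho P ^+ s * h).
Proof.
by apply: ladderE => p; apply: eul_rho; apply: wofD.
Qed.

Local Notation "0m" := (@mnm0 N).

(** * Decomposition of polynomials into harmonic forms *)

Definition lapT := lap predT.
Definition eulT := eul (wof predT).
Definition rhoT := rho predT.
HB.instance Definition _ := GRing.Linear.on lapT.
HB.instance Definition _ := GRing.Linear.on eulT.

Lemma wdegT m : wdeg (wof predT) m = (mdeg m)%:R.
Proof.
rewrite mdegE natr_sum /wdeg big_split_ord [RHS]big_split_ord /=.
by congr (_ + _); apply: eq_bigr => i _; rewrite ?wof_l ?wof_r mul1r.
Qed.

(** Exponents are naturals. Degrees live in [C] so that [k - 2 s] needs no truncation; when it is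
    negative, this lemma makes the form zero. *)
Lemma eulT_eq0 (a : C) p : eulT p = a *: p -> (forall k : nat, a != k%:R) -> p = 0.
Proof.
move=> Ep an; apply/mpolyP => m; rewrite mcoeff0.
have /eqP := congr1 (mcoeff m) Ep; rewrite mcoeff_eul wdegT mcoeffZ -subr_eq0 -mulrBl.
rewrite mulf_eq0 subr_eq0 => /orP[/eqP e|/eqP//].
by have := an (mdeg m); rewrite e eqxx.
Qed.

Definition harm (a : C) h := lapT h = 0 /\ eulT h = a *: h.

Lemma harm0 a : harm a 0. Proof. by split; rewrite ?raddf0 ?scaler0. Qed.

Lemma harmZ a c h : harm a h -> harm a (c *: h).
Proof. by move=> [l e]; split; rewrite linearZ /= ?l ?e ?scaler0 // !scalerA mulrC. Qed.

Lemma harmD a h g : harm a h -> harm a g -> harm a (h + g).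
Proof. by move=> [l e] [l' e']; split; rewrite raddfD /= ?l ?l' ?e ?e' ?addr0 // scalerDr. Qed.

Lemma lapT_rhoX a h s : harm a h ->
  lapT (rhoT ^+ s.+1 * h) = (s.+1%:R * (s%:R + K%:R + a)) *: (rhoT ^+ s * h).
Proof. by move=> [l e]; have := lap_rhoX s l e; rewrite card_ord. Qed.

Lemma eulT_lapT a p : eulT p = a *: p -> eulT (lapT p) = (a - 2) *: lapT p.
Proof.
move=> e; rewrite [LHS](@eul_lap _ _ 2) => [|i _]; last exact: wofD.
by rewrite [eul _ _]e linearZ /= scalerBl.
Qed.

(** Induction on the degree: decompose the Laplacian of [p], lift each summand through the ladder to
    obtain [p'] with the same Laplacian, and take [p - p'] as the new harmonic summand. *)
Lemma hom_decomp k p : eulT p = k%:R *: p ->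
  exists h : nat -> A, (forall s, harm (k%:R - s.*2%:R) (h s)) /\
     p = \sum_(s < k.+1) rhoT ^+ s * h s.
Proof.
elim/ltn_ind: k p => k IH p Ep.
have [k2|k2] := ltnP k 2.
  exists (fun s => if s == 0%N then p else 0); split; last first.
    by rewrite big_ord_recl /= expr0 mul1r big1 ?addr0 // => i _; rewrite mulr0.
  case=> [|s] /=; last exact: harm0.
  rewrite subr0; split => //; apply: (eulT_eq0 (eulT_lapT Ep)) => j.
  by rewrite subr_eq -natrD eqr_nat; lia.
case: k k2 IH Ep => [|[|k]] // _ IH Ep.
have El := eulT_lapT Ep.
have e2 : k.+2%:R - 2 = k%:R :> C by rewrite -addn2 natrD addrK.
rewrite e2 in El.
have [//|h [hh lp]] := IH k _ (lapT p) El.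
pose c s : C := s.+1%:R * (s%:R + K%:R + (k%:R - s.*2%:R)).
(* The factor equals [(s + 1) (n + k - s + 1)]. *)
have c0 s : (s <= k)%N -> c s != 0.
  move=> sk; rewrite mulf_neq0 ?pnatr_eq0 //.
  suff -> : s%:R + K%:R + (k%:R - s.*2%:R) = (n + (k - s)).+1%:R :> C.
    by rewrite pnatr_eq0.
  rewrite -!natrD addrA -natrD -natrB; last by lia.
  by congr (_%:R); lia.
pose p' := \sum_(s < k.+1) rhoT ^+ s.+1 * ((c s)^-1 *: h s).
have lp' : lapT p' = lapT p.
  rewrite lp raddf_sum /=; apply: eq_bigr => s _.
  rewrite -scalerAr linearZ /= (lapT_rhoX _ (hh s)) scalerA mulVf ?scale1r //.
  by apply: c0; have := ltn_ord s; lia.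
have Ep' : eulT p' = k.+2%:R *: p'.
  rewrite raddf_sum scaler_sumr /=; apply: eq_bigr => s _.
  rewrite -scalerAr linearZ /= [eulT _](eul_rhoX _ (hh s).2) !scalerA mulrC.
  congr ((_ * _) *: _); rewrite doubleS -[s.*2.+2]addn2 -[k.+2]addn2 !natrD; ring.
exists (fun s => if s is s'.+1 then (if (s' <= k)%N then (c s')^-1 *: h s' else 0) else p - p'); split.
  case=> [|s]; first by rewrite subr0; split; rewrite raddfB /= ?lp' ?subrr // Ep Ep' scalerBr.
  case: ifP => _; last exact: harm0.
  apply: harmZ; have := hh s; rewrite doubleS -[s.*2.+2]addn2 -[k.+2]addn2 !natrD.
  by congr (harm _ _); ring.
rewrite big_ord_recl /= expr0 mul1r big_ord_recr /= ltnn mulr0 addr0.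
rewrite -[LHS](subrK p'); congr (_ + _); apply: eq_bigr => s _ /=.
by rewrite /bump /= add1n -ltnS ltn_ord.
Qed.

Lemma harm_ind (P : A -> Prop) :
  (forall c p q, P p -> P q -> P (c *: p + q)) ->
  (forall s k h, harm k%:R h -> P (rhoT ^+ s * h)) -> forall p, P p.
Proof.
move=> Plin Ph.
have P0 : P 0 by have := Ph 0%N 0%N 0 (harm0 _); rewrite mulr0.
have PD p q : P p -> P q -> P (p + q).
  by move=> Pp Pq; have := Plin 1 _ _ Pp Pq; rewrite scale1r.
elim/mpolyind => // c m p _ _ Pp; apply: Plin => //.
have e : eulT (mon m) = (mdeg m)%:R *: mon m by rewrite [LHS]eul_mon wdegT.
have [h [hh ->]] := hom_decomp e; apply: (big_ind P) => // s _.
have [sk|sk] := leqP s.*2 (mdeg m).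
  by apply: (@Ph _ (mdeg m - s.*2)%N); rewrite natrB.
suff -> : h s = 0 by rewrite mulr0.
apply: (eulT_eq0 (hh s).2) => j; rewrite subr_eq -natrD eqr_nat; lia.
Qed.

(** Replacing [rho ^ s] by [1] costs a multiple of [rho - 1]. The bound [D] comes with the vanishing
    of all later [h j], so that two decompositions can be brought to a common length and added. *)
Lemma harm_decomp p : exists (h : nat -> A) (D : nat) (q : A),
  [/\ forall j, harm j%:R (h j), forall j, (D <= j)%N -> h j = 0 &
      p = \sum_(j < D) h j + (rhoT - 1) * q].
Proof.
have widen (h : nat -> A) D D' : (D <= D')%N -> (forall j, (D <= j)%N -> h j = 0) ->
    \sum_(j < D) h j = \sum_(j < D') h j.
  move=> DD' h0; rewrite -!(big_mkord xpredT h) [RHS](big_cat_nat (n := D)) //=.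
  by rewrite [X in _ = _ + X]big_nat [X in _ = _ + X]big1 ?addr0 // => j /andP[/h0].
elim/harm_ind: p => [c p q [h [D [r [hh h0 ->]]]] [h' [D' [r' [hh' h0' ->]]]]|s k h hh].
  exists (fun j => c *: h j + h' j), (maxn D D'), (c *: r + r'); split.
  - by move=> j; apply: harmD => //; apply: harmZ.
  - by move=> j; rewrite geq_max => /andP[/h0 -> /h0' ->]; rewrite scaler0 addr0.
  rewrite (widen h _ (maxn D D')) ?leq_maxl // (widen h' _ (maxn D D')) ?leq_maxr //.
  rewrite big_split /= -scaler_sumr scalerDr mulrDr -scalerAr addrACA //.
have [q ->] : exists q, rhoT ^+ s * h = h + (rhoT - 1) * q.
  elim: s => [|s [q IH]]; first by exists 0; rewrite mulr0 expr0 mul1r addr0.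
  by exists (h + rhoT * q); rewrite exprS -mulrA IH; ring.
exists (fun j => if j == k then h else 0), k.+1, q; split.
- by move=> j; case: eqP => [->//|_]; apply: harm0.
- by move=> j; case: eqP => // ->; rewrite ltnn.
congr (_ + _); rewrite big_ord_recr /= eqxx big1 ?add0r // => j _.
by rewrite ltn_eqF.
Qed.

(** * The mean over the sphere as an algebraic functional *)

Definition cmean (s : nat) : C := \prod_(i < s) (i.+1%:R * (i + K)%:R).
Definition lapn s p := iter s lapT p.

Lemma lapn_is_linear s : linear (lapn s).
Proof. by move=> a p q; elim: s => //= s ->; rewrite linearP. Qed.
HB.instance Definition _ s := GRing.isLinear.Build C A A _ (lapn s) (lapn_is_linear s).

Lemma lapnSr s p : lapn s.+1 p = lapn s (lapT p). Proof. exact: iterSr. Qed.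

Lemma eul_lapn w a s p : (forall i, w (lshift K i) + w (rshift K i) = a) ->
  eul w (lapn s p) = lapn s (eul w p) - (s%:R * a) *: lapn s p.
Proof.
move=> wa; elim: s => [|s IH]; first by rewrite mul0r scale0r subr0.
rewrite /= [LHS](@eul_lap _ _ a) => [|i _]; last exact: wa.
rewrite -/(lapT _) -/(lapT _) IH linearB linearZ /= -natr1 mulrDl mul1r scalerDl.
by rewrite opprD addrA.
Qed.

(* The mean over the sphere: [lapT ^ s] of a form of degree [2 s] is [cmean s]
   times the constant in its decomposition into harmonic forms. *)
Definition mean p : C := \sum_(s < msize p) (cmean s)^-1 * (lapn s p)@_0m.

(** [lapn s] lowers the degree by [2 s], so it leaves a constant only in degree exactly [2 s]. Hence
    the sum in [mean] may run to any larger bound, and two polynomials can share one bound in the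
    proof of linearity. *)
Lemma lapn_coef0 s p : (msize p <= s)%N -> (lapn s p)@_0m = 0.
Proof.
move=> ps; rewrite [p]mpolyE raddf_sum /= raddf_sum big_seq big1 // => m mp /=.
rewrite linearZ /= mcoeffZ; have := msize_mdeg_lt mp; set d := mdeg m => dp.
have /(congr1 (mcoeff 0m)) := @eul_lapn (wof predT) 2 s (mon m) (fun i => @wofD predT i isT).
rewrite eul_mon mcoeff_eul wdegT mdeg0 mul0r linearZ mcoeffB !mcoeffZ wdegT -mulrBl => /esym/eqP.
rewrite mulf_eq0 subr_eq0 -natrM eqr_nat => /orP[/eqP e|/eqP ->]; last by rewrite mulr0.
by move: dp; rewrite /d e; lia.
Qed.

Lemma meanE B p : (msize p <= B)%N -> mean p = \sum_(s < B) (cmean s)^-1 * (lapn s p)@_0m.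
Proof.
move=> pB; rewrite -(subnKC pB) big_split_ord /= [X in _ = _ + X]big1 ?addr0 // => i _.
by rewrite lapn_coef0 ?mulr0 //= leq_addr.
Qed.

Lemma mean_is_linear : linear_for *%R mean.
Proof.
move=> a p q; set B := maxn (msize (a *: p + q)) (maxn (msize p) (msize q)).
rewrite !(@meanE B) ?leq_max ?leqnn ?orbT // mulr_sumr -big_split /=.
by apply: eq_bigr => s _; rewrite linearP /= mcoeffD mcoeffZ; ring.
Qed.
HB.instance Definition _ := GRing.isLinear.Build C A C _ mean mean_is_linear.

Lemma meanZ a p : mean (a *: p) = a * mean p. Proof. exact: linearZ. Qed.

Lemma meanB p q : mean (p - q) = mean p - mean q. Proof. exact: linearB. Qed.

Lemma coef0_rho : (rhoT)@_0m = 0.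
Proof.
rewrite raddf_sum big1 //= => i _; rewrite rmorphM /= !mcoeffX.
by rewrite !mnm1_eq0 mul0r.
Qed.

Lemma harm_coef0 a h : harm a h -> a * h@_0m = 0.
Proof.
by move=> [_ /(congr1 (mcoeff 0m))]; rewrite mcoeff_eul wdegT mdeg0 mul0r mcoeffZ.
Qed.

Lemma cmean_neq0 s : cmean s != 0.
Proof. by apply/prodf_neq0 => i _; rewrite mulf_neq0 // pnatr_eq0 ?addnS. Qed.

Lemma lapn_rhoX a h s : harm a h ->
  lapn s (rhoT ^+ s * h) = (\prod_(i < s) (i.+1%:R * (i%:R + K%:R + a))) *: h.
Proof.
move=> hh; elim: s => [|s IH]; first by rewrite big_ord0 expr0 mul1r scale1r.
by rewrite lapnSr (lapT_rhoX _ hh) linearZ /= IH scalerA big_ord_recr /= mulrC.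
Qed.

Lemma lapn_rhoX_coef0 a h s t : harm a h -> s <> t -> (lapn s (rhoT ^+ t * h))@_0m = 0.
Proof.
move=> hh; elim: s t => [|s IH] [|t] st //.
- by rewrite /= exprS -mulrA rmorphM /= coef0_rho mul0r.
- by rewrite expr0 mul1r lapnSr hh.1 !raddf0.
rewrite lapnSr (lapT_rhoX _ hh) linearZ /= mcoeffZ IH ?mulr0 //; lia.
Qed.

Lemma mean_rhoX a h s : harm a h -> mean (rhoT ^+ s * h) = h@_0m.
Proof.
move=> hh; rewrite (@meanE (maxn (msize (rhoT ^+ s * h)) s.+1)) ?leq_maxl //.
have sB : (s < maxn (msize (rhoT ^+ s * h)) s.+1)%N by rewrite leq_maxr.
rewrite (bigD1 (Ordinal sB)) //= [X in _ + X]big1 ?addr0; last first.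
  move=> i ni; rewrite (lapn_rhoX_coef0 hh) ?mulr0 // => e.
  by case/eqP: ni; apply: val_inj.
rewrite (lapn_rhoX _ hh) mcoeffZ.
have [->|a0] := eqVneq (h@_0m) 0; first by rewrite !mulr0.
have /eqP := harm_coef0 hh; rewrite mulf_eq0 (negPf a0) orbF => /eqP az.
rewrite mulrA (_ : \prod_(i < s) _ = cmean s) ?mulVf ?cmean_neq0 ?mul1r //.
by apply: eq_bigr => i _; rewrite az addr0 natrD.
Qed.

Lemma mean1 : mean 1 = 1.
Proof.
have h1 : harm 0 1.
  split; first by rewrite /lapT /lap big1 // => i _; rewrite /dz /dzb mderivC raddf0.
  by rewrite scale0r /eulT /eul big1 // => i _; rewrite mderivC mulr0 scaler0.
by rewrite -[X in mean X]mulr1 -(expr0 rhoT) (mean_rhoX _ h1) mcoeff1 eqxx.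
Qed.

(** By [mean_rhoX] the powers of [rho] do not affect the mean. Consequently [mean] depends only on
    the class of a polynomial modulo the equation of the sphere. *)
Lemma mean_sphere q : mean ((rhoT - 1) * q) = 0.
Proof.
elim/harm_ind: q => [c p q mp mq|s k h hh].
  by rewrite mulrDr -scalerAr linearP /= mp mq mulr0 addr0.
by rewrite mulrBl mul1r mulrA -exprS linearB /= !(mean_rhoX _ hh) subrr.
Qed.

Lemma harm_mderiv v a h : harm a h -> harm (a - 1) (mderiv v h).
Proof.
move=> [l e]; split.
  by rewrite [LHS]lap_mderiv [lap _ _]l raddf0.
rewrite [LHS]eul_mderiv [eul _ _]e mderivZ scalerBl; congr (_ - _); congr (_ *: _).
by rewrite /wof; case: (fintype.split v).
Qed.

(** The Laplacian of a product of harmonic forms is a sum of products of their derivatives, of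
    degrees [a - 1] and [b - 1]: the inequality of the degrees survives until the evaluation at the
    origin. *)
Lemma lapn_harmM s a b h g : harm a h -> harm b g -> a != b -> (lapn s (h * g))@_0m = 0.
Proof.
elim: s a b h g => [|s IH] a b h g hh hg ab.
  rewrite /= rmorphM /=; apply/eqP; rewrite mulf_eq0.
  have /eqP := harm_coef0 hh; have /eqP := harm_coef0 hg.
  rewrite !mulf_eq0 => /orP[/eqP b0|->]; last by rewrite orbT.
  by move=> /orP[/eqP a0|-> //]; rewrite a0 b0 eqxx in ab.
rewrite lapnSr [lapT _]lapM [lap _ g](hg.1) [lap _ h](hh.1) !mulr0 !add0r !raddf_sum big1 // => i _ /=.
rewrite raddfD mcoeffD /= !(IH (a - 1) (b - 1)) ?addr0 //; first [exact: harm_mderiv | by rewrite (inj_eq (addIr _))].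
Qed.

Lemma mean_harmM a b h g : harm a h -> harm b g -> a != b -> mean (h * g) = 0.
Proof.
by move=> hh hg ab; rewrite /mean big1 // => s _; rewrite (lapn_harmM _ hh hg ab) mulr0.
Qed.

(* The Laplacian of the sphere on restrictions of polynomials. *)
Definition slap p : A := eulT (eulT p) + (n.*2)%:R *: eulT p - 4 *: lapT p.

(** On [rho ^ s * h] the mean comes out as [a (a + 2 n)] times the constant term of [h], and
    [harm_coef0] says that [a] times this term is zero. *)
Lemma mean_slap p : mean (slap p) = 0.
Proof.
elim/harm_ind: p => [c p q mp mq|s k h hh].
  have -> : slap (c *: p + q) = c *: slap p + slap q.
    rewrite /slap !linearP /= !scalerDr !scalerN !scalerA.
    move: (c *: eulT _) (eulT (eulT q)) (_ *: eulT p) (_ *: eulT q) (_ *: lapT p) (_ *: lapT q).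
    by move=> x1 x2 x3 x4 x5 x6; ring.
  by rewrite linearP /= mp mq mulr0 addr0.
have E := eul_rhoX s hh.2; rewrite -/rhoT -/eulT in E.
rewrite /slap E linearZ /= E !scalerA -scalerDl meanB !meanZ (mean_rhoX _ hh).
have := harm_coef0 hh; set x := h@_0m => ax.
case: s E => [|s] _.
  rewrite expr0 mul1r hh.1 (raddf0 mean) mulr0 subr0 add0r -mulrDl -mulrA ax mulr0 //.
rewrite (lapT_rhoX _ hh) meanZ (mean_rhoX _ hh) -/x -muln2 natrM -[s.+1%:R]natr1 -[n.+1%:R]natr1 -muln2 natrM.
ring: ax.
Qed.

(** * Powers of a linear form *)

Definition linf (a b : 'I_K -> C) : A := \sum_i (a i *: zz i + b i *: zb i).

Lemma dz_linf a b i : dz i (linf a b) = (a i)%:A.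
Proof.
rewrite /linf raddf_sum (bigD1 i) //= big1 => [|j nji].
  by rewrite linearD !linearZ /= dz_zz dz_zb eqxx scaler0 !addr0.
by rewrite linearD !linearZ /= dz_zz dz_zb eq_sym (negPf nji) !scaler0 addr0.
Qed.

Lemma dzb_linf a b i : dzb i (linf a b) = (b i)%:A.
Proof.
rewrite /linf raddf_sum (bigD1 i) //= big1 => [|j nji].
  by rewrite linearD !linearZ /= dzb_zz dzb_zb eqxx scaler0 add0r addr0.
by rewrite linearD !linearZ /= dzb_zz dzb_zb eq_sym (negPf nji) !scaler0 addr0.
Qed.

Lemma eul_linf a b : eulT (linf a b) = linf a b.
Proof.
rewrite /linf raddf_sum; apply: eq_bigr => i _ /=.
by rewrite /eulT raddfD /= !linearZ /= !eul_var wof_l wof_r !scale1r.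
Qed.

Section Zonal.
Variables a b : 'I_K -> C.
Hypothesis ab : 4 * (\sum_i a i * b i) = 1.
Let t := linf a b.
Let g j := (1 + t) ^+ j.

Lemma eulT1 : eulT 1 = 0.
Proof. by rewrite /eulT /eul big1 // => i _; rewrite mderivC mulr0 scaler0. Qed.

Lemma eul_zonal j : eulT (g j.+1) = j.+1%:R *: (t * g j).
Proof.
elim: j => [|j IH].
  by rewrite /g expr1 expr0 mulr1 scale1r raddfD /= eulT1 add0r eul_linf.
rewrite /g exprS [eulT _]eulM -/(eulT _) -/(eulT _) -/(g _) IH raddfD /= eulT1 add0r eul_linf -/t.
by rewrite -[j.+2%:R]natr1 scalerDl scale1r /g exprS !scaler_nat; ring.
Qed.

Lemma dz_zonal i j : dz i (g j.+1) = (j.+1%:R * a i) *: g j.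
Proof.
have d1 : dz i (1 + t) = (a i)%:A by rewrite raddfD /= dz_linf /dz mderivC add0r.
elim: j => [|j IH]; first by rewrite /g expr1 expr0 mul1r d1.
rewrite /g exprS [dz _ _]mderivM -/(dz _ _) -/(dz _ _) -/(g _) IH d1.
rewrite -scalerAl mul1r -scalerAr /g -exprS -scalerDl -[j.+2%:R]natr1.
by congr (_ *: _); ring.
Qed.

Lemma dzb_zonal i j : dzb i (g j.+1) = (j.+1%:R * b i) *: g j.
Proof.
have d1 : dzb i (1 + t) = (b i)%:A by rewrite raddfD /= dzb_linf /dzb mderivC add0r.
elim: j => [|j IH]; first by rewrite /g expr1 expr0 mul1r d1.
rewrite /g exprS [dzb _ _]mderivM -/(dzb _ _) -/(dzb _ _) -/(g _) IH d1.
rewrite -scalerAl mul1r -scalerAr /g -exprS -scalerDl -[j.+2%:R]natr1.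
by congr (_ *: _); ring.
Qed.

Lemma lap_zonal j : 4 *: lapT (g j.+2) = (j.+2 * j.+1)%:R *: g j.
Proof.
rewrite /lapT /lap; under eq_bigr => i _ do
  rewrite dzb_zonal linearZ /= dz_zonal scalerA.
rewrite -scaler_suml scalerA; congr (_ *: _).
have -> : \sum_(i | predT i) j.+2%:R * b i * (j.+1%:R * a i) =
    j.+2%:R * j.+1%:R * \sum_i a i * b i.
  by rewrite mulr_sumr; apply: eq_bigr => i _; ring.
by rewrite mulrCA ab mulr1 natrM.
Qed.

(** The mean of the Laplacian of [(1 + t) ^ (j + 2)] vanishes. Under the normalization [ab], [t]
    plays the role of the inner product with a unit vector; the identity says that on average
    [1 - t] is of order [1 / j] with respect to the weight [(1 + t) ^ j], so these powers
    concentrate where [t = 1]. *)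
Lemma mean_zonal j :
  (n.*2.+1)%:R * mean (t * (1 + t) ^+ j.+1) = j.+1%:R * mean ((1 - t) * (1 + t) ^+ j.+1).
Proof.
have key : slap (g j.+2) =
    j.+2%:R *: (n.*2.+1%:R *: (t * g j.+1) - j.+1%:R *: ((1 - t) * g j.+1)).
  rewrite /slap eul_zonal linearZ /= [eulT (t * _)]eulM -/(eulT _) -/(eulT _) eul_linf.
  rewrite eul_zonal lap_zonal -/t.
  have -> : g j.+1 = (1 + t) * g j by rewrite /g exprS.
  move: (g j) t => G T; rewrite !scaler_nat -mul2n mulrnA; ring.
have := mean_slap (g j.+2); rewrite key linearZ /= => /eqP; rewrite mulf_eq0 pnatr_eq0 /=.
by rewrite meanB !meanZ subr_eq0 => /eqP.
Qed.

Lemma mean_linf : mean t = 0.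
Proof.
have := mean_slap t; rewrite /slap !eul_linf.
have -> : lapT t = 0.
  rewrite /lapT /lap big1 // => i _; rewrite dzb_linf linearZ /= /dz mderivC scaler0 //.
rewrite scaler0 subr0 -[X in mean (X + _)]scale1r -scalerDl linearZ /= => /eqP.
by rewrite mulf_eq0 addrC natr1 pnatr_eq0 /= => /eqP.
Qed.
End Zonal.

(** * Harmonic completion of reduced monomials *)

Notation l0 := (lshift K (ord0 : 'I_K)).
Notation r0 := (rshift K (ord0 : 'I_K)).

(** Modulo [rho] the product [z_0 zb_0] can be traded for the other [z_i zb_i], so these monomials
    represent the quotient by [rho]. They index a basis of the harmonic forms through [hcompl], as
    [harm_expand] and [mcoeff_hcompl] show. *)
Definition reduced m := (m l0 == 0%N) || (m r0 == 0%N).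
Notation P0 := (pred1 (ord0 : 'I_K)).
Notation P1 := (predC1 (ord0 : 'I_K)).

Lemma lapT_split p : lapT p = lap P0 p + lap P1 p.
Proof. by rewrite /lapT /lap (bigID P0). Qed.

(** Coefficients of a series of Bessel type in [rho P0]: the recurrence [ncoefS] makes the plane-[0]
    Laplacian of each term cancel the Laplacian of the previous term in the other planes. *)
Definition ncoef (s j : nat) : C := (-1) ^+ j * s`!%:R / (j`! * (s + j)`!)%:R.

Definition hcompl m : A :=
  \sum_(j < (mdeg m).+1) ncoef (m l0 + m r0) j *: (rho P0 ^+ j * iter j (lap P1) (mon m)).

Lemma eul_iter w a b P p j : (forall i, w (lshift K i) + w (rshift K i) = a) ->
  eul w p = b *: p -> eul w (iter j (lap P) p) = (b - j%:R * a) *: iter j (lap P) p.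
Proof.
move=> wa e; elim: j => [|j IH]; first by rewrite mul0r subr0.
rewrite /= [LHS](@eul_lap _ _ a) => [|i _]; last exact: wa.
by rewrite IH linearZ /= -scalerBl; congr (_ *: _); rewrite -natr1; ring.
Qed.

Lemma eul_rhoXw w a b P p j : (forall i, w (lshift K i) + w (rshift K i) = a) ->
  eul w p = b *: p -> eul w (rho P ^+ j * p) = (b + j%:R * a) *: (rho P ^+ j * p).
Proof.
move=> wa e; elim: j => [|j IH]; first by rewrite expr0 !mul1r mul0r addr0.
rewrite exprS -mulrA (@eul_rho _ _ a) => [|i _]; last exact: wa.
by rewrite IH -scalerAr -scalerDl; congr (_ *: _); rewrite -natr1; ring.
Qed.

Lemma eul_hcompl w a m : (forall i, w (lshift K i) + w (rshift K i) = a) ->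
  eul w (hcompl m) = wdeg w m *: hcompl m.
Proof.
move=> wa; rewrite /hcompl raddf_sum scaler_sumr; apply: eq_bigr => j _ /=.
rewrite linearZ /= (eul_rhoXw _ _ wa (eul_iter _ _ wa (eul_mon _ _))) !scalerA mulrC.
by congr ((_ * _) *: _); ring.
Qed.

Lemma iter_lap1_eq0 m : iter (mdeg m).+1 (lap P1) (mon m) = 0.
Proof.
have wa i : wof predT (lshift K i) + wof predT (rshift K i) = 2 by rewrite wofD.
apply: (eulT_eq0 (eul_iter _ _ wa (eul_mon _ _))) => k.
rewrite wdegT subr_eq -natrM -natrD eqr_nat; lia.
Qed.

Lemma lap0_mon m : reduced m -> lap P0 (mon m) = 0.
Proof.
rewrite /lap big_pred1_eq /dz /dzb => /orP[]/eqP m0; last first.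
  by rewrite mderivX m0 scale0r raddf0.
by rewrite mderiv_comm mderivX m0 scale0r raddf0.
Qed.

Lemma lap_iter P Q p j : lap P (iter j (lap Q) p) = iter j (lap Q) (lap P p).
Proof. by elim: j => //= j <-; rewrite lap_comm. Qed.

Lemma lap1_rho0 p j : lap P1 (rho P0 ^+ j * p) = rho P0 ^+ j * lap P1 p.
Proof.
elim: j => [|j IH]; first by rewrite expr0 !mul1r.
rewrite exprS -!mulrA -IH lapM [X in _ + X]big1 ?addr0; last first.
  by move=> i /= /negPf i0; rewrite dz_rho dzb_rho /= i0 !mul0r addr0.
rewrite [X in _ + _ * X]big1 ?mulr0 ?addr0 // => i /= /negPf i0.
by rewrite dzb_rho /= i0 mul0r raddf0.
Qed.

Lemma wdeg0 m : wdeg (wof P0) m = (m l0 + m r0)%:R.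
Proof.
rewrite /wdeg big_split_ord natrD; congr (_ + _); rewrite (bigD1 (ord0 : 'I_K)) //= ?wof_l ?wof_r mul1r.
  by rewrite big1 ?addr0 // => i /negPf i0; rewrite wof_l /= i0 mul0r.
by rewrite big1 ?addr0 // => i /negPf i0; rewrite wof_r /= i0 mul0r.
Qed.

Lemma ncoefS s j : ncoef s j.+1 * (j.+1%:R * (j%:R + 1 + s%:R)) = - ncoef s j.
Proof.
rewrite /ncoef addnS !factS !natrM exprS.
have nz1 : j.+1%:R != 0 :> C by rewrite pnatr_eq0.
have nz2 : (s + j).+1%:R != 0 :> C by rewrite pnatr_eq0.
have f1 k : k`!%:R != 0 :> C by rewrite pnatr_eq0 -lt0n fact_gt0.
have -> : j%:R + 1 + s%:R = (s + j).+1%:R :> C by rewrite -[(s + j).+1%:R]natr1 natrD; ring.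
move: nz1 nz2 (f1 j) (f1 (s + j)%N); set x := j.+1%:R; set y := (s + j).+1%:R.
set z := j`!%:R; set w := (s + j)`!%:R => x0 y0 z0 w0.
field; rewrite w0 z0 [1 + (_ + _)]addrC [1 + j%:R]addrC -natrD !natr1.
by rewrite [_ != 0]y0 [_ != 0]x0.
Qed.

Lemma lapT_hcompl m : reduced m -> lapT (hcompl m) = 0.
Proof.
move=> rm; set s := (m l0 + m r0)%N; set D := (mdeg m).+1.
pose L j := iter j (lap P1) (mon m).
have l0L j : lap P0 (L j) = 0.
  by rewrite /L lap_iter lap0_mon //; elim: j => //= j ->; rewrite raddf0.
have e0L j : eul (wof P0) (L j) = s%:R *: L j.
  elim: j => [|j IH]; first by rewrite /L /= eul_mon wdeg0.
  rewrite /L /= (@eul_lap _ _ 0) => [|i /= /negPf i0].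
    by rewrite -/(L j) IH linearZ scale0r subr0.
  by rewrite wof_l wof_r /= i0 addr0.
have l0r j : lap P0 (rho P0 ^+ j.+1 * L j.+1) =
    (j.+1%:R * (j%:R + 1 + s%:R)) *: (rho P0 ^+ j * L j.+1).
  by rewrite (lap_rhoX _ (l0L _) (e0L _)) card1.
rewrite lapT_split /hcompl -/s -/D.
have -> : lap P1 (\sum_(j < D) ncoef s j *: (rho P0 ^+ j * L j)) =
    \sum_(j < D) ncoef s j *: (rho P0 ^+ j * L j.+1).
  by rewrite raddf_sum; apply: eq_bigr => j _; rewrite /= linearZ /= lap1_rho0.
rewrite raddf_sum big_ord_recl /= linearZ /= expr0 mul1r lap0_mon // scaler0 add0r.
rewrite [X in _ + X]big_ord_recr /= [lap P1 (L (mdeg m))]iter_lap1_eq0 mulr0 scaler0 addr0 -big_split big1 // => j _ /=.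
by rewrite linearZ /= /bump /= add1n l0r scalerA ncoefS scaleNr addNr.
Qed.

Lemma harm_hcompl m : reduced m -> harm (mdeg m)%:R (hcompl m).
Proof.
move=> rm; split; first exact: lapT_hcompl.
by rewrite [LHS](@eul_hcompl _ 2) ?wdegT // => i; rewrite wofD.
Qed.

Lemma mcoeff_var0 v m p : m v = 0%N -> ('X_v * p)@_m = 0.
Proof.
move=> mv; elim/mpolyind: p => [|c m' p _ _ IH]; first by rewrite mulr0 mcoeff0.
rewrite mulrDr mcoeffD IH -scalerAr mcoeffZ -mpolyXD mcoeffX addr0.
case: eqP => [e|_]; last by rewrite mulr0.
by move: mv; rewrite -e mnmDE mnm1E eqxx.
Qed.

Lemma mcoeff_hcompl m m' : reduced m' -> (hcompl m)@_m' = (m == m')%:R.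
Proof.
move=> rm; rewrite /hcompl big_ord_recl /= expr0 mul1r /ncoef expr0 fact0 addn0 mul1n mul1r.
rewrite divff ?scale1r; last by rewrite pnatr_eq0 -lt0n fact_gt0.
rewrite mcoeffD mcoeffX raddf_sum big1 ?addr0 // => j _ /=.
rewrite mcoeffZ /bump /= add1n [rho _ ^+ _]exprS -mulrA /rho big_pred1_eq.
case/orP: rm => /eqP m0; first by rewrite -!mulrA mcoeff_var0 ?mulr0.
by rewrite -!mulrA [zz _ * _]mulrCA mcoeff_var0 ?mulr0.
Qed.

(** Induction on the smaller exponent of plane [0]. The coefficient of [lapT h = 0] at [m1]
    expresses the coefficient of [h] at [m] through those at [m1 + pair i] with [i != ord0], for
    which this exponent has dropped by one. *)
Lemma harm_reduced_eq0 h : lapT h = 0 -> (forall m, reduced m -> h@_m = 0) -> h = 0.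
Proof.
move=> lh rh; apply/mpolyP => m; rewrite mcoeff0.
have [t] := ubnP (minn (m l0) (m r0)); elim: t m => // t IH m mt.
have [|nr] := boolP (reduced m); first exact: rh.
pose pair (i : 'I_K) := mnm_add (mnm1 (lshift K i)) (mnm1 (rshift K i)).
pose m1 := mnm_sub m (pair ord0).
have mE : m = mnm_add m1 (pair ord0).
  rewrite /m1 submK //; apply/mnm_lepP => v; rewrite mnmDE !mnm1E.
  move: nr; rewrite negb_or -!lt0n => /andP[ml mr].
  case: (eqVneq l0 v) => [<-|_]; first by rewrite eq_rlshift addn0.
  by case: eqVneq => [<-|].
have cf i : (dz i (dzb i h))@_m1 =
    h@_(mnm_add m1 (pair i)) *+ (m1 (rshift K i)).+1 *+ (m1 (lshift K i)).+1.
  rewrite /dz /dzb !mcoeff_deriv /pair addmA; congr (_ *+ _ *+ _).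
  by rewrite mnmDE mnm1E eq_lrshift addn0.
have /(congr1 (mcoeff m1)) := lh; rewrite mcoeff0 raddf_sum /= (bigD1 ord0) //=.
rewrite big1 ?addr0 => [|i i0].
  rewrite cf -mE => /eqP; rewrite !mulrn_eq0 /= => /eqP //.
rewrite cf IH ?mul0rn //.
have mlr : m1 l0 = (m l0).-1 /\ m1 r0 = (m r0).-1.
  by rewrite /m1 !mnmBE !mnmDE !mnm1E !eqxx eq_lrshift eq_rlshift addn0 add0n !subn1.
rewrite !mnmDE !mnm1E !eq_lshift !eq_rshift eq_lrshift eq_rlshift (negPf i0) !addn0 mlr.1 mlr.2.
move: nr mt; rewrite negb_or -!lt0n; lia.
Qed.

Lemma harm_expand k h : harm k%:R h ->
  h = \sum_(m <- msupp h | reduced m) h@_m *: hcompl m.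
Proof.
move=> [lh eh]; apply/eqP; rewrite -subr_eq0; apply/eqP; apply: harm_reduced_eq0.
  rewrite linearB /= lh sub0r [lapT _](linear_sum lapT) big1 ?oppr0 // => m rm.
  by rewrite /= linearZ /= lapT_hcompl ?scaler0.
move=> m rm; rewrite mcoeffB raddf_sum /=.
under eq_bigr => m' rm' do rewrite mcoeffZ mcoeff_hcompl //.
have [mh|mh] := boolP (m \in msupp h); last first.
  rewrite (memN_msupp_eq0 mh) sub0r big_seq_cond big1 ?oppr0 // => m' /andP[mh' _].
  by case: eqVneq => [e|_]; rewrite ?mulr0 //; rewrite e (negPf mh) in mh'.
rewrite big_mkcond (bigD1_seq m) ?msupp_uniq //= rm eqxx mulr1 big1 ?addr0 ?subrr // => m' /negPf ->.
by rewrite mulr0 if_same.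
Qed.

Lemma harm_mdeg k h m : harm k%:R h -> m \in msupp h -> mdeg m = k.
Proof.
move=> [_ eh] mh; have /(congr1 (mcoeff m)) := eh.
rewrite mcoeff_eul wdegT mcoeffZ => /eqP; rewrite -subr_eq0 -mulrBl mulf_eq0 subr_eq0 eqr_nat.
by rewrite mcoeff_msupp in mh; rewrite (negPf mh) orbF => /eqP.
Qed.

(** * The action of the torus *)

Definition malpha (al : 'I_N -> C) m : C := \prod_v al v ^+ m v.
Definition tau (al : 'I_N -> C) p : A := comp_mpoly [tuple al v *: 'X_v | v < N] p.

Lemma tau_mon al m : tau al (mon m) = malpha al m *: mon m.
Proof.
rewrite /tau comp_mpolyX /malpha (mpolyXE_id C m) -scaler_prod; apply: eq_bigr => v _.
by rewrite tnth_mktuple exprZn.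
Qed.

Lemma tau_is_linear al : linear (tau al). Proof. exact: linearP. Qed.
HB.instance Definition _ al := GRing.isLinear.Build C A A _ (tau al) (tau_is_linear al).

Lemma tauM al p q : tau al (p * q) = tau al p * tau al q.
Proof. exact: rmorphM. Qed.

Lemma mcoeff_tau al p m : (tau al p)@_m = malpha al m * p@_m.
Proof.
elim/mpolyind: p => [|c m' p _ _ IH]; first by rewrite !raddf0 mulr0.
rewrite linearP /= !mcoeffD IH tau_mon !mcoeffZ mulrDr !mcoeffX.
by case: eqVneq => [->|_]; rewrite ?mulr0 //; ring.
Qed.

Lemma meval_tau al x p : meval x (tau al p) = meval (fun v => al v * x v) p.
Proof.
rewrite /tau comp_mpoly_meval; apply: meval_eq => v.
by rewrite tnth_mktuple mevalZ mevalXU.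
Qed.

(** The weight of the rotations of plane [i]. Its values on [z_i] and on the conjugate cancel, so
    its Euler operator commutes with the Laplacian; by [malpha_wind] a character of the torus
    depends on these weights only. Hence every [hcompl m] is an eigenvector of the torus. *)
Definition wind (i : 'I_K) (v : 'I_N) : C :=
  match fintype.split v with inl j => (i == j)%:R | inr j => - (i == j)%:R end.

Lemma wind_l i j : wind i (lshift K j) = (i == j)%:R.
Proof. by rewrite /wind (unsplitK (inl j : 'I_K + 'I_K)). Qed.
Lemma wind_r i j : wind i (rshift K j) = - (i == j)%:R.
Proof. by rewrite /wind (unsplitK (inr j : 'I_K + 'I_K)). Qed.

Lemma wdeg_wind i m : wdeg (wind i) m = (m (lshift K i))%:R - (m (rshift K i))%:R.
Proof.
rewrite /wdeg big_split_ord /= (bigD1 i) //= [X in _ + X](bigD1 i) //= wind_l wind_r eqxx.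
rewrite !big1 => [|j nji|j nji]; last 2 first.
- by rewrite wind_r eq_sym (negPf nji) oppr0 mul0r.
- by rewrite wind_l eq_sym (negPf nji) mul0r.
by rewrite !addr0 mul1r mulN1r.
Qed.

Lemma windD i j : wind i (lshift K j) + wind i (rshift K j) = 0.
Proof. by rewrite wind_l wind_r subrr. Qed.

Section Unitary.
Variable al : 'I_N -> C.
Hypothesis al1 : forall i, al (lshift K i) * al (rshift K i) = 1.

Lemma malpha_wind m m' : (forall i, wdeg (wind i) m = wdeg (wind i) m') ->
  malpha al m = malpha al m'.
Proof.
move=> e; rewrite /malpha !big_split_ord /= -!big_split /=; apply: eq_bigr => i _.
have := e i; rewrite !wdeg_wind => /eqP.
rewrite subr_eq addrAC eq_sym subr_eq -!natrD eqr_nat => /eqP E.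
have [ul ur] : al (lshift K i) \is a GRing.unit /\ al (rshift K i) \is a GRing.unit.
  by apply/andP; rewrite -unitrM al1 unitr1.
apply: (mulIr (unitrX (m (rshift K i) + m' (rshift K i)) ul)).
have : (al (lshift K i) * al (rshift K i)) ^+ (m (rshift K i)) =
       (al (lshift K i) * al (rshift K i)) ^+ (m' (rshift K i)) by rewrite al1 !expr1n.
rewrite !exprMn => F; rewrite exprD.
transitivity (al (lshift K i) ^+ (m (lshift K i) + m' (rshift K i)) *
   (al (lshift K i) ^+ m (rshift K i) * al (rshift K i) ^+ m (rshift K i))).
  by rewrite exprD; ring.
by rewrite F (_ : m _ + _ = m' (lshift K i) + m (rshift K i))%N ?exprD; [ring | lia].
Qed.

(** The Laplacian preserves windings and constants have winding zero, so a monomial with nonzero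
    winding has mean zero; on the other monomials the character is [1]. *)
Lemma mean_tau p : mean (tau al p) = mean p.
Proof.
elim/mpolyind: p => [|c m p _ _ IH]; first by rewrite raddf0.
rewrite !linearP /= IH tau_mon linearZ /=; congr (c * _ + _).
have [/forallP e|/forallPn[i ei]] := boolP [forall i, wdeg (wind i) m == 0].
  rewrite (@malpha_wind m 0m) => [|i]; last first.
    by rewrite (eqP (e i)) /wdeg big1 // => v _; rewrite mnm0E mulr0.
  by rewrite /malpha big1 ?mul1r // => v _; rewrite mnm0E expr0.
suff -> : mean (mon m) = 0 by rewrite mulr0.
rewrite /mean big1 // => s _.
have /(congr1 (mcoeff 0m)) := eul_lapn s (mon m) (windD i).
rewrite mulr0 scale0r subr0 eul_mon linearZ /= mcoeffZ mcoeff_eul => /eqP.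
rewrite {1}/wdeg big1 ?mul0r => [|v _]; last by rewrite mnm0E mulr0.
by rewrite eq_sym mulf_eq0 (negPf ei) /= => /eqP ->; rewrite mulr0.
Qed.

Lemma tau_hcompl m : tau al (hcompl m) = malpha al m *: hcompl m.
Proof.
apply/mpolyP => m'; rewrite mcoeff_tau mcoeffZ.
have [->|nz] := eqVneq ((hcompl m)@_m') 0; first by rewrite !mulr0.
congr (_ * _); apply: malpha_wind => i.
have /(congr1 (mcoeff m')) := eul_hcompl m (windD i).
by rewrite mcoeff_eul mcoeffZ => /(mulIf nz).
Qed.
End Unitary.

(** * Real coordinates and the radially constant extension *)

Section RealCoordinates.
Variable ii : C.
Hypothesis ii2 : ii * ii = -1.

Definition dx (i : 'I_K) p : A := dz i p + dzb i p.
Definition dy (i : 'I_K) p : A := ii *: (dz i p - dzb i p).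
Definition xx (i : 'I_K) : A := 2^-1 *: (zz i + zb i).
Definition yy (i : 'I_K) : A := (- ii / 2) *: (zz i - zb i).

Lemma halfE (u v : A) : u = v + v -> 2^-1 *: u = v.
Proof.
by move=> ->; rewrite -mulr2n -[v *+ 2]scaler_nat scalerA mulVf ?scale1r // pnatr_eq0.
Qed.

Lemma dz_1 i : dz i 1 = 0. Proof. exact: mderivC. Qed.
Lemma dzb_1 i : dzb i 1 = 0. Proof. exact: mderivC. Qed.
Lemma dzM i p q : dz i (p * q) = dz i p * q + p * dz i q. Proof. exact: mderivM. Qed.
Lemma dzbM i p q : dzb i (p * q) = dzb i p * q + p * dzb i q. Proof. exact: mderivM. Qed.
Lemma dzD i p q : dz i (p + q) = dz i p + dz i q. Proof. exact: mderivD. Qed.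
Lemma dzbD i p q : dzb i (p + q) = dzb i p + dzb i q. Proof. exact: mderivD. Qed.
Lemma dzB i p q : dz i (p - q) = dz i p - dz i q. Proof. exact: mderivB. Qed.
Lemma dzbB i p q : dzb i (p - q) = dzb i p - dzb i q. Proof. exact: mderivB. Qed.
Lemma dzZ i c p : dz i (c *: p) = c *: dz i p. Proof. exact: mderivZ. Qed.
Lemma dzbZ i c p : dzb i (c *: p) = c *: dzb i p. Proof. exact: mderivZ. Qed.

Lemma dx_lin i c p q : dx i (c *: p + q) = c *: dx i p + dx i q.
Proof. by rewrite /dx dzD dzbD dzZ dzbZ scalerDr addrACA. Qed.
Lemma dy_lin i c p q : dy i (c *: p + q) = c *: dy i p + dy i q.
Proof.
rewrite /dy dzD dzbD dzZ dzbZ opprD addrACA -scalerBr scalerDr !scalerA.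
by rewrite [c * _]mulrC.
Qed.
Lemma dxM i p q : dx i (p * q) = dx i p * q + p * dx i q.
Proof. by rewrite /dx dzM dzbM; ring. Qed.
Lemma dyM i p q : dy i (p * q) = dy i p * q + p * dy i q.
Proof. by rewrite /dy dzM dzbM -scalerAl -scalerAr -scalerDr; congr (_ *: _); ring. Qed.
Lemma dx_1 i : dx i 1 = 0. Proof. by rewrite /dx dz_1 dzb_1 addr0. Qed.
Lemma dy_1 i : dy i 1 = 0. Proof. by rewrite /dy dz_1 dzb_1 subr0 scaler0. Qed.

Lemma dx_xx i : dx i (xx i) = 1.
Proof.
rewrite /dx /xx dzZ dzbZ dzD dzbD dz_zz dz_zb dzb_zz dzb_zb eqxx addr0 add0r -scalerDr.
exact: halfE.
Qed.

Lemma mII : ii * (- ii / 2) = 2^-1.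
Proof. by rewrite mulrA mulrN ii2 opprK mul1r. Qed.

Lemma dy_yy i : dy i (yy i) = 1.
Proof.
rewrite /dy /yy dzZ dzbZ dzB dzbB dz_zz dz_zb dzb_zz dzb_zb eqxx subr0 sub0r -scalerBr opprK.
rewrite scalerA mII; exact: halfE.
Qed.

Lemma dx_rho i : dx i rhoT = 2 *: xx i.
Proof.
rewrite /dx [dz _ _]dz_rho [dzb _ _]dzb_rho /= !mul1r /xx scalerA mulfV ?pnatr_eq0 // scale1r.
exact: addrC.
Qed.
Lemma dy_rho i : dy i rhoT = 2 *: yy i.
Proof.
rewrite /dy [dz _ _]dz_rho [dzb _ _]dzb_rho /= !mul1r /yy scalerA mulrCA mulfV ?pnatr_eq0 // mulr1.
by rewrite scaleNr -scalerN opprB.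
Qed.

Lemma xy_eul i p : xx i * dx i p + yy i * dy i p = zz i * dz i p + zb i * dzb i p.
Proof.
rewrite /xx /yy /dx /dy -!scalerAl -!scalerAr scalerA [_ * ii]mulrC mII -scalerDr.
apply: halfE; ring.
Qed.

Lemma dxx_dyy i p : dx i (dx i p) + dy i (dy i p) = 4 *: dz i (dzb i p).
Proof.
have com : dzb i (dz i p) = dz i (dzb i p) by exact: mderiv_comm.
rewrite /dx /dy !dzD !dzbD !dzZ !dzbZ -scalerBr scalerA ii2 scaleN1r !dzB !dzbB com scaler_nat.
by ring.
Qed.

Lemma xx_yy i : xx i * xx i + yy i * yy i = zz i * zb i.
Proof.
rewrite /xx /yy -!scalerAl -!scalerAr !scalerA.
have -> : - ii / 2 * (- ii / 2) = - (2^-1 * 2^-1).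
  by rewrite mulrACA mulrNN ii2 mulN1r.
rewrite scaleNr -scalerBr -scalerA; apply: halfE; apply: halfE; ring.
Qed.

Lemma sum_xy_eul p : \sum_i (xx i * dx i p + yy i * dy i p) = eulT p.
Proof. by rewrite /eulT eul_wofE; apply: eq_bigr => i _; rewrite xy_eul. Qed.

(* [rdx], [rdy] express that [p / |x| ^ k] has the derivatives [rdx k p / |x| ^ (k + 2)]. *)
Definition rdx (k : nat) i p : A := rhoT * dx i p - k%:R *: (xx i * p).
Definition rdy (k : nat) i p : A := rhoT * dy i p - k%:R *: (yy i * p).

Lemma dx_scale i (c : nat) p : dx i (c%:R *: p) = c%:R *: dx i p.
Proof. by have := dx_lin i c%:R p 0; rewrite !addr0 /dx !raddf0 addr0 addr0. Qed.
Lemma dxB i p q : dx i (p - q) = dx i p - dx i q.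
Proof. by rewrite /dx dzB dzbB opprD addrACA. Qed.
Lemma dy_scale i (c : nat) p : dy i (c%:R *: p) = c%:R *: dy i p.
Proof. by rewrite /dy dzZ dzbZ -scalerBr !scalerA mulrC. Qed.
Lemma dyB i p q : dy i (p - q) = dy i p - dy i q.
Proof. by rewrite /dy dzB dzbB -scalerBr; congr (_ *: _); rewrite !opprD !opprK addrACA. Qed.

(** This is the numerator of the flat Laplacian of [h / |x| ^ k], the extension of [h] that is
    constant along rays; it is where the eigenvalue [k (k + 2 n)] appears. *)
Lemma rdxx_rdyy k h : harm k%:R h ->
  \sum_i (rdx k.+2 i (rdx k i h) + rdy k.+2 i (rdy k i h)) = - ((k * (k + n.*2))%:R *: (rhoT * h)).
Proof.
move=> [lh eh].
have E i : rdx k.+2 i (rdx k i h) + rdy k.+2 i (rdy k i h) =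
    - ((k + k)%:R *: (rhoT * (xx i * dx i h + yy i * dy i h)))
    + rhoT * rhoT * (4 *: dz i (dzb i h)) - (k + k)%:R *: (rhoT * h)
    + (k * k.+2)%:R *: ((xx i * xx i + yy i * yy i) * h).
  rewrite -dxx_dyy /rdx /rdy !dxB !dyB !dx_scale !dy_scale !dxM !dyM dx_rho dy_rho dx_xx dy_yy.
  rewrite !scaler_nat; ring.
rewrite (eq_bigr _ (fun i _ => E i)) !big_split /= !sumrN -!scaler_sumr -!mulr_sumr -mulr_suml.
rewrite sum_xy_eul eh -scaler_sumr.
have -> : \sum_i dz i (dzb i h) = 0 by exact: lh.
have -> : \sum_i (xx i * xx i + yy i * yy i) = rhoT.
  by rewrite /rhoT /rho; apply: eq_bigr => i _; rewrite xx_yy.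
rewrite sumr_const card_ord scaler0 mulr0 addr0 -addnn !scaler_nat; ring.
Qed.
End RealCoordinates.

End BigradedPolynomials.

(** * The Laplacian of the sphere *)

Section Directional.
Context {R : realType} {V : normedModType R}.
Implicit Types (F : V -> R) (x v : V) (d : R).

Lemma is_derive_lineP F x v d :
  is_derive x v F d <-> is_derive (0 : R) 1 (fun h : R => F (h *: v + x)) d.
Proof.
have e : 'D_v F x = 'D_1 (fun h : R => F (h *: v + x)) 0.
  rewrite /derive; set g1 := fun h => h^-1 *: _; set g2 := fun h => h^-1 *: _.
  suff -> : g1 = g2 by [].
  by apply/funext => h; rewrite /g1 /g2 /= addr0 scale0r add0r [_%:A]mulr1.
split=> -[df <-].
  by rewrite e; exact: (DeriveDef ((derivable1P _ _ _).1 df) erefl).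
by rewrite -e; exact: (DeriveDef ((derivable1P _ _ _).2 df) erefl).
Qed.

End Directional.

Section Directional2.
Context {R : realType} {V : normedModType R}.
Implicit Types (F : V -> R) (x v : V) (d : R).

Lemma is_derive_line F y v (t : R) d : is_derive (y + t *: v) v F d ->
  is_derive t 1 (fun s : R => F (y + s *: v)) d.
Proof.
move/is_derive_lineP => h; apply/is_derive_lineP; move: h.
congr is_derive; apply/funext => s.
by rewrite [_%:A]mulr1 scalerDl addrCA.
Qed.

Lemma is_derive_mulr (c t : R) : is_derive t 1 (fun s : R => s * c) c.
Proof.
have := is_deriveM (is_derive_id t 1) (is_derive_cst c t 1).
by rewrite scaler0 add0r [_%:A]mulr1.
Qed.

Lemma is_derive_mull F x v c d : is_derive x v F d -> is_derive x v (fun z => c * F z) (c * d).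
Proof.
move=> h; have := is_deriveM (is_derive_cst c x v) h.
by rewrite scaler0 addr0.
Qed.

Lemma is_derive_scale F x v c d : is_derive x v F d -> is_derive x (c *: v) F (c * d).
Proof.
move/is_derive_lineP => h; apply/is_derive_lineP.
have -> : (fun s : R => F (s *: (c *: v) + x)) = (fun s => F (s *: v + x)) \o (fun s => s * c).
  by apply/funext => s /=; rewrite scalerA.
have h' : is_derive ((0 : R) * c) 1 (fun s : R => F (s *: v + x)) d by rewrite mul0r.
rewrite mulrC; apply: is_derive1_comp; exact: is_derive_mulr.
Qed.

End Directional2.

Section ContinuouslyDifferentiable.
Context {R : realType} {m : nat}.
Implicit Types (F : 'cV[R]_m -> R) (x v w : 'cV[R]_m).

Let tr (k : nat) w : 'cV[R]_m := \col_j (if (j < k)%N then w j 0 else 0).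

Let trS (k : 'I_m) w : tr k.+1 w = tr k w + w k 0 *: delta_mx k 0.
Proof.
apply/matrixP => i j; rewrite !mxE [j]ord1 eqxx andbT ltnS.
case: ltngtP => [ik|ik|/val_inj ->]; rewrite ?eqxx ?mulr1 ?add0r //.
  by rewrite (_ : (i == k) = false) ?mulr0 ?addr0 //; apply/eqP => e; rewrite e ltnn in ik.
by rewrite (_ : (i == k) = false) ?mulr0 ?addr0 //; apply/eqP => e; rewrite e ltnn in ik.
Qed.

Let norm_tr (k : 'I_m) w t : 0 <= t <= 1 -> `|tr k w + (t * w k 0) *: delta_mx k 0| <= `|w|.
Proof.
move=> /andP[t0 t1]; have wle i j : `|w i j| <= `|w|.
  rewrite [in leRHS]/Num.norm /= mx_normE; exact: (le_bigmax _ (fun ij => `|w ij.1 ij.2|%:nng) (i, j)).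
rewrite [in leLHS]/Num.norm /= mx_normrE; apply: bigmax_le => [|[i j] _ /=].
  exact: (normr_ge0 w).
rewrite !mxE [j]ord1 eqxx andbT; case: ltngtP => [ik|ik|/val_inj ->].
- rewrite (_ : (i == k) = false) ?mulr0 ?addr0 ?wle //; apply/eqP => e; by rewrite e ltnn in ik.
- rewrite (_ : (i == k) = false) ?mulr0 ?addr0 ?normr0 ?normr_ge0 //; apply/eqP => e; by rewrite e ltnn in ik.
rewrite eqxx mulr1 add0r normrM ger0_norm // (le_trans _ (wle k 0)) // ler_piMl //.
Qed.

(** The increment is split into legs parallel to the axes, through the truncations [tr k w], and the
    mean value theorem is applied to each leg. The norm is the maximum norm, so by [norm_tr] no leg
    leaves the ball. Euler's identity needs this, since it differentiates in the direction of the
    point itself. *)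
Lemma C1_is_derive F x v :
  (\forall y \near x, forall j, derivable F y (delta_mx j 0)) ->
  (forall j, {for x, continuous (partial j F)}) ->
  is_derive x v F (\sum_j v j 0 * partial j F x).
Proof.
move=> dF cF.
set S := \sum_j `|v j 0|.
have S0 : 0 <= S by exact: sumr_ge0.
have key (e : R) : 0 < e -> \forall h \near (0 : R),
    `|F (h *: v + x) - F x - h * (\sum_j v j 0 * partial j F x)| <= e * `|h| * S.
  move=> e0.
  have : \forall y \near x, forall j, derivable F y (delta_mx j 0) /\
      `|partial j F y - partial j F x| < e.
    near=> y => j; split; first by move: j; near: y.
    move: j; near: y; apply: filter_forall => j.
    by have /cvgr_distC_lt := cF j; apply.
  move=> /nbhs_ballP[d /= d0 hd].
  have : \forall h \near (0 : R), `|h| * `|v| < d.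
    have c : (fun h : R => `|h| * `|v|) @ (0 : R) --> `|0 : R| * `|v|.
      by apply: cvgM; [apply: cvg_norm; apply: cvg_id | apply: cvg_cst].
    by apply: (cvgr_lt _ c); rewrite normr0 mul0r.
  apply: filterS => h hv; set w := h *: v.
  have wd : `|w| < d by rewrite normrZ.
  have inb (k : 'I_m) t : 0 <= t <= 1 -> ball x d (x + (tr k w + (t * w k 0) *: delta_mx k 0)).
    move=> t01; rewrite -ball_normE /= opprD addrA subrr sub0r normrN.
    exact: le_lt_trans (norm_tr k w t01) wd.
  have step (k : 'I_m) : `|F (x + tr k.+1 w) - F (x + tr k w) - w k 0 * partial k F x| <= e * `|w k 0|.
    have der (t : R) : 0 <= t <= 1 -> is_derive t 1
        (fun s : R => F ((x + tr k w) + s *: (w k 0 *: delta_mx k 0)))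
        (w k 0 * partial k F (x + (tr k w + (t * w k 0) *: delta_mx k 0))).
      move=> t01; apply: is_derive_line; apply: is_derive_scale.
      rewrite scalerA -addrA; apply: DeriveDef => //.
      by have [] := hd _ (inb k t t01) k.
    have [t tin||c cin] := @MVT_segment R
        (fun s : R => F ((x + tr k w) + s *: (w k 0 *: delta_mx k 0)))
        (fun t => w k 0 * partial k F (x + (tr k w + (t * w k 0) *: delta_mx k 0))) 0 1 ler01.
    - by apply: der; move: tin; rewrite in_itv /= => /andP[/ltW -> /ltW ->].
    - apply: derivable_within_continuous => t tin.
      have tin' : 0 <= t <= 1 by move: tin; rewrite in_itv.
      by have [] := der t tin'.
    rewrite subr0 mulr1 scale1r scale0r addr0 => E; rewrite trS addrA E.
    rewrite -mulrBr normrM mulrC ler_wpM2r // ltW //.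
    by have [] := hd _ (inb k c (_ : 0 <= c <= 1)) k; first by move: cin; rewrite in_itv.
  have tele : F (h *: v + x) - F x = \sum_(k < m) (F (x + tr k.+1 w) - F (x + tr k w)).
    rewrite -(big_mkord xpredT (fun k => F (x + tr k.+1 w) - F (x + tr k w))) telescope_sumr //.
    have -> : tr 0 w = 0 by apply/matrixP => i j; rewrite !mxE.
    have -> : tr m w = w by apply/matrixP => i j; rewrite !mxE ltn_ord [j]ord1.
    by rewrite addr0 [x + w]addrC.
  rewrite tele mulr_sumr -sumrB (le_trans (ler_norm_sum _ _ _)) //.
  have -> : e * `|h| * S = \sum_j e * `|w j 0|.
    by rewrite /S mulr_sumr; apply: eq_bigr => j _; rewrite mxE normrM mulrA.
  apply: ler_sum => k _; have := step k; rewrite mxE; congr (_ <= _).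
  by congr (`| _ |); rewrite mulrA.
have cv : h^-1 *: ((F \o shift x) (h *: v) - F x) @[h --> 0^'] --> \sum_j v j 0 * partial j F x.
  apply/cvgrPdist_le => e e0.
  have e0' : 0 < e / (S + 1) by rewrite divr_gt0 // ltr_wpDl.
  have h1 := nbhs_dnbhs (key _ e0'); apply: filterS2 (nbhs_dnbhs_neq (0 : R)) h1 => h h0 hk /=.
  rewrite -[X in X - _](mulKf h0) -[_ *: _]/(_ * _) -mulrBr normrM distrC normfV.
  rewrite ler_pdivrMl ?normr_gt0 // (le_trans hk) // mulrAC mulrC ler_wpM2l //.
  rewrite mulrAC ler_pdivrMr ?ltr_wpDl // ler_pM2l // lerDl //.
by apply: DeriveDef; [apply/cvg_ex; exists (\sum_j v j 0 * partial j F x) | apply: cvg_lim].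
Unshelve. all: by end_near. Qed.

End ContinuouslyDifferentiable.

(** At the maximum [dg 0 = 0]. If [d] were positive, [dg] would be positive just to the right of
    [0], and the mean value theorem would give a larger value of [g] there. *)
Lemma second_derivative_max {R : realType} (g dg : R -> R) (d : R) :
  (\forall t \near (0 : R), is_derive (t : R) (1 : R) g (dg t)) -> is_derive (0 : R) 1 dg d ->
  (\forall t \near (0 : R), g t <= g 0) -> d <= 0.
Proof.
move=> dgn d2 gmax; rewrite leNgt; apply/negP => d0.
have /nbhs_ballP[r /= r0 hr] : \forall t \near (0 : R), is_derive (t : R) (1 : R) g (dg t) /\ g t <= g 0.
  by apply: filterS2 dgn gmax.
have inr t : `|t| < r -> is_derive (t : R) (1 : R) g (dg t) /\ g t <= g 0.
  by move=> tr; apply: hr; rewrite /ball /= sub0r normrN.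
have dg0 : dg 0 = 0.
  have r2 : - (r / 2) <= r / 2 by rewrite (@le_trans _ _ 0) // ?oppr_le0 divr_ge0 // ltW.
  have inb t : t \in `]- (r / 2), r / 2[ -> `|t| < r.
    by rewrite in_itv /= -ltr_norml => /lt_trans; apply; rewrite ltr_pdivrMr // ltr_pMr // ltr1n.
  have dd t : t \in `]- (r / 2), r / 2[ -> derivable g t 1.
    by move=> /inb /inr[[]].
  have zin : 0 \in `]- (r / 2), r / 2[ by rewrite in_itv /= oppr_lt0 divr_gt0.
  have [_ e] := derive1_at_max r2 dd zin (fun t tin => (inr t (inb t tin)).2).
  have [|[_ e'] _] := inr 0; first by rewrite normr0.
  by rewrite -e' e.
have [dd dE] := d2.
have cv : h^-1 *: ((dg \o shift 0) (h *: 1) - dg 0) @[h --> 0^'] --> d by rewrite -dE; exact: dd.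
have /nbhs_ballP[s /= s0 hs] : \forall h \near 0^', 0 < h^-1 *: ((dg \o shift 0) (h *: 1) - dg 0).
  by apply: (cvgr_gt _ cv).
pose h := Num.min r s / 2.
have h0 : 0 < h by rewrite divr_gt0 // lt_min r0.
have hrs : h < r /\ h < s.
  split; (apply: (@lt_le_trans _ _ (Num.min r s)); last by rewrite ge_min lexx ?orbT);
  by rewrite ltr_pdivrMr // ltr_pMr ?ltr1n // lt_min r0.
have [t tin||c cin E] := @MVT _ g dg 0 h h0.
- have tt : `|t| < r.
    move: tin; rewrite in_itv /= => /andP[t0 th]; rewrite gtr0_norm //.
    exact: lt_trans th hrs.1.
  by have [] := inr t tt.
- apply: derivable_within_continuous => t; rewrite in_itv /= => /andP[t0 th].
  have tt : `|t| < r by rewrite ger0_norm // (le_lt_trans th) // hrs.1.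
  by have [[]] := inr t tt.
move: cin; rewrite in_itv /= => /andP[c0 ch].
have := hs c _ (lt0r_neq0 c0).
rewrite /= dg0 subr0 addr0 [_%:A]mulr1 => /(_ _)/wrap[].
  by rewrite /ball /= sub0r normrN gtr0_norm // (lt_trans ch) // hrs.2.
rewrite pmulr_rgt0 ?invr_gt0 // => dc.
have gh : g h <= g 0 by apply: (inr h _).2; rewrite gtr0_norm // hrs.1.
by move: gh; rewrite -subr_le0 E subr0 leNgt mulr_gt0.
Qed.

(** * Radial extensions and Euler's identity *)

Section SphereCalculus.
Context {R : realType} {n : nat}.
Local Notation N := (\sum_(i < n.+1) 2)%N.
Local Notation vec := 'cV[R]_N.
Implicit Types (x v : vec) (f : sphere R n -> R) (y : sphere R n).

Lemma sqnorm_ge0 x : 0 <= sqnorm x.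
Proof. by apply: sumr_ge0 => i _; exact: sqr_ge0. Qed.

Lemma sqnorm_eq0 x : (sqnorm x == 0) = (x == 0).
Proof.
apply/eqP/eqP => [|->]; last by rewrite /sqnorm big1 // => i _; rewrite mxE expr0n.
move/eqP; rewrite psumr_eq0 => [/allP h|i _]; last exact: sqr_ge0.
apply/matrixP => i j; rewrite [j]ord1 mxE.
by have := h i (mem_index_enum _); rewrite sqrf_eq0 => /eqP.
Qed.

Lemma sqnorm_gt0 x : (0 < sqnorm x) = (x != 0).
Proof. by rewrite lt_def sqnorm_ge0 andbT sqnorm_eq0. Qed.

Lemma sqnormZ (c : R) x : sqnorm (c *: x) = c ^+ 2 * sqnorm x.
Proof. by rewrite /sqnorm mulr_sumr; apply: eq_bigr => i _; rewrite mxE exprMn. Qed.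

Lemma sphereP y : sqnorm (val y) = 1.
Proof. by have := valP y; rewrite inE. Qed.

Lemma sphere_neq0 y : val y != 0.
Proof. by rewrite -sqnorm_gt0 sphereP. Qed.

Definition enorm x : R := Num.sqrt (sqnorm x).

Lemma enorm_gt0 x : (0 < enorm x) = (x != 0).
Proof. by rewrite sqrtr_gt0 sqnorm_gt0. Qed.

Lemma enormZ (c : R) x : 0 < c -> enorm (c *: x) = c * enorm x.
Proof.
move=> c0; rewrite /enorm sqnormZ sqrtrM ?sqr_ge0 // sqrtr_sqr gtr0_norm //.
Qed.

Lemma normalize_subproof x : x != 0 -> (enorm x)^-1 *: x \in [set z : vec | sqnorm z = 1].
Proof.
move=> x0; rewrite inE /= sqnormZ exprVn /enorm sqr_sqrtr ?sqnorm_ge0 //.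
by rewrite mulVf // sqnorm_eq0.
Qed.

Definition normalize x (x0 : x != 0) : sphere R n := Sub ((enorm x)^-1 *: x) (normalize_subproof x0).

Lemma radial_extE f x (x0 : x != 0) : radial_ext f x = f (normalize x0).
Proof. rewrite /radial_ext; case: insubP => [u _ e|].
  by congr f; apply: val_inj; rewrite e.
by rewrite normalize_subproof. Qed.

Lemma enorm_sphere y : enorm (val y) = 1.
Proof. by rewrite /enorm sphereP sqrtr1. Qed.

Lemma radial_ext_val f y : radial_ext f (val y) = f y.
Proof.
rewrite (radial_extE _ (sphere_neq0 y)); congr f; apply: val_inj => /=.
by rewrite enorm_sphere invr1 scale1r.
Qed.

(** Homogeneity of degree [- k]: constancy along rays for [k = 0], and each partial derivative
    raises [k] by one. *)
Definition homog (k : nat) (G : vec -> R) :=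
  forall c x, 0 < c -> x != 0 -> G (c *: x) = c^-1 ^+ k * G x.

Lemma homog_radial_ext f : homog 0 (radial_ext f).
Proof.
move=> c x c0 x0; rewrite expr0 mul1r /radial_ext -/(enorm _) -/(enorm _) enormZ //.
by rewrite scalerA invfM -mulrA mulrCA mulVf ?mulr1 // gt_eqF.
Qed.

Lemma near_neq0 x : x != 0 -> \forall z \near x, z != 0.
Proof.
move=> x0; apply/nbhs_ballP; exists `|x|; first by rewrite /= normr_gt0.
move=> z; rewrite -ball_normE /= => xz; apply/eqP => z0.
by rewrite z0 subr0 ltxx in xz.
Qed.

Lemma homog_is_derive k G x v c d : 0 < c -> x != 0 -> homog k G ->
  is_derive x v G d -> is_derive (c *: x) v G (c^-1 ^+ k.+1 * d).
Proof.
move=> c0 x0 hG dG; have cx0 : c *: x != 0 by rewrite scaler_eq0 negb_or gt_eqF.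
have nE : \forall z \near c *: x, c^-1 ^+ k * G (c^-1 *: z) = G z.
  apply: filterS (near_neq0 cx0) => z z0.
  by rewrite hG ?invr_gt0 // invrK mulrA -exprMn mulVf ?gt_eqF // expr1n mul1r.
apply: (near_eq_is_derive nE); apply/is_derive_lineP.
have /is_derive_lineP h := is_derive_scale c^-1 dG.
have -> : (fun h => c^-1 ^+ k * G (c^-1 *: (h *: v + c *: x))) =
   (fun h : R => c^-1 ^+ k * G (h *: (c^-1 *: v) + x)).
  apply/funext => t /=; rewrite scalerDr !scalerA mulVf ?gt_eqF // scale1r.
  by rewrite [c^-1 * t]mulrC.
by rewrite exprSr -mulrA; exact: is_derive_mull.
Qed.

Lemma homog_partial k G j : homog k G ->
  (forall x, x != 0 -> derivable G x (delta_mx j 0)) -> homog k.+1 (partial j G).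
Proof.
move=> hG dG c x c0 x0.
have [] := homog_is_derive c0 x0 hG (DeriveDef (dG x x0) erefl).
by rewrite /partial.
Qed.

Lemma homog_euler k G x : x != 0 -> homog k G ->
  (forall z, z != 0 -> forall j, derivable G z (delta_mx j 0)) ->
  (forall j, {for x, continuous (partial j G)}) ->
  \sum_j x j 0 * partial j G x = - (k%:R * G x).
Proof.
move=> x0 hG dG cG.
have dn : \forall z \near x, forall j, derivable G z (delta_mx j 0).
  by apply: filterS (near_neq0 x0) => z z0 j; apply: dG.
have d1 := C1_is_derive x dn cG.
have d2 : is_derive x x G (- (k%:R * G x)).
  apply/is_derive_lineP.
  have nE : \forall h \near (0 : R), (1 + h)^-1 ^+ k * G x = G (h *: x + x).
    apply/nbhs_ballP; exists 1 => //= h; rewrite /ball /= sub0r normrN ltr_norml => /andP[h1 _].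
    rewrite -{3}[x]scale1r -scalerDl addrC [h + 1]addrC hG // addrC.
    by rewrite -ltrBlDr sub0r.
  apply: (near_eq_is_derive nE).
  have d1h : is_derive (0 : R) (1 : R) (fun h : R => 1 + h) 1.
    by have := is_deriveD (is_derive_cst (1 : R) (0 : R) (1 : R)) (is_derive_id (0 : R) (1 : R)); rewrite add0r.
  have d2h : is_derive (0 : R) (1 : R) (fun h : R => (1 + h)^-1) (-1).
    have nz : (1 : R) + 0 != 0 by rewrite addr0 oner_eq0.
    have := @is_deriveV R (fun h => 1 + h) 0 1 1 nz d1h.
    by rewrite /= addr0 expr1n invr1 [_ *: _]mulr1.
  case: k {hG nE} => [|k].
    rewrite mul0r oppr0; have -> : (fun h : R => (1 + h)^-1 ^+ 0 * G x) = cst (G x) :> (R -> R).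
      by apply/funext => h; rewrite expr0 mul1r.
    exact: is_derive_cst.
  have := is_deriveM (is_deriveX k.+1 d2h) (is_derive_cst (G x) (0 : R) (1 : R)).
  rewrite scaler0 add0r => h.
  have -> : (fun h : R => (1 + h)^-1 ^+ k.+1 * G x) = (fun h : R => (1 + h)^-1) ^+ k.+1 * cst (G x).
    by apply/funext => t; rewrite !fctE.
  apply: (is_derive_eq h).
  have sE (a b : R^o) : a *: b = a * b :> R by [].
  by rewrite !sE /cst addr0 invr1 expr1n; ring.
by have [_ <-] := d1; have [_ ->] := d2.
Qed.

Section Smooth.
Variable f : sphere R n -> R.
Hypothesis fs : sphere_smooth f.
Local Notation F := (radial_ext f).

Lemma smooth_der (s : seq 'I_N) (x : vec) (j : 'I_N) : x != 0 -> derivable (foldr partial F s) x (delta_mx j 0).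
Proof. by move=> x0; have [_ h] := fs s x0; exact: h. Qed.

Arguments smooth_der s x j : clear implicits.

Lemma smooth_cont (s : seq 'I_N) x : x != 0 -> {for x, continuous (foldr partial F s)}.
Proof. by move=> x0; have [] := fs s x0. Qed.
Arguments smooth_cont s x : clear implicits.

Lemma euler0 x : x != 0 -> \sum_j x j 0 * partial j F x = 0.
Proof.
move=> x0; rewrite (@homog_euler 0 F x x0); first by rewrite mul0r oppr0.
- exact: homog_radial_ext.
- by move=> z z0 j; exact: (smooth_der [::] z j z0).
by move=> j; exact: (smooth_cont [:: j] x x0).
Qed.

Lemma homog1 k : homog 1 (partial k F).
Proof.
apply: homog_partial; first exact: homog_radial_ext.
by move=> z z0; exact: (smooth_der [::] z _ z0).
Qed.

Lemma euler1 x k : x != 0 -> \sum_j x j 0 * partial j (partial k F) x = - partial k F x.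
Proof.
move=> x0; rewrite (@homog_euler 1 (partial k F) x x0); first by rewrite mul1r.
- exact: homog1.
- by move=> z z0 j; exact: (smooth_der [:: k] z j z0).
by move=> j; exact: (smooth_cont [:: j; k] x x0).
Qed.

Lemma radial_ext_grad x i : x != 0 ->
  radial_ext (fun y => sphere_grad f y i 0) x = enorm x * partial i F x.
Proof.
move=> x0; rewrite (radial_extE _ x0) /sphere_grad /tangent_proj mulmxBl mul1mx -mulmxA.
set y := normalize x0.
have -> : (val y)^T *m (\col_j partial j F (val y)) = 0.
  apply/matrixP => a b; rewrite [a]ord1 [b]ord1 !mxE -[RHS](euler0 (sphere_neq0 y)).
  by apply: eq_bigr => j _; rewrite !mxE.
rewrite mulmx0 subr0 mxE /= homog1 // ?invr_gt0 ?enorm_gt0 //.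
by rewrite expr1 invrK.
Qed.

Lemma is_derive_enorm x i : x != 0 -> is_derive x (delta_mx i 0) enorm (x i 0 / enorm x).
Proof.
move=> x0; apply/is_derive_lineP.
pose g (h : R) := sqnorm x + h * (2 * x i 0) + h ^+ 2.
have gE h : sqnorm (h *: delta_mx i 0 + x) = g h.
  rewrite /g /sqnorm (bigD1 i) //= [in RHS](bigD1 i) //= !mxE !eqxx.
  rewrite (eq_bigr (fun j => x j 0 ^+ 2)); first by rewrite /= mulr1; ring.
  by move=> j /negPf ji; rewrite !mxE ji mulr0 add0r.
have -> : (fun h : R => enorm (h *: delta_mx i 0 + x)) = Num.sqrt \o g.
  by apply/funext => h; rewrite /enorm gE.
have g0 : g 0 = sqnorm x by rewrite /g mul0r expr0n !addr0.
have dg : is_derive (0 : R) (1 : R) g (2 * x i 0).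
  have := is_deriveD (is_deriveD (is_derive_cst (sqnorm x) (0 : R) (1 : R)) (is_derive_mulr (2 * x i 0) 0))
     (is_deriveX 2 (is_derive_id (0 : R) 1)).
  by rewrite add0r expr1 mulr0 scale0r addr0.
have ds : is_derive (g 0) (1 : R) Num.sqrt (2 * Num.sqrt (g 0))^-1.
  by apply: is_derive1_sqrt; rewrite g0 sqnorm_gt0.
apply: (is_derive_eq (is_derive1_comp ds dg)).
rewrite g0 -/(enorm x) invfM; have e0 : enorm x != 0 by rewrite gt_eqF ?enorm_gt0.
by field.
Qed.

(** The terms of the tangential divergence that contain the projection onto [x] are radial
    derivatives. Euler's identity evaluates them, [euler0] for the extension and [euler1] for its
    gradient, and only the flat Laplacian of the extension survives. *)
Lemma sphere_laplacianE y :
  sphere_laplacian f y = - \sum_i partial i (partial i F) (val y).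
Proof.
have y0 := sphere_neq0 y; set x := val y in y0 *.
rewrite /sphere_laplacian /sphere_div -/x; congr (- _).
have D i j : partial i (radial_ext (fun y => sphere_grad f y j 0)) x =
    partial i (partial j F) x + x i 0 * partial j F x.
  have nE : \near x, enorm x * partial j F x = radial_ext (fun y => sphere_grad f y j 0) x.
    by apply: filterS (near_neq0 y0) => z z0; rewrite radial_ext_grad.
  have h := is_deriveM (is_derive_enorm i y0) (DeriveDef (smooth_der [:: j] _ i y0) erefl).
  have [_] := near_eq_is_derive nE h.
  rewrite /= -/x /partial => ->; rewrite /x enorm_sphere invr1 mulr1 scale1r; congr (_ + _).
  by rewrite -[LHS]/(_ * _) mulrC.
rewrite /mxtrace.
have -> : \sum_i (tangent_proj y *m (\matrix_(i0, j) partial j (radial_ext (fun y0 => sphere_grad f y0 i0 0)) x)) i i =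
  \sum_i \sum_k ((i == k)%:R - x i 0 * x k 0) * (partial i (partial k F) x + x i 0 * partial k F x).
  by apply: eq_bigr => i _; rewrite mxE; apply: eq_bigr => k _; rewrite !mxE big_ord1 !mxE D.
transitivity (\sum_i (partial i (partial i F) x + x i 0 * partial i F x) -
   \sum_i \sum_k x i 0 * x k 0 * (partial i (partial k F) x + x i 0 * partial k F x)).
  rewrite -sumrB; apply: eq_bigr => i _.
  under eq_bigr => k _ do rewrite mulrBl.
  rewrite sumrB; congr (_ - _); rewrite (bigD1 i) //= eqxx mul1r [X in _ + X]big1 ?addr0 // => k.
  by rewrite eq_sym => /negPf ->; rewrite mul0r.
rewrite big_split /= euler0 // addr0.
suff -> : \sum_i \sum_k x i 0 * x k 0 * (partial i (partial k F) x + x i 0 * partial k F x) = 0 by rewrite subr0.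
transitivity (\sum_i \sum_k x k 0 * (x i 0 * partial i (partial k F) x) +
   \sum_i x i 0 ^+ 2 * \sum_k x k 0 * partial k F x).
  rewrite -big_split; apply: eq_bigr => i _ /=; rewrite mulr_sumr -big_split /=.
  by apply: eq_bigr => k _; ring.
rewrite [X in _ + X]big1 ?addr0 => [|i _]; last by rewrite euler0 ?mulr0.
rewrite exchange_big /=; under eq_bigr => k _ do rewrite -mulr_sumr euler1 // mulrN.
by rewrite sumrN euler0 ?oppr0.
Qed.

(** Away from the origin the radial extension takes only values of [f], so it too has a maximum at
    [y] along every coordinate line of the ambient space. This is the core of the maximum
    principle. *)
Lemma sphere_laplacian_at_max y : (forall z, f z <= f y) -> 0 <= sphere_laplacian f y.
Proof.
move=> fmax; rewrite sphere_laplacianE oppr_ge0; apply: sumr_le0 => i _.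
have y0 := sphere_neq0 y; set x := val y in y0 *.
have nz : \forall t \near (0 : R), x + t *: delta_mx i 0 != 0.
  have c : (fun t : R => x + t *: delta_mx i 0) @ (0 : R) --> x + 0 *: delta_mx i 0.
    by apply: cvgD; [exact: cvg_cst | apply: cvgZr_tmp; exact: cvg_id].
  by rewrite scale0r addr0 in c; exact: (c _ (near_neq0 y0)).
apply: (@second_derivative_max R (fun t => F (x + t *: delta_mx i 0)) (fun t => partial i F (x + t *: delta_mx i 0))).
- apply: filterS nz => t t0; apply: is_derive_line; apply: DeriveDef => //; exact: (smooth_der [::] _ _ t0).
- apply: is_derive_line; rewrite scale0r addr0; apply: DeriveDef => //; exact: (smooth_der [:: i] _ _ y0).
by apply: filterS nz => t t0; rewrite scale0r addr0 (radial_extE _ t0) radial_ext_val.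
Qed.

End Smooth.
Arguments smooth_der {f} fs s x j _.
Arguments smooth_cont {f} fs s x _.

End SphereCalculus.
Arguments smooth_der {R n f} fs s x j _.
Arguments smooth_cont {R n f} fs s x _.

(** * Complex-valued functions *)

Section ComplexParts.
Context {R : realType}.
Implicit Types (z w : R[i]) (a : R).

Lemma ReD z w : Re (z + w) = Re z + Re w. Proof. by case: z w => ? ? [? ?]. Qed.
Lemma ImD z w : Im (z + w) = Im z + Im w. Proof. by case: z w => ? ? [? ?]. Qed.
Lemma ReN z : Re (- z) = - Re z. Proof. by case: z. Qed.
Lemma ImN z : Im (- z) = - Im z. Proof. by case: z. Qed.
Lemma ReB z w : Re (z - w) = Re z - Re w. Proof. by rewrite ReD ReN. Qed.
Lemma ImB z w : Im (z - w) = Im z - Im w. Proof. by rewrite ImD ImN. Qed.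
Lemma ReM z w : Re (z * w) = Re z * Re w - Im z * Im w. Proof. by case: z w => ? ? [? ?]. Qed.
Lemma ImM z w : Im (z * w) = Re z * Im w + Im z * Re w. Proof. by case: z w => ? ? [? ?]. Qed.
Lemma ReZ a z : Re (a%:C * z) = a * Re z. Proof. by rewrite ReM /= mul0r subr0. Qed.
Lemma complex_ext z w : Re z = Re w -> Im z = Im w -> z = w.
Proof. by case: z w => ? ? [? ?] /= -> ->. Qed.

Lemma Re_sum (I : Type) (r : seq I) (P : pred I) (F : I -> R[i]) :
  Re (\sum_(i <- r | P i) F i) = \sum_(i <- r | P i) Re (F i).
Proof. by apply: (big_morph (@complex.Re R)) => //; exact: ReD. Qed.
Lemma Im_sum (I : Type) (r : seq I) (P : pred I) (F : I -> R[i]) :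
  Im (\sum_(i <- r | P i) F i) = \sum_(i <- r | P i) Im (F i).
Proof. by apply: (big_morph (@complex.Im R)) => //; exact: ImD. Qed.

Lemma natC (k : nat) : k%:R = (k%:R : R)%:C :> R[i].
Proof. by rewrite rmorph_nat. Qed.
Lemma Re_nat (k : nat) : Re (k%:R : R[i]) = k%:R. Proof. by rewrite natC. Qed.
Lemma Im_nat (k : nat) : Im (k%:R : R[i]) = 0. Proof. by rewrite natC. Qed.

Lemma normc_ge0 z : 0 <= normc z. Proof. by case: z => a b; exact: sqrtr_ge0. Qed.
Lemma Re_le_normc z : `|Re z| <= normc z.
Proof.
case: z => a b /=; rewrite -sqrtr_sqr ler_wsqrtr // lerDl sqr_ge0 //.
Qed.
Lemma Im_le_normc z : `|Im z| <= normc z.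
Proof.
case: z => a b /=; rewrite -sqrtr_sqr ler_wsqrtr // lerDr sqr_ge0 //.
Qed.
Lemma normc_le z : normc z <= `|Re z| + `|Im z|.
Proof.
case: z => a b /=; rewrite -(ger0_norm (addr_ge0 (normr_ge0 a) (normr_ge0 b))) -sqrtr_sqr.
rewrite ler_wsqrtr // sqrrD !real_normK ?num_real // addrAC lerDl.
by rewrite mulrn_wge0 // mulr_ge0.
Qed.
Lemma normc_real a : normc a%:C = `|a|.
Proof. by rewrite /= expr0n addr0 sqrtr_sqr. Qed.
Lemma normc_nat (k : nat) : normc (k%:R : R[i]) = k%:R.
Proof. by rewrite natC normc_real ger0_norm. Qed.
Lemma normc_sum (I : Type) (r : seq I) (P : pred I) (F : I -> R[i]) :
  normc (\sum_(i <- r | P i) F i) <= \sum_(i <- r | P i) normc (F i).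
Proof.
elim/big_rec2: _ => [|i y x _ h]; first by rewrite normc0.
by apply: (le_trans (le_normcD _ _)); rewrite lerD2l.
Qed.
Lemma normcX z k : normc (z ^+ k) = normc z ^+ k.
Proof. by elim: k => [|k IH]; rewrite ?expr0 ?normc1 // !exprS normcM IH. Qed.
Lemma normc_conj z : normc z^*%C = normc z.
Proof. by case: z => a b /=; rewrite sqrrN. Qed.
End ComplexParts.

Section ComplexDerivative.
Context {R : realType} {V : normedModType R}.
Implicit Types (f g : V -> R[i]) (x v : V) (d e : R[i]).

Definition is_cderive x v f d :=
  is_derive x v (fun y => Re (f y)) (Re d) /\ is_derive x v (fun y => Im (f y)) (Im d).

Lemma is_cderive_cst x v d : is_cderive x v (fun=> d) 0.
Proof. by split; exact: is_derive_cst. Qed.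

Lemma is_cderiveD x v f g d e : is_cderive x v f d -> is_cderive x v g e ->
  is_cderive x v (fun y => f y + g y) (d + e).
Proof.
move=> [a b] [a' b']; split.
  under eq_fun do rewrite ReD; rewrite ReD; exact: is_deriveD.
under eq_fun do rewrite ImD; rewrite ImD; exact: is_deriveD.
Qed.

Lemma is_deriveM_mul (f g : V -> R) x v (df dg : R) : is_derive x v f df -> is_derive x v g dg ->
  is_derive x v (fun y => f y * g y) (f x * dg + df * g x).
Proof. by move=> a b; have := is_deriveM a b; rewrite [df * _]mulrC. Qed.

Lemma is_cderiveM x v f g d e : is_cderive x v f d -> is_cderive x v g e ->
  is_cderive x v (fun y => f y * g y) (f x * e + d * g x).
Proof.
move=> [a b] [a' b']; split.
  under eq_fun do rewrite ReM; rewrite ReD !ReM.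
  have := is_deriveB (is_deriveM_mul a a') (is_deriveM_mul b b').
  move=> h; apply: (is_derive_eq h); ring.
under eq_fun do rewrite ImM; rewrite ImD !ImM.
have := is_deriveD (is_deriveM_mul a b') (is_deriveM_mul b a').
move=> h; apply: (is_derive_eq h); ring.
Qed.

Definition ccontinuous_at f x :=
  {for x, continuous (fun y => Re (f y))} /\ {for x, continuous (fun y => Im (f y))}.

Lemma ccontinuous_cst x d : ccontinuous_at (fun=> d) x.
Proof. by split; exact: cvg_cst. Qed.
Lemma ccontinuousD x f g : ccontinuous_at f x -> ccontinuous_at g x ->
  ccontinuous_at (fun y => f y + g y) x.
Proof.
move=> [a b] [a' b']; split.
  rewrite (_ : (fun y => _) = (fun y => Re (f y)) \+ (fun y => Re (g y))); first exact: continuousD.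
  by apply/funext => y; rewrite ReD.
rewrite (_ : (fun y => _) = (fun y => Im (f y)) \+ (fun y => Im (g y))); first exact: continuousD.
by apply/funext => y; rewrite ImD.
Qed.
Lemma ccontinuousM x f g : ccontinuous_at f x -> ccontinuous_at g x ->
  ccontinuous_at (fun y => f y * g y) x.
Proof.
move=> [a b] [a' b']; split.
  rewrite (_ : (fun y => _) = (fun y => Re (f y)) \* (fun y => Re (g y)) \- (fun y => Im (f y)) \* (fun y => Im (g y))).
    by apply: continuousB; exact: continuousM.
  by apply/funext => y; rewrite ReM.
rewrite (_ : (fun y => _) = (fun y => Re (f y)) \* (fun y => Im (g y)) \+ (fun y => Im (f y)) \* (fun y => Re (g y))).
  by apply: continuousD; exact: continuousM.
by apply/funext => y; rewrite ImM.
Qed.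
End ComplexDerivative.

(** * Polynomials on the sphere *)

Lemma near_continuous {R : realType} {T : topologicalType} (F G : T -> R) (x : T) :
  (\forall z \near x, F z = G z) -> {for x, continuous F} -> {for x, continuous G}.
Proof.
move=> e cF; apply/cvgrPdist_lt => d d0; rewrite -(nbhs_singleton e).
have /cvgrPdist_lt /(_ d d0) := cF; apply: filterS2 e => z ez.
by rewrite ez.
Qed.

Section SpherePolynomials.
Context {R : realType} {n : nat}.
Local Notation K := n.+1.
Local Notation N := (\sum_(i < n.+1) 2)%N.
Local Notation vec := 'cV[R]_N.
Local Notation C := R[i].
Local Notation A := (mpoly (K + K) C).
Local Notation "''X_' v" := (@mpolyX (K + K) C (mnm1 v)) (at level 8, v at level 2, format "''X_' v").
Local Notation mon m := (@mpolyX (K + K) C m).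
Local Notation ix i := (tagnat.Rank i (ord0 : 'I_2) : 'I_N).
Local Notation iy i := (tagnat.Rank i (ord_max : 'I_2) : 'I_N).
Implicit Types (x v : vec) (p q h : A) (y : sphere R n).

Lemma sum_coords (B : nmodType) (F : 'I_N -> B) :
  \sum_j F j = \sum_(i < n.+1) (F (ix i) + F (iy i)).
Proof.
rewrite (reindex (@tagnat.rank n.+1 (fun=> 2%N))); last exact: tagnat.rank_bij_on.
rewrite (eq_bigr (fun s => F (@tagnat.Rank n.+1 (fun=> 2%N) (tag s) (tagged s)))); last first.
  by move=> s _; rewrite tagnat.rankE.
rewrite -(sig_big_dep xpredT (fun _ _ => true) (fun i j => F (@tagnat.Rank n.+1 (fun=> 2%N) i j))) /=.
apply: eq_bigr => i _; rewrite big_ord_recl big_ord1; congr (_ + F _).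
by congr tagnat.Rank; apply: val_inj.
Qed.

Lemma coordsP (P : 'I_N -> Prop) : (forall i, P (ix i)) -> (forall i, P (iy i)) -> forall j, P j.
Proof.
move=> px py j; rewrite -(tagnat.sig2K j).
case: (tagnat.sig2 j) => [[|[|//]] lt].
  by rewrite (_ : Ordinal lt = ord0); [exact: px | exact: val_inj].
by rewrite (_ : Ordinal lt = ord_max); [exact: py | exact: val_inj].
Qed.

Definition zc x (i : 'I_K) : C := x (ix i) 0 +i* x (iy i) 0.
Definition pt x (v : 'I_(K + K)) : C :=
  match fintype.split v with inl i => zc x i | inr i => (zc x i)^* end.
Definition ev x p : C := meval (pt x) p.

Lemma pt_l x i : pt x (lshift K i) = zc x i.
Proof. by rewrite /pt (unsplitK (inl i : 'I_K + 'I_K)). Qed.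
Lemma pt_r x i : pt x (rshift K i) = (zc x i)^*.
Proof. by rewrite /pt (unsplitK (inr i : 'I_K + 'I_K)). Qed.

Lemma evD x p q : ev x (p + q) = ev x p + ev x q. Proof. exact: mevalD. Qed.
Lemma evB x p q : ev x (p - q) = ev x p - ev x q. Proof. exact: mevalB. Qed.
Lemma evM x p q : ev x (p * q) = ev x p * ev x q. Proof. exact: mevalM. Qed.
Lemma evZ x c p : ev x (c *: p) = c * ev x p. Proof. exact: mevalZ. Qed.
Lemma ev1 x : ev x 1 = 1. Proof. exact: meval1. Qed.
Lemma evX x p k : ev x (p ^+ k) = ev x p ^+ k. Proof. exact: rmorphXn. Qed.
Lemma ev_sum x (I : Type) (r : seq I) (P : pred I) (F : I -> A) :
  ev x (\sum_(i <- r | P i) F i) = \sum_(i <- r | P i) ev x (F i).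
Proof. exact: raddf_sum. Qed.
Lemma ev_zz x i : ev x (zz C i) = zc x i. Proof. by rewrite /ev mevalXU pt_l. Qed.
Lemma ev_zb x i : ev x (zb C i) = (zc x i)^*. Proof. by rewrite /ev mevalXU pt_r. Qed.

Lemma sqnorm_zc x : (sqnorm x)%:C = \sum_i zc x i * (zc x i)^*.
Proof.
rewrite /sqnorm sum_coords rmorph_sum; apply: eq_bigr => i _ /=.
by apply: complex_ext => /=; ring.
Qed.

Lemma ev_rho x : ev x (rhoT C n) = (sqnorm x)%:C.
Proof.
rewrite sqnorm_zc /rhoT /rho ev_sum; apply: eq_bigr => i _.
by rewrite evM ev_zz ev_zb.
Qed.

Lemma ev_rho1 y : ev (val y) (rhoT C n) = 1.
Proof. by rewrite ev_rho sphereP. Qed.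

Local Notation xx := (@xx C n).
Local Notation yy := (@yy C n 'i).
Local Notation dx := (@dx C n).
Local Notation dy := (@dy C n 'i).

Lemma ev_xx x i : ev x (xx i) = (x (ix i) 0)%:C.
Proof.
rewrite /xx evZ evD ev_zz ev_zb; apply: (canLR (mulKf _)); first by rewrite pnatr_eq0.
by apply: complex_ext; rewrite ?ReM ?ImM ?Re_nat ?Im_nat /=; ring.
Qed.
Lemma ev_yy x i : ev x (yy i) = (x (iy i) 0)%:C.
Proof.
rewrite /yy evZ evB ev_zz ev_zb.
have -> : zc x i - (zc x i)^* = 2 * 'i * (x (iy i) 0)%:C.
  by apply: complex_ext; rewrite ?ReM ?ImM ?Re_nat ?Im_nat /=; rewrite ?ReM ?ImM ?Re_nat ?Im_nat /=; ring.
rewrite !mulrA -[_ / 2 * 2]mulrA mulVf ?pnatr_eq0 // mulr1 mulNr.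
by rewrite -expr2 sqr_i opprK mul1r.
Qed.

Lemma eq_is_cderive x v (f g : vec -> C) d : f =1 g -> is_cderive x v f d -> is_cderive x v g d.
Proof. by move=> /funext ->. Qed.

(** Both sides are derivations over the evaluation at [x], so agreement on the variables is
    enough. *)
Lemma is_cderive_ev_gen x v (D : A -> A) :
  (forall c p q, D (c *: p + q) = c *: D p + D q) ->
  (forall p q, D (p * q) = D p * q + p * D q) -> D 1 = 0 ->
  (forall u, is_cderive x v (fun x => ev x 'X_u) (ev x (D 'X_u))) ->
  forall p, is_cderive x v (fun x => ev x p) (ev x (D p)).
Proof.
move=> Dlin DM D1 DX; have D0 : D 0 = 0 by have := Dlin (-1) 1 1; rewrite D1 scaler0 addr0 scaleN1r addNr.
have ev0 z : ev z 0 = 0 by exact: meval0.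
have d1 : is_cderive x v (fun z => ev z 1) (ev x (D 1)).
  rewrite D1 ev0; apply: (eq_is_cderive (fun z => esym (ev1 z))); exact: is_cderive_cst.
have dM p q : is_cderive x v (fun z => ev z p) (ev x (D p)) -> is_cderive x v (fun z => ev z q) (ev x (D q)) ->
    is_cderive x v (fun z => ev z (p * q)) (ev x (D (p * q))).
  move=> h1 h2; rewrite DM evD !evM addrC; apply: (eq_is_cderive (fun z => esym (evM z p q))); exact: is_cderiveM.
elim/mpolyind => [|c m p _ _ IH].
  rewrite D0 ev0; apply: (eq_is_cderive (fun z => esym (ev0 z))); exact: is_cderive_cst.
rewrite Dlin evD; apply: (eq_is_cderive (fun z => esym (evD z _ _))).
apply: is_cderiveD IH; apply: (eq_is_cderive (fun z => esym (evZ z _ _))).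
have -> : ev x (c *: D (mon m)) = c * ev x (D (mon m)) + 0 * ev x (mon m) by rewrite evZ mul0r addr0.
apply: is_cderiveM; first exact: is_cderive_cst.
rewrite (mpolyXE_id C m).
apply: (big_ind (fun p => is_cderive x v (fun z => ev z p) (ev x (D p)))) => // u _.
elim: (m u) => [|k IHk]; first by rewrite expr0.
by rewrite exprS; exact: dM.
Qed.

Lemma is_derive_coord x (j k : 'I_N) : is_derive x (delta_mx k 0) (fun x : vec => x j 0) (j == k)%:R.
Proof.
apply/is_derive_lineP.
have -> : (fun h : R => (h *: delta_mx k 0 + x) j 0) = (fun h : R => h * (j == k)%:R + x j 0).
  by apply/funext => h; rewrite !mxE andbT.
have := is_deriveD (is_derive_mulr (j == k)%:R (0 : R)) (is_derive_cst (x j 0) (0 : R) (1 : R)).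
by rewrite addr0.
Qed.

Lemma eq_ix i j : (ix i == ix j) = (i == j).
Proof. by rewrite -val_eqE tagnat.eq_Rank eqxx andbT. Qed.
Lemma eq_iy i j : (iy i == iy j) = (i == j).
Proof. by rewrite -val_eqE tagnat.eq_Rank eqxx andbT. Qed.
Lemma eq_ixy i j : (ix i == iy j) = false.
Proof. by rewrite -val_eqE tagnat.eq_Rank andbF. Qed.
Lemma eq_iyx i j : (iy i == ix j) = false.
Proof. by rewrite -val_eqE tagnat.eq_Rank andbF. Qed.

Lemma is_cderive_ev_x x i p : is_cderive x (delta_mx (ix i) 0) (fun x => ev x p) (ev x (dx i p)).
Proof.
apply: is_cderive_ev_gen => [c p1 q|p1 q||u]; [exact: dx_lin | exact: dxM | exact: dx_1 | rewrite /dx].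
rewrite -(splitK u); case: (fintype.split u) => j /=.
- rewrite -/(zz C j) dz_zz dzb_zz addr0 /ev rmorph_nat -/(ev _ _).
  apply: (eq_is_cderive (fun z => esym (ev_zz z j))); split; rewrite ?Re_nat ?Im_nat.
    by have := is_derive_coord x (ix j) (ix i); rewrite eq_ix eq_sym.
  by have := is_derive_coord x (iy j) (ix i); rewrite eq_iyx.
rewrite -/(zb C j) dz_zb dzb_zb add0r /ev rmorph_nat -/(ev _ _).
apply: (eq_is_cderive (fun z => esym (ev_zb z j))); split; rewrite ?Re_nat ?Im_nat.
  by have := is_derive_coord x (ix j) (ix i); rewrite eq_ix eq_sym.
by have := is_deriveN (is_derive_coord x (iy j) (ix i)); rewrite eq_iyx oppr0.
Qed.

Lemma is_cderive_ev_y x i p : is_cderive x (delta_mx (iy i) 0) (fun x => ev x p) (ev x (dy i p)).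
Proof.
apply: is_cderive_ev_gen => [c p1 q|p1 q||u]; [exact: dy_lin | exact: dyM | exact: dy_1 | rewrite /dy].
rewrite -(splitK u); case: (fintype.split u) => j /=.
- rewrite -/(zz C j) dz_zz dzb_zz subr0 evZ [ev _ _]rmorph_nat mulrC.
  apply: (eq_is_cderive (fun z => esym (ev_zz z j))); split; rewrite ?ReiNIm ?ImiRe ?Re_nat ?Im_nat.
    by have := is_derive_coord x (ix j) (iy i); rewrite eq_ixy oppr0.
  by have := is_derive_coord x (iy j) (iy i); rewrite eq_iy eq_sym.
rewrite -/(zb C j) dz_zb dzb_zb sub0r evZ /ev rmorphN /= rmorph_nat mulrC -/(ev _ _).
apply: (eq_is_cderive (fun z => esym (ev_zb z j))); split; rewrite ?ReiNIm ?ImiRe ?ReN ?ImN ?Re_nat ?Im_nat.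
  by have := is_derive_coord x (ix j) (iy i); rewrite eq_ixy !oppr0.
by have := is_deriveN (is_derive_coord x (iy j) (iy i)); rewrite eq_iy eq_sym.
Qed.

Lemma ccontinuous_ev x p : ccontinuous_at (fun z => ev z p) x.
Proof.
have cc (f g : vec -> C) : f =1 g -> ccontinuous_at f x -> ccontinuous_at g x by move=> /funext ->.
have dM p1 q1 : ccontinuous_at (fun z => ev z p1) x -> ccontinuous_at (fun z => ev z q1) x ->
    ccontinuous_at (fun z => ev z (p1 * q1)) x.
  by move=> h1 h2; apply: (cc _ _ (fun z => esym (evM z p1 q1))); exact: ccontinuousM.
have d1 : ccontinuous_at (fun z => ev z 1) x.
  apply: (cc _ _ (fun z => esym (ev1 z))); exact: ccontinuous_cst.
elim/mpolyind: p => [|c m p _ _ IH].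
  apply: (cc (fun=> 0)); first by move=> z; rewrite /ev meval0.
  exact: ccontinuous_cst.
apply: (cc _ _ (fun z => esym (evD z _ _))); apply: ccontinuousD IH.
apply: (cc _ _ (fun z => esym (evZ z _ _))); apply: ccontinuousM; first exact: ccontinuous_cst.
rewrite (mpolyXE_id C m).
apply: (big_ind (fun p => ccontinuous_at (fun z => ev z p) x)) => [||u _]; [exact: d1 | exact: dM | ].
elim: (m u) => [|k IHk]; first by rewrite expr0.
rewrite exprS; apply: dM; last exact: IHk.
have co (j : 'I_N) : {for x, continuous (fun z : vec => z j 0)} by exact: coord_continuous.
rewrite -(splitK u); case: (fintype.split u) => j /=.
  apply: (cc _ _ (fun z => esym (ev_zz z j))); split; exact: co.
apply: (cc _ _ (fun z => esym (ev_zb z j))); split; first exact: co.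
by apply: continuousN; exact: co.
Qed.

(* The family of functions [Re p / |x| ^ k] is stable under partial derivatives. *)
Definition rpoly (pk : A * nat) x : R := Re (ev x pk.1) * (enorm x)^-1 ^+ pk.2.

Definition rpx i (pk : A * nat) : A * nat := (rdx pk.2 i pk.1, pk.2.+2).
Definition rpy i (pk : A * nat) : A * nat := (rdy 'i pk.2 i pk.1, pk.2.+2).

Lemma is_derive_enorm_inv x (j : 'I_N) k : x != 0 ->
  is_derive x (delta_mx j 0) (fun z => (enorm z)^-1 ^+ k) (- (k%:R * x j 0) * (enorm x)^-1 ^+ k.+2).
Proof.
move=> x0; have e0 : enorm x != 0 by rewrite gt_eqF ?enorm_gt0.
have /is_derive_lineP d1 := is_derive_enorm j x0.
set g := fun h : R => enorm (h *: delta_mx j 0 + x) in d1.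
have g0 : g 0 = enorm x by rewrite /g scale0r add0r.
have g00 : g 0 != 0 by rewrite g0.
have d2 := @is_deriveV R g 0 _ 1 g00 d1.
apply/is_derive_lineP.
elim: k => [|k IH].
  rewrite mul0r oppr0 mul0r.
  rewrite (_ : (fun h : R => _) = cst 1); first exact: is_derive_cst.
  by apply/funext => h; rewrite expr0.
have := is_deriveM_mul d2 IH.
rewrite (_ : (fun z : R => _ * _) = (fun h : R => (enorm (h *: delta_mx j 0 + x))^-1 ^+ k.+1)); last first.
  by apply/funext => h; rewrite /g exprS.
move=> h; apply: (is_derive_eq h); rewrite g0 scale0r add0r.
rewrite -[_ *: _]/(_ * _) -exprVn -natr1 !exprS expr0; ring.
Qed.

Lemma is_derive_rpoly_gen x (j : 'I_N) (X D : A -> A) (pk : A * nat) : x != 0 ->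
  is_cderive x (delta_mx j 0) (fun z => ev z pk.1) (ev x (D pk.1)) ->
  ev x (X pk.1) = (x j 0)%:C * ev x pk.1 ->
  is_derive x (delta_mx j 0) (rpoly pk) (rpoly (rhoT C n * D pk.1 - pk.2%:R *: X pk.1, pk.2.+2) x).
Proof.
case: pk => p k /= x0 [dp _] eX; have e0 : enorm x != 0 by rewrite gt_eqF ?enorm_gt0.
have h := is_deriveM_mul dp (is_derive_enorm_inv j k x0).
rewrite /rpoly /= ; apply: (is_derive_eq h).
rewrite evB evM evZ eX ev_rho natC ReB !ReZ.
have -> : sqnorm x = enorm x ^+ 2 by rewrite /enorm sqr_sqrtr ?sqnorm_ge0.
set E := (enorm x)^-1; rewrite [E ^+ k.+2]exprS [E ^+ k.+1]exprS.
have EE : enorm x * E = 1 by rewrite mulfV.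
set ex := enorm x in EE *; set P := E ^+ k.
transitivity (Re (ev x p) * (- (k%:R * x j 0) * (E * (E * P))) + Re (ev x (D p)) * P * (ex * E) ^+ 2).
  by rewrite EE expr1n mulr1.
by ring.
Qed.

Lemma is_derive_rpoly_x x i pk : x != 0 -> is_derive x (delta_mx (ix i) 0) (rpoly pk) (rpoly (rpx i pk) x).
Proof.
move=> x0; apply: (is_derive_rpoly_gen (X := fun p => xx i * p) x0 (is_cderive_ev_x x i pk.1)).
by rewrite evM ev_xx.
Qed.
Lemma is_derive_rpoly_y x i pk : x != 0 -> is_derive x (delta_mx (iy i) 0) (rpoly pk) (rpoly (rpy i pk) x).
Proof.
move=> x0; apply: (is_derive_rpoly_gen (X := fun p => yy i * p) x0 (is_cderive_ev_y x i pk.1)).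
by rewrite evM ev_yy.
Qed.

Lemma continuous_enorm x : {for x, continuous (@enorm R n)}.
Proof.
apply: continuous_comp; last exact: sqrt_continuous.
have : ccontinuous_at (fun z => ev z (rhoT C n)) x by exact: ccontinuous_ev.
move=> [h _]; rewrite (_ : @sqnorm _ _ = fun z : vec => Re (ev z (rhoT C n))) //.
by apply/funext => z; rewrite ev_rho.
Qed.

Lemma continuous_rpoly x pk : x != 0 -> {for x, continuous (rpoly pk)}.
Proof.
move=> x0; apply: continuousM; first by case: (ccontinuous_ev x pk.1).
have c1 : {for x, continuous (fun z : vec => (enorm z)^-1)}.
  by apply: continuousV; [rewrite gt_eqF ?enorm_gt0 | exact: continuous_enorm].
elim: (pk.2) => [|k IH]; first exact: (@cst_continuous _ _ (1 : R) x).
by rewrite (_ : (fun z => _) = (fun z : vec => (enorm z)^-1) \* (fun z => (enorm z)^-1 ^+ k)); [exact: continuousM | apply/funext => z; rewrite exprS].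
Qed.

Lemma ev_mon_scale (c : R) x m : ev (c *: x) (mon m) = c%:C ^+ mdeg m * ev x (mon m).
Proof.
rewrite /ev !mevalX mdegE -prodrXr -big_split; apply: eq_bigr => u _ /=.
rewrite -exprMn; congr (_ ^+ _).
rewrite -(splitK u); case: (fintype.split u) => j /=; rewrite ?pt_l ?pt_r /zc !mxE.
  by apply: complex_ext => /=; ring.
by apply: complex_ext => /=; ring.
Qed.

Lemma ev_hom_scale k (c : R) x p : eulT p = k%:R *: p -> ev (c *: x) p = c%:C ^+ k * ev x p.
Proof.
move=> ep; rewrite [p]mpolyE !ev_sum mulr_sumr big_seq [RHS]big_seq; apply: eq_bigr => m mp.
rewrite !evZ ev_mon_scale mulrCA; congr (_ * (_ * _)).
have /(congr1 (mcoeff m)) := ep; rewrite mcoeff_eul wdegT mcoeffZ => /eqP.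
rewrite -subr_eq0 -mulrBl mulf_eq0 subr_eq0 eqr_nat.
by rewrite mcoeff_msupp in mp; rewrite (negPf mp) orbF => /eqP ->.
Qed.

Definition rfun p y : R := Re (ev (val y) p).

Lemma rfunD p q y : rfun (p + q) y = rfun p y + rfun q y.
Proof. by rewrite /rfun evD ReD. Qed.

Lemma radial_ext_rfun k p x : eulT p = k%:R *: p -> x != 0 ->
  radial_ext (rfun p) x = rpoly (p, k) x.
Proof.
move=> ep x0; rewrite (radial_extE _ x0) /rfun /= (ev_hom_scale _ _ ep) /rpoly /=.
by rewrite -rmorphXn /= ReZ mulrC.
Qed.

Definition rsum (s : seq (A * nat)) x : R := \sum_(pk <- s) rpoly pk x.

Lemma sig_ixy (i : 'I_n.+1) (b : 'I_2) :
  (tagnat.sig1 (tagnat.Rank i b : 'I_N) = i) /\ ((tagnat.sig2 (tagnat.Rank i b : 'I_N) : nat) = b).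
Proof.
have := tagnat.sig2K (tagnat.Rank i b : 'I_N); move: (tagnat.sig2 _) => b'; move: (tagnat.sig1 _) => i' /(congr1 val) /eqP.
by rewrite -[_ == _]/(val _ == val _) tagnat.eq_Rank => /andP[/eqP -> /eqP ->].
Qed.

Definition rpd (j : 'I_N) : A * nat -> A * nat :=
  if (tagnat.sig2 j : nat) == 0%N then rpx (tagnat.sig1 j) else rpy (tagnat.sig1 j).

Lemma is_derive_rpoly x j pk : x != 0 -> is_derive x (delta_mx j 0) (rpoly pk) (rpoly (rpd j pk) x).
Proof.
move=> x0; rewrite -{1}(tagnat.sig2K j) /rpd.
case: (tagnat.sig2 j) => [[|[|//]] lt] /=.
  rewrite (_ : Ordinal lt = ord0); last exact: val_inj.
  exact: is_derive_rpoly_x.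
rewrite (_ : Ordinal lt = ord_max); last exact: val_inj.
exact: is_derive_rpoly_y.
Qed.

Lemma is_derive_rsum x j s : x != 0 -> is_derive x (delta_mx j 0) (rsum s) (rsum (map (rpd j) s) x).
Proof.
move=> x0; elim: s => [|pk s IH].
  rewrite (_ : rsum [::] = cst 0); last by apply/funext => z; rewrite /rsum big_nil.
  exact: is_derive_cst.
rewrite (_ : rsum (pk :: s) = rpoly pk \+ rsum s); last by apply/funext => z; rewrite /rsum big_cons.
rewrite /rsum /= big_cons; exact: is_deriveD (is_derive_rpoly j pk x0) IH.
Qed.

Lemma continuous_rsum x s : x != 0 -> {for x, continuous (rsum s)}.
Proof.
move=> x0; elim: s => [|pk s IH].
  rewrite (_ : rsum [::] = cst 0); last by apply/funext => z; rewrite /rsum big_nil.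
  exact: (@cst_continuous _ _ (0 : R) x).
rewrite (_ : rsum (pk :: s) = rpoly pk \+ rsum s); last by apply/funext => z; rewrite /rsum big_cons.
by apply: continuousD; [exact: continuous_rpoly | exact: IH].
Qed.

Lemma near_neq0_eq (F G : vec -> R) x : x != 0 -> (forall z, z != 0 -> F z = G z) ->
  \forall z \near x, F z = G z.
Proof. by move=> x0 h; apply: filterS (near_neq0 x0) => z /h. Qed.

Lemma near_neq0_continuous (F G : vec -> R) x : x != 0 -> (forall z, z != 0 -> G z = F z) ->
  {for x, continuous F} -> {for x, continuous G}.
Proof.
by move=> x0 h; apply: near_continuous; apply: near_neq0_eq => // z z0; rewrite h.
Qed.

Lemma partial_ext (F G : vec -> R) j x : x != 0 -> (forall z, z != 0 -> F z = G z) ->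
  partial j F x = partial j G x.
Proof. by move=> x0 h; apply: near_eq_derive; apply: near_neq0_eq. Qed.

Lemma foldr_partial_rsum (F : vec -> R) s : (forall z, z != 0 -> F z = rsum s z) ->
  forall t : seq 'I_N, exists s', forall z, z != 0 -> foldr partial F t z = rsum s' z.
Proof.
move=> h; elim=> [|j t [s' IH]]; first by exists s.
exists (map (rpd j) s') => z z0 /=; rewrite (partial_ext j z0 IH).
by have [_ <-] := is_derive_rsum j s' z0.
Qed.

(** The family [rsum] is closed under partial derivatives and its members are continuous away from
    the origin, which settles all orders at once. *)
Lemma smooth_on_rsum (F : vec -> R) s : (forall z, z != 0 -> F z = rsum s z) ->
  smooth_on [set x : vec | x != 0] F.
Proof.
move=> h t x /= x0; have [s' hs'] := foldr_partial_rsum h t; split=> [|j].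
  have c : {for x, continuous (rsum s')} by exact: continuous_rsum.
  exact: (@near_neq0_continuous (rsum s') (foldr partial F t) x x0 hs' c).
have [d _] := is_derive_rsum j s' x0.
by apply: near_eq_derivable d; apply: near_neq0_eq => // z z0; rewrite hs'.
Qed.

Definition harm_sum (h : nat -> A) D : A := \sum_(j < D) h j.

Lemma rfun_harm_sum (h : nat -> A) D y : rfun (harm_sum h D) y = \sum_(j < D) rfun (h j) y.
Proof. by rewrite /rfun /harm_sum ev_sum Re_sum. Qed.

Lemma radial_ext_harm_sum (h : nat -> A) D x : (forall j, harm j%:R (h j)) -> x != 0 ->
  radial_ext (rfun (harm_sum h D)) x = rsum [seq (h j, j) | j <- iota 0 D] x.
Proof.
move=> hh x0; rewrite (radial_extE _ x0) rfun_harm_sum /rsum big_map.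
rewrite -(big_mkord xpredT (fun j => rfun (h j) (normalize x0))) /index_iota subn0.
apply: eq_bigr => j _.
by rewrite -(radial_ext_rfun (hh j).2 x0) (radial_extE _ x0).
Qed.

Lemma smooth_harm_sum (h : nat -> A) D : (forall j, harm j%:R (h j)) ->
  sphere_smooth (rfun (harm_sum h D)).
Proof.
by move=> hh; apply: smooth_on_rsum => z z0; exact: radial_ext_harm_sum.
Qed.

Lemma partial_rsum s j x : x != 0 -> partial j (rsum s) x = rsum (map (rpd j) s) x.
Proof. by move=> x0; have [_ <-] := is_derive_rsum j s x0. Qed.

Lemma rpd_x i pk : rpd (ix i) pk = rpx i pk.
Proof. by have [e1 e2] := sig_ixy i ord0; rewrite /rpd e2 e1 eqxx. Qed.
Lemma rpd_y i pk : rpd (iy i) pk = rpy i pk.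
Proof. by have [e1 e2] := sig_ixy i ord_max; rewrite /rpd e2 e1. Qed.

Lemma rpoly_sphere pk y : rpoly pk (val y) = Re (ev (val y) pk.1).
Proof. by rewrite /rpoly enorm_sphere invr1 expr1n mulr1. Qed.

Lemma laplacian_rpoly k h y : harm k%:R h ->
  \sum_j partial j (partial j (rpoly (h, k))) (val y) = - ((k * (k + n.*2))%:R * rfun h y).
Proof.
move=> hh; have y0 := sphere_neq0 y.
have r1 pk z : rpoly pk z = rsum [:: pk] z by rewrite /rsum big_seq1.
have E j : partial j (partial j (rpoly (h, k))) (val y) = Re (ev (val y) (rpd j (rpd j (h, k))).1).
  rewrite (@partial_ext _ (rsum [:: rpd j (h, k)])) //; last first.
    by move=> z z0; rewrite (partial_ext j z0 (fun z _ => r1 (h, k) z)) partial_rsum.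
  by rewrite partial_rsum // /= /rsum big_seq1 rpoly_sphere.
under eq_bigr => j _ do rewrite E.
rewrite sum_coords; under eq_bigr => i _ do rewrite !rpd_x !rpd_y -ReD -evD.
rewrite -Re_sum -ev_sum /= (@rdxx_rdyy C n 'i) //; last by rewrite -expr2 sqr_i.
by rewrite /ev mevalN -/(ev _ _) evZ evM ev_rho1 mul1r natC ReN ReZ.
Qed.

Lemma sphere_smooth_harm k h : harm k%:R h -> sphere_smooth (rfun h).
Proof.
move=> hh; have hh' : forall j, harm j%:R (if j == k then h else 0).
  by move=> j; case: eqP => [->//|_]; exact: harm0.
have := smooth_harm_sum k.+1 hh'; rewrite (_ : rfun _ = rfun h) //.
apply/funext => z; rewrite rfun_harm_sum big_ord_recr /= eqxx big1 ?add0r // => j _.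
by rewrite ltn_eqF // /rfun /ev meval0.
Qed.

Lemma laplacian_harm k h y : harm k%:R h ->
  sphere_laplacian (rfun h) y = (k * (k + n.*2))%:R * rfun h y.
Proof.
move=> hh; have sm := sphere_smooth_harm hh.
apply: (etrans (sphere_laplacianE sm y)); apply: oppr_inj; apply: (etrans (opprK _)).
apply: (etrans _ (laplacian_rpoly y hh)).
have y0 := sphere_neq0 y; apply: eq_bigr => j _; apply: partial_ext; first exact: y0.
move=> z z0; apply: partial_ext; first exact: z0.
by move=> w w0; exact: radial_ext_rfun hh.2 w0.
Qed.

Section Linear.
Variables f g : sphere R n -> R.
Hypotheses (fs : sphere_smooth f) (gs : sphere_smooth g).
Variable c : R.
Let u y := f y + c * g y.

Let radu z : radial_ext u z = radial_ext f z + c * radial_ext g z.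
Proof. by rewrite /radial_ext; case: insub => //=; rewrite mulr0 addr0. Qed.

Let foldr_lin (t : seq 'I_N) x : x != 0 ->
  foldr partial (radial_ext u) t x = foldr partial (radial_ext f) t x + c * foldr partial (radial_ext g) t x.
Proof.
elim: t x => [|j t IH] x x0 /=; first exact: radu.
rewrite (partial_ext j x0 IH).
have d1 := DeriveDef (smooth_der fs t x j x0) erefl.
have d2 := DeriveDef (smooth_der gs t x j x0) erefl.
by have [_] := is_deriveD d1 (is_derive_mull c d2).
Qed.

Lemma sphere_smoothD : sphere_smooth u.
Proof.
move=> t x /= x0; split=> [|j].
  pose G := foldr partial (radial_ext f) t \+ (cst c \* foldr partial (radial_ext g) t).
  have cG : {for x, continuous G}.
    apply: continuousD; first exact: (smooth_cont fs t x x0).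
    by apply: continuousM; [exact: cst_continuous | exact: (smooth_cont gs t x x0)].
  by apply: (near_neq0_continuous x0 _ cG) => z z0; rewrite foldr_lin.
have d1 := DeriveDef (smooth_der fs t x j x0) erefl.
have d2 := DeriveDef (smooth_der gs t x j x0) erefl.
have [d _] := is_deriveD d1 (is_derive_mull c d2).
by apply: near_eq_derivable d; apply: near_neq0_eq => // z z0; rewrite foldr_lin.
Qed.

Lemma sphere_laplacianD y : sphere_laplacian u y = sphere_laplacian f y + c * sphere_laplacian g y.
Proof.
rewrite (sphere_laplacianE sphere_smoothD) (sphere_laplacianE fs) (sphere_laplacianE gs).
rewrite mulrN -opprD mulr_sumr -big_split; congr (- _); apply: eq_bigr => i _.
exact: (@foldr_lin [:: i; i] _ (sphere_neq0 y)).
Qed.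
End Linear.

Lemma compact_sphere : compact [set x : vec | sqnorm x = 1].
Proof.
(* Compactness of closed bounded sets is applied to row vectors and carried over by
   transposition. *)
have -> : [set x : vec | sqnorm x = 1] = (@trmx R 1 N) @` [set x : 'rV[R]_N | sqnorm x^T = 1].
  apply/seteqP; split => [x /= x1|x [z /= z1 <-//]].
  by exists x^T; rewrite ?trmxK //= trmxK.
have ctr : continuous (@trmx R 1 N).
  move=> x; apply/(@cvgrPdist_lt _ vec _ (nbhs x)) => e e0; near=> z.
  rewrite -linearB /= [X in X < _]/Num.norm /= mx_normrE.
  apply: (@le_lt_trans _ _ `|x - z|).
    apply: bigmax_le => [|[i j] _ /=]; first exact: (normr_ge0 (x - z)).
    rewrite mxE [in leRHS]/Num.norm /= mx_normrE.
    exact: (le_bigmax _ (fun ij => `|(x - z) ij.1 ij.2|) (j, i)).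
  by near: z; apply: cvgr_dist_lt.
apply: continuous_compact; first exact: continuous_subspaceT.
apply: bounded_closed_compact.
  exists 1; split => // M M1 x /= x1; rewrite [X in X <= _]/Num.norm /= mx_normrE.
  apply: bigmax_le => [|[i j] _ /=]; first by rewrite (le_trans ler01) // ltW.
  rewrite (le_trans _ (ltW M1)) // -[leRHS]sqrtr1 -sqrtr_sqr ler_wsqrtr //.
  rewrite -[leRHS]x1 /sqnorm (bigD1 j) //= !mxE (ord1 i) lerDl sumr_ge0 // => k _.
  exact: sqr_ge0.
have : closed ((fun x : 'rV[R]_N => sqnorm x^T) @^-1` [set 1 : R]).
  apply: preimage_closed; last exact: closed_eq.
  move=> x _; apply: continuous_comp; first exact: ctr.
  have : ccontinuous_at (fun z => ev z (rhoT C n)) x^T by exact: ccontinuous_ev.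
  move=> [h _]; rewrite (_ : @sqnorm _ _ = fun z : vec => Re (ev z (rhoT C n))) //.
  by apply/funext => z; rewrite ev_rho.
by [].
Unshelve. all: by end_near. Qed.

Lemma sphere_max (f : sphere R n -> R) : sphere_smooth f -> exists y, forall z, f z <= f y.
Proof.
move=> fs; pose F := radial_ext f.
have A0 : [set x : vec | sqnorm x = 1] !=set0.
  exists (delta_mx (ix ord0) 0) => /=; rewrite /sqnorm (bigD1 (ix ord0)) //= mxE !eqxx /= expr1n.
  rewrite big1 ?addr0 // => j /negPf j0; by rewrite mxE j0 /= expr0n.
have cF : {within [set x : vec | sqnorm x = 1], continuous F}.
  apply: continuous_in_subspaceT => x; rewrite inE /= => x1.
  by apply: (smooth_cont fs [::] x); rewrite -sqnorm_gt0 x1.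
have [x xA xmax] := compact_EVT_max A0 compact_sphere cF.
exists (Sub x xA) => z; have := xmax (val z) (valP z).
by rewrite /F radial_ext_val -{1}(radial_ext_val f (Sub x xA)).
Qed.

(* The maximum principle: the resolvent of the Laplacian is a contraction. *)
Lemma resolvent_le (f : sphere R n -> R) (s c : R) : 0 < s -> sphere_smooth f ->
  (forall y, sphere_laplacian f y + s * f y <= s * c) -> forall y, f y <= c.
Proof.
move=> s0 fs h y; have [z zmax] := sphere_max fs; apply: le_trans (zmax y) _.
rewrite -(ler_pM2l s0); apply: le_trans (h z).
by rewrite lerDr; apply: sphere_laplacian_at_max.
Qed.

End SpherePolynomials.

(** * Density of the polynomials *)

(** One step of the random walk in [bern]: a step [s] or [- s] with probabilities [(1 + t) / 2] and
    [(1 - t) / 2] has mean [s t] and variance at most [s ^ 2]. The slack is [2 kap s ^ 2 t ^ 2]. *)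
Lemma walk_step {R : realType} (t e kap S s y L : R) : 0 <= kap ->
  (1 + t) * (e + kap * (S + s * y *+ 2 + s ^+ 2 + L * s ^+ 2)) +
  (1 - t) * (e + kap * (S + - s * y *+ 2 + (- s) ^+ 2 + L * s ^+ 2)) <=
  2 * (e + kap * (S + s * t * y *+ 2 + (s * t) ^+ 2 + (L + 1) * s ^+ 2)).
Proof.
move=> k0; rewrite -subr_ge0 (_ : _ - _ = 2 * kap * s ^+ 2 * t ^+ 2); last by ring.
by rewrite mulr_ge0 ?sqr_ge0 // mulr_ge0 ?sqr_ge0 // mulr_ge0.
Qed.

Section MeanBounds.
Context {R : realType} {n : nat}.
Local Notation K := n.+1.
Local Notation N := (\sum_(i < n.+1) 2)%N.
Local Notation vec := 'cV[R]_N.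
Local Notation C := R[i].
Local Notation A := (mpoly (K + K) C).
Local Notation "p @_ m" := (@mcoeff (K + K) C m p) (at level 3, m at level 2, format "p @_ m").
Local Notation "0m" := (@mnm0 (K + K)).
Local Notation ix i := (tagnat.Rank i (ord0 : 'I_2) : 'I_N).
Local Notation iy i := (tagnat.Rank i (ord_max : 'I_2) : 'I_N).
Implicit Types (x v : vec) (p q h : A) (y : sphere R n).

Definition lamk (k : nat) : R := (k * (k + n.*2))%:R.

Lemma lamk_ge0 k : 0 <= lamk k. Proof. exact: ler0n. Qed.
Lemma lamk_inj : injective lamk.
Proof.
move=> j k /eqP; rewrite eqr_nat => /eqP e.
by apply/eqP; case: (ltngtP j k) => // l; nia.
Qed.

Lemma harm_sumS (h : nat -> A) D : harm_sum h D.+1 = harm_sum h D + h D.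
Proof. exact: big_ord_recr. Qed.

Lemma laplacian_harm_sum (h : nat -> A) D y : (forall j, harm j%:R (h j)) ->
  sphere_laplacian (rfun (harm_sum h D)) y = \sum_(j < D) lamk j * rfun (h j) y.
Proof.
move=> hh; elim: D => [|D IH].
  have e : rfun (harm_sum h 0) = rfun (0 : A) by rewrite /harm_sum big_ord0.
  have h0 : harm 0%:R (0 : A) by exact: harm0.
  by rewrite e (laplacian_harm y h0) mul0n mul0r big_ord0.
rewrite big_ord_recr /= -IH -(laplacian_harm y (hh D)).
have e : rfun (harm_sum h D.+1) = fun y => rfun (harm_sum h D) y + 1 * rfun (h D) y.
  by apply/funext => z; rewrite harm_sumS rfunD mul1r.
rewrite e (sphere_laplacianD (smooth_harm_sum D hh) (sphere_smooth_harm (hh D))).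
by rewrite mul1r.
Qed.

(** The operator [c (Delta + s)^-1] on a sum of harmonic forms. With [c = s] it is a contraction
    that tends to the mean as [s] goes to [0]; with [s = 1] and [c = mu + 1] it models an operator
    fixing the eigenfunctions of eigenvalue [mu]. *)
Definition resolvent (s c : R) (h : nat -> A) (j : nat) : A := (c / (lamk j + s))%:C *: h j.

Lemma harm_resolvent s c (h : nat -> A) : (forall j, harm j%:R (h j)) -> forall j, harm j%:R (resolvent s c h j).
Proof. by move=> hh j; apply: harmZ. Qed.

Lemma rfunZ (c : R) p y : rfun (c%:C *: p) y = c * rfun p y.
Proof. by rewrite /rfun evZ ReZ. Qed.

Lemma laplacian_resolvent s c (h : nat -> A) D y : 0 < s -> (forall j, harm j%:R (h j)) ->
  let r := harm_sum (resolvent s c h) D in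
  sphere_laplacian (rfun r) y + s * rfun r y = c * rfun (harm_sum h D) y.
Proof.
move=> s0 hh /=; rewrite laplacian_harm_sum; last exact: harm_resolvent.
rewrite !rfun_harm_sum !mulr_sumr -big_split /=; apply: eq_bigr => j _.
rewrite /resolvent rfunZ; have : lamk j + s != 0 by rewrite gt_eqF // ltr_wpDl // lamk_ge0.
move=> ls; set F := rfun _ _; have -> : c * F = (lamk j + s) * (c / (lamk j + s) * F) by rewrite [in RHS]mulrA [_ * (c / _)]mulrC divfK.
by rewrite mulrDl.
Qed.

Lemma harm_const h : harm 0%:R h -> h = h@_0m *: 1.
Proof.
move=> hh; apply/mpolyP => m; rewrite mcoeffZ mcoeff1.
case: (eqVneq m 0m) => [->|m0]; first by rewrite mulr1.
rewrite mulr0; apply/eqP; rewrite mcoeff_eq0; apply/negP => mh.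
by have := harm_mdeg hh mh; move/eqP; rewrite mdeg_eq0 (negPf m0).
Qed.

Lemma mean_harm k h : harm k%:R h -> k != 0%N -> mean h = 0.
Proof.
move=> hh k0; have h1 : harm 0%:R (1 : A).
  split; first by rewrite /lapT /lap big1 // => i _; rewrite /dz /dzb -mpolyC1 !(mderivC, raddf0).
  by rewrite scale0r /eulT /eul big1 // => v _; rewrite -mpolyC1 mderivC mulr0 scaler0.
by have := mean_harmM hh h1; rewrite mulr1; apply; rewrite eqr_nat.
Qed.

Lemma mean_harm_sum (h : nat -> A) D : (forall j, harm j%:R (h j)) ->
  mean (harm_sum h D.+1) = (h 0%N)@_0m.
Proof.
move=> hh; rewrite /harm_sum raddf_sum big_ord_recl /= big1 ?addr0 => [|j _].
  by rewrite {1}(harm_const (hh 0%N)) linearZ /= mean1 mulr1.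
exact: mean_harm (hh _) _.
Qed.

Lemma harm_rfun0 h y : harm 0%:R h -> rfun h y = Re h@_0m.
Proof. by move=> hh; rewrite {1}(harm_const hh) /rfun evZ ev1 mulr1. Qed.

Lemma harm_decompS p : exists (h : nat -> A) (D : nat) (q : A),
  (forall j, harm j%:R (h j)) /\ p = harm_sum h D.+1 + (@rhoT C n - 1) * q.
Proof.
have [h [D [q [hh h0 e]]]] := harm_decomp p; exists h, D, q; split=> //.
by rewrite harm_sumS h0 // addr0.
Qed.

Lemma ev_sphere h q y : ev (val y) (h + (@rhoT C n - 1) * q) = ev (val y) h.
Proof. by rewrite evD evM evB ev_rho1 ev1 subrr mul0r addr0. Qed.

(** By the maximum principle [s (Delta + s)^-1] does not increase upper bounds, and as [s] tends to
    [0] it damps every harmonic component except the constant one, which is the mean. This replaces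
    the positivity of an integral. *)
Lemma mean_le p c : (forall y, rfun p y <= c) -> Re (mean p) <= c.
Proof.
have [h [D [q [hh ->]]]] := harm_decompS p => pc.
have {}pc y : rfun (harm_sum h D.+1) y <= c by have := pc y; rewrite /rfun ev_sphere.
rewrite linearD /= mean_sphere addr0 (mean_harm_sum D hh).
have y0 : sphere R n.
  by apply: (@normalize R n (delta_mx (ix ord0) 0)); apply/eqP => /matrixP/(_ (ix ord0) 0)/eqP; rewrite !mxE !eqxx oner_eq0.
have bd s : 0 < s -> rfun (harm_sum (resolvent s s h) D.+1) y0 <= c.
  move=> s0; apply: (resolvent_le s0 (smooth_harm_sum _ (harm_resolvent s s hh))) => y.
  by rewrite (laplacian_resolvent s D.+1 y s0 hh) ler_pM2l.
pose B := \sum_(j < D) `|rfun (h j.+1) y0|.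
have B0 : 0 <= B by apply: sumr_ge0.
(* In positive degree [lamk] is at least [1], so the factor [s / (lamk j.+1 + s)] is at most [s]. *)
have key s : 0 < s -> Re (h 0%N)@_0m <= c + s * B.
  move=> s0; have := bd s s0; rewrite rfun_harm_sum big_ord_recl /= /resolvent !rfunZ.
  rewrite {1}/lamk mul0n add0r mulfV ?gt_eqF // mul1r (harm_rfun0 _ (hh 0%N)).
  rewrite -lerBrDr => /le_trans; apply; rewrite lerD2l -sumrN /B mulr_sumr.
  apply: ler_sum => j _; rewrite /bump /= add1n rfunZ.
  rewrite (le_trans (ler_norm _)) // normrN normrM ler_wpM2r // ger0_norm.
    have l1 : 1 <= lamk j.+1 by rewrite /lamk ler1n muln_gt0.
    rewrite ler_pdivrMr ?(ltr_wpDl (lamk_ge0 _) s0) // ler_peMr ?ltW //.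
    by rewrite ltr_pwDr.
  by rewrite divr_ge0 ?addr_ge0 ?lamk_ge0 // ltW.
apply/ler_addgt0Pr => e e0; have B1 : 0 < B + 1 by rewrite ltr_wpDl.
apply: (le_trans (key (e / (B + 1)) (divr_gt0 e0 B1))); rewrite lerD2l mulrAC.
by rewrite ler_pdivrMr // ler_pM2l // lerDl.
Qed.

Lemma mean_ge p c : (forall y, c <= rfun p y) -> c <= Re (mean p).
Proof.
move=> h; rewrite -lerN2 -ReN -raddfN; apply: mean_le => y.
by rewrite /rfun /ev mevalN ReN lerN2; exact: h.
Qed.

Definition coefsum p : R := \sum_(m <- msupp p) normc p@_m.

Lemma coefsum_ge0 p : 0 <= coefsum p.
Proof. by apply: sumr_ge0 => m _; exact: normc_ge0. Qed.

Lemma zc_le1 y i : normc (zc (val y) i) <= 1.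
Proof.
rewrite /zc /= -[leRHS]sqrtr1 ler_wsqrtr // -[leRHS](sphereP y) /sqnorm (sum_coords (fun j => val y j 0 ^+ 2)).
rewrite [leRHS](bigD1 i) //= lerDl; apply: sumr_ge0 => j _; apply: addr_ge0; exact: sqr_ge0.
Qed.

Lemma normc_ev_le p y : normc (ev (val y) p) <= coefsum p.
Proof.
rewrite {1}[p]mpolyE ev_sum; apply: (le_trans (normc_sum _ _ _)); apply: ler_sum => m _.
rewrite evZ normcM ler_piMr ?normc_ge0 // /ev mevalX.
apply: (big_ind (fun z => normc z <= 1)); first by rewrite normc1.
  by move=> u v hu hv; rewrite normcM mulr_ile1 ?normc_ge0.
move=> v _; rewrite normcX exprn_ile1 ?normc_ge0 //.
rewrite -(splitK v); case: (fintype.split v) => j /=; rewrite ?pt_l ?pt_r ?normc_conj; exact: zc_le1.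
Qed.

Lemma Re_mean_le p c : (forall y, normc (ev (val y) p) <= c) -> `|Re (mean p)| <= c.
Proof.
move=> h; have h' y : `|rfun p y| <= c by apply: le_trans (h y); exact: Re_le_normc.
rewrite ler_norml; apply/andP; split.
  by apply: mean_ge => y; have := h' y; rewrite ler_norml => /andP[].
by apply: mean_le => y; have := h' y; rewrite ler_norml => /andP[].
Qed.

Lemma sqnorm_coord x j : x j 0 ^+ 2 <= sqnorm x.
Proof.
by rewrite [leRHS](bigD1 j) //= lerDl; apply: sumr_ge0 => i _; exact: sqr_ge0.
Qed.

Lemma mx_norm_lt x (r : R) : 0 < r -> sqnorm x < r ^+ 2 -> `|x| < r.
Proof.
move=> r0 h; rewrite [X in X < _]/Num.norm /= mx_normrE; apply: bigmax_lt => // -[i j] _ /=.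
rewrite [j]ord1 -(@ltr_pXn2r _ 2) ?nnegrE ?(ltW r0) // real_normK ?num_real //.
exact: le_lt_trans (sqnorm_coord x i) h.
Qed.

Lemma sqnormB_delta x j (s : R) : sqnorm (x + s *: delta_mx j 0) = sqnorm x + s * x j 0 *+ 2 + s ^+ 2.
Proof.
rewrite /sqnorm [LHS](bigD1 j) //= [X in _ = X + _ + _](bigD1 j) //= !mxE !eqxx mulr1.
rewrite (eq_bigr (fun i => x i 0 ^+ 2)); first by ring.
by move=> i /negPf ij; rewrite !mxE ij mulr0 addr0.
Qed.

(** * Approximation of smooth functions by expectations of random walks *)

Section Bernstein.
Variable f : sphere R n -> R.
Hypothesis fs : sphere_smooth f.
Local Notation g := (radial_ext f).

Lemma smooth_bounded : exists2 M, 0 <= M & forall u, `|g u| <= M.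
Proof.
(* This is [- f] in the form provided by [sphere_smoothD]; its maximum is the minimum of [f]. *)
have fN : sphere_smooth (fun y => f y + (-2) * f y) by exact: sphere_smoothD.
have [y1 h1] := sphere_max fs; have [y2 h2] := sphere_max fN.
exists (`|f y1| + `|f y2|) => [|u]; first exact: addr_ge0.
case: (eqVneq u 0) => [->|u0].
  rewrite /radial_ext; case: insubP => [z|_] /=; last by rewrite normr0 addr_ge0.
  by rewrite scaler0 inE /= /sqnorm big1 => [/eqP|i _]; rewrite ?mxE ?expr0n // eq_sym oner_eq0.
rewrite (radial_extE _ u0); set z := normalize u0.
have h2z := h2 z; have h1z := h1 z.
have hy2 : f y2 <= f z by move: h2z; lra.
rewrite ler_norml; apply/andP; split.
  by have := ler_norm (- f y2); rewrite normrN; have := normr_ge0 (f y1); lra.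
by have := ler_norm (f y1); have := normr_ge0 (f y2); lra.
Qed.

Lemma smooth_unif_cont (e : R) : 0 < e -> exists2 d, 0 < d &
  forall y u, sqnorm (u - val y) < d -> `|g u - f y| <= e.
Proof.
move=> e0.
pose P (d : R) (x : vec) := forall u, sqnorm (u - x) < d -> `|g u - g x| <= e.
have cv := (compact_near_coveringP _).1 (@compact_sphere R n) R (0 : R)^'+ P _.
have : \forall d \near (0 : R)^'+, [set x : vec | sqnorm x = 1] `<=` P d.
  apply: cv => x /= x1.
  have x0 : x != 0 by rewrite -sqnorm_gt0 x1.
  have e2 : 0 < e / 2 by rewrite divr_gt0.
  have /cvgrPdist_lt /(_ _ e2) /nbhs_ballP[r /= r0 hr] := smooth_cont fs [::] x x0.
  have r2 : 0 < r / 2 by rewrite divr_gt0.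
  have n1 : \forall x' \near x, `|x - x'| < r / 2.
    by apply/nbhs_ballP; exists (r / 2) => //= z; rewrite -ball_normE.
  have n2 : \forall d \near (0 : R)^'+, d < (r / 2) ^+ 2.
    by apply: nbhs_right_lt; rewrite exprn_gt0.
  exists ([set x' | `|x - x'| < r / 2], [set d | d < (r / 2) ^+ 2]) => //.
  move=> [x' d] /= [hx' hd] u hu.
  have hu' : `|u - x'| < r / 2 by apply: mx_norm_lt => //; exact: lt_trans hd.
  have b1 : `|g x - g u| < e / 2.
    apply: hr; rewrite -ball_normE /= [r]splitr (_ : x - u = (x - x') - (u - x')); last by rewrite opprB addrA subrK.
    exact: le_lt_trans (ler_normB _ _) (ltrD hx' hu').
  have b2 : `|g x - g x'| < e / 2.
    by apply: hr; rewrite -ball_normE /= (lt_trans hx') // ltr_pdivrMr // ltr_pMr // ltr1n.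
  rewrite (_ : g u - g x' = (g x - g x') - (g x - g u)); last by ring.
  by rewrite (le_trans (ler_normB _ _)) // [leRHS]splitr lerD // ltW.
move=> h; have h2 : \forall d \near (0 : R)^'+, 0 < d by exact: nbhs_right_gt.
have [d [hd d0]] := @filter_ex _ ((0 : R)^'+) _ _ (filterI h h2).
by exists d => // y u hu; have := hd (val y) (sphereP y) u hu; rewrite radial_ext_val.
Qed.

(** The walk in [bern] leaves the sphere, so the error is needed at all ambient points [u]: uniform
    continuity serves near [y], and farther away the bound [2 M] is absorbed by the quadratic
    term. *)
Lemma smooth_quadratic (e : R) : 0 < e -> exists2 kap, 0 <= kap &
  forall y u, `|g u - f y| <= e + kap * sqnorm (u - val y).
Proof.
move=> e0; have [d d0 hd] := smooth_unif_cont e0; have [M M0 hM] := smooth_bounded.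
exists (M *+ 2 / d) => [|y u]; first by rewrite divr_ge0 ?mulrn_wge0 // ltW.
case: (ltP (sqnorm (u - val y)) d) => [/hd|dl].
  by move/le_trans; apply; rewrite lerDl mulr_ge0 ?sqnorm_ge0 // divr_ge0 ?mulrn_wge0 // ltW.
apply: (@le_trans _ _ (M *+ 2)).
  by rewrite (le_trans (ler_normB _ _)) // mulr2n -(radial_ext_val f y) lerD.
by rewrite ler_wpDl ?(ltW e0) // mulrAC ler_pdivlMr // ler_wpM2l ?mulrn_wge0.
Qed.

Definition coordp (j : 'I_N) : A :=
  if (tagnat.sig2 j : nat) == 0%N then @xx C n (tagnat.sig1 j) else @yy C n 'i (tagnat.sig1 j).

Lemma ev_coordp x j : ev x (coordp j) = (x j 0)%:C.
Proof.
move: j; apply: coordsP => i.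
  by have [e1 e2] := @sig_ixy n i ord0; rewrite /coordp e2 e1 eqxx ev_xx.
by have [e1 e2] := @sig_ixy n i ord_max; rewrite /coordp e2 e1 ev_yy.
Qed.

(* The expected value of [g] at the endpoint of a random walk from [v] whose
   steps are [+s] or [-s] in the listed directions, with mean [s] times the
   corresponding coordinate. *)
Fixpoint bern (s : R) (l : seq 'I_N) (v : vec) : A :=
  match l with
  | [::] => (g v)%:C *: 1
  | i :: l' => (2^-1)%:C *: ((1 + coordp i) * bern s l' (v + s *: delta_mx i 0) +
                        (1 - coordp i) * bern s l' (v - s *: delta_mx i 0))
  end.

Fixpoint bernR (x : vec) (s : R) (l : seq 'I_N) (v : vec) : R :=
  match l with
  | [::] => g v
  | i :: l' => 2^-1 * ((1 + x i 0) * bernR x s l' (v + s *: delta_mx i 0) +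
                        (1 - x i 0) * bernR x s l' (v - s *: delta_mx i 0))
  end.

Lemma ev_bern x s l v : ev x (bern s l v) = (bernR x s l v)%:C.
Proof.
elim: l v => [|i l IH] v /=; first by rewrite evZ ev1 mulr1.
rewrite evZ evD !evM evD evB ev1 ev_coordp !IH.
by rewrite [RHS]rmorphM rmorphD !rmorphM rmorphD rmorphB rmorph1.
Qed.

(** The expected squared distance of the endpoint from [x] is that of the expected endpoint plus the
    variance, and each step contributes at most [s ^ 2] to the latter. *)
Lemma bernR_bound x s c e kap l v : (forall i, `|x i 0| <= 1) -> 0 <= kap ->
  (forall u, `|g u - c| <= e + kap * sqnorm (u - x)) ->
  `|bernR x s l v - c| <= e + kap * (sqnorm (v + \sum_(i <- l) (s * x i 0) *: delta_mx i 0 - x) + (size l)%:R * s ^+ 2).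
Proof.
move=> x1 k0 h; elim: l v => [|i l IH] v.
  by rewrite /= big_nil mul0r !addr0.
rewrite [bernR _ _ _ _]/= [size _]/=.
have := IH (v + s *: delta_mx i 0); have := IH (v - s *: delta_mx i 0).
rewrite big_cons.
set a := bernR _ _ _ _; set b := bernR _ _ _ _.
set d := \sum_(i <- l) _; pose D := v + d - x.
have -> : v + s *: delta_mx i 0 + d - x = D + s *: delta_mx i 0.
  by rewrite /D [v + _ + d]addrAC [_ + _ - x]addrAC.
have -> : v - s *: delta_mx i 0 + d - x = D + (- s) *: delta_mx i 0.
  by rewrite scaleNr /D [v + _ + d]addrAC [_ + _ - x]addrAC.
have -> : v + ((s * x i 0) *: delta_mx i 0 + d) - x = D + (s * x i 0) *: delta_mx i 0.
  by rewrite /D [_ + d]addrC addrA [_ + _ - x]addrAC.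
rewrite !sqnormB_delta; set L := (size l)%:R.
have := x1 i; set t := x i 0; rewrite ler_norml => /andP[t1 t2] ha hb.
have -> : 2^-1 * ((1 + t) * b + (1 - t) * a) - c = 2^-1 * ((1 + t) * (b - c) + (1 - t) * (a - c)) by field.
rewrite normrM ger0_norm ?invr_ge0 // ler_pdivrMl //.
apply: (le_trans (ler_normD _ _)); rewrite !normrM.
rewrite (ger0_norm (_ : 0 <= 1 + t)); last by rewrite addrC -lerBlDr sub0r.
rewrite (ger0_norm (_ : 0 <= 1 - t)) ?subr_ge0 //.
have t1' : 0 <= 1 + t by rewrite addrC -lerBlDr sub0r.
have t2' : 0 <= 1 - t by rewrite subr_ge0.
apply: (le_trans (lerD (ler_wpM2l t1' hb) (ler_wpM2l t2' ha))).
set S := sqnorm D; set y := D i 0.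
rewrite -(natr1 (size l)) -/L; exact: walk_step.
Qed.

Lemma sphere_coord_le1 y j : `|val y j 0| <= 1.
Proof.
rewrite -(@ler_pXn2r _ 2) ?nnegrE // expr1n real_normK ?num_real // -[leRHS](sphereP y).
exact: sqnorm_coord.
Qed.

(** Bernstein's argument: [k + 1] rounds through all coordinates with steps of size
    [s = 1 / (k + 1)], starting at [0], have expected endpoint [y], while the variance is at most
    the number of coordinates times [s]. *)
Lemma polynomial_density (e : R) : 0 < e -> exists p, forall y, normc (ev (val y) p - (f y)%:C) <= e.
Proof.
move=> e0; have e2 : 0 < e / 2 by rewrite divr_gt0.
have [kap k0 hk] := smooth_quadratic e2.
pose NN : nat := size (enum 'I_N).
have [k hkk] : exists k : nat, kap * NN%:R <= (e / 2) * k.+1%:R.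
  have [k hk'] : exists k : nat, kap * NN%:R / (e / 2) < k%:R.
    exists (Num.bound (kap * NN%:R / (e / 2))); apply: archi_boundP.
    by rewrite divr_ge0 ?mulr_ge0 // ltW.
  exists k; rewrite [leRHS]mulrC -ler_pdivrMr // (le_trans (ltW hk')) // ler_nat //.
pose s : R := k.+1%:R^-1; pose l := flatten (nseq k.+1 (enum 'I_N)).
have s0 : k.+1%:R * s = 1 by rewrite mulfV.
exists (bern s l 0) => y.
rewrite ev_bern -rmorphB normc_real.
have := @bernR_bound (val y) s (f y) (e / 2) kap l 0 (sphere_coord_le1 y) k0 (hk y).
move/le_trans; apply; rewrite [leRHS]splitr lerD2l add0r.
have -> : \sum_(i <- l) (s * val y i 0) *: delta_mx i 0 = val y :> vec.
  have -> : forall m, \sum_(i <- flatten (nseq m (enum 'I_N))) (s * val y i 0) *: delta_mx i 0 = (m%:R * s) *: val y :> vec.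
    elim=> [|m IH]; first by rewrite big_nil mul0r scale0r.
    rewrite /= big_cat /= IH -natr1 [(m%:R + 1) * s]mulrDl mul1r scalerDl addrC; congr (_ + _).
    rewrite [in RHS](matrix_sum_delta (val y)) scaler_sumr big_enum /=; apply: eq_bigr => i _.
    by rewrite big_ord1 scalerA.
  by rewrite s0 scale1r.
have -> : size l = (k.+1 * NN)%N by rewrite /l size_flatten /shape map_nseq sumn_nseq mulnC.
rewrite subrr [sqnorm 0]/sqnorm big1 => [|i _]; last by rewrite mxE expr0n.
have -> : (k.+1 * NN)%:R * s ^+ 2 = NN%:R * (k.+1%:R * s) * s by rewrite natrM; ring.
rewrite s0 mulr1 add0r mulrA.
by rewrite ler_pdivrMr.
Qed.
End Bernstein.

End MeanBounds.

(** * Completeness of the spherical harmonics *)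

Section RingIdentities.
Variable T : comPzRingType.
Implicit Types a b c x y w : T.
Lemma sub_lin c a b x y : c * a + b - (c * x + y) = c * (a - x) + (b - y). Proof. ring. Qed.
Lemma sub_lin3 c a b x y w : w - (x + c * y) = (a - x) + c * (b - y) - (a + c * b - w). Proof. ring. Qed.
Lemma sub_lin4 c a x : (1 - c) * x = c * (a - x) - (c * a - x). Proof. ring. Qed.
Lemma sub_lin5 a b c : a - b = (c - b) - (c - a). Proof. ring. Qed.
Lemma sub_lin6 c a b x y : (a + c * b) - (x + c * y) = (a - x) + c * (b - y). Proof. ring. Qed.
Lemma sub_lin7 a b c x : a * (b * x) + b * (c * x *+ 2) = (b * (c *+ 2) + a * b) * x. Proof. ring. Qed.
End RingIdentities.

Lemma zonal_term (T : numFieldType) (a b x y : T) :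
  (a - b) * (x - y) = a * x + b * y - 2 * (2^-1 * y * a + 2^-1 * b * x).
Proof. by field. Qed.

Lemma zonal_term2 (T : numFieldType) (a b : T) : 4 * ((2^-1 * b) * (2^-1 * a)) = a * b.
Proof. by field. Qed.

Section Pairing.
Context {R : realType} {n : nat}.
Local Notation K := n.+1.
Local Notation N := (\sum_(i < n.+1) 2)%N.
Local Notation vec := 'cV[R]_N.
Local Notation C := R[i].
Local Notation A := (mpoly (K + K) C).
Local Notation "p @_ m" := (@mcoeff (K + K) C m p) (at level 3, m at level 2, format "p @_ m").
Local Notation "0m" := (@mnm0 (K + K)).
Implicit Types (f g : sphere R n -> R) (x v : vec) (p q h : A) (y z : sphere R n) (d : R).

Lemma meanD p q : mean (p + q) = mean p + mean q. Proof. exact: linearD. Qed.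
Lemma Re_Ni (w : C) : Re (- 'i * w) = Im w.
Proof. by rewrite mulNr ReN mulrC ReiNIm opprK. Qed.
Lemma rfun_Ni p y : rfun (- 'i *: p) y = Im (ev (val y) p).
Proof. by rewrite /rfun evZ Re_Ni. Qed.
Lemma mean_Ni p : Re (mean (- 'i *: p)) = Im (mean p).
Proof. by rewrite meanZ Re_Ni. Qed.

Definition approx p d f := forall y, normc (ev (val y) p - (f y)%:C) <= d.

Lemma small_eq0 (z : C) (c : R) : (forall d, 0 < d -> normc z <= c * d) -> z = 0.
Proof.
move=> h; apply/eq0_normc/eqP; rewrite eq_le normc_ge0 andbT; apply/ler_addgt0Pr => e e0.
rewrite add0r; have c1 : 0 < `|c| + 1 by rewrite ltr_wpDl.
rewrite (le_trans (h (e / (`|c| + 1)) (divr_gt0 e0 c1))) // mulrA ler_pdivrMr // mulrC ler_pM2l //.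
by rewrite (le_trans (ler_norm c)) // lerDl.
Qed.

(** The integral of [f q] by continuity: a polynomial [p] within [d] of [f] determines it up to
    [coefsum q * d], and all lower bounds so obtained are compatible with all upper bounds, so their
    supremum is the common value. *)
Definition pairR f q : R :=
  sup [set r | exists p d, approx p d f /\ r = Re (mean (p * q)) - coefsum q * d].

Lemma approx_mean_sub f p p' d d' q : approx p d f -> approx p' d' f ->
  `|Re (mean ((p - p') * q))| <= (d + d') * coefsum q.
Proof.
move=> a b; apply: Re_mean_le => y; rewrite evM normcM; apply: ler_pM; rewrite ?normc_ge0 ?normc_ev_le //.
rewrite evB (_ : _ - _ = (ev (val y) p - (f y)%:C) - (ev (val y) p' - (f y)%:C)); last by ring.
by rewrite (le_trans (le_normcD _ _)) // normcN lerD.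
Qed.

Lemma pairRP f p d q : approx p d f -> `|Re (mean (p * q)) - pairR f q| <= coefsum q * d.
Proof.
move=> a; set S := [set r | exists p' d', approx p' d' f /\ r = Re (mean (p' * q)) - coefsum q * d'].
have ub r : S r -> r <= Re (mean (p * q)) + coefsum q * d.
  move=> [p' [d' [a' ->]]]; have := approx_mean_sub q a' a; rewrite mulrBl linearB /= ReB.
  by rewrite ler_norml => /andP[_]; lra.
have S0 : S (Re (mean (p * q)) - coefsum q * d) by exists p, d.
have hs : has_sup S by split; [exists (Re (mean (p * q)) - coefsum q * d) | exists (Re (mean (p * q)) + coefsum q * d)].
have u1 : pairR f q <= Re (mean (p * q)) + coefsum q * d by apply: ge_sup => //; exists (Re (mean (p * q)) - coefsum q * d).
have u2 : Re (mean (p * q)) - coefsum q * d <= pairR f q by apply: ub_le_sup => //; case: hs.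
by rewrite ler_norml; apply/andP; split; lra.
Qed.

(* The normalized integral of [f q] over the sphere. *)
Definition pairC f q : C := pairR f q +i* pairR f (- 'i *: q).
Definition pairc q : R := coefsum q + coefsum (- 'i *: q).

Lemma pairCP f p d q : approx p d f -> normc (mean (p * q) - pairC f q) <= pairc q * d.
Proof.
move=> a; rewrite (le_trans (normc_le _)) // mulrDl ReB ImB lerD //=; first exact: pairRP.
have -> : Im (mean (p * q)) = Re (mean (p * (- 'i *: q))) by rewrite -scalerAr mean_Ni.
exact: pairRP.
Qed.

(** The route to identities for [pairC]: they are verified on polynomial approximations up to an
    error linear in [d], and density lets [d] tend to [0]. *)
Lemma pairC_eq f q (z : C) c : sphere_smooth f ->
  (forall p d, 0 < d -> approx p d f -> normc (mean (p * q) - z) <= c * d) -> pairC f q = z.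
Proof.
move=> fs h; apply/eqP; rewrite -subr_eq0; apply/eqP; apply: (@small_eq0 _ (c + pairc q)) => d d0.
have [p a] := polynomial_density fs d0.
rewrite (sub_lin5 _ _ (mean (p * q))).
by rewrite (le_trans (le_normcD _ _)) // normcN mulrDl lerD ?h ?pairCP.
Qed.

Lemma pairC_linr f c q q' : sphere_smooth f -> pairC f (c *: q + q') = c * pairC f q + pairC f q'.
Proof.
move=> fs; apply: (pairC_eq (c := normc c * pairc q + pairc q') fs) => p d d0 a.
rewrite mulrDr linearD /= -scalerAr linearZ /=.
rewrite sub_lin.
rewrite (le_trans (le_normcD _ _)) // normcM mulrDl -mulrA lerD ?pairCP //.
by rewrite ler_wpM2l ?normc_ge0 ?pairCP.
Qed.

Lemma pairC_linl f g (c : R) q : sphere_smooth f -> sphere_smooth g ->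
  pairC (fun y => f y + c * g y) q = pairC f q + c%:C * pairC g q.
Proof.
move=> fs gs; have us := sphere_smoothD fs gs c; set u := fun y => _ in us *.
apply/eqP; rewrite -subr_eq0; apply/eqP.
apply: (@small_eq0 _ (pairc q * (1 + `|c|) + pairc q + `|c| * pairc q)) => d d0.
have [p a] := polynomial_density fs d0; have [p' a'] := polynomial_density gs d0.
have au : approx (p + c%:C *: p') ((1 + `|c|) * d) u.
  move=> y; rewrite evD evZ /u rmorphD rmorphM.
  rewrite sub_lin6.
  rewrite (le_trans (le_normcD _ _)) // normcM normc_real mulrDl mul1r lerD //.
  by rewrite ler_wpM2l.
have h1 := pairCP q au; have h2 := pairCP q a; have h3 := pairCP q a'.
have mE : mean ((p + c%:C *: p') * q) = mean (p * q) + c%:C * mean (p' * q).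
  by rewrite mulrDl linearD /= -scalerAl linearZ.
rewrite mE in h1; rewrite (sub_lin3 _ (mean (p * q)) (mean (p' * q))).
rewrite (le_trans (le_normcD _ _)) // normcN (le_trans (lerD (le_normcD _ _) h1)) // normcM normc_real.
rewrite (le_trans (lerD (lerD h2 (ler_wpM2l (normr_ge0 c) h3)) (lexx _))) //.
by rewrite le_eqVlt; apply/orP; left; apply/eqP; ring.
Qed.

Lemma sphere_smooth0 : sphere_smooth (fun _ : sphere R n => 0).
Proof.
have h0 : harm 0%:R (0 : A) by exact: harm0.
have := sphere_smooth_harm h0; congr sphere_smooth; apply/funext => y.
by rewrite /rfun /ev meval0.
Qed.

Lemma sphere_smooth_lin (I : Type) (r : seq I) (c : I -> R) (b : I -> sphere R n -> R) :
  (forall i, sphere_smooth (b i)) -> sphere_smooth (fun y => \sum_(i <- r) c i * b i y).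
Proof.
move=> bs; elim: r => [|i r IH].
  rewrite (_ : (fun y => _) = fun=> 0); first exact: sphere_smooth0.
  by apply/funext => y; rewrite big_nil.
have := sphere_smoothD IH (bs i) (c i); congr sphere_smooth; apply/funext => y.
by rewrite big_cons addrC.
Qed.

Lemma pairC_sum (I : Type) (r : seq I) (c : I -> R) (b : I -> sphere R n -> R) q :
  (forall i, sphere_smooth (b i)) ->
  pairC (fun y => \sum_(i <- r) c i * b i y) q = \sum_(i <- r) (c i)%:C * pairC (b i) q.
Proof.
move=> bs; elim: r => [|i r IH].
  rewrite big_nil; under eq_fun do rewrite big_nil.
  have := pairC_linl 1 q sphere_smooth0 sphere_smooth0.
  under eq_fun do rewrite mulr0 addr0.
  by rewrite mul1r => /eqP; rewrite eq_sym -subr_eq0 addrK => /eqP.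
rewrite big_cons -IH addrC -pairC_linl //; last exact: sphere_smooth_lin.
by congr pairC; apply/funext => y; rewrite big_cons addrC.
Qed.

Lemma sphere_laplacian_lin (I : Type) (r : seq I) (c : I -> R) (b : I -> sphere R n -> R) mu y :
  (forall i, sphere_smooth (b i)) -> (forall i y, sphere_laplacian (b i) y = mu * b i y) ->
  sphere_laplacian (fun y => \sum_(i <- r) c i * b i y) y = mu * \sum_(i <- r) c i * b i y.
Proof.
move=> bs be; elim: r => [|i r IH].
  rewrite big_nil; under eq_fun do rewrite big_nil.
  have := sphere_laplacianD sphere_smooth0 sphere_smooth0 1 y.
  under eq_fun do rewrite mulr0 addr0.
  by rewrite mul1r mulr0 => /eqP; rewrite eq_sym -subr_eq0 addrK => /eqP.
rewrite big_cons.
have e : (fun y => \sum_(j <- i :: r) c j * b j y) = fun y => (\sum_(j <- r) c j * b j y) + c i * b i y.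
  by apply/funext => z; rewrite big_cons addrC.
rewrite e (sphere_laplacianD (sphere_smooth_lin r c bs) (bs i)) IH be; ring.
Qed.

Lemma resolvent_norm f (s c : R) : 0 < s -> sphere_smooth f ->
  (forall y, `|sphere_laplacian f y + s * f y| <= s * c) -> forall y, `|f y| <= c.
Proof.
move=> s0 fs h y; rewrite ler_norml; apply/andP; split; last first.
  by apply: (resolvent_le s0 fs) => z; rewrite (le_trans (ler_norm _)) ?h.
have gs := sphere_smoothD fs fs (-2).
have hg z : sphere_laplacian (fun y => f y + (-2) * f y) z + s * (f z + (-2) * f z) <= s * c.
  rewrite (sphere_laplacianD fs fs) (le_trans _ (h z)) // -normrN (le_trans _ (ler_norm _)) //.
  by rewrite le_eqVlt; apply/orP; left; apply/eqP; ring.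
by have := resolvent_le s0 gs hg y; lra.
Qed.

Lemma mean_harm_sumM (h : nat -> A) D k (g : A) : (forall j, harm j%:R (h j)) -> harm k%:R g ->
  mean (harm_sum h D * g) = if (k < D)%N then mean (h k * g) else 0.
Proof.
move=> hh hg; elim: D => [|D IH]; first by rewrite /harm_sum big_ord0 mul0r raddf0.
rewrite harm_sumS mulrDl linearD /= IH ltnS; case: (ltngtP k D) => [lt|gt|->].
- by rewrite (mean_harmM (hh D) hg) ?addr0 // eqr_nat gtn_eqF.
- by rewrite (mean_harmM (hh D) hg) ?addr0 // eqr_nat ltn_eqF.
- by rewrite add0r.
Qed.

(** An eigenfunction is fixed by [(mu + 1) (Delta + 1)^-1]. If [p] approximates [f], then so does
    its image [r], because the resolvent is a contraction; but pairing with [g] multiplies by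
    [a = (mu + 1) / (lamk k + 1)]. In the limit [(1 - a)] times the pairing is zero, and [a] differs
    from [1]. *)
Lemma pairC_eigen f mu k (g : A) : sphere_smooth f -> (forall y, sphere_laplacian f y = mu * f y) ->
  harm k%:R g -> mu != @lamk R n k -> pairC f g = 0.
Proof.
move=> fs fe hg muk.
pose a : R := (mu + 1) / (@lamk R n k + 1).
have l1 : @lamk R n k + 1 != 0 :> R by rewrite gt_eqF // ltr_wpDl // lamk_ge0.
have a1 : 1 - a != 0.
  rewrite subr_eq0 eq_sym /a; apply: contra muk => /eqP e; have := congr1 (fun w => w * (@lamk R n k + 1)) e.
  by rewrite divfK // mul1r => /addIr ->.
have : (1 - a)%:C * pairC f g = 0.
  apply: (@small_eq0 _ (pairc g * (`|mu + 1| *+ 2) + `|a| * pairc g)) => d d0.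
  have [p ap] := polynomial_density fs d0; have [h [D [q [hh e]]]] := harm_decompS p.
  pose r := harm_sum (resolvent 1 (mu + 1) h) D.+1.
  have lt01 : 0 < 1 :> R by [].
  have pE y : ev (val y) p = ev (val y) (harm_sum h D.+1) by rewrite e ev_sphere.
  have ar : approx r (`|mu + 1| * d *+ 2) f.
    move=> y; rewrite (le_trans (normc_le _)) // mulr2n lerD //.
      rewrite ReB /=; move: y; have rs := smooth_harm_sum D.+1 (harm_resolvent 1 (mu + 1) hh).
      have us := sphere_smoothD rs fs (-1).
      move=> y; rewrite -[Re _]/(rfun r y) (_ : _ - _ = rfun r y + -1 * f y); last by rewrite mulN1r.
      move: y; apply: (resolvent_norm lt01 us) => y.
      rewrite (sphere_laplacianD rs fs) fe.
      have E : sphere_laplacian (rfun r) y + 1 * rfun r y = (mu + 1) * rfun (harm_sum h D.+1) y := laplacian_resolvent (mu + 1) D.+1 y lt01 hh.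
      have -> : sphere_laplacian (rfun r) y + -1 * (mu * f y) + 1 * (rfun r y + -1 * f y) =
          (mu + 1) * (rfun (harm_sum h D.+1) y - f y) by rewrite mulrBr -E; ring.
      rewrite mul1r normrM ler_wpM2l // (le_trans _ (ap y)) // (le_trans _ (Re_le_normc _)) //.
      by rewrite ReB pE.
    (* The factor [- 'i] turns the imaginary part into a real part, to which the same contraction
       estimate applies with [0] in place of [f]. *)
    pose h' j := - 'i *: h j.
    have hh' j : harm j%:R (h' j) by apply: harmZ.
    have sE (h0 : nat -> A) D0 : harm_sum (fun j => - 'i *: h0 j) D0 = - 'i *: harm_sum h0 D0 :> A.
      by rewrite /harm_sum scaler_sumr.
    have rE : harm_sum (resolvent 1 (mu + 1) h') D.+1 = - 'i *: r.
      by rewrite -sE; apply: eq_bigr => j _; rewrite /resolvent /h' !scalerA mulrC.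
    rewrite ImB /= subr0 -rfun_Ni -rE.
    have rs := smooth_harm_sum D.+1 (harm_resolvent 1 (mu + 1) hh').
    move: y; apply: (resolvent_norm lt01 rs) => y.
    rewrite (laplacian_resolvent (mu + 1) D.+1 y lt01 hh') mul1r normrM ler_wpM2l //.
    rewrite sE rfun_Ni -pE (le_trans _ (ap y)) // (le_trans _ (Im_le_normc _)) //.
    by rewrite ImB /= subr0.
  have mE : mean (r * g) = a%:C * mean (p * g).
    rewrite /r (mean_harm_sumM D.+1 (harm_resolvent 1 (mu + 1) hh) hg) e mulrDl linearD /=.
    rewrite -mulrA mean_sphere addr0 (mean_harm_sumM D.+1 hh hg).
    case: ifP => _; last by rewrite mulr0.
    by rewrite /resolvent -scalerAl linearZ.
  have h1 := pairCP g ar; have h2 := pairCP g ap.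
  rewrite rmorphB rmorph1 (sub_lin4 _ (mean (p * g))) -mE.
  rewrite (le_trans (le_normcD _ _)) // normcN normcM normc_real.
  rewrite (le_trans (lerD (ler_wpM2l (normr_ge0 a) h2) h1)) //.
  by rewrite sub_lin7.
by move/eqP; rewrite mulf_eq0 => /orP[|/eqP //]; rewrite -(rmorph0 (@real_complex R)) (inj_eq (@complexI R)) (negPf a1).
Qed.

(** As a function of [z] on the sphere this is [1 + <z, y>], nonnegative and largest at [z = y]. Its
    high powers act as an approximate delta function at [y]. *)
Definition zonal (y : sphere R n) : A :=
  1 + linf (fun i => 2^-1 * (zc (val y) i)^*) (fun i => 2^-1 * zc (val y) i).

Lemma ev_zonal y z : ev (val z) (zonal y) = (2 - sqnorm (val z - val y) / 2)%:C.
Proof.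
have e : (sqnorm (val z - val y))%:C = \sum_i (zc (val z) i - zc (val y) i) * ((zc (val z) i)^* - (zc (val y) i)^*).
  rewrite sqnorm_zc; apply: eq_bigr => i _; apply: complex_ext => /=; rewrite !mxE; ring.
have e1 : \sum_i zc (val z) i * (zc (val z) i)^* = 1 :> C by rewrite -sqnorm_zc sphereP.
have e2 : \sum_i zc (val y) i * (zc (val y) i)^* = 1 :> C by rewrite -sqnorm_zc sphereP.
rewrite rmorphB rmorphM /= e fmorphV !rmorph_nat /zonal evD ev1 /linf ev_sum.
set S := \sum_i ev _ _.
have -> : \sum_i (zc (val z) i - zc (val y) i) * ((zc (val z) i)^* - (zc (val y) i)^*) = 2 - 2 * S.
  transitivity (\sum_i zc (val z) i * (zc (val z) i)^* + \sum_i zc (val y) i * (zc (val y) i)^* - 2 * S); last by rewrite e1 e2.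
  rewrite -big_split /= /S mulr_sumr -sumrB; apply: eq_bigr => i _.
  by rewrite evD !evZ ev_zz ev_zb zonal_term.
by move: S => S; rewrite mulrBl mulrAC divff ?pnatr_eq0 // mul1r; field.
Qed.

Lemma zonal_sum y : 4 * (\sum_i (2^-1 * (zc (val y) i)^*) * (2^-1 * zc (val y) i)) = 1 :> C.
Proof.
have e2 : \sum_i zc (val y) i * (zc (val y) i)^* = 1 :> C by rewrite -sqnorm_zc sphereP.
rewrite -[RHS]e2 mulr_sumr; apply: eq_bigr => i _; by rewrite zonal_term2.
Qed.

Lemma sqnormB_sphere y z : 0 <= sqnorm (val z - val y) / 2 <= 2.
Proof.
rewrite divr_ge0 ?sqnorm_ge0 //= ler_pdivrMr //.
have -> : 2 * 2 = 2 * sqnorm (val z) + 2 * sqnorm (val y) :> R by rewrite !sphereP; ring.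
rewrite /sqnorm !mulr_sumr -big_split /=; apply: ler_sum => i _; rewrite !mxE.
by rewrite -subr_ge0 (_ : _ - _ = (val z i 0 + val y i 0) ^+ 2) ?sqr_ge0 //; ring.
Qed.

Lemma ev_zonalX y z j : ev (val z) (zonal y ^+ j) = ((2 - sqnorm (val z - val y) / 2) ^+ j)%:C.
Proof. by rewrite evX ev_zonal rmorphXn. Qed.

Lemma zonal_ge0 y z j : 0 <= (2 - sqnorm (val z - val y) / 2) ^+ j.
Proof. by have /andP[_ h] := sqnormB_sphere y z; rewrite exprn_ge0 // subr_ge0. Qed.

(** Bernoulli's inequality [(1 + u) ^ j >= 1 + j u] with [u = <z, y>], averaged over the sphere: the
    linear form has mean zero. *)
Lemma mean_zonal_ge1 y j : 1 <= Re (mean (zonal y ^+ j)).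
Proof.
have b z : 1 + j%:R * ((2 - sqnorm (val z - val y) / 2) - 1) <= (2 - sqnorm (val z - val y) / 2) ^+ j.
  have /andP[h0 h2] := sqnormB_sphere y z; set s := sqnorm _ / 2 in h0 h2 *.
  have [s0 s1] : 0 <= 2 - s /\ 2 - s - 1 <= 1 by split; lra.
  elim: j => [|j IH]; first by rewrite mul0r addr0 expr0.
  have IH' := ler_wpM2l s0 IH.
  rewrite exprS (le_trans _ IH') // -natr1; set J : R := j%:R; have J0 : 0 <= J by exact: ler0n.
  rewrite -subr_ge0 (_ : _ - _ = J * (1 - s) ^+ 2); last by ring.
  by rewrite mulr_ge0 ?sqr_ge0.
have h : 0 <= Re (mean (zonal y ^+ j - (1 + j%:R *: (zonal y - 1)))).
  apply: mean_ge => z; rewrite /rfun evB ReB ev_zonalX subr_ge0 evD evZ evB !ev1 ev_zonal natC.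
  by rewrite -(rmorph1 (@real_complex R)) -rmorphB -rmorphM -rmorphD /=; exact: b.
have m1 : mean (zonal y) = 1 by rewrite meanD mean1 mean_linf ?addr0 //; exact: zonal_sum.
move: h; rewrite meanB meanD meanZ meanB m1 mean1 subrr mulr0 addr0 ReB subr_ge0.
exact: id.
Qed.

Lemma pairR_real f p d q : approx p d f -> (forall y, Im (ev (val y) q) = 0) ->
  `|Im (mean (p * q))| <= coefsum q * d.
Proof.
move=> a rq.
rewrite -mean_Ni.
have b y : `|rfun (- 'i *: (p * q)) y| <= coefsum q * d.
  have h1 := le_trans (Re_le_normc _) (normc_ev_le q y).
  have h2 : `|Im (ev (val y) p)| <= d.
    by apply: le_trans (a y); apply: le_trans (Im_le_normc _); rewrite ImB subr0.
  rewrite rfun_Ni evM ImM rq mulr0 add0r normrM mulrC.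
  exact: (ler_pM (normr_ge0 _) (normr_ge0 _) h1 h2).
rewrite ler_norml; apply/andP; split.
  by apply: mean_ge => y; have := b y; rewrite ler_norml => /andP[].
by apply: mean_le => y; have := b y; rewrite ler_norml => /andP[].
Qed.

Lemma pairC_real f q : sphere_smooth f -> (forall y, Im (ev (val y) q) = 0) -> Im (pairC f q) = 0.
Proof.
move=> fs rq.
have -> : pairC f q = (pairR f q)%:C; last by [].
apply: (pairC_eq (c := coefsum q + coefsum q) fs) => p d d0 a.
rewrite (le_trans (normc_le _)) // mulrDl lerD //.
  by rewrite ReB /=; exact: pairRP.
by rewrite ImB /= subr0; exact: pairR_real a rq.
Qed.

(** By [smooth_quadratic], [f] is at least [3 / 4] of [f y] minus a multiple of the squared distance
    to [y]. Against a high power of [zonal y] that multiple costs at most a quarter of [f y], and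
    replacing [f] by a polynomial costs another quarter. *)
Lemma pairC_zonal_gt0 f y : sphere_smooth f -> 0 < f y -> exists j, 0 < Re (pairC f (zonal y ^+ j)).
Proof.
move=> fs f0; have f4 : 0 < f y / 4 by rewrite divr_gt0.
have [kap k0 hk] := smooth_quadratic fs f4.
(* The squared distance to [y] is [2 (1 - t)], and by [mean_zonal] the mean of [(1 - t) q] is at
   most [(2 n + 1) / (j + 1)] times that of [q]. *)
pose B : R := 2 * kap * n.*2.+1%:R.
have B0 : 0 <= B by rewrite mulr_ge0 // mulr_ge0.
pose j := Num.bound (B / (f y / 4)).
have hj : B <= f y / 4 * j.+1%:R.
  rewrite [leRHS]mulrC -ler_pdivrMr //; apply: le_trans (ltW (archi_boundP _)) _.
    by rewrite divr_ge0 // ltW.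
  by rewrite ler_nat.
exists j.+1; set q := zonal y ^+ j.+1.
have C0 : 0 < 1 + coefsum q by rewrite ltr_pwDl // coefsum_ge0.
(* The approximation error enters twice, as [d] times the mean of [q] and as [coefsum q * d] in
   [pairRP]; this [d] bounds both together. *)
pose d := f y / (4 * (1 + coefsum q)).
have d0 : 0 < d by rewrite divr_gt0 // mulr_gt0.
have dE : d * (1 + coefsum q) = f y / 4 by rewrite /d; field; rewrite gt_eqF.
have [p a] := polynomial_density fs d0.
have q1 : 1 <= Re (mean q) by exact: mean_zonal_ge1.
pose t := linf (fun i => 2^-1 * (zc (val y) i)^*) (fun i => 2^-1 * zc (val y) i).
have tE : zonal y = 1 + t by [].
have evt z : ev (val z) (1 - t) = (sqnorm (val z - val y) / 2)%:C.
  have -> : 1 - t = 2 *: 1 - zonal y by rewrite tE scaler_nat mulr2n; ring.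
  rewrite evB evZ ev1 mulr1 ev_zonal natC -rmorphB; congr (_ %:C); ring.
pose c0 := f y * 3 / 4 - d.
have h1 : c0 * Re (mean q) - 2 * kap * Re (mean ((1 - t) * q)) <= Re (mean (p * q)).
  have : 0 <= Re (mean (p * q - (c0%:C *: q - (2 * kap)%:C *: ((1 - t) * q)))).
    apply: mean_ge => z; rewrite /rfun evB (evM _ p) evB !evZ (evM _ (1 - t)) evt /q ev_zonalX.
    set Q := (2 - _) ^+ _; have Q0 : 0 <= Q by exact: zonal_ge0.
    have -> : ev (val z) p * Q%:C - (c0%:C * Q%:C - (2 * kap)%:C * ((sqnorm (val z - val y) / 2)%:C * Q%:C)) =
        Q%:C * (ev (val z) p - (c0 - kap * sqnorm (val z - val y))%:C).
      rewrite -!rmorphM -rmorphB [RHS]mulrC [RHS]mulrBl -rmorphM; congr (_ - _%:C).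
      by set s := sqnorm _; field.
    rewrite ReZ mulr_ge0 // ReB /= subr_ge0.
    have := le_trans (Re_le_normc _) (a z); rewrite ReB /= ler_norml => /andP[az _].
    have := hk y (val z); rewrite radial_ext_val ler_norml => /andP[kz _].
    rewrite /c0; set s := kap * _ in kz *; lra.
  rewrite !meanB !meanZ !ReB !ReZ subr_ge0; exact: id.
have h2 : Re (mean ((1 - t) * q)) * j.+1%:R <= n.*2.+1%:R * Re (mean q).
  have /(congr1 (fun w : C => Re w)) := mean_zonal (zonal_sum y) j; rewrite -/t -tE -/q !natC !ReZ => E.
  rewrite mulrC -E ler_wpM2l //.
  have : 0 <= Re (mean ((1 - t) * q)).
    apply: mean_ge => z; rewrite /rfun evM evt /q ev_zonalX -rmorphM /= mulr_ge0 ?zonal_ge0 //.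
    by rewrite divr_ge0 ?sqnorm_ge0.
  by rewrite mulrBl mul1r meanB ReB subr_ge0.
have h3 : 2 * kap * Re (mean ((1 - t) * q)) <= f y / 4 * Re (mean q).
  have J0 : 0 < j.+1%:R :> R by [].
  have k2 : 0 <= 2 * kap by rewrite mulr_ge0.
  have i1 := ler_wpM2l k2 h2; have i2 := ler_wpM2r (le_trans ler01 q1) hj.
  rewrite -(ler_pM2r J0); move: i1 i2; rewrite /B.
  move: (Re (mean ((1 - t) * q))) (Re (mean q)) (j.+1%:R : R) (n.*2.+1%:R : R) (f y / 4) => X m J c F i1 i2.
  by apply: (le_trans (_ : _ <= 2 * kap * c * m)); [rewrite -!mulrA; rewrite -!mulrA in i1 | rewrite [leRHS]mulrAC].
have := pairRP q a; rewrite ler_norml => /andP[_ h4].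
rewrite -[Re (pairC f q)]/(pairR f q).
have h5 : 0 <= coefsum q * d by rewrite mulr_ge0 ?coefsum_ge0 // ltW.
have h6 : f y / 4 * 1 <= f y / 4 * Re (mean q) by rewrite ler_pM2l.
have h7 : d * Re (mean q) <= f y / 4 * Re (mean q).
  rewrite ler_wpM2r ?(le_trans ler01) // -dE mulrDr mulr1 lerDl mulrC //.
move: h1; rewrite /c0 mulrBl => h1.
have h8 : d + coefsum q * d = f y / 4 by rewrite -dE; ring.
have e3 : f y * 3 / 4 * Re (mean q) = f y / 4 * Re (mean q) *+ 3 by ring.
rewrite e3 in h1; move: (f y / 4 * Re (mean q)) (d * Re (mean q)) (coefsum q * d) h1 h3 h4 h5 h6 h7 h8 => u v w h1 h3 h4 h5 h6 h7 h8.
move: (2 * kap * _) (f y / 4) (pairR f q) (Re (mean (p * q))) h1 h3 h4 h6 h7 h8 => x F r P h1 h3 h4 h6 h7 h8.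
lra.
Qed.

(** Powers of [zonal y] are real on the sphere, so the hypothesis separates into one for [f] and one
    for [g]; a nonzero value of either sign would be detected by [pairC_zonal_gt0]. *)
Lemma pairC_nondegenerate f g : sphere_smooth f -> sphere_smooth g ->
  (forall q, pairC f q + 'i * pairC g q = 0) -> forall y, f y = 0 /\ g y = 0.
Proof.
move=> fs gs h.
have rz y j : Re (pairC f (zonal y ^+ j)) = 0 /\ Re (pairC g (zonal y ^+ j)) = 0.
  have im z : Im (ev (val z) (zonal y ^+ j)) = 0 by rewrite ev_zonalX.
  have hz := h (zonal y ^+ j); have fi := pairC_real fs im; have gi := pairC_real gs im.
  split.
    by have /(congr1 (fun w : C => Re w)) := hz; rewrite ReD ReM gi /= mul0r mulr0 subr0 addr0.
  by have /(congr1 (fun w : C => Im w)) := hz; rewrite ImD ImM fi gi /= mul0r mul1r !add0r.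
have key u y : sphere_smooth u -> (forall y j, Re (pairC u (zonal y ^+ j)) = 0) -> u y <= 0.
  move=> us hu; rewrite leNgt; apply/negP => /(pairC_zonal_gt0 us)[j]; by rewrite hu ltxx.
have keyN u y : sphere_smooth u -> (forall y j, Re (pairC u (zonal y ^+ j)) = 0) -> u y = 0.
  move=> us hu; have h1 := key u y us hu.
  have h2 := key (fun z => u z + (-2) * u z) y (sphere_smoothD us us (-2)).
  have {h2} : u y + -2 * u y <= 0.
    by apply: h2 => z j; rewrite pairC_linl // ReD ReZ hu mulr0 addr0.
  by lra.
by move=> y; split; apply: keyN => // z j; have [] := rz z j.
Qed.

End Pairing.

(** * Eigenspaces of the lens space *)

Lemma lin_combine (T : comPzRingType) (a c x y x' y' : T) :
  a * x + y + c * (a * x' + y') = a * (x + c * x') + (y + c * y').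
Proof. ring. Qed.

(** * Polynomials are determined by their values *)

Section Evaluation.
Context {R : realType} {n : nat}.
Local Notation K := n.+1.
Local Notation N := (\sum_(i < n.+1) 2)%N.
Local Notation vec := 'cV[R]_N.
Local Notation C := R[i].
Local Notation A := (mpoly (K + K) C).
Local Notation "p @_ m" := (@mcoeff (K + K) C m p) (at level 3, m at level 2, format "p @_ m").
Local Notation "0m" := (@mnm0 (K + K)).
Local Notation ix i := (tagnat.Rank i (ord0 : 'I_2) : 'I_N).
Local Notation iy i := (tagnat.Rank i (ord_max : 'I_2) : 'I_N).
Implicit Types (x v : vec) (p q h : A) (y z : sphere R n).

Lemma cderive_eq0 x v (f : vec -> C) d : (forall w, f w = 0) -> is_cderive x v f d -> d = 0.
Proof.
move=> f0 [[_ d1] [_ d2]]; have e : f = fun=> 0 by apply/funext.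
by apply: complex_ext; rewrite -?d1 -?d2 e; apply: (derive_cst (0 : R)).
Qed.

Lemma mcoeff_ev0 p : ev 0 p = p@_0m.
Proof.
have pt0 : @pt R n 0 = fun=> 0.
  apply/funext => v; rewrite -(splitK v); case: (fintype.split v) => j /=; rewrite ?pt_l ?pt_r /zc !mxE.
    by [].
  by apply: complex_ext => /=; rewrite ?oppr0.
elim/mpolyind: p => [|c m p _ _ IH]; first by rewrite /ev meval0 mcoeff0.
rewrite evD evZ IH mcoeffD mcoeffZ mcoeffX; congr (c * _ + _).
rewrite /ev mevalX pt0; case: (eqVneq m 0m) => [->|m0].
  by rewrite big1 // => v _; rewrite mnm0E expr0.
have /existsP[v mv] : [exists v, m v != 0%N].
  rewrite -negb_forall; apply: contra m0 => /forallP h; apply/eqP/mnmP => v.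
  by rewrite mnm0E; apply/eqP.
by rewrite (bigD1 v) //= expr0n (negPf mv) mul0r.
Qed.

Lemma ev_mderiv_eq0 p (v : 'I_(K + K)) : (forall x, ev x p = 0) -> forall x, ev x (mderiv v p) = 0.
Proof.
move=> h x.
have dz_dzb i : ev x (dz i p) = 0 /\ ev x (dzb i p) = 0.
  have h1 := cderive_eq0 h (is_cderive_ev_x x i p).
  have h2 := cderive_eq0 h (is_cderive_ev_y x i p).
  move: h1 h2; rewrite /dx /dy evD evZ evB => h1 /eqP; rewrite mulf_eq0 subr_eq0 => /orP[|/eqP e].
    by rewrite -(sqrf_eq0 'i) sqr_i oppr_eq0 oner_eq0.
  move/eqP: h1; rewrite e -mulr2n mulrn_eq0 /= => /eqP e'.
  by split.
rewrite -(splitK v); case: (fintype.split v) => i; [exact: (dz_dzb i).1 | exact: (dz_dzb i).2].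
Qed.

Lemma ev_eq0 p : (forall x, ev x p = 0) -> p = 0.
Proof.
move=> h; apply/mpolyP => m; rewrite mcoeff0.
move: {2}(mdeg m) (erefl (mdeg m)) => k; elim: k m p h => [|k IH] m p h mk.
  by have -> : m = 0m; [apply/eqP; rewrite -mdeg_eq0 mk | rewrite -mcoeff_ev0].
have /existsP[v mv] : [exists v, m v != 0%N].
  rewrite -negb_forall; apply/negP => /forallP e; move/eqP: mk.
  by rewrite mdegE big1 // => v _; apply/eqP.
have e : mnm_add (mnm_sub m (mnm1 v)) (mnm1 v) = m.
  by apply/mnmP => u; rewrite mnmDE mnmBE mnm1E subnK //; case: eqVneq => [<-|//]; rewrite lt0n.
have := IH (mnm_sub m (mnm1 v)) _ (ev_mderiv_eq0 v h).
rewrite mcoeff_mderiv e => H; apply/eqP; have /eqP : mcoeff m p *+ (mnm_sub m (mnm1 v) v).+1 = 0; last by rewrite mulrn_eq0.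
apply: H; have := congr1 mdeg e; rewrite mdegD mdeg1 mk addn1 => -[]; exact: id.
Qed.

Lemma harm_sphere_eq0 k h : harm k%:R h -> (forall y, ev (val y) h = 0) -> h = 0.
Proof.
move=> hh h0; apply: ev_eq0 => x; case: (eqVneq x 0) => [->|x0].
  have y0 : sphere R n.
    by apply: (@normalize R n (delta_mx (ix ord0) 0)); apply/eqP => /matrixP/(_ (ix ord0) 0)/eqP; rewrite !mxE !eqxx oner_eq0.
  by rewrite -(scale0r (val y0)) (ev_hom_scale _ _ hh.2) h0 mulr0.
have -> : x = enorm x *: val (normalize x0) by rewrite /= scalerA mulfV ?scale1r // gt_eqF ?enorm_gt0.
by rewrite (ev_hom_scale _ _ hh.2) h0 mulr0.
Qed.

Lemma kernel_vector (d D : nat) (M : 'M[C]_(d, D)) : (D < d)%N ->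
  exists2 c : 'rV[C]_d, c != 0 & c *m M = 0.
Proof.
move=> Dd; exists (nz_row (kermx M)).
  rewrite nz_row_eq0 -mxrank_eq0 mxrank_ker subn_eq0 -ltnNge.
  exact: leq_ltn_trans (rank_leq_col M) Dd.
by apply/sub_kermxP; apply: nz_row_sub.
Qed.

End Evaluation.

Section Lens.
Context {R : realType} {n q : nat} (p : 'I_n.+1 -> int).
Local Notation K := n.+1.
Local Notation N := (\sum_(i < n.+1) 2)%N.
Local Notation vec := 'cV[R]_N.
Local Notation C := R[i].
Local Notation A := (mpoly (K + K) C).
Local Notation "p @_ m" := (@mcoeff (K + K) C m p) (at level 3, m at level 2, format "p @_ m").
Local Notation "0m" := (@mnm0 (K + K)).
Local Notation ix i := (tagnat.Rank i (ord0 : 'I_2) : 'I_N).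
Local Notation iy i := (tagnat.Rank i (ord_max : 'I_2) : 'I_N).
Local Notation T := (lens_generator R q p).
Local Notation lens := (lens_space R q p).
Local Notation proj := (@lens_proj R n q p).
Implicit Types (x v : vec) (h : A) (y z : sphere R n).

Definition langle (i : 'I_K) : R := 2 * pi * (p i)%:~R / q%:R.

Lemma mxdiag_Rank (B : 'I_K -> 'M[R]_2) i j (a b : 'I_2) :
  (\mxdiag_i B i) (tagnat.Rank i a) (tagnat.Rank j b) = if i == j then B i a b else 0.
Proof.
have := congr1 (fun M : 'M[R]_2 => M a b) (mxblockK (fun i j => if i == j then conform_mx 0 (B i) else 0 : 'M[R]_2) i j).
rewrite /submxblock mxE /mxdiag => E.
apply: (etrans E); by case: eqP => [_|_]; rewrite ?conform_mx_id ?mxE.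
Qed.

Lemma zc_rotation (a : 'I_K -> R) v i :
  zc ((\mxdiag_i rotation (a i)) *m v) i = expi (a i) * zc v i.
Proof.
have row (b : 'I_2) : ((\mxdiag_i rotation (a i)) *m v) (tagnat.Rank i b) 0 =
    rotation (a i) b ord0 * v (ix i) 0 + rotation (a i) b ord_max * v (iy i) 0.
  rewrite mxE (sum_coords (fun j => (\mxdiag_i rotation (a i)) (tagnat.Rank i b) j * v j 0)).
  rewrite [LHS](bigD1 i) //= !mxdiag_Rank eqxx [X in _ + X]big1 ?addr0 // => j ji.
  by rewrite !mxdiag_Rank eq_sym (negPf ji) !mul0r addr0.
rewrite /zc !row !mxE /=; apply: complex_ext; rewrite ?ReM ?ImM /=; ring.
Qed.

Lemma zc_gen k v i : zc (T ^+ k *m v) i = expi (k%:R * langle i) * zc v i.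
Proof. by rewrite generatorX zc_rotation. Qed.

Lemma expi_conj (t : R) : (expi t)^*%C = expi (- t).
Proof. by rewrite /expi cosN sinN. Qed.

Lemma expiD (s t : R) : expi (s + t) = expi s * expi t.
Proof. by rewrite /expi cosD sinD; apply: complex_ext => /=; ring. Qed.

Lemma expi0 : expi 0 = 1 :> C.
Proof. by rewrite /expi cos0 sin0. Qed.

Lemma expiN_mul (t : R) : expi t * expi (- t) = 1.
Proof. by rewrite -expiD subrr expi0. Qed.

Lemma expi_norm (t : R) : expi t * (expi t)^*%C = 1.
Proof. by rewrite expi_conj expiN_mul. Qed.

Lemma expiX (t : R) k : expi t ^+ k = expi (k%:R * t).
Proof. by elim: k => [|k IH]; rewrite ?mul0r ?expi0 // exprS IH -expiD -natr1 mulrDl mul1r addrC. Qed.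

Lemma conjcM (a b : C) : (a * b)^*%C = a^*%C * b^*%C.
Proof. exact: rmorphM. Qed.

Lemma sqnorm_gen k v : sqnorm (T ^+ k *m v) = sqnorm v.
Proof.
apply: (@complexI R); rewrite !sqnorm_zc; apply: eq_bigr => i _.
rewrite zc_gen; apply: (etrans (congr1 (fun w => _ * w) (conjcM _ _))).
by rewrite mulrACA expi_norm mul1r.
Qed.

Lemma gen_sphere_subproof k y : T ^+ k *m val y \in [set x : vec | sqnorm x = 1].
Proof. by rewrite inE /= sqnorm_gen sphereP. Qed.

Definition lens_act k y : sphere R n := Sub (T ^+ k *m val y) (gen_sphere_subproof k y).

Lemma proj_act k y : proj (lens_act k y) = proj y.
Proof.
apply/eqmodP; rewrite /= /same_orbit; have h : same_orbit q p y (lens_act k y) by apply/asboolP; exists k.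
have e := same_orbit_sym q p y (lens_act k y); rewrite h in e; exact: esym e.
Qed.

Lemma proj_eqP y z : proj y = proj z -> exists k, z = lens_act k y.
Proof.
move/eqmodP => /= /asboolP[k e]; exists k; exact: val_inj.
Qed.

Lemma projK (u : lens) : proj (repr u) = u.
Proof. exact: reprK. Qed.

Definition alph k (v : 'I_(K + K)) : C :=
  match fintype.split v with inl i => expi (k%:R * langle i) | inr i => expi (- (k%:R * langle i)) end.

Lemma alph_l k i : alph k (lshift K i) = expi (k%:R * langle i).
Proof. by rewrite /alph (unsplitK (inl i : 'I_K + 'I_K)). Qed.
Lemma alph_r k i : alph k (rshift K i) = expi (- (k%:R * langle i)).
Proof. by rewrite /alph (unsplitK (inr i : 'I_K + 'I_K)). Qed.

Lemma alph1 k i : alph k (lshift K i) * alph k (rshift K i) = 1.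
Proof. by rewrite alph_l alph_r expiN_mul. Qed.

Lemma malphaX k m : malpha (alph k) m = malpha (alph 1) m ^+ k.
Proof.
rewrite /malpha -prodrXl; apply: eq_bigr => v _; rewrite exprAC; congr (_ ^+ _).
rewrite -(splitK v); case: (fintype.split v) => i /=; rewrite ?alph_l ?alph_r expiX mul1r //.
by rewrite mulrN.
Qed.

Lemma ev_act k y h : ev (val (lens_act k y)) h = ev (val y) (tau (alph k) h).
Proof.
rewrite /ev meval_tau; apply: meval_eq => v.
rewrite -(splitK v); case: (fintype.split v) => i /=; rewrite ?pt_l ?pt_r ?alph_l ?alph_r zc_gen //.
by rewrite conjcM expi_conj.
Qed.

Lemma pairC_invariant (f : sphere R n -> R) k h : sphere_smooth f -> (forall y, f (lens_act k y) = f y) ->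
  pairC f (tau (alph k) h) = pairC f h.
Proof.
move=> fs fk; apply/esym; apply: (pairC_eq (c := pairc (tau (alph k) h)) fs) => g d d0 a.
rewrite -(mean_tau (alph1 k)) tauM; apply: pairCP => y.
by rewrite -ev_act -fk; exact: a.
Qed.

Lemma pairC_hcompl (f : sphere R n -> R) m : sphere_smooth f -> (forall y, f (lens_act 1 y) = f y) ->
  malpha (alph 1) m != 1 -> pairC f (hcompl C m) = 0.
Proof.
move=> fs fk am; have := pairC_invariant (hcompl C m) fs fk.
rewrite (tau_hcompl (alph1 1)).
have lin0 c : pairC f (c *: hcompl C m) = c * pairC f (hcompl C m).
  have z0 : pairC f (0 : A) = 0.
    have := pairC_linr 1 (0 : A) 0 fs; rewrite scaler0 addr0 mul1r => /eqP.
    by rewrite -subr_eq0 opprD addrA subrr sub0r oppr_eq0 => /eqP.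
  by have := pairC_linr c (hcompl C m) 0 fs; rewrite !addr0 z0 addr0.
rewrite lin0 => /eqP; rewrite -subr_eq0 -{2}[pairC _ _]mul1r -mulrBl mulf_eq0 subr_eq0 (negPf am) /=.
by move/eqP.
Qed.

Local Notation E mu := (@laplace_eigenspace R n q p mu).

Lemma eigenspace0 mu : E mu (fun=> 0).
Proof.
split=> [|y]; first exact: sphere_smooth0.
have h0 : harm 0%:R (0 : A) by exact: harm0.
have e : (fun=> 0) \o proj = rfun (0 : A).
  by apply/funext => z; rewrite /rfun /ev meval0.
by rewrite e (laplacian_harm y h0) /rfun /ev meval0 mulr0 mulr0.
Qed.

(** With more basis functions than entries of [s], some nonzero complex combination [f1 + i f2]
    pairs to zero with the completions of all monomials in [s]. It pairs to zero with the other
    completions of the same degree by invariance, and with other degrees by [pairC_eigen]; so it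
    vanishes, against the uniqueness of coordinates. If [mu] is not of the form [lamk k], the list
    may be empty. *)
Lemma eigen_dim_le mu d (s : seq (multinom (K + K))) : has_dim (E mu) d ->
  (forall k m, mu = @lamk R n k -> reduced m -> mdeg m = k -> malpha (alph 1) m = 1 -> m \in s) ->
  (d <= size s)%N.
Proof.
move=> [b [bE bu]] hs; rewrite leqNgt; apply/negP => sd.
pose B i := b i \o proj.
have Bs i : sphere_smooth (B i) by have [] := bE i.
have Be i y : sphere_laplacian (B i) y = mu * B i y by have [_] := bE i; apply.
pose M : 'M[C]_(d, size s) := \matrix_(i, j) pairC (B i) (hcompl C (nth 0m s j)).
have [c c0 cM] := kernel_vector M sd.
pose f1 y := \sum_i Re (c 0 i) * B i y; pose f2 y := \sum_i Im (c 0 i) * B i y.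
have f1s : sphere_smooth f1 by exact: sphere_smooth_lin.
have f2s : sphere_smooth f2 by exact: sphere_smooth_lin.
have f1e y : sphere_laplacian f1 y = mu * f1 y by exact: sphere_laplacian_lin.
have f2e y : sphere_laplacian f2 y = mu * f2 y by exact: sphere_laplacian_lin.
have f1i y : f1 (lens_act 1 y) = f1 y by apply: eq_bigr => i _; rewrite /B /= proj_act.
have f2i y : f2 (lens_act 1 y) = f2 y by apply: eq_bigr => i _; rewrite /B /= proj_act.
pose Phi h := pairC f1 h + 'i * pairC f2 h.
have PhiE h : Phi h = \sum_i c 0 i * pairC (B i) h.
  rewrite /Phi !(pairC_sum _ _ _ Bs) mulr_sumr -big_split /=; apply: eq_bigr => i _.
  rewrite mulrA -mulrDl; congr (_ * _); case: (c 0 i) => u v.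
  by apply: complex_ext; rewrite ?ReD ?ImD ?ReM ?ImM /=; ring.
have Phi_lin a g h : Phi (a *: g + h) = a * Phi g + Phi h.
  by rewrite /Phi !pairC_linr // lin_combine.
have Phi0 : Phi 0 = 0 by have := Phi_lin 1 0 0; rewrite scaler0 addr0 mul1r => /eqP; rewrite -subr_eq0 opprD addrA subrr sub0r oppr_eq0 => /eqP.
have Phi_hcompl k m : mu = @lamk R n k -> reduced m -> mdeg m = k -> Phi (hcompl C m) = 0.
  move=> mk rm dm; have [am|am] := eqVneq (malpha (alph 1) m) 1; last first.
    by rewrite /Phi !pairC_hcompl // mulr0 addr0.
  have ms := hs k m mk rm dm am.
  have js : (index m s < size s)%N by rewrite index_mem.
  have := congr1 (fun M : 'rV_(size s) => M 0 (Ordinal js)) cM; rewrite !mxE => e.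
  rewrite PhiE -[RHS]e; apply: eq_bigr => i _.
  by rewrite mxE nth_index.
have Phi_harm k h : harm k%:R h -> Phi h = 0.
  move=> hh; have [mk|mk] := eqVneq mu (@lamk R n k); last first.
    by rewrite /Phi (pairC_eigen f1s f1e hh mk) (pairC_eigen f2s f2e hh mk) mulr0 addr0.
  rewrite (harm_expand hh) big_seq_cond.
  apply: (big_ind (fun h => Phi h = 0)) => [//|g g' e e'|m /andP[mh rm]].
    by rewrite -[g]scale1r Phi_lin e e' mulr0 addr0.
  rewrite -[_ *: _]addr0 Phi_lin Phi0 addr0 (Phi_hcompl k) ?mulr0 //.
  exact: harm_mdeg hh mh.
have Phi_all h : Phi h = 0.
  have [g [D [r [hg ->]]]] := harm_decompS h.
  rewrite -[X in X + _]scale1r Phi_lin mul1r.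
  have -> : Phi ((rhoT C n - 1) * r) = 0.
    have z f : sphere_smooth f -> pairC f ((rhoT C n - 1) * r) = 0.
      move=> fs; apply: (pairC_eq (c := 0) fs) => g' d' d0 _.
      by rewrite mulrCA mean_sphere subr0 normc0 mul0r.
    by rewrite /Phi !z // mulr0 addr0.
  rewrite addr0 /harm_sum; apply: (big_ind (fun h => Phi h = 0)) => [//|u v e e'|j _].
    by rewrite -[u]scale1r Phi_lin e e' mulr0 addr0.
  exact: Phi_harm (hg j).
have nd := pairC_nondegenerate f1s f2s Phi_all.
have [c' [_ cu]] := bu _ (eigenspace0 mu).
have uniq_c (a : 'I_d -> R) : (forall y, \sum_i a i * B i y = 0) -> forall i, a i = 0.
  move=> ha; have e1 : [ffun i => a i] = c'.
    apply/esym/cu => u; rewrite -[LHS](ha (repr u)); apply: eq_bigr => i _.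
    by rewrite ffunE /B /= projK.
  have e2 : [ffun=> 0] = c'.
    by apply/esym/cu => u; rewrite big1 // => i _; rewrite ffunE mul0r.
  by move=> i; have /ffunP/(_ i) := etrans e1 (esym e2); rewrite !ffunE.
have r0 := uniq_c (fun i => Re (c 0 i)) (fun y => (nd y).1).
have i0 := uniq_c (fun i => Im (c 0 i)) (fun y => (nd y).2).
move/eqP: c0; apply; apply/matrixP => a i; rewrite [a]ord1 mxE.
by apply: complex_ext; rewrite ?r0 ?i0.
Qed.

(** The real and imaginary parts of an invariant completion descend to real eigenfunctions, so the
    completion has complex coordinates in the real basis [b]. More completions than [d] would
    satisfy a linear relation, which the reduced coefficients exclude. *)
Lemma eigen_dim_ge k d (s : seq (multinom (K + K))) : has_dim (E (@lamk R n k)) d -> uniq s ->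
  (forall m, m \in s -> [/\ reduced m, mdeg m = k & malpha (alph 1) m = 1]) ->
  (size s <= d)%N.
Proof.
move=> [b [bE bu]] us hs; rewrite leqNgt; apply/negP => ds.
have inv m y j : m \in s -> ev (val (lens_act j y)) (hcompl C m) = ev (val y) (hcompl C m).
  move=> ms; have [_ _ am] := hs m ms.
  by rewrite ev_act (tau_hcompl (alph1 j)) malphaX am expr1n scale1r.
pose u (c : C) m (z : lens) := rfun (c *: hcompl C m) (repr z).
have uE c m : m \in s -> E (@lamk R n k) (u c m).
  move=> ms; have [rm dm _] := hs m ms.
  have hh : harm k%:R (c *: hcompl C m) by apply: harmZ; rewrite -dm; exact: harm_hcompl.
  have e : u c m \o proj = rfun (c *: hcompl C m).
    apply/funext => y /=; rewrite /u /rfun !evZ; congr (Re (_ * _)).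
    have [j ->] := proj_eqP (esym (projK (proj y))); exact: inv.
  split; first by rewrite e; exact: sphere_smooth_harm hh.
  by move=> y; rewrite e (laplacian_harm y hh) -[u c m (proj y)]/((u c m \o proj) y) e.
have coord c m : m \in s -> exists a : 'I_d -> R, forall z : lens, u c m z = \sum_i a i * b i z.
  by move=> ms; have [a [ha _]] := bu _ (uE c m ms); exists a.
have coordC (j : 'I_(size s)) : exists a : 'I_d -> C, forall y,
    ev (val y) (hcompl C (nth 0m s j)) = \sum_i a i * (b i (proj y))%:C.
  have ms : nth 0m s j \in s by rewrite mem_nth.
  have [a1 h1] := coord 1 _ ms; have [a2 h2] := coord (- 'i) _ ms.
  exists (fun i => a1 i +i* a2 i) => y; have [j' ej] := proj_eqP (projK (proj y)).
  have e1 := h1 (proj y); have e2 := h2 (proj y).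
  have -> : ev (val y) (hcompl C (nth 0m s j)) = ev (val (repr (proj y))) (hcompl C (nth 0m s j)).
    by rewrite {1}ej inv.
  apply: complex_ext.
    transitivity (u 1 (nth 0m s j) (proj y)); first by rewrite /u scale1r.
    by rewrite e1 Re_sum; apply: eq_bigr => i _; rewrite ReM /= mulr0 subr0.
  transitivity (u (- 'i) (nth 0m s j) (proj y)); first by rewrite /u rfun_Ni.
  by rewrite e2 Im_sum; apply: eq_bigr => i _; rewrite ImM /= mulr0 add0r.
have [a ha] := choice coordC.
pose M : 'M[C]_(size s, d) := \matrix_(j, i) a j i.
have [c c0 cM] := kernel_vector M ds.
pose h : A := \sum_(j < size s) c 0 j *: hcompl C (nth 0m s j).
have hh : harm k%:R h.
  apply: (big_ind (harm k%:R)) => [|? ?|j _]; [exact: harm0 | exact: harmD |].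
  have [rm dm _] := hs _ (mem_nth 0m (ltn_ord j)).
  by apply: harmZ; rewrite -{1}dm; exact: harm_hcompl.
have h0 : h = 0.
  apply: (harm_sphere_eq0 hh) => y; rewrite ev_sum.
  transitivity (\sum_j \sum_i c 0 j * (a j i * (b i (proj y))%:C)).
    by apply: eq_bigr => j _; rewrite evZ ha mulr_sumr.
  rewrite exchange_big /= big1 // => i _.
  have := congr1 (fun M : 'rV_d => M 0 i) cM; rewrite !mxE => e.
  transitivity ((\sum_j c 0 j * M j i) * (b i (proj y))%:C); last by rewrite e mul0r.
  rewrite mulr_suml; apply: eq_bigr => j _.
  by rewrite mxE mulrA.
move/eqP: c0; apply; apply/matrixP => i0 j; rewrite [i0]ord1 mxE.
have [rj _ _] := hs _ (mem_nth 0m (ltn_ord j)).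
have := congr1 (fun g : A => g@_(nth 0m s j)) h0; rewrite mcoeff0 /h raddf_sum /= (bigD1 j) //=.
rewrite mcoeffZ mcoeff_hcompl // eqxx mulr1 big1 ?addr0 // => j' jj.
by rewrite mcoeffZ mcoeff_hcompl // nth_uniq // (_ : (_ == _) = false) ?mulr0 //; apply/negbTE.
Qed.

End Lens.

(** * Multiplicities *)

Section HomogeneousSums.
Variable C : numFieldType.
Implicit Types (L : seq C) (k B : nat).

(** The complete homogeneous symmetric polynomial, that is, the coefficient of [z ^ k] in the
    product of the series [1 / (1 - a z)] over [L]. *)
Fixpoint hseq L k : C :=
  match L with
  | [::] => (k == 0%N)%:R
  | a :: L' => \sum_(j < k.+1) a ^+ j * hseq L' (k - j)
  end.

Definition tgeom B (a : C) : {poly C} := \poly_(i < B.+1) a ^+ i.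

Lemma coef_prod_tgeom B L k : (k <= B)%N -> (\prod_(a <- L) tgeom B a)`_k = hseq L k.
Proof.
elim: L k => [|a L IH] k kB; first by rewrite big_nil coef1.
rewrite big_cons coefM; apply: eq_bigr => j _.
have jk : (j <= k)%N by rewrite -ltnS.
rewrite coef_poly ltnS (leq_trans jk kB) IH //.
exact: leq_trans (leq_subr _ _) kB.
Qed.

Lemma hseq_sum M B (al : 'I_M -> C) k : (k <= B)%N ->
  \sum_(f : {ffun 'I_M -> 'I_B.+1} | (\sum_u f u == k)%N) \prod_u al u ^+ f u =
  hseq [seq al u | u <- enum 'I_M] k.
Proof.
move=> kB; rewrite -(coef_prod_tgeom _ kB) big_map big_enum /=.
have -> : \prod_i tgeom B (al i) = \prod_i \sum_(a : 'I_B.+1) (al i ^+ a) *: 'X^a.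
  by apply: eq_bigr => i _; rewrite /tgeom poly_def.
rewrite bigA_distr_bigA /= coef_sum big_mkcond /=; apply: eq_bigr => f _.
have -> : \prod_i ((al i ^+ f i) *: 'X^(f i) : {poly C}) = (\prod_i al i ^+ f i) *: 'X^(\sum_i f i).
  rewrite scaler_prod; congr (_ *: _); rewrite -prodrXr; exact: eq_bigr.
by rewrite coefZ coefXn eq_sym; case: eqP => _; rewrite ?mulr1 ?mulr0.
Qed.

Lemma root_of_unity_sum q (w : C) : w ^+ q = 1 -> \sum_(l < q) w ^+ l = if w == 1 then q%:R else 0.
Proof.
move=> wq; case: eqVneq => [->|w1].
  by rewrite (eq_bigr (fun=> 1)) ?sumr_const ?card_ord // => l _; rewrite expr1n.
have := subrX1 w q; rewrite wq subrr => /esym/eqP; rewrite mulf_eq0 subr_eq0 (negPf w1) /=.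
by move/eqP.
Qed.

End HomogeneousSums.

Section Multiplicity.
Context {R : realType} {n q : nat} (p : 'I_n.+1 -> int).
Hypothesis q0 : (0 < q)%N.
Local Notation K := n.+1.
Local Notation C := R[i].
Local Notation mon_t := (multinom (K + K)).
Local Notation alph := (@alph R n q p).
Local Notation l0 := (lshift K (ord0 : 'I_K)).
Local Notation r0 := (rshift K (ord0 : 'I_K)).

Section Exponents.
Variable k : nat.
Local Notation expo := {ffun 'I_(K + K) -> 'I_k.+1}.

Definition mm (f : expo) : mon_t := Multinom [tuple (f u : nat) | u < K + K].

Lemma mmE f u : mm f u = f u. Proof. by rewrite mnmE. Qed.

Lemma mm_inj : injective mm.
Proof. by move=> f g /mnmP e; apply/ffunP => u; apply: val_inj; have := e u; rewrite !mmE. Qed.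

Lemma mdeg_mm f : mdeg (mm f) = (\sum_u f u)%N.
Proof. by rewrite mdegE; apply: eq_bigr => u _; rewrite mmE. Qed.

Lemma malpha_mm (al : 'I_(K + K) -> C) f : malpha al (mm f) = \prod_u al u ^+ f u.
Proof. by apply: eq_bigr => u _; rewrite mmE. Qed.

Lemma mmP m : mdeg m = k -> exists f, m = mm f.
Proof.
move=> mk; have lt u : (m u < k.+1)%N.
  by rewrite ltnS -mk mdegE (bigD1 u) //= leq_addr.
by exists [ffun u => Ordinal (lt u)]; apply/mnmP => u; rewrite mmE ffunE.
Qed.

Definition invariant_expo : pred expo :=
  fun f => [&& reduced (mm f), (\sum_u f u == k)%N & malpha (alph 1) (mm f) == 1].

Definition invariant_mons : seq mon_t := [seq mm f | f <- enum invariant_expo].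

Lemma uniq_invariant_mons : uniq invariant_mons.
Proof. by rewrite map_inj_uniq ?enum_uniq //; exact: mm_inj. Qed.

Lemma mem_invariant_mons m :
  (m \in invariant_mons) = [&& reduced m, mdeg m == k & malpha (alph 1) m == 1].
Proof.
apply/idP/idP => [/mapP[f + ->]|/and3P[rm /eqP dm am]].
  by rewrite mem_enum [_ \in _]/(invariant_expo f) /invariant_expo -mdeg_mm.
have [f e] := mmP dm; apply/mapP; exists f => //.
by rewrite mem_enum [_ \in _]/(invariant_expo f) /invariant_expo -e rm am -mdeg_mm -e dm eqxx.
Qed.

End Exponents.

Definition lens_mult k : nat := size (invariant_mons k).

Lemma alphq u : alph 1 u ^+ q = 1.
Proof.
rewrite -(splitK u); case: (fintype.split u) => i /=; rewrite ?alph_l ?alph_r expiX mul1r /langle ?mulrN.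
  have -> : q%:R * (2 * pi * (p i)%:~R / q%:R) = 2 * pi * (p i)%:~R :> R.
    by rewrite mulrC divfK // pnatr_eq0 -lt0n.
  by rewrite /expi; have [-> ->] := cos_sin_int R (p i).
have -> : q%:R * (2 * pi * (p i)%:~R / q%:R) = 2 * pi * (p i)%:~R :> R.
  by rewrite mulrC divfK // pnatr_eq0 -lt0n.
by rewrite -expi_conj /expi; have [-> ->] := cos_sin_int R (p i); rewrite /= oppr0.
Qed.

Lemma malphaq m : malpha (alph 1) m ^+ q = 1.
Proof.
rewrite /malpha -prodrXl big1 // => u _.
by rewrite exprAC alphq expr1n.
Qed.

Definition alist l : seq C := [seq alph l u | u <- enum 'I_(K + K)].

(** Division by [z_0 zb_0] identifies the nonreduced monomials of degree [k] with all monomials of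
    degree [k - 2], and it preserves the character, since the two values in plane [0] are inverse to
    each other. *)
Lemma sum_nonreduced k l :
  \sum_(f : {ffun 'I_(K + K) -> 'I_k.+1} | (\sum_u f u == k)%N && ~~ reduced (mm f)) malpha (alph l) (mm f) =
  if (1 < k)%N then hseq (alist l) (k - 2) else 0.
Proof.
pose e (u : 'I_(K + K)) : nat := ((u == l0) + (u == r0))%N.
have el : e l0 = 1%N by rewrite /e eqxx eq_lrshift.
have er : e r0 = 1%N by rewrite /e eqxx eq_rlshift.
have e1 u : (e u <= 1)%N.
  by rewrite /e; case: eqVneq => [->|_]; [rewrite eq_lrshift | case: eqP].
have se : (\sum_u e u = 2)%N.
  have s1 (v : 'I_(K + K)) : (\sum_u ((u == v) : nat) = 1)%N.
    by rewrite (bigD1 v) //= eqxx big1 // => u /negPf ->.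
  by rewrite /e big_split /= !s1.
have nr (f : {ffun 'I_(K + K) -> 'I_k.+1}) : ~~ reduced (mm f) -> forall u, (e u <= f u)%N.
  rewrite /reduced negb_or !mmE -!lt0n => /andP[fl fr] u.
  rewrite /e; case: (eqVneq u l0) => [->|_]; first by rewrite eq_lrshift.
  by case: (eqVneq u r0) => [->|_].
case: ltnP => k2; last first.
  apply: big1 => f /andP[/eqP fk nrf]; suff : (2 <= k)%N by rewrite ltnNge k2.
  by rewrite -se -fk leq_sum // => u _; apply: nr.
have kB : (k - 2 <= k)%N by rewrite leq_subr.
rewrite -(hseq_sum _ kB).
(* The bijection and its inverse add and subtract the exponent [e] of [z_0 zb_0]. The value of
   [inord] is the intended one only for exponents within the bound [k], which [gle] provides under
   the degree condition. *)
pose h (g : {ffun 'I_(K + K) -> 'I_k.+1}) : {ffun 'I_(K + K) -> 'I_k.+1} := [ffun u => inord (g u + e u)].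
pose h' (f : {ffun 'I_(K + K) -> 'I_k.+1}) : {ffun 'I_(K + K) -> 'I_k.+1} := [ffun u => inord (f u - e u)].
have gle (g : {ffun 'I_(K + K) -> 'I_k.+1}) u : (\sum_u g u = k - 2)%N -> (g u + e u <= k)%N.
  move=> gk; have : (g u <= k - 2)%N by rewrite -gk (bigD1 u) //= leq_addr.
  by have := e1 u; lia.
have hE (g : {ffun 'I_(K + K) -> 'I_k.+1}) u : (\sum_u g u = k - 2)%N -> h g u = (g u + e u)%N :> nat.
  by move=> gk; rewrite ffunE inordK // ltnS gle.
have h'E (f : {ffun 'I_(K + K) -> 'I_k.+1}) u : h' f u = (f u - e u)%N :> nat.
  by rewrite ffunE inordK // ltnS (leq_trans (leq_subr _ _)) // -ltnS.
rewrite (reindex_onto h h') => [|f /andP[/eqP fk nrf]]; last first.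
  have s2 : (\sum_u h' f u = k - 2)%N.
    rewrite (eq_bigr (fun u => f u - e u)%N) => [|u _]; last by rewrite h'E.
    by rewrite sumnB => [|u _]; [rewrite fk se | exact: nr].
  by apply/ffunP => u; apply: val_inj; rewrite [LHS]hE // h'E subnK // nr.
have hh (g : {ffun 'I_(K + K) -> 'I_k.+1}) : (\sum_u g u = k - 2)%N ->
    (\sum_u h g u == k)%N && ~~ reduced (mm (h g)) && (h' (h g) == g).
  move=> gk; rewrite (eq_bigr (fun u => g u + e u)%N) => [|u _]; last by rewrite hE.
  rewrite big_split /= gk se subnK // eqxx /= /reduced !mmE !hE // el er !addn1 /=.
  by apply/eqP/ffunP => u; apply: val_inj; rewrite [LHS]h'E hE // addnK.
apply: eq_big => [g|g].
  apply/idP/idP => [/andP[/andP[/eqP hk nrh] /eqP e']|/eqP/hh //].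
  apply/eqP; rewrite -e' (eq_bigr (fun u => h g u - e u)%N) => [|u _]; last by rewrite h'E.
  by rewrite sumnB => [|u _]; [rewrite hk se | exact: nr].
move=> /andP[/andP[/eqP hk nrh] /eqP e'].
have gk : (\sum_u g u = k - 2)%N.
  rewrite -e' (eq_bigr (fun u => h g u - e u)%N) => [|u _]; last by rewrite h'E.
  by rewrite sumnB => [|u _]; [rewrite hk se | exact: nr].
rewrite malpha_mm (eq_bigr (fun u => alph l u ^+ g u * alph l u ^+ e u)) => [|u _]; last first.
  by rewrite hE // exprD.
rewrite big_split /= -[RHS]mulr1; congr (_ * _).
rewrite (bigD1 l0) //= (bigD1 r0) //= el er mulrA alph1 mul1r big1 // => u /andP[ul ur].
by rewrite /e (negPf ul) (negPf ur) expr0.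
Qed.

(** Molien's formula: averaging the characters over the cyclic group selects the invariant
    monomials, and [sum_nonreduced] removes the nonreduced ones. In generating functions the [l]-th
    summand is [1 - z ^ 2] over the product of the [1 - a z]. *)
Lemma lens_multE k : (lens_mult k)%:R = q%:R^-1 *
  \sum_(l < q) (hseq (alist l) k - if (1 < k)%N then hseq (alist l) (k - 2) else 0).
Proof.
have qn : q%:R != 0 :> C by rewrite pnatr_eq0 -lt0n.
rewrite /lens_mult size_map -cardE -sum1_card natr_sum.
transitivity (\sum_(f : {ffun 'I_(K + K) -> 'I_k.+1} | (\sum_u f u == k)%N && reduced (mm f))
    (q%:R^-1 * \sum_(l < q) malpha (alph l) (mm f))).
  rewrite big_mkcond [RHS]big_mkcond; apply: eq_bigr => f _.
  rewrite [_ \in _]/(invariant_expo f) /invariant_expo; case: (reduced _) => /=; rewrite ?andbF // andbT.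
  case: (_ == k) => //=.
  rewrite (eq_bigr (fun l : 'I_q => malpha (alph 1) (mm f) ^+ l)) => [|l _]; last by rewrite malphaX.
  rewrite (root_of_unity_sum (malphaq _)); case: ifP => _; rewrite ?mulr0 //.
  by rewrite mulVf.
rewrite -mulr_sumr exchange_big /=; congr (_ * _); apply: eq_bigr => l _.
rewrite -(sum_nonreduced k l) -(hseq_sum (alph l) (leqnn k)).
rewrite [X in _ = X - _](bigID (fun f => reduced (mm f))) /= addrC.
rewrite [X in _ = _ + X - _](eq_bigr (fun f => malpha (alph l) (mm f))) => [|f _]; last by rewrite malpha_mm.
rewrite [X in _ = X + _ - _](eq_bigr (fun f => malpha (alph l) (mm f))) => [|f _]; last by rewrite malpha_mm.
by rewrite addrAC subrr add0r.
Qed.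

End Multiplicity.

(** * Quasi-polynomial sequences *)

Section Sequences.
Context {R : realType}.
Local Notation C := R[i].
Implicit Types (u v x y : nat -> C) (a : C) (L : seq C) (e : int).

(** On generating functions [Sh] is multiplication by [z], [sh a] by [1 - a z], and [ops L] by the
    product of these factors. *)
Definition Sh x k : C := if k is k'.+1 then x k' else 0.
Definition sh a x k : C := x k - a * Sh x k.
Definition ops L x : nat -> C := foldr sh x L.
Definition finsupp_seq x := exists B, forall k, (B <= k)%N -> x k = 0.

Lemma ShD x y : Sh (fun k => x k + y k) = fun k => Sh x k + Sh y k.
Proof. by apply/funext => -[|k] //=; rewrite addr0. Qed.
Lemma ShZ c x : Sh (fun k => c * x k) = fun k => c * Sh x k.
Proof. by apply/funext => -[|k] //=; rewrite mulr0. Qed.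
Lemma shD a x y : sh a (fun k => x k + y k) = fun k => sh a x k + sh a y k.
Proof. by apply/funext => k; rewrite /sh ShD /=; move: (x k) (y k) (Sh x k) (Sh y k) => *; ring. Qed.
Lemma shZ a c x : sh a (fun k => c * x k) = fun k => c * sh a x k.
Proof. by apply/funext => k; rewrite /sh ShZ /=; move: (x k) (Sh x k) => *; ring. Qed.
Lemma sh_Sh a x : sh a (Sh x) = Sh (sh a x).
Proof. by apply/funext => -[|k] //=; rewrite /sh /= mulr0 subr0. Qed.
Lemma shC a b x : sh a (sh b x) = sh b (sh a x).
Proof.
apply/funext => -[|[|k]]; rewrite /sh /= ?mulr0 ?subr0 //; [move: (x 1%N) (x 0%N) | move: (x k.+2) (x k.+1) (x k)] => *; ring.
Qed.

Lemma ops_cat L1 L2 x : ops (L1 ++ L2) x = ops L1 (ops L2 x).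
Proof. exact: foldr_cat. Qed.
Lemma ops_sh L a x : ops L (sh a x) = sh a (ops L x).
Proof. by elim: L => //= b L ->; rewrite shC. Qed.
Lemma ops_Sh L x : ops L (Sh x) = Sh (ops L x).
Proof. by elim: L => //= b L ->; rewrite sh_Sh. Qed.
Lemma opsD L x y : ops L (fun k => x k + y k) = fun k => ops L x k + ops L y k.
Proof. by elim: L => //= b L ->; rewrite shD. Qed.
Lemma opsZ L c x : ops L (fun k => c * x k) = fun k => c * ops L x k.
Proof. by elim: L => //= b L ->; rewrite shZ. Qed.
Lemma ops_perm L1 L2 x : perm_eq L1 L2 -> ops L1 x = ops L2 x.
Proof.
elim: L1 L2 => [|a L1 IH] L2 pL; first by move: pL; rewrite perm_sym => /perm_nilP ->.
have aL2 : a \in L2 by rewrite -(perm_mem pL) mem_head.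
move: pL; case/splitPr: aL2 => A B; rewrite perm_sym -[A ++ _]/(A ++ [:: a] ++ B) perm_catCA perm_cons perm_sym => pL.
rewrite /= (IH _ pL) -ops_sh -cat1s !ops_cat /=; congr (ops A _).
by rewrite ops_sh.
Qed.

Lemma Sh_finsupp x : finsupp_seq x -> finsupp_seq (Sh x).
Proof. by move=> [B h]; exists B.+1 => -[|k] //= kB; apply: h. Qed.
Lemma finsuppD x y : finsupp_seq x -> finsupp_seq y -> finsupp_seq (fun k => x k + y k).
Proof.
move=> [B h] [B' h']; exists (maxn B B') => k; rewrite geq_max => /andP[kB kB'].
by rewrite h // h' // addr0.
Qed.
Lemma finsuppZ c x : finsupp_seq x -> finsupp_seq (fun k => c * x k).
Proof. by move=> [B h]; exists B => k kB; rewrite h // mulr0. Qed.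
Lemma sh_finsupp a x : finsupp_seq x -> finsupp_seq (sh a x).
Proof.
move=> fx; have := finsuppD fx (finsuppZ (- a) (Sh_finsupp fx)); congr finsupp_seq.
by apply/funext => k; rewrite /sh mulNr.
Qed.
Lemma ops_finsupp L x : finsupp_seq x -> finsupp_seq (ops L x).
Proof. by move=> fx; elim: L => //= a L; exact: sh_finsupp. Qed.

Definition psum x (z : C) (K : nat) : C := \sum_(k < K) x k * z ^+ k.

Lemma psum_sh a x z K : psum (sh a x) z K.+1 = (1 - a * z) * psum x z K + x K * z ^+ K.
Proof.
rewrite /psum; elim: K => [|K IH].
  by rewrite big_ord_recr !big_ord0 /= /sh /= mulr0 subr0 mulr0 !add0r.
rewrite big_ord_recr IH [in RHS]big_ord_recr /= /sh /= exprS.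
move: (\sum_(i < K) _) (x K) (x K.+1) (z ^+ K) => *; ring.
Qed.

Lemma psum_sh_root a x z K : a * z = 1 -> psum (sh a x) z K.+1 = x K * z ^+ K.
Proof. by move=> az; rewrite psum_sh az subrr mul0r add0r. Qed.

End Sequences.

(** * Uniform bounds and symbols in the index *)

Section Symbols.
Context {R : realType}.
Local Notation C := R[i].
Variable T : set R.
Implicit Types (x y : R -> nat -> C) (a : C) (L : seq C) (e : int).

(** Uniformity over [T] is what later lets a single cutoff of the series serve a whole neighbourhood
    of the length [ell]. *)
Definition bnd e x := exists c : R, forall t k, T t -> normc (x t k) <= c * k.+1%:R ^ e.

Lemma pos_pow k e : 0 < k.+1%:R ^ e :> R.
Proof. exact: exprz_gt0. Qed.

Lemma bnd_ge0 e x : bnd e x -> exists2 c : R, 0 <= c & forall t k, T t -> normc (x t k) <= c * k.+1%:R ^ e.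
Proof.
move=> [c h]; exists `|c|; first exact: normr_ge0.
move=> t k Tt; apply: (le_trans (h t k Tt)); rewrite ler_wpM2r ?ler_norm //; exact/ltW/pos_pow.
Qed.

Lemma bndD e x y : bnd e x -> bnd e y -> bnd e (fun t k => x t k + y t k).
Proof.
move=> [c h] [c' h']; exists (c + c') => t k Tt; rewrite mulrDl.
by rewrite (le_trans (le_normcD _ _)) // lerD ?h ?h'.
Qed.

Lemma bndM e e' x y : bnd e x -> bnd e' y -> bnd (e + e') (fun t k => x t k * y t k).
Proof.
move=> /bnd_ge0[c c0 h] /bnd_ge0[c' c0' h']; exists (c * c') => t k Tt; rewrite normcM expfzDr // mulrACA.
by apply: ler_pM; rewrite ?normc_ge0 ?h ?h'.
Qed.

Lemma bnd_le e e' x : (e <= e')%R -> bnd e x -> bnd e' x.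
Proof.
move=> ee /bnd_ge0[c c0 h]; exists c => t k Tt; apply: (le_trans (h t k Tt)).
by rewrite ler_wpM2l // ler_weXz2l // ler1n.
Qed.

Lemma bnd_const (f : R -> C) (c : R) : (forall t, T t -> normc (f t) <= c) -> bnd 0 (fun t _ => f t).
Proof. by move=> h; exists c => t k Tt; rewrite expr0z mulr1 h. Qed.

Lemma bndZ e (f : R -> C) (c : R) x : (forall t, T t -> normc (f t) <= c) -> bnd e x ->
  bnd e (fun t k => f t * x t k).
Proof. by move=> /bnd_const hf hx; have := bndM hf hx; rewrite add0r. Qed.

Lemma pow_shift k e : k.+1%:R ^ e <= 2 ^+ `|e|%N * k.+2%:R ^ e :> R.
Proof.
have k1 : 0 < k.+1%:R :> R by [].
have k2 : 0 < k.+2%:R :> R by [].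
case: e => m.
  rewrite /= -!exprnP (@le_trans _ _ (k.+2%:R ^+ m)) ?lerXn2r ?nnegrE ?ler_nat //.
  by rewrite ler_peMl ?exprn_ge0 // exprn_ege1 // ler1n.
rewrite (_ : `|Negz m|%N = m.+1) // NegzE -!exprnN -!exprVn -exprMn lerXn2r ?nnegrE ?mulr_ge0 ?invr_ge0 //.
by rewrite -[leLHS]mul1r ler_pdivrMr // mulrAC ler_pdivlMr // mul1r -natrM ler_nat; lia.
Qed.

Lemma bnd_Sh e x : bnd e x -> bnd e (fun t => Sh (x t)).
Proof.
move=> /bnd_ge0[c c0 h]; exists (c * 2 ^+ `|e|%N) => t [|k] Tt.
  by rewrite (_ : Sh (x t) 0 = 0) // normc0 mulr_ge0 ?mulr_ge0 ?exprn_ge0 // ltW ?pos_pow.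
by rewrite (le_trans (h t k Tt)) // -mulrA ler_wpM2l // pow_shift.
Qed.

Lemma bnd_sh e a x : bnd e x -> bnd e (fun t => sh a (x t)).
Proof.
move=> hx; have h1 : bnd e (fun t k => (- a) * Sh (x t) k).
  by apply: (bndZ (f := fun=> - a) (c := normc (- a))) => //; exact: bnd_Sh.
have := bndD hx h1; congr (bnd e _); apply/funext => t; apply/funext => k.
by rewrite /sh mulNr.
Qed.

Lemma bnd_ops e L x : bnd e x -> bnd e (fun t => ops L (x t)).
Proof. by move=> hx; elim: L => //= a L; exact: bnd_sh. Qed.

Lemma bnd_finsupp e (h : nat -> C) : finsupp_seq h -> bnd e (fun=> h).
Proof.
move=> [B hB]; exists (\sum_(j < B) normc (h j) * (j.+1%:R ^ e)^-1) => t k _.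
have S0 : 0 <= \sum_(j < B) normc (h j) * (j.+1%:R ^ e)^-1.
  by apply: sumr_ge0 => j _; rewrite mulr_ge0 ?normc_ge0 ?invr_ge0 // ltW // pos_pow.
case: (ltnP k B) => [kB|/hB ->]; last by rewrite normc0 mulr_ge0 // ltW // pos_pow.
rewrite -ler_pdivrMr ?pos_pow // (bigD1 (Ordinal kB)) //= lerDl.
by apply: sumr_ge0 => j _; rewrite mulr_ge0 ?normc_ge0 ?invr_ge0 // ltW // pos_pow.
Qed.

(* Symbols of order [-j], with control of [i] iterated differences. *)
Fixpoint sym (i j : nat) x : Prop :=
  match i with
  | 0 => bnd (- j%:Z) x
  | i'.+1 => bnd (- j%:Z) x /\ sym i' j.+1 (fun t => sh 1 (x t))
  end.

Lemma sym_bnd i j x : sym i j x -> bnd (- j%:Z) x.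
Proof. by case: i => [//|i []]. Qed.

Lemma symS i j x : sym i.+1 j x -> sym i j x.
Proof. by elim: i j x => [|i IH] j x [h1 h2] //=; split => //; apply: IH. Qed.

Lemma sym_weaken i j x : sym i j.+1 x -> sym i j x.
Proof.
have w j' y : bnd (- j'.+1%:Z) y -> bnd (- j'%:Z) y by apply: bnd_le; rewrite lerN2 lez_nat.
elim: i j x => [|i IH] j x /=; first exact: w.
by move=> [h1 h2]; split; [exact: w | exact: IH].
Qed.

Lemma symD i j x y : sym i j x -> sym i j y -> sym i j (fun t k => x t k + y t k).
Proof.
elim: i j x y => [|i IH] j x y /=; first exact: bndD.
move=> [h1 h2] [h1' h2']; split; first exact: bndD.
by have := IH _ _ _ h2 h2'; congr sym; apply/funext => t; rewrite shD.
Qed.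

Lemma sym_Sh i j x : sym i j x -> sym i j (fun t => Sh (x t)).
Proof.
elim: i j x => [|i IH] j x /=; first exact: bnd_Sh.
move=> [h1 h2]; split; first exact: bnd_Sh.
by have := IH _ _ h2; congr sym; apply/funext => t; rewrite sh_Sh.
Qed.

(** A discrete Leibniz rule in which the twisted difference falls on [u] alone and [v] sees only the
    plain difference. *)
Lemma sh1M (u v : nat -> C) a : sh a (fun k => u k * v k) = fun k => sh a u k * v k + a * (Sh u k * sh 1 v k).
Proof.
apply/funext => -[|k]; rewrite /sh /=; first by rewrite !mulr0 mul0r !subr0 mulr0 addr0.
move: (u k) (v k) (u k.+1) (v k.+1) => *; ring.
Qed.

Lemma symM i j j' x y : sym i j x -> sym i j' y -> sym i (j + j') (fun t k => x t k * y t k).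
Proof.
have e (a b : nat) : - (a + b)%N%:Z = - a%:Z + - b%:Z :> int by rewrite PoszD opprD.
elim: i j j' x y => [|i IH] j j' x y; first by rewrite /= e; exact: bndM.
move=> hx hy; split; first by rewrite e; apply: bndM; [exact: sym_bnd hx | exact: sym_bnd hy].
have h1 := IH _ _ _ _ hx.2 (symS hy).
have h2 := IH _ _ _ _ (sym_Sh (symS hx)) hy.2.
rewrite addSn in h1; rewrite addnS in h2.
have := symD h1 h2; congr sym; apply/funext => t; rewrite sh1M.
by apply/funext => k; rewrite mul1r.
Qed.

Lemma sym_finsupp i j (h : nat -> C) : finsupp_seq h -> sym i j (fun=> h).
Proof.
elim: i j h => [|i IH] j h fh /=; first exact: bnd_finsupp.
by split; [exact: bnd_finsupp | apply: IH; exact: sh_finsupp].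
Qed.

Lemma sh1_const (c : C) : sh 1 (fun=> c) = fun k => if k is 0 then c else 0.
Proof. by apply/funext => -[|k]; rewrite /sh /= ?mulr0 ?subr0 // mul1r subrr. Qed.

(** The difference of a constant sequence is supported at the index [0] and hence has every
    order. *)
Lemma sym_const i (f : R -> C) (c : R) : (forall t, T t -> normc (f t) <= c) -> sym i 0 (fun t _ => f t).
Proof.
move=> hf; case: i => [|i] /=; first by apply: bnd_const hf.
split; first by apply: bnd_const hf.
have b j : bnd j (fun t (k : nat) => if k is 0 then f t else 0).
  exists c => t [|k] Tt; first by rewrite exp1rz mulr1 hf.
  by rewrite normc0 mulr_ge0 ?(le_trans (normc_ge0 _) (hf t Tt)) // ltW // pos_pow.
have -> : (fun t => sh 1 (fun=> f t)) = fun t k => f t * (if k is 0 then 1 else 0).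
  by apply/funext => t; rewrite sh1_const; apply/funext => -[|k]; rewrite ?mulr1 ?mulr0.
have fs : finsupp_seq (fun k => if k is 0 then 1 else 0 : C) by exists 1%N => -[].
suff gen j' h : finsupp_seq h -> sym i j' (fun t k => f t * h k) by exact: gen.
elim: i j' h {fs} => [|i IH] j h fs /=.
  by apply: (bndZ hf); exact: bnd_finsupp.
split; first by apply: (bndZ hf); exact: bnd_finsupp.
by have := IH j.+1 _ (sh_finsupp 1 fs); congr (sym i); apply/funext => t; rewrite shZ.
Qed.

Lemma symZ i j (f : R -> C) (c : R) x : (forall t, T t -> normc (f t) <= c) -> sym i j x ->
  sym i j (fun t k => f t * x t k).
Proof. by move=> /(sym_const i) hf hx; exact: (symM hf hx). Qed.

(** The generating function of [h] is a polynomial divided by the product of the [1 - a z] over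
    [L]. *)
Definition QP L (h : nat -> C) := finsupp_seq (ops L h).

Lemma QP_perm L1 L2 h : perm_eq L1 L2 -> QP L1 h -> QP L2 h.
Proof. by move=> pL; rewrite /QP (ops_perm _ pL). Qed.

Lemma QP_sh a L h : QP (a :: L) h -> QP L (sh a h).
Proof. by rewrite /QP ops_sh. Qed.

Lemma QP_Sh L h : QP L h -> QP L (Sh h).
Proof. by rewrite /QP ops_Sh; exact: Sh_finsupp. Qed.

Lemma growth_sh a (h : nat -> C) (m : nat) : normc a = 1 ->
  bnd m%:Z (fun=> sh a h) -> bnd m.+1%:Z (fun=> h).
Proof.
move=> a1 /bnd_ge0[c c0 hc]; exists c => t k Tt.
have h' : forall k, normc (h k) <= c * k.+1%:R ^+ m.+1.
  elim=> [|j IH].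
    by have := hc t 0%N Tt; rewrite /sh /= mulr0 subr0 exp1rz expr1n.
  have := hc t j.+1 Tt; rewrite /sh /= -exprnP => hj.
  have -> : h j.+1 = (h j.+1 - a * h j) + a * h j by rewrite subrK.
  rewrite (le_trans (le_normcD _ _)) // normcM a1 mul1r (le_trans (lerD hj IH)) // -mulrDr ler_wpM2l //.
  rewrite [in leRHS]exprS -[X in _ <= X * _]natr1 mulrDl mul1r addrC lerD2r exprS ler_wpM2l //.
  by rewrite lerXn2r ?nnegrE // ler_nat.
by rewrite -exprnP.
Qed.

(** From some index on [h] is geometric with ratio of modulus [1]. This base case makes the exponent
    in [QP_growth] one less than the number of roots. *)
Lemma bounded_sh a (h : nat -> C) : normc a = 1 -> finsupp_seq (sh a h) -> bnd 0 (fun=> h).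
Proof.
move=> a1 [B hB]; exists (\sum_(j < B.+1) normc (h j)) => t k _; rewrite expr0z mulr1.
have leS j : (j <= B)%N -> normc (h j) <= \sum_(j < B.+1) normc (h j).
  move=> jB; rewrite (bigD1 (inord j)) //= inordK // lerDl; apply: sumr_ge0 => i _; exact: normc_ge0.
have : normc (h k) <= normc (h (minn k B)).
  elim: k => [|k IH]; first by rewrite min0n.
  case: (leqP k.+1 B) => [//|kB].
  have kB' : (B <= k)%N by [].
  rewrite (minn_idPr kB') in IH; rewrite (le_trans _ IH) //.
  have := hB k.+1 (ltnW kB); rewrite /sh /= => /eqP; rewrite subr_eq0 => /eqP ->.
  by rewrite normcM a1 mul1r.
by move/le_trans; apply; apply: leS; rewrite geq_minr.
Qed.

Lemma QP_growth L h : (forall a, a \in L -> normc a = 1) -> QP L h -> bnd ((size L)%:Z - 1) (fun=> h).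
Proof.
elim: L h => [|a L IH] h un qh; first exact: bnd_finsupp.
have a1 := un a (mem_head _ _); have un' b : b \in L -> normc b = 1 by move=> bL; apply: un; rewrite inE bL orbT.
case: L IH un un' qh => [|b L] IH un un' qh; first exact: (bounded_sh a1 qh).
have := IH _ un' (QP_sh qh).
have -> : (size (b :: L))%:Z - 1 = (size L)%:Z :> int by rewrite /=; lia.
have -> : (size [:: a, b & L])%:Z - 1 = (size L).+1%:Z :> int by rewrite /=; lia.
move=> h1.
apply: growth_sh a1 _; exact: h1.
Qed.

(* Each difference either removes a root from [h] or lowers the order of [x]. *)
Lemma ops_symbol L1 L2 h i j x : (forall a, a \in L1 ++ L2 -> normc a = 1) -> QP (L1 ++ L2) h ->
  (size L1 <= i)%N -> sym i j x ->
  bnd ((size L2)%:Z - 1 - j%:Z) (fun t => ops L1 (fun k => h k * x t k)).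
Proof.
elim: L1 L2 h i j x => [|a L1 IH] L2 h i j x un qh si hx.
  by apply: bndM; [exact: QP_growth | exact: sym_bnd hx].
case: i si hx => [//|i] si hx; have a1 : normc a = 1 by apply: un; rewrite mem_head.
have un' b : b \in L1 ++ L2 -> normc b = 1 by move=> bL; apply: un; rewrite inE bL orbT.
have h1 := IH _ _ i j x un' (QP_sh qh) si (symS hx).
have un2 b : b \in L1 ++ a :: L2 -> normc b = 1.
  by rewrite -cat1s mem_cat mem_cat orbCA -mem_cat inE => h'; apply: un; rewrite inE.
have q2 : QP (L1 ++ a :: L2) (Sh h).
  by apply: QP_perm (QP_Sh qh); rewrite perm_sym -[L1 ++ _]/(L1 ++ [:: a] ++ L2) perm_catCA.
have h2 := IH _ _ i j.+1 _ un2 q2 si hx.2.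
have e : (size (a :: L2))%:Z - 1 - j.+1%:Z = (size L2)%:Z - 1 - j%:Z :> int by rewrite /=; lia.
rewrite e in h2.
have h3 : bnd ((size L2)%:Z - 1 - j%:Z) (fun t k => a * ops L1 (fun k => Sh h k * sh 1 (x t) k) k).
  by apply: (bndZ (f := fun=> a) (c := normc a)).
have := bndD h1 h3; congr bnd; apply/funext => t; apply/funext => k.
by rewrite /= -ops_sh sh1M opsD opsZ.
Qed.

End Symbols.

Lemma taylor_aux (A : comPzRingType) (i y k P : A) :
  i * y * (k * i * P) + i * (i * y * P) = (k + 1) * i * (i * y * P).
Proof. ring. Qed.

Lemma taylor_aux2 (A : fieldType) (i P f m : A) : m != 0 -> i * (P * f) = m * i * P * (f * m^-1).
Proof. by move=> m0; field. Qed.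

(** * Expansion of the phase in powers of [wk] *)

Section PhaseExpansion.
Context {R : realType} {n : nat}.
Local Notation C := R[i].

(** Induction on [J] by the mean value theorem: the derivative of each remainder is ['i] times the
    previous one, which exchanges real and imaginary parts, so the two bounds have to be proved
    together. *)
Lemma expi_taylor (J : nat) (x : R) :
  `|Re (expi x - \sum_(j < J) ('i * x%:C) ^+ j / (j`!)%:R)| <= `|x| ^+ J /\
  `|Im (expi x - \sum_(j < J) ('i * x%:C) ^+ j / (j`!)%:R)| <= `|x| ^+ J.
Proof.
pose T J x : C := \sum_(j < J) ('i * x%:C) ^+ j / (j`!)%:R.
pose dT J x : C := if J is J'.+1 then 'i * T J' x else 0.
have dTE m y : is_cderive y (1 : R) (T m) (dT m y).
  elim: m => [|m IH].
    have -> : T 0%N = fun=> 0 by apply/funext => z; rewrite /T big_ord0.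
    exact: is_cderive_cst.
  have -> : T m.+1 = fun z => T m z + ('i * z%:C) ^+ m / (m`!)%:R.
    by apply/funext => z; rewrite /T big_ord_recr.
  have dpow k : is_cderive y (1 : R) (fun z : R => ('i * z%:C) ^+ k) (k%:R * 'i * ('i * y%:C) ^+ k.-1).
    elim: k => [|k IHk].
      rewrite !mul0r; have -> : (fun z : R => ('i * z%:C) ^+ 0) = fun=> 1 by apply/funext => z; rewrite expr0.
      exact: is_cderive_cst.
    have d1 : is_cderive y (1 : R) (fun z : R => 'i * z%:C) 'i.
      have d0 : is_cderive y (1 : R) (fun z : R => z%:C) 1.
        by split => /=; [exact: is_derive_id | exact: is_derive_cst].
      by have := is_cderiveM (is_cderive_cst y 1 'i) d0; rewrite mulr1 mul0r addr0.
    have -> : (fun z : R => ('i * z%:C) ^+ k.+1) = fun z => ('i * z%:C) * ('i * z%:C) ^+ k.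
      by apply/funext => z; rewrite exprS.
    have := is_cderiveM d1 IHk.
    have -> // : 'i * y%:C * (k%:R * 'i * ('i * y%:C) ^+ k.-1) + 'i * ('i * y%:C) ^+ k = k.+1%:R * 'i * ('i * y%:C) ^+ k.+1.-1.
    rewrite -natr1 /=; case: k {IHk} => [|k] /=; first by rewrite expr0; ring.
    rewrite exprS; exact: taylor_aux.
  have -> : dT m.+1 y = dT m y + (m%:R * 'i * ('i * y%:C) ^+ m.-1 / (m`!)%:R).
    rewrite /dT; case: m {IH dpow} => [|m]; first by rewrite /T big_ord0 mulr0 mul0r mul0r mul0r addr0.
    rewrite {1}/T big_ord_recr /= mulrDr; congr (_ + _).
    rewrite factS natrM invfM; have m0 : m.+1%:R != 0 :> C by rewrite pnatr_eq0.
    rewrite [_^-1 * _]mulrC; exact: taylor_aux2.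
  apply: is_cderiveD IH _.
  have := is_cderiveM (dpow m) (is_cderive_cst y 1 ((m`!)%:R^-1)).
  by rewrite mulr0 add0r.
elim: J x => [|J IH] x.
  rewrite big_ord0 subr0 expr0 /expi /=; split; rewrite ler_norml ?cos_geN1 ?cos_le1 ?sin_geN1 ?sin_le1 //.
pose f m z : C := expi z - T m z.
have df z : is_cderive z (1 : R) (f J.+1) ('i * f J z).
  have de : is_cderive z (1 : R) expi ('i * expi z).
    split; rewrite /expi /= ?ReM ?ImM /= !(mul0r, mul1r, sub0r, add0r, addr0).
      exact: is_derive_cos.
    exact: is_derive_sin.
  have := is_cderiveD de (is_cderiveM (is_cderive_cst z 1 (-1)) (dTE J.+1 z)).
  have -> : 'i * expi z + (-1 * dT J.+1 z + 0 * T J.+1 z) = 'i * f J z.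
    by rewrite /dT /f mul0r addr0 mulN1r mulrBr.
  congr (is_cderive _ _ _ _); apply/funext => w; by rewrite mulN1r.
have f0 : f J.+1 0 = 0.
  rewrite /f /T big_ord_recl /= big1 => [|j _]; last by rewrite mulr0 expr0n mul0r.
  by rewrite expr0 divr1 addr0 /expi cos0 sin0 subrr.
have mvt (g dg : R -> R) : (forall z, is_derive z (1 : R) g (dg z)) -> g 0 = 0 ->
    (forall z, `|dg z| <= `|z| ^+ J) -> `|g x| <= `|x| ^+ J.+1.
  move=> gd g0 hd.
  have cg a b : {within `[a, b], continuous g}.
    by apply: derivable_within_continuous => z _; have [] := gd z.
  have [x0|x0] := leP 0 x.
    have [z zin] := MVT_segment x0 (fun z _ => gd z) (cg _ _).
    rewrite g0 !subr0 => ->; rewrite normrM exprSr ler_wpM2r // (le_trans (hd z)) //.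
    move: zin; rewrite in_itv /= => /andP[z0 zx]; rewrite !ger0_norm // lerXn2r // nnegrE //.
  have [z zin] := MVT_segment (ltW x0) (fun z _ => gd z) (cg _ _).
  rewrite g0 !sub0r => /eqP; rewrite mulrN eqr_oppLR opprK => /eqP ->.
  rewrite normrM exprSr ler_wpM2r // (le_trans (hd z)) //.
  move: zin; rewrite in_itv /= => /andP[z0 zx]; rewrite lerXn2r // ?nnegrE //.
  by rewrite (ler0_norm zx) (ler0_norm (ltW x0)) lerN2.
split.
  apply: (mvt (fun z => Re (f J.+1 z)) (fun z => Re ('i * f J z))) => [z||z].
  - exact: (df z).1.
  - by rewrite f0.
  - by rewrite ReM /= mul0r sub0r mul1r normrN; exact: (IH z).2.
apply: (mvt (fun z => Im (f J.+1 z)) (fun z => Im ('i * f J z))) => [z||z].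
- exact: (df z).2.
- by rewrite f0.
- by rewrite ImM /= mul0r add0r mul1r; exact: (IH z).1.
Qed.

Definition muk (k : nat) : R := (k + n)%:R.
Definition nuk (k : nat) : R := Num.sqrt (k * (k + n.*2))%:R.
Definition delk (k : nat) : R := muk k - nuk k.
Definition wk (k : nat) : R := (muk k)^-1.

Lemma nuk_sqr k : nuk k ^+ 2 = muk k ^+ 2 - n%:R ^+ 2.
Proof.
rewrite /nuk sqr_sqrtr // /muk natrM !natrD -addnn natrD; ring.
Qed.

Lemma nuk_ge k : k%:R <= nuk k.
Proof.
rewrite /nuk -[leLHS]ger0_norm // -sqrtr_sqr ler_wsqrtr // expr2 -natrM ler_nat.
by rewrite leq_mul2l leq_addr orbT.
Qed.

Lemma delk_ge0 k : 0 <= delk k.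
Proof.
rewrite subr_ge0 -(@ler_pXn2r _ 2) ?nnegrE ?sqrtr_ge0 // ?ler0n // nuk_sqr.
by rewrite lerBlDr lerDl sqr_ge0.
Qed.

Lemma delk_le k : delk k <= n%:R.
Proof. by rewrite lerBlDr addrC -lerBlDr (le_trans _ (nuk_ge k)) // /muk natrD addrK. Qed.

(** A rearrangement of [(muk - delk) ^ 2 = muk ^ 2 - n ^ 2] into a fixed-point equation with the
    small factor [wk]. *)
Lemma delk_rec k : delk k = wk k * ((n%:R ^+ 2 + delk k ^+ 2) / 2).
Proof.
have e : n%:R ^+ 2 + delk k ^+ 2 = 2 * muk k * delk k.
  rewrite /delk; have := nuk_sqr k; move: (muk k) (nuk k) (n%:R ^+ 2 : R) => m v N; nra.
(* [muk k] is zero only for [k = n = 0]; there [wk k] is [0] by the convention on inverses, and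
   [delk k] is [0] as well. *)
rewrite e /wk; have [m0|m0] := eqVneq (muk k) 0; last first.
  by clear e; move: (delk k) (muk k) m0 => D M m0; field.
rewrite m0 invr0 mul0r /delk m0; have := nuk_ge k; have := delk_ge0 k; rewrite /delk m0.
move=> h1 h2; have k0 : 0 <= k%:R :> R := ler0n _ _; lra.
Qed.

Variable T0 : R.
Let T : set R := [set t | `|t| <= T0].
Local Notation bnd := (bnd T).
Local Notation sym := (sym T).

Let wC (k : nat) : C := (wk k)%:C.
Let delC (k : nat) : C := (delk k)%:C.

Lemma wk_ge0 k : 0 <= wk k. Proof. by rewrite invr_ge0 ler0n. Qed.

Lemma bnd_wC : bnd (-1) (fun=> wC).
Proof.
exists 2 => t k _; rewrite normc_real ger0_norm ?wk_ge0 // /wk.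
have [->|m0] := eqVneq (muk k) 0; first by rewrite invr0 mulr_ge0 // exprz_ge0.
rewrite -exprN1 -exprnN expr1 -[leLHS]mul1r ler_pdivrMr; last by rewrite lt_def m0 ler0n.
rewrite mulrAC ler_pdivlMr // mul1r /muk -natrM ler_nat.
by move: m0; rewrite /muk pnatr_eq0; lia.
Qed.

(** Apart from the first indices, the difference of [1 / (k + n)] is minus the product of two
    consecutive values, so each difference gains one order. *)
Lemma sym_wC i : sym i 1 (fun=> wC).
Proof.
elim: i => [|i IH] /=; first exact: bnd_wC.
split; first exact: bnd_wC.
have fs : finsupp_seq (fun k => sh 1 wC k + wC k * Sh wC k).
  exists 2%N => -[|[|k]] // _; rewrite /sh /= /wC -!rmorphM -rmorphB -rmorphD; apply/eqP.
  rewrite (_ : _ + _ = 0 :> R) ?rmorph0 // /wk /muk.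
  have a0 : (k.+2 + n)%:R != 0 :> R by rewrite pnatr_eq0.
  have b0 : (k.+1 + n)%:R != 0 :> R by rewrite pnatr_eq0.
  have e : (k.+2 + n)%:R = (k.+1 + n)%:R + 1 :> R by rewrite natr1.
  rewrite mul1r; move: a0; rewrite e => a0; move: ((k.+1 + n)%:R : R) b0 a0 => b b0 a0.
  by field; rewrite a0 b0.
have h1 := symM IH (sym_Sh IH).
have n1 : normc (-1 : C) <= 1 by rewrite normcN normc1.
have h2 := @symZ _ T i _ (fun=> -1) 1 _ (fun _ _ => n1) h1.
have := symD (sym_finsupp T i 2 fs) h2; congr (sym i 2); apply/funext => t; apply/funext => k.
by rewrite mulN1r addrK.
Qed.

(** Iterates of the fixed-point equation [delk_rec] starting from [0]. They are polynomials in [wk],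
    hence symbols, and by [bnd_delC_pdel] each iteration gains one order of accuracy. *)
Fixpoint pdel (j : nat) (k : nat) : C :=
  if j is j'.+1 then wC k * ((n%:R ^+ 2 + pdel j' k * pdel j' k) / 2) else 0.

Lemma sym_pdel i j : sym i 1 (fun=> pdel j).
Proof.
elim: j => [|j IH] /=.
  by apply: sym_finsupp; exists 0%N.
have c1 : sym i 0 (fun _ _ => n%:R ^+ 2 : C) by exact: (@sym_const _ T i (fun=> n%:R ^+ 2) (normc (n%:R ^+ 2))).
have c2 : sym i 0 (fun _ _ => 2^-1 : C) by exact: (@sym_const _ T i (fun=> 2^-1) (normc (2^-1))).
exact: symM (sym_wC i) (symM (symD c1 (sym_weaken (sym_weaken (symM IH IH)))) c2).
Qed.

Lemma bnd_cst (c : C) : bnd 0 (fun _ _ => c).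
Proof. by apply: (@bnd_const _ T (fun=> c) (normc c)). Qed.

Lemma bnd_delC0 : bnd 0 (fun=> delC).
Proof. by exists n%:R => t k _; rewrite expr0z mulr1 normc_real ger0_norm ?delk_ge0 ?delk_le. Qed.

Lemma delC_rec k : delC k = wC k * ((n%:R ^+ 2 + delC k * delC k) / 2).
Proof.
transitivity ((wk k * ((n%:R ^+ 2 + delk k * delk k) / 2))%:C); first by rewrite -expr2 -delk_rec.
rewrite rmorphM; congr (_ * _); rewrite rmorphM fmorphV rmorph_nat; congr (_ / _).
by rewrite rmorphD; congr (_ + _); [rewrite rmorphXn rmorph_nat | rewrite rmorphM].
Qed.

Lemma bnd_delC : bnd (-1) (fun=> delC).
Proof.
have -> : (fun=> delC) = fun (t : R) k => wC k * ((n%:R ^+ 2 + delC k * delC k) / 2).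
  by apply/funext => t; apply/funext => k; exact: delC_rec.
exact: bndM bnd_wC (bndM (bndD (bnd_cst _) (bndM bnd_delC0 bnd_delC0)) (bnd_cst _)).
Qed.

Lemma bnd_delC_pdel j : bnd (- j%:Z) (fun _ k => delC k - pdel j k).
Proof.
elim: j => [|j IH].
  have := bnd_delC0; congr (bnd 0); apply/funext => t; apply/funext => k; by rewrite subr0.
have b1 : bnd 0 (fun=> pdel j) by apply: bnd_le (sym_bnd (sym_pdel 0 j)).
have := bndM bnd_wC (bndM IH (bndM (bndD bnd_delC0 b1) (bnd_cst 2^-1))).
have -> : -1 + (- j%:Z + (0 + 0)) = - j.+1%:Z :> int by lia.
congr (bnd _ _); apply/funext => t; apply/funext => k.
rewrite [in RHS]delC_rec /=; move: (wC k) (delC k) (pdel j k) (n%:R ^+ 2 : C) => *; ring.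
Qed.

Lemma bnd_pow j x : bnd 0 x -> bnd 0 (fun t k => x t k ^+ j).
Proof.
move=> hx; elim: j => [|j IH].
  have := bnd_cst 1; congr (bnd 0); apply/funext => t; apply/funext => k; by rewrite expr0.
have := bndM hx IH; rewrite addr0; congr (bnd 0); apply/funext => t; apply/funext => k; by rewrite exprS.
Qed.

Lemma bnd_delC_pdelX m j : bnd (- m%:Z) (fun _ k => delC k ^+ j - pdel m k ^+ j).
Proof.
elim: j => [|j IH].
  have := @bnd_finsupp _ T (- m%:Z) (fun=> 0) (ex_intro _ 0%N (fun _ _ => erefl)).
  by congr (bnd _ _); apply/funext => t; apply/funext => k; rewrite !expr0 subrr.
have b1 : bnd 0 (fun=> pdel m) by apply: bnd_le (sym_bnd (sym_pdel 0 m)).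
have h1 := bndM bnd_delC0 IH; rewrite add0r in h1.
have h2 := bndM (bnd_delC_pdel m) (bnd_pow j b1); rewrite addr0 in h2.
have := bndD h1 h2.
congr (bnd _ _); apply/funext => t; apply/funext => k.
rewrite !exprS; move: (delC k) (pdel m k) (delC k ^+ j) (pdel m k ^+ j) => *; ring.
Qed.

Lemma sym_pdelX i m j : sym i 1 (fun _ k => pdel m k ^+ j.+1).
Proof.
elim: j => [|j IH].
  have := sym_pdel i m; congr (sym i 1); apply/funext => t; apply/funext => k; by rewrite expr1.
exact: sym_weaken (symM (sym_pdel i m) IH).
Qed.

Let cf (j : nat) (t : R) : C := ('i * t%:C) ^+ j / (j`!)%:R.

Lemma cf_le j t : T t -> normc (cf j t) <= `|T0| ^+ j.
Proof.
rewrite /T /= => tT; rewrite /cf normcM normcX normcM normc_real.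
have ni : normc ('i : C) = 1 by rewrite /= expr2 mulr0 expr1n add0r sqrtr1.
rewrite ni mul1r natC -fmorphV normc_real (ger0_norm (_ : 0 <= (j`!)%:R^-1)) ?invr_ge0 // -[leRHS]mulr1.
apply: ler_pM; [exact: exprn_ge0 | by rewrite invr_ge0 | |].
  by rewrite lerXn2r ?nnegrE // (le_trans tT) // ler_norm.
by rewrite invf_le1 ?ltr0n ?ler1n fact_gt0.
Qed.

(** The exponential series is truncated and [delk] is replaced by [pdel J.+1]; both errors have
    order [- (J + 1)]. What is left is a polynomial in [pdel J.+1] with coefficients bounded on
    [T]. *)
Lemma phase_expansion (J : nat) : exists a r : R -> nat -> C,
  [/\ forall i, sym i 1 a, bnd (- J%:Z) r &
      forall t k, expi (delk k * t) = 1 + a t k + r t k].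
Proof.
pose a t k := \sum_(j < J) cf j.+1 t * pdel J.+1 k ^+ j.+1.
pose r t k := expi (delk k * t) - 1 - a t k.
exists a, r; split => [i||t k]; last first.
- by rewrite /r; move: (expi _) (a t k) => *; ring.
- pose r1 t k : C := expi (delk k * t) - \sum_(j < J.+1) ('i * (delk k * t)%:C) ^+ j / (j`!)%:R.
  have hr1 : bnd (- J.+1%:Z) r1.
    have [c c0 hc] := bnd_ge0 bnd_delC.
    exists ((c * `|T0|) ^+ J.+1 *+ 2) => t k Tt.
    have [h1 h2] := expi_taylor J.+1 (delk k * t).
    rewrite (le_trans (normc_le _)) // (le_trans (lerD h1 h2)) // -mulr2n mulrnAl lerMn2r /=.
    have := hc t k Tt; rewrite normc_real => hd.
    have hx : `|delk k * t| <= (c * `|T0|) * k.+1%:R ^ (-1).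
      rewrite normrM mulrAC; apply: ler_pM => //.
      by rewrite /T /= in Tt; rewrite (le_trans Tt) // ler_norm.
    apply: (@le_trans _ _ (((c * `|T0|) * k.+1%:R ^ (-1)) ^+ J.+1)).
      by rewrite lerXn2r ?nnegrE // (le_trans _ hx).
    by rewrite exprMn [X in _ * X]exprnP exprz_exp mulN1r.
  have hr2 M : bnd (- J.+1%:Z) (fun t k => \sum_(j < M) cf j.+1 t * (delC k ^+ j.+1 - pdel J.+1 k ^+ j.+1)).
    elim: M => [|m IH].
      have := @bnd_finsupp _ T (- J.+1%:Z) (fun=> 0) (ex_intro _ 0%N (fun _ _ => erefl)).
      by congr (bnd _ _); apply/funext => t; apply/funext => k; rewrite big_ord0.
    have := bndD IH (bndZ (@cf_le m.+1) (bnd_delC_pdelX J.+1 m.+1)).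
    by congr (bnd _ _); apply/funext => t; apply/funext => k; rewrite big_ord_recr.
  have : bnd (- J.+1%:Z) r.
    have := bndD hr1 (hr2 J); congr (bnd _ _); apply/funext => t; apply/funext => k.
    rewrite /r1 /r /a big_ord_recl /= expr0 divr1.
    have -> : \sum_(i < J) ('i * (delk k * t)%:C) ^+ bump 0 i / ((bump 0 i)`!)%:R = \sum_(j < J) cf j.+1 t * delC k ^+ j.+1.
      apply: eq_bigr => j _; rewrite /bump /= add1n /cf /delC rmorphM mulrCA [X in X / _]exprMn.
      exact: (etrans (esym (mulrA _ _ _)) (mulrC _ _)).
    under [X in _ + X = _]eq_bigr do rewrite mulrBr.
    rewrite sumrB; move: (expi _) (\sum_(j < J) _) (\sum_(j < J) _) => *; ring.
  by apply: bnd_le; rewrite lerN2 lez_nat.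
suff H M : sym i 1 (fun t k => \sum_(j < M) cf j.+1 t * pdel J.+1 k ^+ j.+1) by exact: H.
elim: M => [|m IH].
  have := @sym_finsupp _ T i 1 (fun=> 0) (ex_intro _ 0%N (fun _ _ => erefl)).
  by congr (sym _ _); apply/funext => t; apply/funext => k; rewrite big_ord0.
have := symD IH (symZ (@cf_le m.+1) (sym_pdelX i J.+1 m)).
by congr (sym _ _); apply/funext => t; apply/funext => k; rewrite big_ord_recr.
Qed.

Variables (zeta : C) (L : seq C) (d : nat -> C).
Hypothesis Lun : forall a, a \in zeta :: L -> normc a = 1.
Hypothesis dQP : QP (zeta :: L) d.

(** All factors applied to [d * a] give order [-2] by [ops_symbol] with no root left over. For the
    comparison at a root, the factor of [zeta] is held back: the others give order [-1], and
    [psum_sh_root] collapses the sum over the last factor to a single boundary term. *)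
Lemma ops_phase : bnd (-2) (fun t => ops (zeta :: L) (fun k => d k * expi (delk k * t))) /\
  exists c : R, forall t K z, T t -> zeta * z = 1 ->
    normc (psum (ops (zeta :: L) (fun k => d k * expi (delk k * t))) z K.+1 -
           psum (ops (zeta :: L) d) z K.+1) <= c / K.+1%:R.
Proof.
(* [d] grows at most like the power [size L], so this [J] makes [d * r] of order [-2]. *)
set La := zeta :: L; pose J := (size L + 2)%N.
have [a [r [sa br er]]] := phase_expansion J.
have dg : bnd ((size L)%:Z) (fun=> d).
  by have := QP_growth T Lun dQP; rewrite (_ : _ - 1 = (size L)%:Z) //= -addn1 PoszD addrK.
have bdr : bnd (-2) (fun t k => d k * r t k).
  have := bndM dg br; rewrite (_ : _ + _ = -2) // /J; lia.
have dE t : (fun k => d k * expi (delk k * t)) = fun k => d k + (d k * a t k + d k * r t k).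
  by apply/funext => k; rewrite er; move: (d k) (a t k) (r t k) => *; ring.
split.
  have h1 : bnd (-2) (fun=> ops La d) by exact: bnd_finsupp.
  have h2 : bnd (-2) (fun t => ops La (fun k => d k * a t k)).
    have un0 b : b \in La ++ [::] -> normc b = 1 by rewrite cats0; exact: Lun.
  have q0 : QP (La ++ [::]) d by rewrite cats0.
  have := ops_symbol un0 q0 (leqnn _) (sa _).
    by rewrite (_ : 0%:Z - 1 - 1%:Z = -2).
  have h3 := bnd_ops La bdr.
  have := bndD h1 (bndD h2 h3); congr (bnd _ _); apply/funext => t.
  by rewrite dE !opsD.
have h2 : bnd (-1) (fun t => ops L (fun k => d k * a t k)).
  have p1 : perm_eq (zeta :: L) (L ++ [:: zeta]) by rewrite -cat1s perm_catC.
  have un b : b \in L ++ [:: zeta] -> normc b = 1 by rewrite -(perm_mem p1); exact: Lun.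
  have := @ops_symbol _ T L [:: zeta] d (size L) 1 a un (QP_perm p1 dQP) (leqnn _) (sa _).
  by rewrite /= (_ : 1%:Z - 1 - 1%:Z = -1).
have h3 : bnd (-1) (fun t => ops L (fun k => d k * r t k)) by apply: bnd_le (bnd_ops L bdr).
have [c hc] := bndD h2 h3; exists c => t K z Tt zz.
have nz : normc z = 1.
  have := congr1 (@normc R) zz; rewrite normcM (Lun (mem_head _ _)) mul1r => ->; exact: normc1.
have e : ops La (fun k => d k * expi (delk k * t)) =
    fun k => ops La d k + sh zeta (fun k => ops L (fun k => d k * a t k) k + ops L (fun k => d k * r t k) k) k.
  by rewrite dE opsD; apply/funext => k; congr (_ + _); rewrite -opsD.
have ps (x y : nat -> C) : psum (fun k => x k + y k) z K.+1 - psum x z K.+1 = psum y z K.+1.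
  rewrite /psum -sumrB; apply: eq_bigr => k _; by rewrite mulrDl addrAC subrr add0r.
rewrite e ps (psum_sh_root _ _ zz) normcM normcX nz expr1n mulr1.
by have := hc t K Tt; rewrite -exprnN expr1.
Qed.

End PhaseExpansion.

(** * Roots of unity *)

Section RootsOfUnity.
Context {R : realType} (q : nat).
Hypothesis q2 : (2 < q)%N.
Local Notation C := R[i].

Definition om (a : int) : C := expi (2 * pi * a%:~R / q%:R).

Let q0 : q%:R != 0 :> R. Proof. by rewrite pnatr_eq0 -lt0n (leq_trans _ q2). Qed.

Lemma omD a b : om (a + b) = om a * om b.
Proof. by rewrite /om -expiD -mulrDl -mulrDr -intrD. Qed.

Lemma om0 : om 0 = 1.
Proof. by rewrite /om mulr0 mul0r expi0. Qed.

Lemma om_conj a : (om a)^*%C = om (- a).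
Proof. by rewrite /om expi_conj mulrNz mulrN mulNr. Qed.

Lemma omNM a : om a * om (- a) = 1.
Proof. by rewrite -omD subrr om0. Qed.

Lemma omMq a : om (a * q%:Z) = 1.
Proof.
rewrite /om intrM -pmulrn mulrA mulfK // /expi; by have [-> ->] := cos_sin_int R a.
Qed.

Lemma om_mod a : om (a %% q%:Z)%Z = om a.
Proof. by rewrite [in RHS](divz_eq a q%:Z) [RHS]omD omMq mul1r. Qed.

Lemma omX a k : om a ^+ k = om (k%:Z * a).
Proof.
elim: k => [|k IH]; first by rewrite mul0r om0.
by rewrite exprS IH -omD -addn1 PoszD mulrDl mul1r addrC.
Qed.

Lemma norm_om a : normc (om a) = 1.
Proof. by rewrite /om /expi /= cos2Dsin2 sqrtr1. Qed.

Lemma cos_nat_lt r s : (s < r)%N -> (r.*2 <= q)%N ->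
  Re (om r%:Z) < Re (om s%:Z).
Proof.
move=> sr rq; have p0 := pi_gt0 R.
have q0' : 0 < q%:R :> R by rewrite ltr0n (leq_trans _ q2).
have inpi m : (m.*2 <= q)%N -> 2 * pi * m%:R / q%:R \in `[0, pi : R].
  move=> mq; rewrite in_itv /= divr_ge0 ?mulr_ge0 ?pi_ge0 ?ler0n //= ler_pdivrMr //.
  rewrite [2 * pi]mulrC -mulrA ler_pM2l // -natrM ler_nat mul2n //.
rewrite /om /expi /= -!pmulrn ltr_cos ?inpi //; last first.
  by rewrite (leq_trans _ rq) // leq_double ltnW.
by rewrite ltr_pM2r ?invr_gt0 // ltr_pM2l ?mulr_gt0 // ltr_nat.
Qed.

Lemma Re_omN a : Re (om (- a)) = Re (om a).
Proof. by rewrite -om_conj; case: (om a). Qed.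

(** The reduction modulo [q] and up to sign to [[0, q / 2]], the range on which the cosine
    decreases. *)
Lemma om_fold a : exists r : nat, [/\ (r.*2 <= q)%N, Re (om a) = Re (om r%:Z) &
  (q %| a - r%:Z)%Z \/ (q %| a + r%:Z)%Z].
Proof.
have qz : q%:Z != 0 by rewrite eqz_nat -lt0n (leq_trans _ q2).
have := modz_ge0 a qz; have := ltz_pmod a (_ : 0 < q%:Z); rewrite ltz_nat => /(_ (leq_trans (isT : 0 < 2)%N (ltnW q2))).
case E : (a %% q%:Z)%Z => [r|r] // rq _; rewrite ltz_nat in rq.
have e : (a = (a %/ q%:Z)%Z * q%:Z + r%:Z)%R by rewrite -E -divz_eq.
have [rr|rr] := leqP r.*2 q.
  exists r; split => //; first by rewrite -om_mod E.
  by left; rewrite {1}e addrK dvdz_mull.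
exists (q - r)%N; split; first by lia.
  rewrite -om_mod E -Re_omN -[in LHS](mul1r (om _)) -(omMq 1) -omD mul1r; congr (Re (om _)).
  by rewrite -subzn // ltnW.
right; rewrite {1}e -subzn ?(ltnW rq) // -addrA addrCA addrCA [r%:Z + _]addrC subrK.
by rewrite rpredD ?dvdz_mull ?dvdzz.
Qed.

Lemma om_Re_lt1 a : ~~ (q %| a)%Z -> Re (om a) < 1.
Proof.
move=> na; have [r [rq -> h]] := om_fold a.
have r0 : (0 < r)%N.
  rewrite lt0n; apply: contraNneq na => r0; move: h.
  have -> : a - r%:Z = a by lia.
  have -> : a + r%:Z = a by lia.
  by case.
by have := cos_nat_lt r0 rq; rewrite om0.
Qed.

(** Used twice: for the positivity of [gap], which prevents cancellation in the generating function,
    and for the lower bound on the displacement of deck transformations. *)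
Lemma om_Re_lt a : ~~ (q %| a)%Z -> ~~ (q %| a - 1)%Z -> ~~ (q %| a + 1)%Z -> Re (om a) < Re (om 1).
Proof.
move=> na n1 n2; have [r [rq -> h]] := om_fold a; apply: cos_nat_lt => //.
case: r h {rq} => [|[|//]] h; last by case: h => h; [rewrite h in n1 | rewrite h in n2].
move: h; have -> : a - 0%:Z = a by lia.
by case=> h; rewrite h in na.
Qed.

Lemma om_eq1 a : (om a == 1) = (q %| a)%Z.
Proof.
apply/eqP/idP => [e|/dvdzP[k ->]]; last exact: omMq.
apply: contraT => na; have := om_Re_lt1 na; by rewrite e ltxx.
Qed.

Lemma om_eq a b : (om a == om b) = (q %| a - b)%Z.
Proof.
rewrite -om_eq1 omD; apply/eqP/eqP => [->|e]; first exact: omNM.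
by rewrite -[LHS]mulr1 -(omNM b) [om b * _]mulrC mulrA e mul1r.
Qed.

Lemma om_nat a : exists2 j : nat, (j < q)%N & om a = om j%:Z.
Proof.
have qz : q%:Z != 0 by rewrite eqz_nat -lt0n (leq_trans _ q2).
have := modz_ge0 a qz; have := ltz_pmod a (_ : 0 < q%:Z); rewrite ltz_nat => /(_ (leq_trans (isT : 0 < 2)%N (ltnW q2))).
case E : (a %% q%:Z)%Z => [r|r] // rq _; rewrite ltz_nat in rq.
by exists r => //; rewrite -om_mod E.
Qed.

Lemma om1_sq : om 1 ^+ 2 != 1.
Proof. by rewrite omX om_eq1 mulr1 dvdzE gtnNdvd. Qed.

End RootsOfUnity.

Section Evaluation.
Context {R : realType}.
Local Notation C := R[i].
Implicit Types (x : nat -> C) (z v : C).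

(** Intended for coefficient sequences of polynomials, whose partial sums are eventually constant;
    [v] is then the value at [z]. *)
Definition evp x z v := exists B, forall K, (B <= K)%N -> psum x z K = v.

Lemma evp_sh a x z v : finsupp_seq x -> evp x z v -> evp (sh a x) z ((1 - a * z) * v).
Proof.
move=> [B hB] [B' hB']; exists (maxn B B').+1 => -[//|K]; rewrite ltnS geq_max => /andP[k1 k2].
by rewrite psum_sh hB // mul0r addr0 hB'.
Qed.

Lemma evp_Sh x z v : evp x z v -> evp (Sh x) z (z * v).
Proof.
move=> [B hB]; exists B.+1 => -[//|K]; rewrite ltnS => kB.
rewrite -(hB K kB) /psum big_ord_recl /= mul0r add0r mulr_sumr; apply: eq_bigr => i _.
by rewrite /bump /= add1n exprS mulrCA.
Qed.

Lemma evpD x y z v w : evp x z v -> evp y z w -> evp (fun k => x k + y k) z (v + w).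
Proof.
move=> [B hB] [B' hB']; exists (maxn B B') => K; rewrite geq_max => /andP[k1 k2].
rewrite -(hB K k1) -(hB' K k2) /psum -big_split; apply: eq_bigr => k _; exact: mulrDl.
Qed.

Lemma evpZ c x z v : evp x z v -> evp (fun k => c * x k) z (c * v).
Proof.
move=> [B hB]; exists B => K kB; rewrite -(hB K kB) /psum mulr_sumr; apply: eq_bigr => k _; exact: esym (mulrA _ _ _).
Qed.

Lemma evp_sum (I : Type) (r : seq I) (x : I -> nat -> C) z (v : I -> C) : (forall i, evp (x i) z (v i)) ->
  evp (fun k => \sum_(i <- r) x i k) z (\sum_(i <- r) v i).
Proof.
move=> h; elim: r => [|i r IH].
  rewrite big_nil; exists 0%N => K _; rewrite /psum big1 // => k _; by rewrite big_nil mul0r.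
rewrite big_cons; have := evpD (h i) IH; congr (evp _ _ _); apply/funext => k; by rewrite big_cons.
Qed.

Definition delta0 (k : nat) : C := (k == 0%N)%:R.

Lemma evp_delta0 z : evp delta0 z 1.
Proof.
exists 1%N => -[//|K] _; rewrite /psum big_ord_recl /= /delta0 eqxx mul1r big1 ?addr0 // => i _.
by rewrite mul0r.
Qed.

Lemma finsupp_delta0 : finsupp_seq delta0.
Proof. by exists 1%N => -[]. Qed.

Lemma evp_ops L z : evp (ops L delta0) z (\prod_(a <- L) (1 - a * z)).
Proof.
elim: L => [|a L IH] /=; first by rewrite big_nil; exact: evp_delta0.
by rewrite big_cons; apply: evp_sh IH; apply: ops_finsupp; exact: finsupp_delta0.
Qed.

Lemma sh_hseq a (L : seq C) : sh a (hseq (a :: L)) = hseq L.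
Proof.
apply/funext => -[|k]; rewrite /sh.
  by rewrite /= big_ord1 expr0 mul1r mulr0 subr0.
rewrite [Sh _ _]/=; rewrite [hseq _ k.+1]/= big_ord_recl expr0 mul1r subn0 mulr_sumr.
apply/eqP; rewrite subr_eq; apply/eqP; congr (_ + _); apply: eq_bigr => j _.
by rewrite lift0 subSS exprS mulrA.
Qed.

Lemma ops_hseq (L : seq C) : ops L (hseq L) = delta0.
Proof.
elim: L => [|a L IH]; first by apply/funext => k.
by rewrite -[LHS]/(sh a (ops L (hseq (a :: L)))) -ops_sh sh_hseq.
Qed.

Lemma count_perm_cat (T : eqType) (s1 s2 : seq T) : (forall a, count_mem a s1 <= count_mem a s2)%N ->
  exists s, perm_eq s2 (s1 ++ s).
Proof.
elim: s1 s2 => [|a s1 IH] s2 h; first by exists s2.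
have as2 : a \in s2 by rewrite -has_pred1 has_count (leq_trans _ (h a)) //= eqxx.
have [|s hs] := IH (rem a s2).
  move=> b; have := h b; have /permP/(_ (pred1 b)) := perm_to_rem as2; rewrite /= => ->.
  by rewrite leq_add2l.
by exists s; rewrite (permPl (perm_to_rem as2)) /= perm_cons.
Qed.

End Evaluation.

Lemma second_difference_factor (A : comPzRingType) (u z : A) :
  u + -1 * (z * (z * u)) = u * (1 - z ^+ 2).
Proof. ring. Qed.

(** * The leading pole of the generating function *)

Section MultiplicityGeneratingFunction.
Context {R : realType} {n q : nat} (p : 'I_n.+1 -> int).
Hypothesis q2 : (2 < q)%N.
Hypothesis p1 : p ord0 = 1.
Hypothesis pq : forall i, coprimez (p i) q%:Z.
Local Notation K := n.+1.
Local Notation C := R[i].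
Local Notation om := (@om R q).
Local Notation alph := (@alph R n q p).
Local Notation alist := (@alist R n q p).
Local Notation zeta := (om 1).
Local Notation z := (om (-1)).

Let q0 : (0 < q)%N. Proof. exact: leq_trans q2. Qed.

Lemma alph_om l (i : 'I_K) : alph l (lshift K i) = om (l%:Z * p i) /\ alph l (rshift K i) = om (- (l%:Z * p i)).
Proof.
have e : l%:R * @langle R n q p i = 2 * pi * (l%:Z * p i)%:~R / q%:R :> R.
  rewrite /langle intrM -[(l%:Z)%:~R]/(l%:R : R); ring.
rewrite alph_l alph_r e; split=> //; by rewrite /om mulrNz mulrN mulNr.
Qed.

(** The order of the pole of the [l]-th summand at the inverse of [zeta]; the numerator [1 - z ^ 2]
    does not vanish there since [q > 2]. *)
Definition mlt (l : 'I_q) : nat := count_mem zeta (alist l).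
Definition mmax : nat := \max_(l < q) mlt l.

Lemma count_alist l (P : pred C) :
  count P (alist l) = (\sum_(i < K) (P (om (l%:Z * p i)) + P (om (- (l%:Z * p i)))))%N.
Proof.
rewrite /alist count_map -sum1_count big_enum_cond /= big_mkcond big_split_ord /= -big_split /=.
by apply: eq_bigr => i _; have [-> ->] := alph_om l i; do 2 case: (P _).
Qed.

Lemma mmax_gt0 : (0 < mmax)%N.
Proof.
have l1 : (1 < q)%N by exact: ltnW.
apply: (@leq_trans (mlt (Ordinal l1))); last exact: leq_bigmax.
rewrite /mlt count_alist (bigD1 ord0) //= p1 mulr1 eqxx.
by case: (_ == _).
Qed.

Definition others : seq C := [seq om j%:Z | j <- rem 1%N (iota 0 q)].
(** A common denominator. The multiplicity of [zeta] is exactly maximal, so that the numerator can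
    be nonzero at the inverse of [zeta]; for the other roots the crude multiplicity [2 (n + 1)]
    suffices. *)
Definition allroots : seq C := nseq mmax zeta ++ flatten (nseq (K + K) others).

Lemma zeta_others : zeta \notin others.
Proof.
apply/mapP => -[j]; rewrite mem_rem_uniq ?iota_uniq // inE mem_iota /= => /andP[j1 jq] /eqP.
rewrite om_eq // dvdzE => /dvdnP[k e].
by case: k e => [|k] e; move: j1 e; [lia | rewrite mulSn; lia].
Qed.

Lemma mem_others a : om a != zeta -> om a \in others.
Proof.
have [j jq ->] := om_nat (R := R) q2 a => nz; apply/mapP; exists j => //.
rewrite mem_rem_uniq ?iota_uniq // inE mem_iota /= jq andbT.
by apply: contraNneq nz => ->.
Qed.

Lemma mem_alist l a : a \in alist l -> exists b, a = om b.
Proof.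
move=> /mapP[u _ ->]; rewrite -(splitK u); case: (fintype.split u) => i /=; have [e1 e2] := alph_om l i; rewrite ?e1 ?e2; by eexists.
Qed.

Lemma alist_allroots (l : 'I_q) : exists E, perm_eq allroots (alist l ++ E).
Proof.
apply: count_perm_cat => a; rewrite /allroots count_cat count_nseq count_flatten map_nseq sumn_nseq.
have [->|az] := eqVneq a zeta.
  by rewrite /= eqxx mul1n (leq_trans _ (leq_addr _ _)) //; exact: leq_bigmax.
have [al|al] := boolP (a \in alist l); last by rewrite (count_memPn al).
have [b eb] := mem_alist al; have ao : a \in others by rewrite eb mem_others // -eb.
rewrite (leq_trans (count_size _ _)) // size_map size_enum_ord (leq_trans _ (leq_addl _ _)) //.
by rewrite -{1}[(K + K)%N]mul1n leq_mul2r -has_count has_pred1 ao orbT.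
Qed.

Lemma norm_allroots a : a \in allroots -> normc a = 1.
Proof.
rewrite /allroots mem_cat => /orP[/nseqP[-> _]|/flattenP[s /nseqP[-> _] /mapP[j _ ->]]]; exact: norm_om.
Qed.

Lemma factor_neq0 a : a != zeta -> 1 - a * z != 0.
Proof.
apply: contra; rewrite subr_eq0 => /eqP e; apply/eqP.
have zz : z * zeta = 1 by rewrite mulrC omNM.
by rewrite -[LHS]mulr1 -zz mulrA -e mul1r.
Qed.

Lemma hit_unique (l : nat) i : ~~ ((om (l%:Z * p i) == zeta) && (om (- (l%:Z * p i)) == zeta)).
Proof.
apply/negP => /andP[/eqP e1 /eqP e2]; have := om1_sq (R := R) q2.
by rewrite expr2 -{1}e1 -e2 omNM eqxx.
Qed.

Definition hit (l : nat) i : bool := (om (l%:Z * p i) == zeta) || (om (- (l%:Z * p i)) == zeta).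

Lemma mltE (l : 'I_q) : mlt l = #|[pred i | hit l i]|.
Proof.
rewrite /mlt count_alist -sum1_card [RHS]big_mkcond /=; apply: eq_bigr => i _.
have := hit_unique l i; rewrite inE /hit /=; by do 2 case: (_ == _).
Qed.

Definition gap (l : nat) i : R := if hit l i then 1 else 2 * (Re zeta - Re (om (l%:Z * p i))).

(** A hit shows that [q] does not divide [l], hence by coprimality does not divide any [l p_i].
    Where there is no hit, [l p_i] avoids [0], [1] and [-1] modulo [q] and [om_Re_lt] applies. *)
Lemma gap_gt0 (l : 'I_q) i : (0 < mlt l)%N -> 0 < gap l i.
Proof.
rewrite mltE => /card_gt0P[i0]; rewrite inE => h0; rewrite /gap; case: ifP => // nh.
have qdvd j : (q %| l%:Z * p j)%Z = (q %| l%:Z)%Z.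
  by rewrite Gauss_dvdzl // coprimez_sym.
have nd : ~~ (q %| l%:Z * p i)%Z.
  rewrite qdvd -(qdvd i0); apply/negP => d0.
  have := om1_sq (R := R) q2; suff -> : om 1 = 1 by rewrite expr1n eqxx.
  move: h0; rewrite /hit; have /eqP -> : om (l%:Z * p i0) == 1 by rewrite om_eq1.
  have /eqP -> : om (- (l%:Z * p i0)) == 1 by rewrite om_eq1 // rpredN.
  by rewrite orbb => /eqP <-.
rewrite mulr_gt0 // subr_gt0 om_Re_lt //.
  by apply: contraFN nh => d; rewrite /hit om_eq // d.
apply: contraFN nh => d; rewrite /hit [X in _ || X]om_eq // -opprD rpredN d orbT //.
Qed.

(** Conjugate factors pair up as [(1 - a z) (1 - a^-1 z) = z (zeta + z - a - a^-1)], which is [z]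
    times the real number [gap l i]; in a hit one factor is dropped and the other is [1 - z ^ 2].
    With positive gaps the argument of the product depends on [mlt l] alone. *)
Lemma prod_alist (l : 'I_q) : \prod_(a <- alist l | a != zeta) (1 - a * z) =
  (1 - z ^+ 2) ^+ mlt l * z ^+ (K - mlt l) * (\prod_i gap l i)%:C.
Proof.
rewrite /alist big_map big_enum_cond /= big_mkcond big_split_ord /= -big_split /=.
transitivity (\prod_(i < K) ((if hit l i then 1 - z ^+ 2 else z) * (gap l i)%:C)).
  apply: eq_bigr => i _; have [-> ->] := alph_om l i.
  have hu := hit_unique l i; rewrite /gap; set a := (l%:Z * p i)%R in hu *.
  rewrite /hit -/a.
  have zz : zeta * z = 1 := @omNM R q 1.
  case: (eqVneq (om a) zeta) hu => [e|ne]; case: (eqVneq (om (- a)) zeta) => [e'|ne'] //= _.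
  - rewrite mul1r mulr1; congr (1 - _); rewrite expr2; congr (_ * _).
    by rewrite -om_conj e om_conj.
  - rewrite !mulr1; congr (1 - _); rewrite expr2; congr (_ * _).
    have := congr1 (@conjc R) e'; rewrite !om_conj opprK => ->; by [].
  - have e1 : om a * om (- a) = 1 := @omNM R q a.
    have e2 : (2 * (Re zeta - Re (om a)))%:C = zeta + z - om a - om (- a).
      rewrite -!om_conj; apply: complex_ext; [rewrite !ReB !ReD | rewrite !ImB !ImD]; move: zeta (om a) => [u v] [u' v'] /=; ring.
    rewrite e2; transitivity (1 - (om a + om (- a)) * z + om a * om (- a) * z ^+ 2); first by ring.
    rewrite e1 mul1r -{1}zz; ring.
rewrite big_split /= rmorph_prod; congr (_ * _).
rewrite (bigID (fun i => hit l i)) /=; congr (_ * _).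
  rewrite (eq_bigr (fun=> 1 - z ^+ 2)) => [|i ->//]; by rewrite prodr_const mltE.
rewrite (eq_bigr (fun=> z)) => [|i /negPf -> //]; rewrite prodr_const mltE; congr (_ ^+ _).
have := cardC [pred i | hit l i]; rewrite card_ord => cE.
have le := max_card [pred i | hit l i]; rewrite card_ord in le.
apply/eqP; rewrite -(eqn_add2l #|[pred i | hit l i]|) subnKC // -[X in _ == X]cE eqn_add2l.
by apply/eqP; apply: eq_card => i; rewrite !inE.
Qed.

Theorem lens_QP : exists L, [/\ forall a, a \in zeta :: L -> normc a = 1,
  QP (zeta :: L) (fun k => (@lens_mult R n q p k)%:R) &
  exists2 v, v != 0 & evp (ops (zeta :: L) (fun k => (@lens_mult R n q p k)%:R)) z v].
Proof.
have [m' em] : exists m', mmax = m'.+1 by exists mmax.-1; rewrite prednK ?mmax_gt0.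
exists (nseq m' zeta ++ flatten (nseq (K + K) others)).
have eL : zeta :: (nseq m' zeta ++ flatten (nseq (K + K) others)) = allroots by rewrite /allroots em.
rewrite eL; have [E hE] := choice alist_allroots.
have qn : q%:R != 0 :> C by rewrite pnatr_eq0 -lt0n.
have dE : (fun k => (@lens_mult R n q p k)%:R) =
   fun k => q%:R^-1 * \sum_(l <- enum 'I_q) (hseq (alist l) k + (-1) * Sh (Sh (hseq (alist l))) k).
  apply/funext => k; rewrite (lens_multE p q0) big_enum /=; congr (_ * _); apply: eq_bigr => l _.
  by rewrite mulN1r; case: k => [|[|k]] //=; rewrite subn2.
have ops_l (l : 'I_q) : ops allroots (hseq (alist l)) = ops (E l) delta0.
  by rewrite (ops_perm _ (hE l)) (ops_perm _ (permEl (perm_catC _ _))) ops_cat ops_hseq.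
have opsE : ops allroots (fun k => (@lens_mult R n q p k)%:R) =
   fun k => q%:R^-1 * \sum_(l <- enum 'I_q) (ops (E l) delta0 k + (-1) * Sh (Sh (ops (E l) delta0)) k).
  rewrite dE opsZ.
  suff -> : ops allroots (fun k => \sum_(l <- enum 'I_q) (hseq (alist l) k + -1 * Sh (Sh (hseq (alist l))) k)) =
      fun k => \sum_(l <- enum 'I_q) (ops (E l) delta0 k + -1 * Sh (Sh (ops (E l) delta0)) k) by [].
  elim: (enum 'I_q) => [|l r IH].
    have e0 (F : 'I_q -> nat -> C) : (fun k => \sum_(l <- [::]) F l k) = fun k => 0 * delta0 k.
      by apply/funext => j; rewrite big_nil mul0r.
    by rewrite !e0 opsZ; apply/funext => k; rewrite !mul0r.
  have e1 (F : 'I_q -> nat -> C) : (fun k => \sum_(l <- l :: r) F l k) = fun k => F l k + \sum_(l <- r) F l k.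
    by apply/funext => j; rewrite big_cons.
  by rewrite !e1 opsD IH opsD opsZ !ops_Sh ops_l.
have fE (l : 'I_q) : finsupp_seq (ops (E l) delta0) by apply: ops_finsupp; exact: finsupp_delta0.
have ev_l (l : 'I_q) : evp (fun k => ops (E l) delta0 k + (-1) * Sh (Sh (ops (E l) delta0)) k) z
    (\prod_(a <- E l) (1 - a * z) * (1 - z ^+ 2)).
  have := evpD (evp_ops (E l) z) (evpZ (-1) (evp_Sh (evp_Sh (evp_ops (E l) z)))).
  congr (evp _ _ _); exact: second_difference_factor.
split; first exact: norm_allroots.
  rewrite /QP opsE; apply: finsuppZ; elim: (enum 'I_q) => [|l r IH].
    by exists 0%N => k _; rewrite big_nil.
  have := finsuppD (finsuppD (fE l) (finsuppZ (-1) (Sh_finsupp (Sh_finsupp (fE l))))) IH.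
  by congr finsupp_seq; apply/funext => k; rewrite big_cons.
exists (q%:R^-1 * \sum_(l <- enum 'I_q) \prod_(a <- E l) (1 - a * z) * (1 - z ^+ 2)); last first.
  by rewrite opsE; apply: evpZ; exact: evp_sum.
have z2 : 1 - z ^+ 2 != 0.
  rewrite subr_eq0 eq_sym; apply/negP => /eqP e; have := om1_sq (R := R) q2.
  have : (zeta * z) ^+ 2 = 1 by rewrite omNM expr1n.
  by rewrite exprMn e mulr1 => ->; rewrite eqxx.
have z0 : z != 0 by apply/negP => /eqP e; have := @omNM R q 1; rewrite e mulr0 => /eqP; rewrite eq_sym oner_eq0.
rewrite mulf_neq0 ?invr_neq0 // -mulr_suml mulf_neq0 // big_enum /=.
pose P := \prod_(a <- allroots | a != zeta) (1 - a * z).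
have P0 : P != 0.
  by rewrite prodf_seq_neq0; apply/allP => a _; apply/implyP; exact: factor_neq0.
(* The complex factor common to all summands of maximal pole order; what remains of each is the
   inverse of a product of gaps. In a summand of smaller order, [E l] still contains [zeta] and the
   product vanishes. *)
pose W := P / ((1 - z ^+ 2) ^+ mmax * z ^+ (K - mmax)).
have W0 : W != 0 by rewrite mulf_neq0 // invr_neq0 // mulf_neq0 // expf_neq0.
have term (l : 'I_q) : \prod_(a <- E l) (1 - a * z) =
    W * (if mlt l == mmax then (\prod_i gap l i)^-1 else 0)%:C.
  have cz := permP (hE l) (pred1 zeta).
  have call : count_mem zeta allroots = mmax.
    rewrite /allroots count_cat count_nseq count_flatten map_nseq sumn_nseq /= eqxx mul1n.
    by rewrite (count_memPn zeta_others) mul0n addn0.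
  rewrite call count_cat -/(mlt l) in cz.
  case: eqP => [ml|ml].
    have zE : zeta \notin E l by apply/count_memPn; lia.
    have gp : 0 < \prod_i gap l i by apply: prodr_gt0 => i _; apply: gap_gt0; rewrite ml mmax_gt0.
    have PE : P = \prod_(a <- alist l | a != zeta) (1 - a * z) * \prod_(a <- E l) (1 - a * z).
      rewrite /P (perm_big _ (hE l)) big_cat /=; congr (_ * _).
      rewrite big_seq_cond [RHS]big_seq; apply: eq_bigl => a; case: (boolP (a \in E l)) => //= aE.
      by apply: contraNneq zE => <-.
    rewrite prod_alist ml in PE; rewrite /W PE.
    have g0 : (\prod_i gap l i)%:C != 0 by rewrite -(rmorph0 (@real_complex R)) (inj_eq (@complexI R)) gt_eqF.
    have key (u w e g : R[i]) : u != 0 -> w != 0 -> g != 0 -> e = u * w * g * e / (u * w) * g^-1.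
      by move=> u0 w0 g1; field; rewrite g1 u0 w0.
    by rewrite fmorphV; apply: key => //; exact: expf_neq0.
  rewrite rmorph0 mulr0; have zE : zeta \in E l.
    have : (mlt l <= mmax)%N by exact: leq_bigmax.
    by rewrite -has_pred1 has_count; lia.
  apply/eqP; rewrite prodf_seq_eq0; apply/hasP; exists zeta => //=.
  by rewrite omNM subrr.
rewrite (eq_bigr _ (fun l _ => term l)) -mulr_sumr mulf_neq0 // -rmorph_sum.
rewrite -(rmorph0 (@real_complex R)) (inj_eq (@complexI R)) gt_eqF //.
have r0 (l : 'I_q) : 0 <= (if mlt l == mmax then (\prod_i gap l i)^-1 else 0).
  case: eqP => // ml; rewrite invr_ge0 ltW // prodr_gt0 // => i _; apply: gap_gt0; by rewrite ml mmax_gt0.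
have [l0 el0] : {l0 : 'I_q | mmax = mlt l0} by apply: (@bigop.eq_bigmax _ mlt); rewrite card_ord.
rewrite (bigD1 l0) //= -el0 eqxx ltr_wpDr //; first by apply: sumr_ge0 => l _; exact: r0.
by rewrite invr_gt0 prodr_gt0 // => i _; apply: gap_gt0; rewrite -el0 mmax_gt0.
Qed.

End MultiplicityGeneratingFunction.

(** * Smooth functions of a real variable *)

Section SmoothFunctions.
Context {R : realType}.
Implicit Types (f g : R -> R) (k : nat).

Lemma derive1_val f (x d : R) : is_derive x (1 : R) f d -> derive1 f x = d.
Proof. by move=> [_ <-]; rewrite derive1E. Qed.

Fixpoint Ck k f : Prop :=
  (forall x, derivable f x 1) /\ (if k is k'.+1 then Ck k' (derive1 f) else True).

Definition rsmooth f := forall k x, derivable (derive1n k f) x 1.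

Lemma rsmoothP f : rsmooth f <-> forall k, Ck k f.
Proof.
split=> [h k|h k].
  elim: k f h => [|k IH] f h /=; first by split=> // x; exact: (h 0%N).
  split; first by move=> x; exact: (h 0%N).
  by apply: IH => j x; rewrite -derive1Sn; exact: h.
elim: k f h => [|k IH] f h x; first by have [] := h 0%N.
rewrite derive1Sn; apply: IH => j.
by have [] := h j.+1.
Qed.

Lemma CkS k f : Ck k.+1 f -> Ck k f.
Proof. by elim: k f => [|k IH] f [h1 h2]; split => //; exact: IH. Qed.

Lemma Ck0 k f : Ck k f -> forall x, derivable f x 1.
Proof. by case: k => [|k] []. Qed.

Arguments Ck0 {k f} _ x.

Lemma eq_Ck k f g : f =1 g -> Ck k f -> Ck k g. Proof. by move=> /funext ->. Qed.

Lemma is_derive1_of f x : derivable f x (1 : R) -> is_derive x (1 : R) f (derive1 f x).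
Proof. by move=> df; apply: DeriveDef => //; rewrite derive1E. Qed.

Lemma CkD k f g : Ck k f -> Ck k g -> Ck k (fun x => f x + g x).
Proof.
elim: k f g => [|k IH] f g hf hg.
  by split=> // x; apply: derivableD; [exact: Ck0 hf _ | exact: Ck0 hg _].
split=> [x|]; first by apply: derivableD; [exact: Ck0 hf _ | exact: Ck0 hg _].
apply: eq_Ck (IH _ _ hf.2 hg.2) => x; apply/esym/derive1_val.
exact: is_deriveD (is_derive1_of (Ck0 hf x)) (is_derive1_of (Ck0 hg x)).
Qed.

Lemma CkM k f g : Ck k f -> Ck k g -> Ck k (fun x => f x * g x).
Proof.
have d f1 g1 k1 (h1 : Ck k1 f1) (h2 : Ck k1 g1) x :=
  is_deriveM_mul (is_derive1_of (Ck0 h1 x)) (is_derive1_of (Ck0 h2 x)).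
elim: k f g => [|k IH] f g hf hg.
  by split=> // x; have [] := d _ _ _ hf hg x.
split=> [x|]; first by have [] := d _ _ _ hf hg x.
apply: eq_Ck (CkD (IH _ _ (CkS hf) hg.2) (IH _ _ hf.2 (CkS hg))) => x; apply/esym/derive1_val.
exact: d hf hg x.
Qed.

Lemma Ck_cst k (c : R) : Ck k (fun=> c).
Proof.
elim: k c => [|k IH] c; first by split=> // x; exact: derivable_cst.
split=> [x|]; first exact: derivable_cst.
by apply: eq_Ck (IH 0) => x; apply/esym/derive1_val; exact: is_derive_cst.
Qed.

Lemma is_derive_affine (f : R -> R) (s c x d : R) : is_derive (s * x + c) (1 : R) f d ->
  is_derive x (1 : R) (fun t => f (s * t + c)) (s * d).
Proof.
move=> h; have d1 : is_derive x (1 : R) (fun t : R => s * t + c) s.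
  have := is_deriveD (is_derive_mull s (is_derive_id x (1 : R))) (is_derive_cst c x (1 : R)).
  by rewrite mulr1 addr0.
by rewrite mulrC; exact: is_derive1_comp.
Qed.

Lemma Ck_affine k f (s c : R) : Ck k f -> Ck k (fun t => f (s * t + c)).
Proof.
elim: k f => [|k IH] f hf.
  by split=> // x; have [] := is_derive_affine (is_derive1_of (Ck0 hf (s * x + c))).
split=> [x|]; first by have [] := is_derive_affine (is_derive1_of (Ck0 hf (s * x + c))).
apply: eq_Ck (CkM (Ck_cst k s) (IH _ hf.2)) => x; apply/esym/derive1_val.
exact: is_derive_affine (is_derive1_of (Ck0 hf (s * x + c))).
Qed.

Lemma Ck_cos_sin k : Ck k (@cos R) /\ Ck k (@sin R).
Proof.
elim: k => [|k [IH1 IH2]].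
  split; first by split=> // x; have [] := is_derive_cos x.
  by split=> // x; have [] := is_derive_sin x.
split; split=> [x|].
- by have [] := is_derive_cos x.
- by apply: eq_Ck (CkM (Ck_cst k (-1)) IH2) => x; rewrite mulN1r; apply/esym/derive1_val; exact: is_derive_cos.
- by have [] := is_derive_sin x.
- by apply: eq_Ck IH1 => x; apply/esym/derive1_val; exact: is_derive_sin.
Qed.

Lemma rsmooth_continuous f : rsmooth f -> continuous f.
Proof. by move=> h x; apply: differentiable_continuous; apply/derivable1_diffP; exact: (h 0%N). Qed.

Lemma rsmooth_derive f : rsmooth f -> rsmooth (derive1 f).
Proof. by move=> h k x; rewrite -derive1Sn; exact: h. Qed.

Lemma rsmooth_is_derive f x : rsmooth f -> is_derive x (1 : R) f (derive1 f x).
Proof. by move=> h; apply: is_derive1_of; exact: (h 0%N). Qed.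

Lemma rsmoothM f g : rsmooth f -> rsmooth g -> rsmooth (fun x => f x * g x).
Proof. by move=> /rsmoothP hf /rsmoothP hg; apply/rsmoothP => k; exact: CkM. Qed.
Lemma rsmoothD f g : rsmooth f -> rsmooth g -> rsmooth (fun x => f x + g x).
Proof. by move=> /rsmoothP hf /rsmoothP hg; apply/rsmoothP => k; exact: CkD. Qed.
Lemma rsmooth_cst (c : R) : rsmooth (fun=> c).
Proof. by apply/rsmoothP => k; exact: Ck_cst. Qed.
Lemma rsmooth_affine f (s c : R) : rsmooth f -> rsmooth (fun t => f (s * t + c)).
Proof. by move=> /rsmoothP hf; apply/rsmoothP => k; exact: Ck_affine. Qed.
Arguments rsmooth_affine {f} s c _.
Lemma rsmooth_cos : rsmooth cos. Proof. by apply/rsmoothP => k; have [] := Ck_cos_sin k. Qed.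
Lemma rsmooth_sin : rsmooth sin. Proof. by apply/rsmoothP => k; have [] := Ck_cos_sin k. Qed.
Lemma eq_rsmooth f g : f =1 g -> rsmooth f -> rsmooth g. Proof. by move=> /funext ->. Qed.

(* The functions [P(1/x) exp(-1/x)], extended by [0] to the left of the origin,
   are stable under derivation. *)
Definition flat (P : {poly R}) (x : R) : R := if 0 < x then P.[x^-1] * expR (- x^-1) else 0.

Lemma is_derive_pow (m : nat) (x : R) : is_derive x (1 : R) (fun z : R => z ^+ m) (m%:R * x ^+ m.-1).
Proof.
elim: m => [|m IH].
  rewrite mul0r; have -> : (fun z : R => z ^+ 0) = cst 1 by apply/funext => z; rewrite expr0.
  exact: is_derive_cst.
have := is_deriveM_mul (is_derive_id x (1 : R)) IH.
have -> : (fun y : R => id y * y ^+ m) = fun z => z ^+ m.+1 by apply/funext => z; rewrite exprS.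
move=> h; apply: (is_derive_eq h); case: m {IH h} => [|m]; first by rewrite !mul0r mulr0 add0r.
by rewrite mul1r mulrCA -exprS -{2}(mul1r (x ^+ m.+1)) -mulrDl natr1.
Qed.

Lemma is_derive_horner (P : {poly R}) (x : R) : is_derive x (1 : R) (fun z : R => P.[z]) (P^`()).[x].
Proof.
elim/poly_ind: P => [|P c IH].
  rewrite deriv0 horner0; have -> : (fun z : R => (0 : {poly R}).[z]) = cst 0 by apply/funext => z; rewrite horner0.
  exact: is_derive_cst.
have := is_deriveD (is_deriveM_mul IH (is_derive_id x (1 : R))) (is_derive_cst c x (1 : R)).
have -> : (fun y : R => P.[y] * id y) + cst c = fun z => (P * 'X + c%:P).[z] by apply/funext => z; rewrite !hornerE.
move=> h; apply: (is_derive_eq h); rewrite derivD derivM derivX derivC !hornerE; ring.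
Qed.

Lemma expR_ge_pow (m : nat) (y : R) : 0 <= y -> y ^+ m / (m`!)%:R <= expR y.
Proof.
elim: m y => [|m IH] y y0; first by rewrite expr0 divr1 -(expR0 R) ler_expR.
pose h z : R := expR z - z ^+ m.+1 / (m.+1`!)%:R.
have dh z : is_derive z (1 : R) h (expR z - z ^+ m / (m`!)%:R).
  have dp : is_derive z (1 : R) (fun z : R => z ^+ m.+1 / (m.+1`!)%:R) (z ^+ m / (m`!)%:R).
    have := is_deriveM_mul (is_derive_pow m.+1 z) (is_derive_cst ((m.+1`!)%:R^-1 : R) z (1 : R)).
    rewrite mulr0 add0r => h1; apply: (is_derive_eq h1).
    rewrite /cst factS natrM invfM.
    have f0 : (m`!)%:R != 0 :> R by rewrite pnatr_eq0 -lt0n fact_gt0.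
    have m0 : m.+1%:R != 0 :> R by rewrite pnatr_eq0.
    by rewrite /= [X in X * _]mulrC -mulrA [X in _ * X]mulrA mulfV // mul1r.
  exact: is_deriveB (is_derive_expR z) dp.
have ch : {within `[0, y], continuous h}.
  by apply: derivable_within_continuous => z _; have [] := dh z.
have [z zin] := MVT_segment y0 (fun z _ => dh z) ch.
rewrite {1 2}/h expr0n mul0r subr0 expR0 subr0 => e.
move: zin; rewrite in_itv /= => /andP[z0 zy].
have : 0 <= (expR z - z ^+ m / m`!%:R) * y by rewrite mulr_ge0 // subr_ge0 IH.
by rewrite -e; lra.
Qed.

(** The exponential beats the polynomial in the inverse of [x]. The bound is quadratic so that the
    derivative at the origin is [0]. *)
Lemma flat_small P : exists2 c : R, 0 <= c & forall x, x <= 1 -> `|flat P x| <= c * x ^+ 2.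
Proof.
pose d := size P; pose S : R := \sum_(i < d) `|P`_i|.
have S0 : 0 <= S by apply: sumr_ge0.
exists (S * ((d.+2)`!)%:R) => [|x x1]; first by rewrite mulr_ge0.
rewrite /flat; case: ltP => [x0|x0]; last by rewrite normr0 mulr_ge0 ?sqr_ge0 // mulr_ge0.
have y1 : 1 <= x^-1 by rewrite invf_ge1.
have y0 : 0 < x^-1 by rewrite invr_gt0.
have hP : `|P.[x^-1]| <= S * x^-1 ^+ d.
  rewrite horner_coef (le_trans (ler_norm_sum _ _ _)) // mulr_suml; apply: ler_sum => i _.
  rewrite normrM ler_wpM2l // normrX gtr0_norm // ler_weXn2l // ltnW //.
have hE : expR (- x^-1) <= (d.+2`!)%:R * x ^+ d.+2.
  have u0 : 0 < x ^+ d.+2 by exact: exprn_gt0.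
  have f0 : 0 < (d.+2`!)%:R :> R by rewrite ltr0n fact_gt0.
  have := expR_ge_pow d.+2 (ltW y0); rewrite exprVn expRN.
  move: (x ^+ _) u0 (_%:R) f0 (expR_gt0 x^-1) => u u0 f f0 e0 h.
  by rewrite -[leRHS]invrK lef_pV2 ?posrE ?e0 ?invr_gt0 ?mulr_gt0 // invfM mulrC.
rewrite normrM (ger0_norm (expR_ge0 _)) (le_trans (ler_pM (normr_ge0 _) (expR_ge0 _) hP hE)) //.
rewrite -addn2 exprD mulrACA exprVn [S * _]mulrC -!mulrA le_eqVlt; apply/orP; left; apply/eqP.
have xd : x ^+ d != 0 by rewrite expf_neq0 // gt_eqF.
by move: (x ^+ d) xd => u u0; field.
Qed.

Lemma is_derive_flat P x : is_derive x (1 : R) (flat P) (flat ('X^2 * (P - P^`())) x).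
Proof.
have [x0|x0|<-] := ltgtP 0 x.
- have nE : \forall z \near x, P.[z^-1] * expR (- z^-1) = flat P z.
    by apply: filterS (lt_nbhsr x0) => z z0; rewrite /flat z0.
  apply: (near_eq_is_derive nE); have xn : x != 0 by rewrite gt_eqF.
  have dV : is_derive x (1 : R) (fun z : R => z^-1) (- x ^- 2).
    have := @is_deriveV R id x 1 1 xn (is_derive_id x 1).
    by rewrite /= [_ *: _]mulr1.
  have d1 := is_derive1_comp (is_derive_horner P x^-1) dV.
  have dN : is_derive x (1 : R) (fun z : R => - z^-1) (- - x ^- 2) := is_deriveN dV.
  have d2 := @is_derive1_comp R expR (fun z : R => - z^-1) x _ _ (is_derive_expR (- x^-1)) dN.
  have := is_deriveM_mul d1 d2; rewrite /= => h; apply: (is_derive_eq h).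
  rewrite /flat x0 hornerM hornerXn hornerD hornerN opprK -exprVn.
  by move: (x^-1 ^+ 2) P.[_] (P^`()).[_] (expR _) => u a b e; ring.
- have nE : \forall z \near x, 0 = flat P z.
    by apply: filterS (lt_nbhsl x0) => z z0; rewrite /flat ltNge ltW.
  rewrite /flat (lt_gtF x0); apply: (near_eq_is_derive nE); exact: is_derive_cst.
have [c c0 hc] := flat_small P.
rewrite {2}/flat ltxx.
have cv : h^-1 *: ((flat P \o shift 0) (h *: 1) - flat P 0) @[h --> 0^'] --> (0 : R).
  apply/cvgrPdist_le => e e0.
  have c1 : 0 < c + 1 by rewrite ltr_wpDl.
  have ec : 0 < e / (c + 1) by exact: divr_gt0.
  near=> h.
  rewrite /= addr0 [_%:A]mulr1 {2}/flat ltxx subr0 sub0r normrN normrM normfV.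
  have h0 : h != 0 by near: h; exact: nbhs_dnbhs_neq.
  rewrite ler_pdivrMl ?normr_gt0 //.
  have h1 : h <= 1.
    near: h; apply: nbhs_dnbhs; exact: (lt_le_nbhsl (@ltr01 R)).
  rewrite (le_trans (hc h h1)) // -real_normK ?num_real // expr2 mulrCA ler_wpM2l //.
  have he : `|h| <= e / (c + 1).
    near: h; apply: nbhs_dnbhs; apply/nbhs_ballP; exists (e / (c + 1)) => //.
    by move=> z; rewrite /ball /= sub0r normrN => /ltW.
  rewrite (le_trans (ler_wpM2l c0 he)) // mulrCA ler_piMr ?(ltW e0) //.
  by rewrite ler_pdivrMr // mul1r lerDl.
by apply: DeriveDef; [apply/cvg_ex; exists 0 | apply: cvg_lim].
Unshelve. all: by end_near. Qed.

Lemma rsmooth_flat P : rsmooth (flat P).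
Proof.
apply/rsmoothP => k; elim: k P => [|k IH] P.
  by split=> // x; have [] := is_derive_flat P x.
split=> [x|]; first by have [] := is_derive_flat P x.
by apply: eq_Ck (IH ('X^2 * (P - P^`()))) => x; apply/esym/derive1_val; exact: is_derive_flat.
Qed.

Definition bump (a b t : R) : R := flat 1 (t - a) * flat 1 (b - t).

Lemma rsmooth_bump a b : rsmooth (bump a b).
Proof.
have h1 := rsmooth_affine 1 (- a) (@rsmooth_flat 1).
have h2 := rsmooth_affine (-1) b (@rsmooth_flat 1).
by apply: eq_rsmooth (rsmoothM h1 h2) => x; rewrite /bump mul1r mulN1r [- x + b]addrC.
Qed.

Lemma flat1_ge0 x : 0 <= flat 1 x.
Proof. by rewrite /flat; case: ifP => // _; rewrite hornerC mul1r expR_ge0. Qed.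

Lemma bump_ge0 a b t : 0 <= bump a b t.
Proof. by rewrite mulr_ge0 ?flat1_ge0. Qed.

Lemma bump_out a b t : (t <= a) || (b <= t) -> bump a b t = 0.
Proof.
have f0 x : x <= 0 -> flat 1 x = 0 by rewrite /flat leNgt => /negPf ->.
by rewrite /bump => /orP[ta|bt]; [rewrite f0 ?mul0r // subr_le0 | rewrite [X in _ * X]f0 ?mulr0 // subr_le0].
Qed.

Lemma bump_lower t0 (r t : R) : 0 < r -> `|t - t0| <= r -> expR (- r^-1) ^+ 2 <= bump (t0 - r *+ 2) (t0 + r *+ 2) t.
Proof.
move=> r0; rewrite ler_norml => /andP[h1 h2].
have key x : r <= x -> expR (- r^-1) <= flat 1 x.
  move=> rx; have x0 : 0 < x by exact: lt_le_trans rx.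
  by rewrite /flat x0 hornerC mul1r ler_expR lerN2 lef_pV2.
rewrite expr2 /bump; apply: ler_pM; rewrite ?expR_ge0 //; apply: key; rewrite mulr2n; lra.
Qed.

End SmoothFunctions.

(** * Oscillatory integrals *)

Section CompactIntegral.
Context {R : realType}.
Variables a b : R.
Hypothesis ab : a <= b.
Implicit Types g h : R -> R.

(** The margin of [1] puts the endpoints strictly outside [[a, b]], where functions satisfying
    [outside] vanish, and keeps the interval nondegenerate even if [a = b]. *)
Definition Iab g : R := \int[lebesgue_measure]_(x in `[a - 1, b + 1]) g x.

Definition outside g := forall x, (x < a) || (b < x) -> g x = 0.

Lemma AB : a - 1 < b + 1. Proof. by move: ab; lra. Qed.

Lemma continuous_integrable g c d : continuous g ->
  lebesgue_measure.-integrable `[c, d] (EFin \o g).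
Proof.
move=> cg; apply: continuous_compact_integrable; first exact: segment_compact.
exact: continuous_subspaceT.
Qed.

Lemma continuousZl (c : R) g : continuous g -> continuous (fun x => c * g x).
Proof. by move=> cg x; apply: continuousM; [exact: cst_continuous|exact: cg]. Qed.

Lemma eq_Iab g h : g =1 h -> Iab g = Iab h. Proof. by move=> /funext ->. Qed.

Lemma IabD g h : continuous g -> continuous h -> Iab (fun x => g x + h x) = Iab g + Iab h.
Proof. by move=> cg ch; apply: RintegralD; [|exact: continuous_integrable..]. Qed.

Lemma IabZ (c : R) g : continuous g -> Iab (fun x => c * g x) = c * Iab g.
Proof. by move=> cg; apply: RintegralZl; [|exact: continuous_integrable]. Qed.

Lemma le_Iab g h : continuous g -> continuous h -> (forall x, g x <= h x) -> Iab g <= Iab h.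
Proof. by move=> cg ch gh; apply: le_Rintegral => //; exact: continuous_integrable. Qed.

Lemma Iab_cst (c : R) : Iab (fun=> c) = c * (b - a + 2).
Proof.
rewrite /Iab Rintegral_cst; last by [].
rewrite [X in fine X]lebesgue_measure_itv /= lte_fin AB -EFinB /=; ring.
Qed.

Lemma norm_Iab g (M : R) : continuous g -> (forall x, `|g x| <= M) -> `|Iab g| <= M * (b - a + 2).
Proof.
move=> cg gM; rewrite -Iab_cst ler_norml; apply/andP; split.
  have -> : - Iab (fun=> M) = Iab (fun=> - M) by rewrite !Iab_cst mulNr.
  by apply: le_Iab => // x; [exact: cst_continuous | have := gM x; rewrite ler_norml => /andP[]].
by apply: le_Iab => // x; [exact: cst_continuous | have := gM x; rewrite ler_norml => /andP[]].
Qed.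

Lemma Rintegral_outside g : outside g -> \int[lebesgue_measure]_x g x = Iab g.
Proof.
move=> og; rewrite /Iab [RHS]Rintegral_mkcond; apply: eq_Rintegral => x _.
rewrite /patch; case: ifPn => // xn.
apply: og; apply: contraNT xn; rewrite negb_or -!leNgt => /andP[h1 h2].
by rewrite inE /= in_itv /=; apply/andP; split; lra.
Qed.

Lemma Iab_gt0 g (c t0 r : R) : continuous g -> (forall x, 0 <= g x) -> 0 < c -> 0 < r ->
  a <= t0 - r -> t0 + r <= b -> (forall x, `|x - t0| <= r -> c <= g x) -> 0 < Iab g.
Proof.
move=> cg g0 c0 r0 h1 h2 gc; pose J : set R := `[t0 - r, t0 + r]%classic.
have JI : J `<=` `[a - 1, b + 1].
  by move=> x; rewrite /J /= !in_itv /= => /andP[? ?]; apply/andP; split; lra.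
have mJ : measurable J by exact: measurable_itv.
have intI := @continuous_integrable g (a - 1) (b + 1) cg.
rewrite /Iab -(setDUK JI) Rintegral_setU //; last 3 first.
- exact: measurableD.
- by rewrite setDUK.
- by rewrite disj_set2E setDE setIA setIAC setICr set0I.
rewrite ltr_pwDl ?Rintegral_ge0 //.
have le : \int[lebesgue_measure]_(x in J) c <= \int[lebesgue_measure]_(x in J) g x.
  apply: le_Rintegral => //; [apply: continuous_integrable; exact: cst_continuous|exact: continuous_integrable|].
  by move=> x; rewrite /J /= in_itv /= => /andP[? ?]; apply: gc; rewrite ler_norml; apply/andP; split; lra.
apply: lt_le_trans le; rewrite Rintegral_cst // [X in fine X]lebesgue_measure_itv /= lte_fin.
have -> : t0 - r < t0 + r by lra.
by rewrite -EFinB /=; apply: mulr_gt0 => //; lra.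
Qed.

Lemma outside_derive g : rsmooth g -> outside g -> outside (derive1 g).
Proof.
move=> sg og x xo; apply: derive1_val.
have nE : \forall z \near x, 0 = g z.
  case/orP: xo => h; first by apply: filterS (lt_nbhsl h) => z hz; rewrite og ?hz.
  by apply: filterS (lt_nbhsr h) => z hz; rewrite og ?hz ?orbT.
by apply: (near_eq_is_derive nE); exact: is_derive_cst.
Qed.

Lemma outsideM g h : outside h -> outside (fun x => g x * h x).
Proof. by move=> oh x /oh ->; rewrite mulr0. Qed.

Lemma Iab_derive g : rsmooth g -> outside g -> Iab (derive1 g) = 0.
Proof.
move=> sg og; rewrite /Iab /Rintegral.
rewrite (@continuous_FTC2 R (derive1 g) g (a - 1) (b + 1) AB).
- rewrite !og ?ltrDl ?ltr01 ?orbT //; first by rewrite -EFinB subrr.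
  by rewrite ltrBlDr ltrDl ltr01.
- apply: continuous_subspaceT; exact: rsmooth_continuous (rsmooth_derive sg).
- split; first by move=> x _; exact: (sg 0%N).
    by apply: cvg_at_right_filter; exact: (rsmooth_continuous sg).
  by apply: cvg_at_left_filter; exact: (rsmooth_continuous sg).
- by [].
Qed.

Lemma by_parts f g : rsmooth f -> rsmooth g -> outside g ->
  Iab (fun x => derive1 f x * g x) = - Iab (fun x => f x * derive1 g x).
Proof.
move=> sf sg og; apply/eqP; rewrite -addr_eq0 -IabD.
- apply/eqP; rewrite -[RHS](@Iab_derive (fun x => f x * g x)); [|exact: rsmoothM|exact: outsideM].
  apply: eq_Iab => x; apply/esym; apply: derive1_val; rewrite addrC.
  exact: is_deriveM_mul (rsmooth_is_derive x sf) (rsmooth_is_derive x sg).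
- exact: rsmooth_continuous (rsmoothM (rsmooth_derive sf) sg).
- exact: rsmooth_continuous (rsmoothM sf (rsmooth_derive sg)).
Qed.

Lemma rsmooth_cos_scale (s : R) : rsmooth (fun t => cos (s * t)).
Proof. by apply: eq_rsmooth (@rsmooth_affine _ _ s 0 rsmooth_cos) => x; rewrite addr0. Qed.
Lemma rsmooth_sin_scale (s : R) : rsmooth (fun t => sin (s * t)).
Proof. by apply: eq_rsmooth (@rsmooth_affine _ _ s 0 rsmooth_sin) => x; rewrite addr0. Qed.

Arguments rsmooth_cos_scale : clear implicits.
Arguments rsmooth_sin_scale : clear implicits.

Lemma bounded_outside g : rsmooth g -> outside g -> exists2 M : R, 0 <= M & forall x, `|g x| <= M.
Proof.
move=> sg og.
have cn : {within `[a, b], continuous (fun x => `|g x|)}.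
  apply: continuous_subspaceT => x; apply: continuous_comp; first exact: rsmooth_continuous.
  exact: norm_continuous.
have [c _ hc] := EVT_max ab cn.
exists `|g c| => // x; have [xin|] := boolP (x \in `[a, b]); first exact: hc.
by rewrite in_itv /= negb_and -!ltNge => /og ->; rewrite normr0.
Qed.

(** Repeated integration by parts, with sine and cosine together because each step exchanges them.
    The weight [1 + s] in place of [s] keeps the estimate meaningful at [s = 0]. *)
Lemma trig_decay (B : nat) g : rsmooth g -> outside g -> exists2 C : R, 0 <= C & forall s : R, 0 <= s ->
  (1 + s) ^+ B * `|Iab (fun t => cos (s * t) * g t)| <= C /\
  (1 + s) ^+ B * `|Iab (fun t => sin (s * t) * g t)| <= C.
Proof.
elim: B g => [|B IH] g sg og.
  have [M M0 hM] := bounded_outside sg og; exists (M * (b - a + 2)).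
    by rewrite mulr_ge0 //; move: ab; lra.
  move=> s s0; rewrite expr0 !mul1r; split; apply: norm_Iab.
  - exact: rsmooth_continuous (rsmoothM (rsmooth_cos_scale s) sg).
  - move=> x; rewrite normrM -[leRHS]mul1r ler_pM // ler_norml cos_geN1 cos_le1 //.
  - exact: rsmooth_continuous (rsmoothM (rsmooth_sin_scale s) sg).
  - move=> x; rewrite normrM -[leRHS]mul1r ler_pM // ler_norml sin_geN1 sin_le1 //.
have [C1 C10 h1] := IH g sg og.
have [C2 C20 h2] := IH (derive1 g) (rsmooth_derive sg) (outside_derive sg og).
exists (C1 + C2); first exact: addr_ge0.
move=> s s0; have [h1c h1s] := h1 s s0; have [h2c h2s] := h2 s s0.
have dcos x : is_derive x (1 : R) (fun t : R => cos (s * t)) (- (s * sin (s * x))).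
  have := is_derive_affine (c := 0) (is_derive_cos (s * x + 0)).
  by rewrite addr0 mulrN; congr is_derive; apply/funext => z; rewrite addr0.
have dsin x : is_derive x (1 : R) (fun t : R => sin (s * t)) (s * cos (s * x)).
  have := is_derive_affine (c := 0) (is_derive_sin (s * x + 0)).
  by rewrite addr0; congr is_derive; apply/funext => z; rewrite addr0.
have pc : s * Iab (fun t => cos (s * t) * g t) = - Iab (fun t => sin (s * t) * derive1 g t).
  rewrite -(by_parts (rsmooth_sin_scale s) sg og) -IabZ.
    by apply: eq_Iab => x; rewrite (derive1_val (dsin x)) mulrA.
  exact: rsmooth_continuous (rsmoothM (rsmooth_cos_scale s) sg).
have ps : s * Iab (fun t => sin (s * t) * g t) = Iab (fun t => cos (s * t) * derive1 g t).
  have := by_parts (rsmooth_cos_scale s) sg og.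
  rewrite -[RHS]opprK => /(congr1 -%R); rewrite !opprK => <-.
  rewrite -IabZ; last exact: rsmooth_continuous (rsmoothM (rsmooth_sin_scale s) sg).
  rewrite -mulN1r -IabZ.
    by apply: eq_Iab => x; rewrite (derive1_val (dcos x)); ring.
  exact: rsmooth_continuous (rsmoothM (rsmooth_derive (rsmooth_cos_scale s)) sg).
have split_s (I J : R) : `|s * I| = `|J| -> (1 + s) ^+ B * `|I| <= C1 -> (1 + s) ^+ B * `|J| <= C2 ->
    (1 + s) ^+ B.+1 * `|I| <= C1 + C2.
  rewrite normrM (ger0_norm s0) => e i1 i2; rewrite exprSr -mulrA mulrDl mul1r mulrDr e; exact: lerD.
split; apply: split_s; [rewrite pc normrN; reflexivity|exact: h1c|exact: h2s|rewrite ps; reflexivity|exact: h1s|exact: h2c].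
Qed.

End CompactIntegral.

(** * Convergence of series *)

Section Convergence.
Context {R : realType}.
Local Notation C := R[i].
Implicit Types (u w : nat -> C) (l c : C).

Definition cnv u l := forall e : R, 0 < e -> exists K0 : nat, forall K, (K0 <= K)%N -> normc (u K - l) <= e.

Lemma cnvD u w l m : cnv u l -> cnv w m -> cnv (fun k => u k + w k) (l + m).
Proof.
move=> hu hw e e0; have e2 : 0 < e / 2 by exact: divr_gt0.
have [K1 h1] := hu _ e2; have [K2 h2] := hw _ e2; exists (maxn K1 K2) => K; rewrite geq_max => /andP[k1 k2].
have -> : u K + w K - (l + m) = (u K - l) + (w K - m) by rewrite opprD addrACA.
by rewrite (le_trans (le_normcD _ _)) // [leRHS](splitr e) lerD ?h1 ?h2.
Qed.

Lemma cnvZ c u l : cnv u l -> cnv (fun k => c * u k) (c * l).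
Proof.
move=> hu e e0; have c1 : 0 < normc c + 1 by rewrite ltr_wpDl ?normc_ge0.
have [K0 h] := hu _ (divr_gt0 e0 c1); exists K0 => K kK.
rewrite -mulrBr normcM (le_trans (ler_wpM2l (normc_ge0 c) (h K kK))) //.
by rewrite mulrCA ler_piMr ?(ltW e0) // ler_pdivrMr // mul1r lerDl.
Qed.

Lemma cnv_eq u w l : u =1 w -> cnv u l -> cnv w l.
Proof. by move=> /funext ->. Qed.

Lemma cnvN u l : cnv u l -> cnv (fun k => - u k) (- l).
Proof. by move=> /(cnvZ (-1)); rewrite mulN1r; apply: cnv_eq => k; rewrite mulN1r. Qed.

Lemma cnvB u w l m : cnv u l -> cnv w m -> cnv (fun k => u k - w k) (l - m).
Proof. by move=> hu hw; exact: cnvD hu (cnvN hw). Qed.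

Lemma cnv_addn u (j : nat) l : cnv u l -> cnv (fun k => u (k + j)%N) l.
Proof. by move=> h e /h [K0 hK]; exists K0 => K kK; apply: hK; exact: leq_trans (leq_addr _ _). Qed.

Lemma cnvS u l : cnv (fun k => u k.+1) l -> cnv u l.
Proof. by move=> h e /h [K0 hK]; exists K0.+1 => -[|K] // kK; exact: hK. Qed.

Lemma inv_small (M e : R) : 0 < e -> exists K0 : nat, forall K, (K0 <= K)%N -> M / K.+1%:R <= e.
Proof.
move=> e0; exists (Num.bound (M / e)) => K kK.
rewrite ler_pdivrMr ?ltr0n // mulrC -ler_pdivrMr //.
apply: (le_trans (ler_norm _)); apply: ltW; apply: lt_le_trans (archi_boundP (normr_ge0 _)) _.
have -> : Num.bound `|M / e| = Num.bound (M / e) by rewrite /Num.bound normr_id.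
by rewrite ler_nat ltnW.
Qed.

Lemma cnv_inv (M : R) u l : (forall k, normc (u k - l) <= M / k.+1%:R) -> cnv u l.
Proof.
by move=> h e /(inv_small M) [K0 hK]; exists K0 => K kK; exact: le_trans (h K) (hK K kK).
Qed.

Lemma cnv_cst l : cnv (fun=> l) l.
Proof. by apply: (@cnv_inv 0) => k; rewrite subrr normc0 mul0r. Qed.

Lemma cnv_Re u l (m : R) : cnv u l -> (forall k, m <= Re (u k)) -> m <= Re l.
Proof.
move=> h hm; rewrite leNgt; apply/negP => lm.
have [K0 hK] := h ((m - Re l) / 2) ltac:(by rewrite divr_gt0 // subr_gt0).
have := le_trans (Re_le_normc _) (hK K0 (leqnn _)); rewrite ReB ler_norml => /andP[_].
by have := hm K0; lra.
Qed.

Lemma cnv_climit u l : cnv u l -> climit u = l.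
Proof.
move=> h.
have hr : Re (u N) @[N --> \oo] --> Re l.
  apply/cvgrPdist_le => e /h [K0 hK]; exists K0 => // K /= kK.
  by rewrite distrC -ReB; exact: le_trans (Re_le_normc _) (hK K kK).
have hi : Im (u N) @[N --> \oo] --> Im l.
  apply/cvgrPdist_le => e /h [K0 hK]; exists K0 => // K /= kK.
  by rewrite distrC -ImB; exact: le_trans (Im_le_normc _) (hK K kK).
by rewrite /climit (cvg_lim _ hr) // (cvg_lim _ hi) //; case: l {h hr hi}.
Qed.

Lemma inv_telescope (k : nat) : (k.+1%:R * k.+2%:R)^-1 = k.+1%:R^-1 - k.+2%:R^-1 :> R.
Proof.
have a0 : k.+1%:R != 0 :> R by rewrite pnatr_eq0.
have b0 : k.+2%:R != 0 :> R by rewrite pnatr_eq0.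
rewrite -[k.+2%:R]natr1 in b0 *; move: k.+1%:R a0 b0 => x a0 b0; field; by rewrite a0 b0.
Qed.

Lemma telescope_tail (M : R) (v : nat -> R) : (forall k, v k <= M / (k.+1%:R * k.+2%:R)) ->
  forall K j, \sum_(K <= k < K + j) v k <= M / K.+1%:R - M / (K + j).+1%:R.
Proof.
move=> h K; elim=> [|j IH]; first by rewrite addn0 big_geq // subrr.
rewrite addnS big_nat_recr ?leq_addr //=; have := h (K + j)%N.
by rewrite inv_telescope mulrBr => h1; have := lerD IH h1; rewrite addrA subrK.
Qed.

(** The partial sums lowered by the tail bound [M / (K + 1)] are nondecreasing and bounded; their
    supremum is the limit, and the rate comes with it. *)
Lemma real_series_cvg (M : R) (v : nat -> R) : 0 <= M -> (forall k, `|v k| <= M / (k.+1%:R * k.+2%:R)) ->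
  exists l : R, forall K, `|\sum_(k < K) v k - l| <= M / K.+1%:R.
Proof.
move=> M0 h; pose s K : R := \sum_(k < K) v k.
have [bt btE] : exists bt : nat -> R, forall K, bt K = M / K.+1%:R by exists (fun K => M / K.+1%:R).
have step K j : `|s (K + j)%N - s K| <= bt K - bt (K + j)%N.
  have -> : s (K + j)%N - s K = \sum_(K <= k < K + j) v k.
    rewrite /s -!(big_mkord xpredT) (big_cat_nat (leq0n K) (leq_addr j K)) /=.
    by rewrite addrAC subrr add0r.
  by rewrite (le_trans (ler_norm_sum _ _ _)) // !btE telescope_tail.
have pos K : 0 <= bt K by rewrite btE divr_ge0.
pose w K := s K - bt K.
have wnd : nondecreasing_seq w.
  move=> K J KJ; have := step K (J - K)%N; rewrite subnKC // ler_norml => /andP[h1 _].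
  by rewrite /w; lra.
have wub : has_ubound (range w).
  exists (s 0%N + bt 0%N) => _ [K _ <-]; have := step 0%N K; rewrite add0n ler_norml => /andP[_ h1].
  by have := pos K; rewrite /w; lra.
exists (sup (range w)) => K; rewrite -/(s K) -btE ler_norml; apply/andP; split.
  have : sup (range w) <= s K + bt K.
    apply: ge_sup; first by exists (w 0%N), 0%N.
    move=> _ [J _ <-]; rewrite /w; have [KJ|/ltnW JK] := leqP K J.
      have := step K (J - K)%N; rewrite subnKC // ler_norml => /andP[_ h1]; have := pos J; lra.
    have := step J (K - J)%N; rewrite subnKC // ler_norml => /andP[h1 _]; have := pos K; lra.
  by move: (sup _) => S; lra.
have : w K <= sup (range w) by apply: ub_le_sup => //; exists K.
by rewrite /w; move: (sup _) => S; lra.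
Qed.

Lemma series_cnv (M : R) (v : nat -> C) : 0 <= M -> (forall k, normc (v k) <= M / (k.+1%:R * k.+2%:R)) ->
  exists l : C, cnv (fun K => \sum_(k < K) v k) l.
Proof.
move=> M0 h.
have [l1 h1] := real_series_cvg M0 (fun k => le_trans (Re_le_normc (v k)) (h k)).
have [l2 h2] := real_series_cvg M0 (fun k => le_trans (Im_le_normc (v k)) (h k)).
exists (l1 +i* l2); apply: (@cnv_inv (M *+ 2)) => K.
apply: (le_trans (normc_le _)); rewrite ReB ImB Re_sum Im_sum mulrnAl mulr2n.
apply: lerD; [exact: h1|exact: h2].
Qed.

(* Dominated convergence for the rearranged series: the multiset [kappa j, j < N]
   exhausts every index [k] exactly [d k] times. *)
Lemma rearrangement (d : nat -> nat) (g : nat -> C) (kappa : nat -> nat) (M : R) l :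
  (forall N k, (count (fun j => kappa j == k) (iota 0 N) <= d k)%N) ->
  (forall k, exists N0, forall N, (N0 <= N)%N -> count (fun j => kappa j == k) (iota 0 N) = d k) ->
  0 <= M -> (forall k, normc ((d k)%:R * g k) <= M / (k.+1%:R * k.+2%:R)) ->
  cnv (fun K => \sum_(k < K) (d k)%:R * g k) l -> cnv (fun N => \sum_(j < N) g (kappa j)) l.
Proof.
move=> cle ceq M0 hg hl e e0; pose cn N k := count (fun j => kappa j == k) (iota 0 N).
have WE N Q : (forall j, (j < N)%N -> (kappa j < Q)%N) ->
    \sum_(j < N) g (kappa j) = \sum_(0 <= k < Q) (cn N k)%:R * g k.
  elim: N => [|N IH] hQ.
    by rewrite big_ord0 big1_seq // => k _; rewrite /cn /= mul0r.
  rewrite big_ord_recr /= IH => [|j jN]; last by apply: hQ; exact: ltnW.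
  have -> : g (kappa N) = \sum_(0 <= k < Q) (kappa N == k)%:R * g k.
    rewrite big_mkord (bigD1 (Ordinal (hQ N (ltnSn N)))) //= eqxx mul1r big1 ?addr0 // => i iN.
    case: eqP => [ei|_]; last by rewrite mul0r.
    by case/eqP: iN; apply/val_inj; rewrite /= ei.
  rewrite -big_split; apply: eq_bigr => k _.
  by rewrite /cn -addn1 iotaD count_cat /= addn0 natrD mulrDl add0n.
have [K1 h1] := hl (e / 2) ltac:(by rewrite divr_gt0).
pose K2 := Num.bound (M / (e / 2)); pose K0 := maxn K1 K2.
have tail : M / K0.+1%:R <= e / 2.
  rewrite ler_pdivrMr ?ltr0n // mulrC -ler_pdivrMr ?divr_gt0 //.
  apply: ltW; apply: lt_le_trans (archi_boundP _) _; first by rewrite divr_ge0 // ltW // divr_gt0.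
  by rewrite ler_nat -/K2 ltnW // ltnS leq_maxr.
have [N0 hN0] : exists N0, forall N, (N0 <= N)%N -> forall k, (k < K0)%N -> cn N k = d k.
  elim: K0 {tail} => [|K [N0 hN]]; first by exists 0%N.
  have [N1 hN1] := ceq K; exists (maxn N0 N1) => N; rewrite geq_max => /andP[n0 n1] k.
  by rewrite ltnS leq_eqVlt => /orP[/eqP ->|]; [exact: hN1|exact: hN].
exists N0 => N NN.
pose Q := (\max_(j < N) kappa j).+1.
have hQ j : (j < N)%N -> (kappa j < K0 + Q)%N.
  move=> jN; rewrite (@leq_trans Q) ?leq_addl // ltnS.
  by apply: (@leq_bigmax _ (fun j : 'I_N => kappa j) (Ordinal jN)).
rewrite (WE N _ hQ) (big_cat_nat (leq0n K0) (leq_addr Q K0)) /=.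
have -> : \sum_(0 <= k < K0) (cn N k)%:R * g k = \sum_(k < K0) (d k)%:R * g k.
  by rewrite big_mkord; apply: eq_bigr => k _; rewrite hN0.
rewrite addrAC (splitr e) (le_trans (le_normcD _ _)) // lerD //.
  by apply: h1; exact: leq_maxl.
apply: (le_trans (normc_sum _ _ _)).
have hv k : normc ((cn N k)%:R * g k) <= M / (k.+1%:R * k.+2%:R).
  apply: le_trans (hg k); rewrite !normcM !normc_nat ler_wpM2r ?normc_ge0 // ler_nat; exact: cle.
apply: (le_trans (telescope_tail hv K0 Q)); apply: le_trans tail.
by rewrite gerBl divr_ge0.
Qed.

End Convergence.

(** * Complex test functions *)

Section ComplexTestFunctions.
Context {R : realType}.
Local Notation C := R[i].
Implicit Types (f g phi psi : R -> C).

Definition csm f := rsmooth (fun t => Re (f t)) /\ rsmooth (fun t => Im (f t)).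
Definition ccont f := forall x, ccontinuous_at f x.

Lemma eq_csm f g : f =1 g -> csm f -> csm g. Proof. by move=> /funext ->. Qed.

Lemma csm_cont f : csm f -> ccont f.
Proof. by move=> [s1 s2] x; split; [exact: (rsmooth_continuous s1)|exact: (rsmooth_continuous s2)]. Qed.

Lemma csmD f g : csm f -> csm g -> csm (fun t => f t + g t).
Proof.
move=> [a1 a2] [b1 b2]; split.
  by apply: eq_rsmooth (rsmoothD a1 b1) => t; rewrite ReD.
by apply: eq_rsmooth (rsmoothD a2 b2) => t; rewrite ImD.
Qed.

Lemma csm_cst (c : C) : csm (fun=> c).
Proof. by split; exact: rsmooth_cst. Qed.

Lemma csmM f g : csm f -> csm g -> csm (fun t => f t * g t).
Proof.
move=> [a1 a2] [b1 b2]; split.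
  have h := rsmoothM (rsmooth_cst (c := -1)) (rsmoothM a2 b2).
  by apply: eq_rsmooth (rsmoothD (rsmoothM a1 b1) h) => t; rewrite ReM mulN1r.
by apply: eq_rsmooth (rsmoothD (rsmoothM a1 b2) (rsmoothM a2 b1)) => t; rewrite ImM.
Qed.

Lemma csm_expi (s : R) : csm (fun t => expi (s * t)).
Proof. split; [exact: rsmooth_cos_scale|exact: rsmooth_sin_scale]. Qed.

Lemma csmX f k : csm f -> csm (fun t => f t ^+ k).
Proof.
move=> sf; elim: k => [|k IH]; first by apply: eq_csm (csm_cst 1) => t; rewrite expr0.
by apply: eq_csm (csmM sf IH) => t; rewrite exprS.
Qed.

Lemma csm_sum (F : nat -> R -> C) K : (forall k, csm (F k)) -> csm (fun t => \sum_(k < K) F k t).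
Proof.
move=> sF; elim: K => [|K IH]; first by apply: eq_csm (csm_cst 0) => t; rewrite big_ord0.
by apply: eq_csm (csmD IH (sF K)) => t; rewrite big_ord_recr.
Qed.

Variables a b : R.
Hypothesis ab : a <= b.

Definition coutside f := forall x, (x < a) || (b < x) -> f x = 0.

Definition ctest psi := csm psi /\ coutside psi.

Lemma ctestM f psi : csm f -> ctest psi -> ctest (fun t => f t * psi t).
Proof. by move=> sf [s o]; split; [exact: csmM|move=> x xo; rewrite o ?mulr0]. Qed.

Lemma ctest_cont psi : ctest psi -> ccont psi. Proof. by move=> [s _]; exact: csm_cont. Qed.

Lemma ctest_parts psi : ctest psi -> outside a b (fun t => Re (psi t)) /\ outside a b (fun t => Im (psi t)).
Proof. by move=> [_ o]; split => x xo; rewrite o. Qed.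

Definition cI f : C := Iab a b (fun t => Re (f t)) +i* Iab a b (fun t => Im (f t)).

Lemma eq_cI f g : f =1 g -> cI f = cI g. Proof. by move=> /funext ->. Qed.

Lemma cID f g : ccont f -> ccont g -> cI (fun t => f t + g t) = cI f + cI g.
Proof.
move=> cf cg; apply: complex_ext; rewrite ?ReD ?ImD /=.
  rewrite -IabD; [|by move=> x; exact: (cf x).1|by move=> x; exact: (cg x).1].
  by apply: eq_Iab => t; rewrite ReD.
rewrite -IabD; [|by move=> x; exact: (cf x).2|by move=> x; exact: (cg x).2].
by apply: eq_Iab => t; rewrite ImD.
Qed.

Lemma ccontM f g : ccont f -> ccont g -> ccont (fun t => f t * g t).
Proof. by move=> cf cg x; exact: ccontinuousM. Qed.

Lemma cIZ (c : C) f : ccont f -> cI (fun t => c * f t) = c * cI f.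
Proof.
move=> cf; have c1 : continuous (fun x => Re (f x)) by move=> x; exact: (cf x).1.
have c2 : continuous (fun x => Im (f x)) by move=> x; exact: (cf x).2.
apply: complex_ext; rewrite ?ReM ?ImM /=.
  rewrite -mulNr -!IabZ // -IabD; [|exact: continuousZl..].
  by apply: eq_Iab => t; rewrite ReM mulNr.
rewrite -!IabZ // -IabD; [|exact: continuousZl..].
by apply: eq_Iab => t; rewrite ImM.
Qed.

Lemma cIB f g : ccont f -> ccont g -> cI (fun t => f t - g t) = cI f - cI g.
Proof.
move=> cf cg; have cm : ccont (fun t => -1 * g t) by apply: ccontM cg => x; exact: ccontinuous_cst.
have -> : (fun t => f t - g t) = fun t => f t + -1 * g t by apply/funext => t; rewrite mulN1r.
by rewrite (cID cf cm) (cIZ _ cg) mulN1r.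
Qed.

Lemma cI_sum (F : nat -> R -> C) K : (forall k, csm (F k)) ->
  cI (fun t => \sum_(k < K) F k t) = \sum_(k < K) cI (F k).
Proof.
move=> sF; elim: K => [|K IH].
  rewrite big_ord0 (_ : (fun _ => _) = fun t => 0 * (0 : C)); last first.
    by apply/funext => t; rewrite big_ord0 mulr0.
  by rewrite cIZ ?mul0r // => x; exact: ccontinuous_cst.
have -> : (fun t => \sum_(k < K.+1) F k t) = fun t => \sum_(k < K) F k t + F K t.
  by apply/funext => t; rewrite big_ord_recr.
rewrite cID; first by rewrite IH big_ord_recr.
  by apply: csm_cont; exact: csm_sum.
exact: csm_cont (sF K).
Qed.

Lemma cintegral_cI f : coutside f -> cintegral f = cI f.
Proof.
by move=> o; rewrite /cintegral !(@Rintegral_outside _ a b) // => x xo; rewrite o.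
Qed.

Lemma fourier_decay (B : nat) psi : ctest psi -> exists2 c : R, 0 <= c &
  forall s : R, 0 <= s -> (1 + s) ^+ B * normc (cI (fun t => expi (- (t * s)) * psi t)) <= c.
Proof.
move=> tp; have [[s1 s2] _] := tp; have [u1 u2] := ctest_parts tp.
have [c1 c10 h1] := trig_decay ab B s1 u1; have [c2 c20 h2] := trig_decay ab B s2 u2.
exists ((c1 + c2) *+ 2) => [|s s0]; first by rewrite mulrn_wge0 // addr_ge0.
have [h1c h1s] := h1 s s0; have [h2c h2s] := h2 s s0.
have p0 : 0 <= (1 + s) ^+ B by rewrite exprn_ge0 // addr_ge0.
have eC t : Re (expi (- (t * s))) = cos (s * t) by rewrite /expi /= cosN mulrC.
have eS t : Im (expi (- (t * s))) = - sin (s * t) by rewrite /expi /= sinN mulrC.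
have cc (h : R -> R) : rsmooth h -> continuous (fun t => cos (s * t) * h t).
  by move=> sh; exact: rsmooth_continuous (rsmoothM (@rsmooth_cos_scale _ s) sh).
have cs (h : R -> R) : rsmooth h -> continuous (fun t => sin (s * t) * h t).
  by move=> sh; exact: rsmooth_continuous (rsmoothM (@rsmooth_sin_scale _ s) sh).
apply: (le_trans (ler_wpM2l p0 (normc_le _))) => /=.
have -> : Iab a b (fun t => Re (expi (- (t * s)) * psi t)) =
    Iab a b (fun t => cos (s * t) * Re (psi t)) + Iab a b (fun t => sin (s * t) * Im (psi t)).
  rewrite -(IabD a b (cc _ s1) (cs _ s2)).
  by apply: eq_Iab => t; rewrite ReM eC eS mulNr opprK.
have -> : Iab a b (fun t => Im (expi (- (t * s)) * psi t)) =
    Iab a b (fun t => cos (s * t) * Im (psi t)) + -1 * Iab a b (fun t => sin (s * t) * Re (psi t)).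
  rewrite -(IabZ a b (-1) (cs _ s1)) -(IabD a b (cc _ s2) (continuousZl (c := -1) (cs _ s1))).
  by apply: eq_Iab => t; rewrite ImM eC eS mulN1r mulNr.
move: h1c h1s h2c h2s.
move: (Iab _ _ _) (Iab _ _ _) (Iab _ _ _) (Iab _ _ _) => A1 B1 A2 B2 h1c h1s h2c h2s.
apply: (@le_trans _ _ ((1 + s) ^+ B * (`|A1| + `|B1| + (`|A2| + `|B2|)))).
  have b1 := ler_normD B2 A1; have b2 := ler_normD B1 (-1 * A2).
  rewrite mulN1r normrN -mulN1r in b2.
  by rewrite ler_wpM2l //; lra.
by move: h1c h1s h2c h2s; rewrite !mulrDr mulr2n; lra.
Qed.

(** * Abel summation under the integral *)

Section Shifting.
Implicit Types (x : R -> nat -> C) (L : seq C).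
Local Notation z t := (expi (- t)).

Lemma csm_z : csm (fun t => z t).
Proof. by apply: eq_csm (csm_expi (-1)) => t; rewrite mulN1r. Qed.

Definition csmseq x := forall k, csm (fun t => x t k).
(** The boundary terms of Abel summation may grow pointwise in [k]; it is only after integration
    against a test function that they tend to [0]. *)
Definition fast x := forall psi, ctest psi -> cnv (fun k => cI (fun t => x t k * z t ^+ k * psi t)) 0.
Definition SK x psi K := cI (fun t => psum (x t) (z t) K * psi t).
Definition DL L (t : R) : C := \prod_(c <- L) (1 - c * z t).

Lemma csm_Sh x : csmseq x -> csmseq (fun t => Sh (x t)).
Proof. by move=> sx [|k]; [exact: csm_cst|exact: sx]. Qed.

Lemma csm_sh c x : csmseq x -> csmseq (fun t => sh c (x t)).
Proof.
move=> sx k; apply: eq_csm (csmD (sx k) (csmM (csm_cst (- c)) (csm_Sh sx k))) => t.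
by rewrite /sh mulNr.
Qed.

Lemma csm_ops L x : csmseq x -> csmseq (fun t => ops L (x t)).
Proof. by move=> sx; elim: L => [|c L IH]; [exact: sx|exact: csm_sh]. Qed.

Lemma csm_psum x K : csmseq x -> csm (fun t => psum (x t) (z t) K).
Proof. by move=> sx; apply: (@csm_sum (fun k t => x t k * z t ^+ k)) => k; apply: csmM => //; apply: csmX; exact: csm_z. Qed.

Lemma csm_factor c : csm (fun t => 1 - c * z t).
Proof. by apply: eq_csm (csmD (csm_cst 1) (csmM (csm_cst (- c)) csm_z)) => t; rewrite mulNr. Qed.

Lemma csm_DL L : csm (DL L).
Proof.
elim: L => [|c L IH]; first by apply: eq_csm (csm_cst 1) => t; rewrite /DL big_nil.
by apply: eq_csm (csmM (csm_factor c) IH) => t; rewrite /DL big_cons.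
Qed.

Lemma fast_sh c x : csmseq x -> fast x -> fast (fun t => sh c (x t)).
Proof.
move=> sx fx psi tp; apply: cnvS.
have tz := ctestM csm_z tp.
have := cnvB (@cnv_addn _ _ 1 _ (fx _ tp)) (cnvZ c (fx _ tz)); rewrite mulr0 subr0.
have sP k ph : ctest ph -> ccont (fun t => x t k * z t ^+ k * ph t).
  by move=> tph; apply: ctest_cont; apply: ctestM => //; apply: csmM => //; apply: csmX; exact: csm_z.
apply: cnv_eq => k; rewrite addn1 -cIZ; last exact: sP.
rewrite -cIB; [|exact: sP|by apply: ccontM; [move=> y; exact: ccontinuous_cst|exact: sP]].
apply: eq_cI => t; rewrite /sh /= !exprS.
move: (x t k.+1) (x t k) (z t) (z t ^+ k) (psi t) => *; ring.
Qed.

Lemma fast_ops L x : csmseq x -> fast x -> fast (fun t => ops L (x t)).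
Proof. by move=> sx fx; elim: L => [|c L IH]; [exact: fx|exact: fast_sh (csm_ops L sx) IH]. Qed.

(* Abel summation: the boundary terms of the shift are oscillatory integrals. *)
Lemma SK_ops x L psi : csmseq x -> fast x -> ctest psi ->
  cnv (fun K => SK (fun t => ops L (x t)) psi (K + size L) - SK x (fun t => DL L t * psi t) K) 0.
Proof.
move=> sx fx; elim: L psi => [|c L IH] psi tp.
  apply: (@cnv_inv _ 0) => K; rewrite mul0r addn0 subr0.
  rewrite (_ : SK x (fun t => _) K = SK (fun t => ops [::] (x t)) psi K) ?subrr ?normc0 //.
  by apply: eq_cI => t; rewrite /DL big_nil mul1r.
have t1 := ctestM (csm_factor c) tp.
have h1 := IH _ t1; have h2 := @cnv_addn _ _ (size L) _ (fast_ops L sx fx tp).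
have := cnvD h1 h2; rewrite addr0; apply: cnv_eq => K.
rewrite addrAC; congr (_ - _); last by apply: eq_cI => t; congr (_ * _); rewrite /DL big_cons mulrA [X in X * _]mulrC.
rewrite /SK -cID.
- apply: eq_cI => t; rewrite /= addnS psum_sh.
  by move: (z t) (psum _ _ _) (ops _ _ (K + size L)%N) (_ ^+ _) => w P o zk; ring.
- by apply: ctest_cont; apply: ctestM => //; apply: csm_psum; exact: csm_ops.
- apply: ctest_cont; apply: ctestM => //; apply: csmM; first exact: (csm_ops L sx).
  by apply: csmX; exact: csm_z.
Qed.
End Shifting.
End ComplexTestFunctions.

(** * The wave trace *)

Section SpectrumMultiplicity.
Context {R : realType} {n q : nat} (p : 'I_n.+1 -> int).
Local Notation E mu := (@laplace_eigenspace R n q p mu).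
Local Notation d := (@lens_mult R n q p).
Local Notation lamk := (@lamk R n).

Lemma eigen_dimE k D : has_dim (E (lamk k)) D -> D = d k.
Proof.
move=> hD; apply/eqP; rewrite eqn_leq; apply/andP; split.
  apply: (eigen_dim_le hD) => k' m /lamk_inj <- rm dm am.
  by rewrite (mem_invariant_mons (R := R)) rm dm am !eqxx.
apply: (eigen_dim_ge hD); first exact: uniq_invariant_mons.
by move=> m; rewrite (mem_invariant_mons (R := R)) => /and3P[rm /eqP dm /eqP am].
Qed.

Variable lam : nat -> R.
Hypothesis hlam : is_spectrum q p lam.

(** For any other value [eigen_dim_le] with the empty list would make the eigenspace trivial,
    although [j] itself counts in the multiplicity of [lam j]. *)
Lemma spectrum_index j : exists k, lam j = lamk k.
Proof.
have [_ hs] := hlam; have [D [hD cD]] := hs (lam j).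
have [//|h] := pselect (exists k, lam j = lamk k).
have := @eigen_dim_le R n q p (lam j) D [::] hD _; rewrite /= leqn0 => D0.
have {D0} D0 : D = 0%N by apply/eqP; apply: D0 => k m ek; case: h; exists k.
move: cD; rewrite D0 II0 card_eq0 => /eqP e0.
by have : [set j' | lam j' = lam j] j by []; rewrite e0.
Qed.

(** [lam] is ordered by size while the multiplicities are indexed by the degree [k]; the two
    counting clauses are the form in which [rearrangement] passes between these summations. *)
Lemma spectrum_enum : exists kappa : nat -> nat,
  [/\ forall j, lam j = lamk (kappa j),
      forall N k, (count (fun j => kappa j == k) (iota 0 N) <= d k)%N &
      forall k, exists N0, forall N, (N0 <= N)%N -> count (fun j => kappa j == k) (iota 0 N) = d k].
Proof.
have [kappa kE] := choice spectrum_index; exists kappa.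
have [_ hs] := hlam.
have fin k : exists s : seq nat, [/\ uniq s, size s = d k & forall j, (j \in s) = (kappa j == k)].
  have [D [hD cD]] := hs (lamk k); have eD := eigen_dimE hD.
  exists (finmap.enum_fset (fset_set [set j | lam j = lamk k])); split.
  - exact: finmap.fset_uniq.
  - by rewrite (card_fset_set cD).
  - move=> j; have fA : finite_set [set j | lam j = lamk k] by exists D.
    have -> := in_fset_set fA j; apply/idP/eqP.
      by rewrite inE /= kE => /lamk_inj.
    by move=> kj; rewrite inE /= kE kj.
have cnt k N s : uniq s -> (forall j, (j \in s) = (kappa j == k)) ->
    (count (fun j => kappa j == k) (iota 0 N) <= size s)%N.
  move=> us ms; rewrite -size_filter; apply: uniq_leq_size.
    by rewrite filter_uniq // iota_uniq.
  by move=> j; rewrite mem_filter ms => /andP[].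
split=> // [N k|k].
  by have [s [us <- ms]] := fin k; exact: cnt.
have [s [us ss ms]] := fin k; exists (\max_(j <- s) j).+1 => N hN.
apply/eqP; rewrite eqn_leq -ss cnt //= -size_filter; apply: uniq_leq_size => // j js.
rewrite mem_filter -ms js mem_iota add0n /= (leq_trans _ hN) // ltnS.
exact: (@leq_bigmax_seq _ s xpredT id).
Qed.
End SpectrumMultiplicity.

Section LocalAnalysis.
Context {R : realType}.
Local Notation C := R[i].

Lemma ccontinuous_ball (f : R -> C) (x e : R) : ccontinuous_at f x -> 0 < e ->
  exists2 r : R, 0 < r & forall y, `|y - x| < r -> normc (f y - f x) <= e.
Proof.
move=> [c1 c2] e0; have e2 : 0 < e / 2 by exact: divr_gt0.
have /cvgrPdist_le/(_ _ e2) h1 := c1; have /cvgrPdist_le/(_ _ e2) h2 := c2.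
have [r /= r0 hr] : nbhs x [set y | `|Re (f x) - Re (f y)| <= e / 2 /\ `|Im (f x) - Im (f y)| <= e / 2].
  by apply: filterI; [exact: h1|exact: h2].
exists r => // y yr; have [|b1 b2] := hr y; first by rewrite /ball_ /= distrC.
by rewrite (le_trans (normc_le _)) // ReB ImB distrC [`|Im _ - _|]distrC [leRHS](splitr e) lerD.
Qed.

Lemma csmooth_ccont (f : R -> C) (U : set R) x : csmooth_on U f -> U x -> ccontinuous_at f x.
Proof.
move=> sf Ux; have [d1 d2] := sf 0%N x Ux.
by split; apply: differentiable_continuous; apply/derivable1_diffP.
Qed.

(** [f] is controlled only on [U]. At a point outside [[a, b]] the cutoff makes the product vanish
    on a neighbourhood. *)
Lemma ccont_cut (a b : R) (f psi : R -> C) (U : set R) : csmooth_on U f -> `[a, b] `<=` U ->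
  ctest a b psi -> ccont (fun t => f t * psi t).
Proof.
move=> sf abU tp x; have [xin|xo] := boolP (x \in `[a, b]).
  by apply: ccontinuousM; [exact: csmooth_ccont sf (abU _ xin)|exact: (ctest_cont tp)].
have zn : \forall y \near x, 0 = f y * psi y.
  move: xo; rewrite in_itv /= negb_and -!ltNge => /orP[h|h].
    by apply: filterS (lt_nbhsl h) => y yh; rewrite tp.2 ?yh // mulr0.
  by apply: filterS (lt_nbhsr h) => y yh; rewrite tp.2 ?yh ?orbT // mulr0.
have g0 (g : R -> R) : (\forall y \near x, 0 = g y) -> {for x, continuous g}.
  move=> h; suff : g y @[y --> x] --> g x by [].
  rewrite -(nbhs_singleton h); apply: cvg_near_cst.
  by apply: filterS h => y <-.
by split; apply: g0; apply: filterS zn => y <-.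
Qed.

Lemma ctest_test (a b : R) (phi : R -> C) (U : set R) : `[a, b] `<=` U -> ctest a b phi -> test_function U phi.
Proof.
move=> abU [[s1 s2] o].
have sub : closure [set t | phi t != 0] `<=` `[a, b].
  have cl : closed (`[a, b]%classic : set R) by exact: itv_closed.
  rewrite [X in _ `<=` X](closure_id _).1 //; apply: closureS => t /=.
  by apply: contraNT; rewrite in_itv /= negb_and -!ltNge => /o ->; rewrite eqxx.
split.
- by move=> k x _; split; [exact: s1|exact: s2].
- by apply: subclosed_compact sub; [exact: closed_closure|exact: segment_compact].
- exact: subset_trans sub abU.
Qed.
End LocalAnalysis.

(** Fourier decay is taken two powers beyond the growth of [d], which dominates the series by a
    telescoping one; the factor [2] passes from [k + 1] to [k + 2]. *)
Lemma mult_decay {R : realType} {n : nat} (a b : R) (d : nat -> R[i]) (s : nat) (c : R) (phi : R -> R[i]) :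
  a <= b -> 0 <= c -> (forall k, normc (d k) <= c * k.+1%:R ^+ s) -> ctest a b phi ->
  exists2 M : R, 0 <= M & forall k,
    normc (d k * cI a b (fun t => expi (- (t * @nuk R n k)) * phi t)) <= M / (k.+1%:R * k.+2%:R).
Proof.
move=> ab c0 hd tp; have [M M0 hM] := fourier_decay ab (s + 2) tp.
exists (2 * (c * M)) => [|k]; first by rewrite !mulr_ge0.
have k1 : 0 < k.+1%:R :> R by rewrite ltr0n.
have k2 : 0 < k.+2%:R :> R by rewrite ltr0n.
have nu0 : 0 <= @nuk R n k by exact: le_trans (ler0n _ k) (nuk_ge k).
rewrite ler_pdivlMr ?mulr_gt0 // normcM.
have := hM _ nu0; move: (cI _ _ _) => w hw.
have hw2 : k.+1%:R ^+ s * k.+1%:R ^+ 2 * normc w <= M.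
  rewrite -exprD; apply: le_trans hw; rewrite ler_wpM2r ?normc_ge0 // lerXn2r ?nnegrE ?addr_ge0 //.
  by rewrite -natr1 addrC lerD2l nuk_ge.
have k21 : k.+2%:R <= 2 * k.+1%:R :> R by rewrite -natrM ler_nat; lia.
apply: (@le_trans _ _ (c * k.+1%:R ^+ s * normc w * (k.+1%:R * (2 * k.+1%:R)))).
  apply: ler_pM; rewrite ?mulr_ge0 ?normc_ge0 // ?ler_wpM2l // ?ler_wpM2r ?normc_ge0 //.
have -> : c * k.+1%:R ^+ s * normc w * (k.+1%:R * (2 * k.+1%:R)) =
    2 * (c * (k.+1%:R ^+ s * k.+1%:R ^+ 2 * normc w)).
  by move: k.+1%:R (k.+1%:R ^+ s) => x y; ring.
by rewrite ler_wpM2l // ler_wpM2l.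
Qed.

(** * The wave trace as a power series on the unit circle *)

Section WaveTrace.
Context {R : realType} {n q : nat} (p : 'I_n.+1 -> int).
Hypothesis q2 : (2 < q)%N.
Hypothesis p1 : p ord0 = 1.
Hypothesis pq : forall i, coprimez (p i) q%:Z.
Variable lam : nat -> R.
Hypothesis hlam : is_spectrum q p lam.
Local Notation C := R[i].
Local Notation d := (fun k => (@lens_mult R n q p k)%:R : C).
Local Notation nuk := (@nuk R n).
Local Notation delk := (@delk R n).
Local Notation zz t := (expi (- t)).

Definition phase (t : R) (k : nat) : C := d k * expi (delk k * t).

(** From [nuk k = k + n - delk k]: the constant [n] is moved into the test function, and the rest is
    a power of [exp (- i t)] with the slowly varying coefficient [phase t k]. *)
Lemma phase_shift t k (y : C) :
  d k * (expi (- (t * nuk k)) * (expi (n%:R * t) * y)) = phase t k * zz t ^+ k * y.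
Proof.
rewrite /phase -!mulrA; congr (_ * _); rewrite !mulrA -expiD; congr (_ * _).
rewrite expiX -expiD; congr expi; rewrite /delk /muk natrD mulrN; move: (nuk k) => v; ring.
Qed.

Lemma csm_phase : csmseq phase.
Proof. by move=> k; apply: csmM; [exact: csm_cst|exact: csm_expi]. Qed.

Lemma mult_growth : exists s c, 0 <= c /\ forall k, normc (d k) <= c * k.+1%:R ^+ s.
Proof.
have [L [Lun dQP _]] := @lens_QP R n q p q2 p1 pq.
have [c c0 hc] := bnd_ge0 (QP_growth setT Lun dQP).
exists (size L), c; split => // k.
have := hc 0 k I; rewrite (_ : _ - 1 = (size L)%:Z) //= -addn1 PoszD addrK //.
Qed.

Variables a b : R.
Hypothesis ab : a <= b.

Lemma twisted_decay psi : ctest a b psi -> exists2 M : R, 0 <= M &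
  forall k, normc (cI a b (fun t => phase t k * zz t ^+ k * psi t)) <= M / (k.+1%:R * k.+2%:R).
Proof.
move=> tp; have [s [c [c0 hc]]] := mult_growth.
have te := ctestM (csm_expi n%:R) tp.
have [M M0 hM] := mult_decay (n := n) ab c0 hc te; exists M => // k.
have := hM k; rewrite -cIZ; last by apply: ctest_cont; apply: ctestM te; 
  apply: eq_csm (csm_expi (- nuk k)) => t; rewrite mulNr mulrC.
by congr (normc _ <= _); apply: eq_cI => t; exact: phase_shift.
Qed.

Lemma phase_fast : fast a b phase.
Proof.
move=> psi tp; have [M M0 hM] := twisted_decay tp.
apply: (@cnv_inv _ M) => k; rewrite subr0 (le_trans (hM k)) // ler_wpM2l //.
rewrite lef_pV2 ?posrE ?mulr_gt0 ?ltr0n // ler_peMr // ler1n //.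
Qed.

Lemma wave_trace_limit psi : ctest a b psi ->
  cnv (SK a b phase psi) (wave_trace lam (fun t => expi (n%:R * t) * psi t)).
Proof.
move=> tp; have [M M0 hM] := twisted_decay tp.
have te := ctestM (csm_expi n%:R) tp.
have tn k : ctest a b (fun t => expi (- (t * nuk k)) * (expi (n%:R * t) * psi t)).
  by apply: ctestM te; apply: eq_csm (csm_expi (- nuk k)) => t; rewrite mulNr mulrC.
pose g k := cI a b (fun t => expi (- (t * nuk k)) * (expi (n%:R * t) * psi t)).
have gE k : d k * g k = cI a b (fun t => phase t k * zz t ^+ k * psi t).
  rewrite /g -cIZ; last exact: ctest_cont (tn k).
  by apply: eq_cI => t; exact: phase_shift.
have hg k : normc (d k * g k) <= M / (k.+1%:R * k.+2%:R) by rewrite gE.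
have [l hl] := series_cnv M0 hg.
have SE : SK a b phase psi =1 fun K => \sum_(k < K) d k * g k.
  move=> K; under eq_bigr do rewrite gE.
  rewrite -(@cI_sum R a b (fun k t => phase t k * zz t ^+ k * psi t)).
    by apply: eq_cI => t; rewrite /psum mulr_suml.
  move=> k; apply: csmM; last exact: tp.1.
  by apply: csmM; [exact: csm_phase|apply: csmX; exact: csm_z].
have -> : wave_trace lam (fun t => expi (n%:R * t) * psi t) = l.
  have [kappa [kE cle ceq]] := spectrum_enum hlam.
  have := rearrangement cle ceq M0 hg hl => /cnv_climit <-.
  rewrite /wave_trace; congr climit; apply/funext => N; apply: eq_bigr => j _.
  rewrite kE (@cintegral_cI _ a b) //.
  by move=> x xo; rewrite tp.2 // !mulr0.
by apply: cnv_eq hl => K; rewrite SE.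
Qed.
End WaveTrace.

Theorem wave_trace_singular (R : realType) (n q : nat) (p : 'I_n.+1 -> int) (lam : nat -> R) :
  (2 < q)%N -> p ord0 = 1 -> (forall i, coprimez (p i) q%:Z) -> is_spectrum q p lam ->
  singular_support (wave_trace lam) (2 * trigo.pi / q%:R).
Proof.
move=> q2 p1 pq hlam [U [f [oU Ut0 sf uE]]].
set t0 := 2 * trigo.pi / q%:R in Ut0.
have [L [Lun dQP [v v0 [B hB]]]] := @lens_QP R n q p q2 p1 pq.
set La := om q 1 :: L in Lun dQP hB.
have t00 : 0 <= t0 by rewrite divr_ge0 // mulr_ge0 // pi_ge0.
(* Uniform bounds are taken for [|t| <= t0 + 1]; the neighbourhood of [t0] chosen below has radius
   less than [1]. *)
have [hb [c' hc']] := @ops_phase R n (t0 + 1) _ _ _ Lun dQP.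
have [c c0 hc] := bnd_ge0 hb.
pose x := @phase R n q p; pose F t K := psum (ops La (x t)) (expi (- t)) K.
have z0 : expi (- t0) = om q (-1) by rewrite /om /t0 mulrN1 mulNr.
have zetaz : om q 1 * expi (- t0) = 1 by rewrite z0; exact: omNM.
(* Three errors of size [dl] leave a real part of at least [1 - 3 / 8] after division by [v], which
   exceeds one half. *)
pose dl := normc v / 8.
have nv : 0 < normc v.
  by rewrite lt_neqAle normc_ge0 andbT eq_sym; apply: contraNneq v0 => /eq0_normc ->.
have dl0 : 0 < dl by rewrite divr_gt0.
have nz1 (t : R) : normc (expi t) = 1 by rewrite /= cos2Dsin2 sqrtr1.
have tail t K j : `|t| <= t0 + 1 -> normc (F t (K + j)%N - F t K) <= (2 * c) / K.+1%:R.
  move=> tT; have -> : F t (K + j)%N - F t K = \sum_(K <= k < K + j) ops La (x t) k * expi (- t) ^+ k.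
    rewrite /F /psum -!(big_mkord xpredT (fun k => ops La (x t) k * expi (- t) ^+ k)).
    by rewrite (big_cat_nat (leq0n K) (leq_addr j K)) /= addrAC subrr add0r.
  apply: (le_trans (normc_sum _ _ _)); apply: (le_trans (telescope_tail (M := 2 * c) _ K j)).
    move=> k; rewrite normcM normcX nz1 expr1n mulr1 (le_trans (hc t k tT)) //.
    have -> : k.+1%:R ^ (-2) = (k.+1%:R ^+ 2)^-1 :> R by [].
    rewrite -mulrA mulrCA ler_wpM2l // ler_pdivlMr ?mulr_gt0 ?ltr0n // mulrC ler_pdivrMr ?exprn_gt0 ?ltr0n //.
    by rewrite expr2 -!natrM ler_nat; lia.
  by rewrite gerBl divr_ge0 // mulr_ge0.
have [K1 hK1] := inv_small (2 * c) dl0; have [K2 hK2] := inv_small c' dl0.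
(* A successor, because [ops_phase] speaks of partial sums of length [K.+1]. *)
pose K0 := (maxn K1 (maxn K2 B)).+1.
have Ft0 : normc (F t0 K0 - v) <= dl.
  have t0T : `|t0| <= t0 + 1 by rewrite ger0_norm // lerDl.
  have vE : psum (ops La (fun k => (@lens_mult R n q p k)%:R)) (expi (- t0)) K0 = v.
    by rewrite z0 hB // ltnW // ltnS !leq_max leqnn !orbT.
  have := hc' t0 K0.-1 _ t0T zetaz; rewrite vE => h; apply: (le_trans h).
  by apply: hK2; rewrite !leq_max leqnn orbT.
have Ftail t K : `|t| <= t0 + 1 -> (K0 <= K)%N -> normc (F t K - F t K0) <= dl.
  move=> tT KK; rewrite -(subnKC KK) (le_trans (tail t K0 _ tT)) // hK1 //.
  by rewrite ltnW // ltnS leq_max leqnn.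
(* [e] is the limit that the sums [F] would have if the wave trace were given by [f]. It vanishes at
   [t0] because [DL La] contains the factor of [zeta], whereas [F t0 K0] is close to [v]. *)
pose e t := f t * (expi (n%:R * t) * DL La t); pose H t := F t K0 - e t.
have sx : csmseq x by exact: csm_phase.
have cH : ccontinuous_at H t0.
  have cF : ccontinuous_at (fun t => F t K0) t0 by apply: csm_cont; apply: csm_psum; exact: csm_ops.
  have ce : ccontinuous_at e t0.
    apply: ccontinuousM; first exact: csmooth_ccont sf Ut0.
    apply: csm_cont; apply: csmM; [exact: csm_expi|exact: csm_DL].
  have := ccontinuousD cF (ccontinuousM (ccontinuous_cst t0 (-1)) ce).
  by congr ccontinuous_at; apply/funext => t; rewrite mulN1r.
have H0 : H t0 = F t0 K0 by rewrite /H /e /DL big_cons zetaz subrr mul0r !mulr0 subr0.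
have [r1 r10 hr1] := ccontinuous_ball cH dl0.
have [r2 /= r20 hr2] : nbhs t0 U by exact: open_nbhs_nbhs.
pose r := Num.min r1 (Num.min r2 1) / 4.
have r0 : 0 < r by rewrite divr_gt0 // !lt_min r10 r20 ltr01.
have [rr1 rr2 rr3] : [/\ r *+ 4 <= r1, r *+ 4 <= r2 & r *+ 4 <= 1].
  have -> : r *+ 4 = Num.min r1 (Num.min r2 1) by rewrite /r -mulr_natr divfK.
  by rewrite !ge_min !lexx !orbT.
pose a := t0 - r *+ 2; pose b := t0 + r *+ 2.
have ab : a <= b by rewrite /a /b mulr2n; lra.
pose psi t : R[i] := (bump a b t)%:C.
have tp : ctest a b psi.
  split; first by split; [exact: rsmooth_bump|exact: rsmooth_cst].
  move=> t h; rewrite /psi bump_out //.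
  by case/orP: h => /ltW ->; rewrite ?orbT.
have abU : `[a, b] `<=` U.
  move=> t; rewrite /= in_itv /= => /andP[h1 h2]; apply: hr2; rewrite /ball_ /=.
  by rewrite ltr_norml /a /b in h1 h2 *; apply/andP; split; move: rr2 h1 h2; rewrite !mulr2n mulrS !mulrSr mulr0n; lra.
have near_t t K : a <= t -> t <= b -> (K0 <= K)%N -> normc (F t K - e t - v) <= 3 * dl.
  move=> h1 h2 KK.
  have ht : `|t - t0| < r1.
    by rewrite ltr_norml; apply/andP; split; move: rr1 h1 h2; rewrite /a /b !mulr2n !mulrSr mulr0n; lra.
  have hT : `|t| <= t0 + 1.
    by rewrite ler_norml; apply/andP; split; move: rr3 h1 h2; rewrite /a /b !mulr2n !mulrSr mulr0n; lra.
  have -> : F t K - e t - v = (F t K - F t K0) + ((H t - H t0) + (F t0 K0 - v)).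
    rewrite H0 /H; move: (F t K) (F t K0) (F t0 K0) (e t) => *; ring.
  have := hr1 t ht; have := Ftail t K hT KK; have := Ft0.
  have := le_normcD (F t K - F t K0) ((H t - H t0) + (F t0 K0 - v)).
  have := le_normcD (H t - H t0) (F t0 K0 - v).
  by move: (normc _) (normc _) (normc _) (normc _) (normc _) => *; lra.
pose phi t := DL La t * psi t.
have tphi : ctest a b phi by exact: ctestM (csm_DL La) tp.
have tephi : ctest a b (fun t => expi (n%:R * t) * phi t) by exact: ctestM (csm_expi _) tphi.
have lim1 : cnv (SK a b x phi) (cI a b (fun t => f t * (expi (n%:R * t) * phi t))).
  have := wave_trace_limit q2 p1 pq hlam ab tphi; congr cnv.
  rewrite uE; last exact: ctest_test abU tephi.
  apply: cintegral_cI => t to; by rewrite tephi.2 ?mulr0.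
have lim2 := SK_ops La sx (phase_fast q2 p1 pq ab) tp.
(* Integrated, [G K] tends to [0] by [lim1] and [lim2]; pointwise on [[a, b]] it stays near the bump
   by [near_t]. The division by [v] turns this conflict into one between real parts. *)
pose G K t := v^-1 * (F t K * psi t - f t * (expi (n%:R * t) * phi t)).
have cf : ccont (fun t => f t * (expi (n%:R * t) * phi t)) by exact: ccont_cut sf abU tephi.
have cFp K : ccont (fun t => F t K * psi t).
  apply: ctest_cont; apply: ctestM tp; apply: csm_psum; exact: csm_ops.
have cD K : ccont (fun t => F t K * psi t - f t * (expi (n%:R * t) * phi t)).
  have cm := ccontM (fun y => ccontinuous_cst y (-1)) cf.
  move=> y; have := ccontinuousD (cFp K y) (cm y).
  by congr ccontinuous_at; apply/funext => t; rewrite mulN1r.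
have lim3 : cnv (fun K => cI a b (G (K + size La)%N)) 0.
  have := cnvZ v^-1 (cnvB (cnvD lim2 lim1) (cnv_cst (cI a b (fun t => f t * (expi (n%:R * t) * phi t))))).
  rewrite add0r subrr mulr0; apply: cnv_eq => K.
  by rewrite subrK (cIZ a b _ (cD _)) (cIB a b (cFp _) cf).
have bump_pos : 0 < Iab a b (bump a b).
  apply: (@Iab_gt0 _ a b _ (expR (- r^-1) ^+ 2) t0 r) => //.
  - exact: rsmooth_continuous (@rsmooth_bump _ a b).
  - exact: bump_ge0.
  - by rewrite exprn_gt0 // expR_gt0.
  - by rewrite /a mulr2n; lra.
  - by rewrite /b mulr2n; lra.
  - by move=> t; exact: bump_lower.
have low K : (K0 <= K)%N -> 2^-1 * Iab a b (bump a b) <= Re (cI a b (G K)).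
  move=> KK; rewrite -IabZ; last exact: rsmooth_continuous (@rsmooth_bump _ a b).
  apply: le_Iab.
  - exact: continuousZl (rsmooth_continuous (@rsmooth_bump _ a b)).
  - move=> y; exact: (ccontM (fun y => ccontinuous_cst y v^-1) (cD K) y).1.
  move=> t; have -> : G K t = v^-1 * (F t K - e t) * psi t.
    rewrite /G /phi /e -mulrA; congr (_ * _); rewrite mulrBl; congr (_ - _).
    by rewrite -!mulrA.
  rewrite mulrC /psi ReM /= mulr0 subr0 mulrC.
  have [to|] := boolP ((t < a) || (b < t)).
    by rewrite bump_out ?mulr0 //; case/orP: to => /ltW ->; rewrite ?orbT.
  rewrite negb_or -!leNgt => /andP[h1 h2]; rewrite ler_wpM2r ?bump_ge0 //.
  have := near_t t K h1 h2 KK; set w := F t K - e t => hw.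
  have key (A : fieldType) (y z : A) : y != 0 -> y^-1 * z = 1 + y^-1 * (z - y) by move=> y0; field.
  have -> : v^-1 * w = 1 + v^-1 * (w - v) by exact: key.
  have : normc (v^-1 * (w - v)) <= 3 / 8.
    rewrite normcM; have -> : normc v^-1 = (normc v)^-1.
      apply: (mulfI (lt0r_neq0 nv)); rewrite -normcM (mulfV v0) normc1 mulfV // gt_eqF //.
    by rewrite mulrC ler_pdivrMr // (le_trans hw) // /dl mulrCA mulrC.
  move=> /(le_trans (Re_le_normc _)); rewrite ler_norml ReD /= => /andP[h3 _]; lra.
have : 2^-1 * Iab a b (bump a b) <= Re (0 : R[i]).
  apply: cnv_Re (cnv_addn K0 lim3) _ => k; apply: low.
  exact: leq_trans (leq_addl k K0) (leq_addr _ _).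
by rewrite /= leNgt mulr_gt0.
Qed.

(** * Geodesics *)

Lemma is_derive_bigsum {R : realType} (I : Type) (r : seq I) (F : I -> R -> R) (dF : I -> R) (x : R) :
  (forall i, is_derive x (1 : R) (F i) (dF i)) ->
  is_derive x (1 : R) (fun y => \sum_(i <- r) F i y) (\sum_(i <- r) dF i).
Proof.
move=> h; elim: r => [|i r IH].
  rewrite big_nil (_ : (fun y => _) = cst 0); first exact: is_derive_cst.
  by apply/funext => y; rewrite big_nil.
rewrite big_cons (_ : (fun y => _) = F i \+ (fun y => \sum_(i <- r) F i y)); first exact: is_deriveD.
by apply/funext => y; rewrite big_cons.
Qed.

Section Geodesics.
Context {R : realType} {n : nat}.
Local Notation K := n.+1.
Local Notation N := (\sum_(i < n.+1) 2)%N.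
Local Notation vec := 'cV[R]_N.
Local Notation C := R[i].
Implicit Types (x : vec).

Definition dot x (y : vec) : R := \sum_j x j 0 * y j 0.

Lemma dot_sqnorm x : dot x x = sqnorm x.
Proof. by apply: eq_bigr => j _; rewrite expr2. Qed.

Lemma trmx_mulE x (y : vec) : x^T *m y = (dot x y)%:M.
Proof.
apply/matrixP => i j; rewrite !ord1 !mxE eqxx mulr1n; apply: eq_bigr => k _; by rewrite mxE.
Qed.

Lemma tangent_projE (s : sphere R n) (y : vec) : tangent_proj s *m y = y - dot (val s) y *: val s.
Proof. by rewrite /tangent_proj mulmxBl mul1mx -mulmxA trmx_mulE mul_mx_scalar. Qed.

Lemma dot_zc x (y : vec) : dot x y = \sum_i Re (zc x i * (zc y i)^*%C).
Proof.
rewrite /dot (sum_coords (fun j => x j 0 * y j 0)); apply: eq_bigr => i _.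
by rewrite /zc ReM /= mulrN opprK.
Qed.

(** Differentiating [|g| ^ 2 = 1] twice gives the normal part of the acceleration, so [g'' = - g],
    and the inner product with the starting point satisfies [h'' = - h] with [h 0 = 1] and
    [h' 0 = 0]. *)
Lemma geodesic_dot (gamma : R -> sphere R n) : sphere_geodesic gamma ->
  forall t, dot (val (gamma 0)) (val (gamma t)) = cos t.
Proof.
move=> geo; pose g t : vec := val (gamma t).
have d1 t j : is_derive t (1 : R) (fun t => g t j 0) (derive1 g t j 0).
  have [/derivable_mxP h _ _ _] := geo t; apply: DeriveDef; first exact: h.
  have [dg _ _ _] := geo t; by rewrite derive1E derive_mx // mxE.
have d2 t j : is_derive t (1 : R) (fun t => derive1 g t j 0) (derive1n 2 g t j 0).
  have [_ dg _ _] := geo t; have /derivable_mxP h := dg; apply: DeriveDef; first exact: h.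
  by rewrite derive1nS /= derive1E derive_mx // mxE.
have gg t : dot (g t) (g t) = 1 by rewrite dot_sqnorm; exact: sphereP.
have gg' t : dot (g t) (derive1 g t) = 0.
  have h : is_derive t (1 : R) (fun t => dot (g t) (g t)) (\sum_j (g t j 0 * derive1 g t j 0 + derive1 g t j 0 * g t j 0)).
    by apply: is_derive_bigsum => j; exact: is_deriveM_mul (d1 t j) (d1 t j).
  have := derive1_val h; rewrite (_ : (fun t => dot (g t) (g t)) = cst 1); last by apply/funext.
  rewrite derive1E derive_cst big_split /= => e.
  have : dot (g t) (derive1 g t) *+ 2 = 0.
    by rewrite mulr2n [RHS]e; congr (_ + _); apply: eq_bigr => j _; rewrite mulrC.
  by move/eqP; rewrite mulrn_eq0 /= => /eqP.
have gg2 t : dot (g t) (derive1n 2 g t) = -1.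
  have h : is_derive t (1 : R) (fun t => dot (g t) (derive1 g t))
      (\sum_j (g t j 0 * derive1n 2 g t j 0 + derive1 g t j 0 * derive1 g t j 0)).
    by apply: is_derive_bigsum => j; exact: is_deriveM_mul (d1 t j) (d2 t j).
  have := derive1_val h; rewrite (_ : (fun t => dot (g t) (derive1 g t)) = cst 0); last by apply/funext.
  rewrite derive1E derive_cst big_split /= => e.
  have [_ _ g1 _] := geo t; rewrite -dot_sqnorm in g1.
  by apply/eqP; rewrite -addr_eq0 -g1 eq_sym; apply/eqP.
have acc t j : derive1n 2 g t j 0 = - g t j 0.
  have [_ _ _] := geo t; rewrite tangent_projE -/(g t) gg2 scaleN1r opprK.
  by move/(congr1 (fun v : vec => v j 0)); rewrite !mxE => /eqP; rewrite addr_eq0 => /eqP.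
pose x := val (gamma 0); pose h t := dot x (g t); pose h' t := dot x (derive1 g t).
have dh t : is_derive t (1 : R) h (h' t).
  apply: is_derive_bigsum => j; exact: is_derive_mull (d1 t j).
have dh' t : is_derive t (1 : R) h' (- h t).
  have := is_derive_bigsum (index_enum _) (fun j => is_derive_mull (x j 0) (d2 t j)).
  congr is_derive; rewrite /h /dot -sumrN; apply: eq_bigr => j _; by rewrite acc mulrN.
(* [c1] and [c2] are the two first integrals of [h'' = - h]; solving them for [h] gives the
   cosine. *)
have c1 t : is_derive t (1 : R) (fun t => h t * cos t + (- 1) * (h' t * sin t)) 0.
  have := is_deriveD (is_deriveM_mul (dh t) (is_derive_cos t))
    (is_derive_mull (-1) (is_deriveM_mul (dh' t) (is_derive_sin t))).
  move=> hh; apply: (is_derive_eq hh); move: (h t) (h' t) (cos t) (sin t) => *; ring.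
have c2 t : is_derive t (1 : R) (fun t => h t * sin t + h' t * cos t) 0.
  have := is_deriveD (is_deriveM_mul (dh t) (is_derive_sin t)) (is_deriveM_mul (dh' t) (is_derive_cos t)).
  move=> hh; apply: (is_derive_eq hh); move: (h t) (h' t) (cos t) (sin t) => *; ring.
move=> t; have e1 := is_derive_0_is_cst t 0 c1; have e2 := is_derive_0_is_cst t 0 c2.
have h0 : h 0 = 1 by exact: gg.
have h'0 : h' 0 = 0 by exact: gg'.
move: e1 e2; rewrite cos0 sin0 h0 h'0 !(mulr0, mulr1, addr0, mul0r) => e1 e2.
rewrite -/(h t) -[LHS]mulr1 -(cos2Dsin2 t).
move: e1 e2; move: (h t) (h' t) (cos t) (sin t) => u w c s e1 e2.
transitivity (c * (u * c + -1 * (w * s)) + s * (u * s + w * c)); first by ring.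
by rewrite e1 e2; ring.
Qed.

Definition sqdist (y z : sphere R n) : R := sqnorm (val y - val z).

Implicit Types (y z w : sphere R n).

Lemma sqdistE y z : sqdist y z = 2 - 2 * dot (val y) (val z).
Proof.
rewrite /sqdist; have sy := sphereP y; have sz := sphereP z.
transitivity (sqnorm (val y) + sqnorm (val z) - 2 * dot (val y) (val z)); last by rewrite sy sz; ring.
rewrite /sqnorm /dot mulr_sumr -big_split -sumrB; apply: eq_bigr => j _; rewrite !mxE /=.
by move: (val y j 0) (val z j 0) => a b; ring.
Qed.

(** Squared chords are polynomial in the coordinates; the factor [2] is the price for avoiding
    square roots, and it determines [eps] below. *)
Lemma sqdist_triangle y z w : sqdist y w <= 2 * sqdist y z + 2 * sqdist z w.
Proof.
rewrite /sqdist /sqnorm !mulr_sumr -big_split; apply: ler_sum => j _; rewrite !mxE /=.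
move: (val y j 0) (val z j 0) (val w j 0) => a b c.
have := sqr_ge0 ((a - b) - (b - c)); nra.
Qed.

Lemma sqdistC y z : sqdist y z = sqdist z y.
Proof. by rewrite !sqdistE; congr (2 - 2 * _); apply: eq_bigr => j _; rewrite mulrC. Qed.

Lemma sqdist0 y : sqdist y y = 0.
Proof. by rewrite /sqdist subrr /sqnorm big1 // => j _; rewrite mxE expr0n. Qed.

Lemma zc_inj x (x' : vec) : (forall i, zc x i = zc x' i) -> x = x'.
Proof.
move=> h; apply/matrixP => j c; rewrite (ord1 c).
by apply: (@coordsP n (fun j => x j 0 = x' j 0)) => i; have [] := h i.
Qed.

End Geodesics.

(** * Displacement of deck transformations *)

Section DeckTransformations.
Context {R : realType} {n q : nat} (p : 'I_n.+1 -> int).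
Hypothesis q2 : (2 < q)%N.
Hypothesis p1 : p ord0 = 1.
Hypothesis pq : forall i, coprimez (p i) q%:Z.
Local Notation K := n.+1.
Local Notation N := (\sum_(i < n.+1) 2)%N.
Local Notation vec := 'cV[R]_N.
Local Notation C := R[i].
Local Notation om := (@om R q).
Local Notation proj := (@lens_proj R n q p).
Local Notation act := (@lens_act R n q p).
Local Notation ell := (2 * trigo.pi / q%:R : R).
Local Notation ix i := (tagnat.Rank i (ord0 : 'I_2) : 'I_N).
Local Notation iy i := (tagnat.Rank i (ord_max : 'I_2) : 'I_N).
Implicit Types (y z : sphere R n).

Lemma val_act k y : val (act k y) = lens_generator R q p ^+ k *m val y. Proof. by []. Qed.

Lemma actD j k y : act j (act k y) = act (j + k) y.
Proof. by apply: val_inj; rewrite /= mulTX. Qed.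

Lemma sqdist_act k y z : sqdist (act k y) (act k z) = sqdist y z.
Proof. by rewrite /sqdist /= -mulmxBr sqnorm_gen. Qed.

Lemma expi_langle k i : expi (k%:R * @langle R n q p i) = om (k%:Z * p i).
Proof. by rewrite /om intrM -pmulrn /langle; congr expi; field; rewrite pnatr_eq0 -lt0n (leq_trans _ q2). Qed.

Lemma dot_act k y : dot (val y) (val (act k y)) = \sum_i Re (zc (val y) i * (zc (val y) i)^*%C) * Re (om (k%:Z * p i)).
Proof.
rewrite dot_zc val_act; apply: eq_bigr => i _; rewrite zc_gen expi_langle.
by move: (om _) (zc _ _) => [a b] [u v] /=; ring.
Qed.

Lemma sum_zc y : \sum_i Re (zc (val y) i * (zc (val y) i)^*%C) = 1.
Proof. by rewrite -dot_zc dot_sqnorm; exact: sphereP. Qed.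

Lemma Re_om1 : Re (om 1) = cos ell.
Proof. by rewrite /om /= mulr1. Qed.

Lemma not_dvd_mul (k : nat) i : ~~ (q %| k)%N -> ~~ (q%:Z %| k%:Z * p i)%Z.
Proof.
move=> nk; rewrite dvdzE abszM /= Gauss_dvdl // coprime_sym.
by have := pq i; rewrite /coprimez /coprime /gcdz /= eqz_nat.
Qed.

(** The left side is a convex combination, with weights [|z_i| ^ 2], of the cosines of
    [2 pi k p_i / q], and [q] divides none of the [k p_i]. *)
Lemma dot_act_le k y : ~~ (q %| k)%N -> dot (val y) (val (act k y)) <= cos ell.
Proof.
move=> nk; rewrite dot_act -Re_om1.
apply: (@le_trans _ _ (\sum_i Re (zc (val y) i * (zc (val y) i)^*%C) * Re (om 1))); last first.
  by rewrite -mulr_suml sum_zc mul1r.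
apply: ler_sum => i _.
apply: ler_wpM2l; first by case: (zc _ _) => a b /=; rewrite mulrN opprK -!expr2 addr_ge0 ?sqr_ge0.
have n0 := not_dvd_mul i nk; set a := _ * _ in n0 *.
have [h|n1] := boolP (q%:Z %| a - 1)%Z.
  by move: h; rewrite -(om_eq (R := R) q2) => /eqP ->.
have [h|n2] := boolP (q%:Z %| a + 1)%Z.
  have : om a == om (-1) by rewrite (om_eq q2) opprK.
  by move/eqP ->; rewrite Re_omN.
exact: ltW (om_Re_lt q2 n0 n1 n2).
Qed.

Lemma act_dvd k y : (q %| k)%N -> act k y = y.
Proof.
move=> /dvdnP[j ->]; apply: val_inj.
apply: zc_inj => i; by rewrite val_act zc_gen expi_langle PoszM mulrAC (omMq q2) mul1r.
Qed.

Lemma cos_ell_lt1 : cos ell < 1.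
Proof. by rewrite -Re_om1; apply: (om_Re_lt1 q2); rewrite dvdzE /= gtnNdvd // ltnW. Qed.

(** Deck transformations are recorded by powers of [zeta], which identify exponents modulo [q]. A
    nontrivial one moves every point by a squared chord of at least [2 (1 - cos ell)]. *)
Lemma close_acts a b y : sqdist (act a y) (act b y) < 2 * (1 - cos ell) -> om 1 ^+ a = om 1 ^+ b.
Proof.
have wl (c d : nat) : (c <= d)%N -> sqdist (act c y) (act d y) < 2 * (1 - cos ell) -> om 1 ^+ c = om 1 ^+ d.
  move=> cd; rewrite -(subnKC cd) -actD sqdist_act sqdistE => h.
  have [/dvdnP[m ->]|nd] := boolP (q %| d - c)%N; last by exfalso; have := dot_act_le y nd; lra.
  by rewrite exprD (omX q 1 (m * q)) mulr1 PoszM (omMq q2) mulr1.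
by case: (leqP a b) => [|/ltnW] ab; [exact: wl|rewrite sqdistC => /(wl _ _ ab) ->].
Qed.

Lemma ell_gt0 : 0 < ell.
Proof. by rewrite divr_gt0 ?mulr_gt0 ?pi_gt0 // ltr0n (leq_trans _ q2). Qed.

Lemma ell_le_pi : ell <= trigo.pi.
Proof.
rewrite ler_pdivrMr ?ltr0n ?(leq_trans _ q2) // mulrC ler_wpM2l ?pi_ge0 // ler_nat; exact: ltnW.
Qed.

(** For [l < ell <= pi] the ends of the lift have inner product [cos l], strictly between [cos ell]
    and [1]. A trivial deck transformation would make it [1], any other at most [cos ell]. *)
Lemma closed_geodesic_ge (c : R -> lens_space R q p) l : closed_geodesic c l -> ell <= l.
Proof.
move=> [l0 [gamma geo ec] per]; rewrite leNgt; apply/negP => ll.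
have e : proj (gamma 0) = proj (gamma l) by have := per 0; rewrite ec add0r.
have [k ek] := proj_eqP e; have := geodesic_dot geo l; rewrite ek => cl.
have lpi : l <= trigo.pi by rewrite (le_trans (ltW ll)) // ell_le_pi.
have pin0 : (0 : R) \in `[0, trigo.pi] by rewrite in_itv /= lexx pi_ge0.
have pinl : l \in `[0, trigo.pi] by rewrite in_itv /= (ltW l0).
have pine : ell \in `[0, trigo.pi] by rewrite in_itv /= (ltW ell_gt0) ell_le_pi.
have h1 : cos ell < cos l by rewrite ltr_cos.
have h2 : cos l < 1 by rewrite -(cos0 R) ltr_cos.
have [kq|kq] := boolP (q %| k)%N.
  by move: cl; rewrite (act_dvd _ kq) dot_sqnorm (sphereP (gamma 0)) => cl; rewrite -cl ltxx in h2.
by have := dot_act_le (gamma 0) kq; rewrite cl leNgt h1.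
Qed.

(** It lies in plane [0], where [p ord0 = 1] makes the generator the rotation by [ell]. *)
Definition circle (t : R) : vec :=
  \col_j (cos t * (j == ix (ord0 : 'I_K))%:R + sin t * (j == iy (ord0 : 'I_K))%:R).

Lemma zc_circle t i : zc (circle t) i = if i == ord0 then expi t else 0.
Proof.
rewrite /zc !mxE eq_ix eq_ixy eq_iyx eq_iy; case: eqP => _; rewrite !(mulr1, mulr0, addr0, add0r) //.
Qed.

Lemma sqnorm_circle t : sqnorm (circle t) = 1.
Proof.
apply: (@complexI R); rewrite sqnorm_zc [LHS](bigD1 ord0) //= [X in _ + X]big1 ?addr0.
  by rewrite zc_circle eqxx expi_norm.
by move=> i i0; rewrite zc_circle (negPf i0) mul0r.
Qed.

Lemma circle_subproof t : circle t \in [set x : vec | sqnorm x = 1].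
Proof. by rewrite inE /= sqnorm_circle. Qed.

Definition great_circle t : sphere R n := Sub (circle t) (circle_subproof t).

Lemma is_derive_circle t j : is_derive t (1 : R) (fun t => circle t j 0) (circle (t + trigo.pi / 2) j 0).
Proof.
have -> : (fun t => circle t j 0) = fun t => (j == ix (ord0 : 'I_K))%:R * cos t + (j == iy (ord0 : 'I_K))%:R * sin t.
  by apply/funext => s; rewrite mxE ![_ * _%:R]mulrC.
have h := is_deriveD (is_derive_mull (j == ix (ord0 : 'I_K))%:R (is_derive_cos t)) (is_derive_mull (j == iy (ord0 : 'I_K))%:R (is_derive_sin t)).
by apply: (is_derive_eq h); rewrite mxE cosDpihalf sinDpihalf ![_ * _%:R]mulrC.
Qed.

Lemma is_derive_circle_shift (c t : R) j :
  is_derive t (1 : R) (fun t => circle (t + c) j 0) (circle (t + c + trigo.pi / 2) j 0).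
Proof.
have := is_derive_affine (s := 1) (c := c) (x := t) (is_derive_circle (1 * t + c) j).
by rewrite !mul1r; congr is_derive; apply/funext => s; rewrite mul1r.
Qed.

Lemma derivable_circle (c t : R) : derivable (fun t => circle (t + c)) t (1 : R).
Proof. by apply/derivable_mxP => j i; rewrite (ord1 i); have [] := is_derive_circle_shift c t j. Qed.

Lemma derive1_circle (c : R) : derive1 (fun t => circle (t + c)) = fun t => circle (t + c + trigo.pi / 2).
Proof.
apply/funext => t; rewrite derive1E derive_mx; last exact: derivable_circle.
by apply/matrixP => j i; rewrite (ord1 i) mxE; have [_ ->] := is_derive_circle_shift c t j.
Qed.

Lemma geodesic_circle : sphere_geodesic great_circle.
Proof.
have e0 : (fun t => val (great_circle t)) = fun t => circle (t + 0) by apply/funext => t; rewrite addr0.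
move=> t; rewrite e0 derive1nS /= !derive1_circle.
have e1 : (fun t => circle (t + 0 + trigo.pi / 2)) = fun t => circle (t + trigo.pi / 2).
  by apply/funext => s; rewrite addr0.
rewrite e1 derive1_circle; split; [exact: derivable_circle|exact: derivable_circle|exact: sqnorm_circle|].
have -> : circle (t + trigo.pi / 2 + trigo.pi / 2) = - circle t.
  by apply/matrixP => j i; rewrite !mxE !cosDpihalf !sinDpihalf cosDpihalf !mulNr opprD.
rewrite mulmxN (tangent_projE (great_circle t) (val (great_circle t))) dot_sqnorm.
by rewrite (sphereP (great_circle t)) scale1r subrr oppr0.
Qed.

Lemma act1_circle t : act 1 (great_circle t) = great_circle (t + ell).
Proof.
apply: val_inj; rewrite val_act; apply: zc_inj => i; rewrite zc_gen expi_langle mul1r.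
rewrite [in RHS]zc_circle zc_circle; case: eqP => [->|_]; last by rewrite mulr0.
by rewrite p1 /om mulr1 -expiD addrC.
Qed.

Lemma closed_circle : closed_geodesic (proj \o great_circle) ell.
Proof.
split; first exact: ell_gt0.
  by exists great_circle; first exact: geodesic_circle.
by move=> t /=; rewrite -act1_circle proj_act.
Qed.

End DeckTransformations.

(** * Homotopy *)

Section Noncontractible.
Context {R : realType} {n q : nat} (p : 'I_n.+1 -> int).
Hypothesis q2 : (2 < q)%N.
Hypothesis p1 : p ord0 = 1.
Hypothesis pq : forall i, coprimez (p i) q%:Z.
Local Notation N := (\sum_(i < n.+1) 2)%N.
Local Notation vec := 'cV[R]_N.
Local Notation om := (@om R q).
Local Notation lens := (lens_space R q p).
Local Notation proj := (@lens_proj R n q p).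
Local Notation act := (@lens_act R n q p).
Local Notation ell := (2 * trigo.pi / q%:R : R).
Local Notation zeta := (om 1).
Implicit Types (y z : sphere R n) (u v w : lens).

(** The separation in [close_acts] is [10 * eps]: comparing a product of two transitions with the
    direct one uses [sqdist_triangle] twice, at a cost below [2 eps + 2 (2 eps + 2 eps)]. *)
Definition eps : R := (1 - cos ell) / 5.

Lemma eps_gt0 : 0 < eps.
Proof. by rewrite divr_gt0 // subr_gt0 (cos_ell_lt1 q2). Qed.

Lemma eps10 : 10 * eps = 2 * (1 - cos ell).
Proof. by rewrite /eps; field. Qed.

Lemma zeta_neq0 : zeta != 0.
Proof.
apply/eqP => z0; have := @omNM R q 1.
by rewrite z0 mul0r => /eqP; rewrite eq_sym oner_eq0.
Qed.

Lemma act0 y : act 0 y = y.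
Proof. by apply: val_inj; rewrite val_act expr0 mul1mx. Qed.

(** [repr] picks points of the orbits without any continuity, so nearness is measured up to a deck
    transformation. *)
Definition close (e : R) u v := exists k, sqdist (repr u : sphere R n) (act k (repr v)) < e.

Lemma close_refl u : close eps u u.
Proof. by exists 0%N; rewrite act0 sqdist0 eps_gt0. Qed.

Lemma act_inv k : exists j, forall y, act j (act k y) = y.
Proof.
exists (k * q - k)%N => y; rewrite actD subnK; last by rewrite leq_pmulr // (leq_trans _ q2).
by rewrite act_dvd // dvdn_mull.
Qed.

Lemma closeC e u v : close e u v -> close e v u.
Proof.
move=> [k hk]; have [j hj] := act_inv k; exists j.
by rewrite -[X in sqdist X _]hj sqdist_act sqdistC.
Qed.

Lemma close_trans (e : R) u v w : close e u v -> close e v w -> close (4 * e) u w.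
Proof.
move=> [j hj] [k hk]; exists (j + k)%N; rewrite -actD.
apply: (le_lt_trans (sqdist_triangle _ (act j (repr v)) _)); rewrite sqdist_act; lra.
Qed.

Lemma continuous_dot (a : vec) : continuous (dot a).
Proof.
have H (r : seq 'I_N) : continuous (fun y : vec => \sum_(j <- r) a j 0 * y j 0).
  move=> x; elim: r => [|j r IH].
    have -> : (fun y : vec => \sum_(j <- [::]) a j 0 * y j 0) = cst 0 by apply/funext => y; rewrite big_nil.
    exact: cst_continuous.
  rewrite (_ : (fun y : vec => _) = (fun y : vec => a j 0 * y j 0) \+ (fun y : vec => \sum_(i <- r) a i 0 * y i 0)).
    apply: continuousD; last exact: IH.
    by apply: continuousM; [exact: cst_continuous|exact: coord_continuous].
  by apply/funext => y; rewrite big_cons.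
exact: H.
Qed.

Lemma open_close (e : R) u : open [set v | close e u v].
Proof.
suff h : open (proj @^-1` [set v | close e u v]) by exact: h.
have -> : proj @^-1` [set v | close e u v] = \bigcup_(k in @setT nat) [set y | sqdist (repr u) (act k y) < e].
  apply/seteqP; split=> [y /= [k hk]|y [k _ /= hk]].
    have [j ej] := proj_eqP (projK (proj y) : proj (repr (proj y)) = proj y).
    have [i hi] := act_inv j; exists (k + i)%N => //=; by rewrite ej -actD hi.
  have [j ej] := proj_eqP (projK (proj y) : proj (repr (proj y)) = proj y).
  by exists (k + j)%N; rewrite -actD -ej.
apply: bigcup_open => k _.
set a := (lens_generator R q p ^+ k)^T *m val (repr u : sphere R n).
have dE y : sqdist (repr u) (act k y) = 2 - 2 * dot a (val y).
  rewrite sqdistE val_act; congr (2 - 2 * _).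
  have /matrixP/(_ 0 0) := trmx_mulE a (val y); rewrite [X in _ = X]mxE eqxx mulr1n => <-.
  have /matrixP/(_ 0 0) := trmx_mulE (val (repr u : sphere R n)) (lens_generator R q p ^+ k *m val y).
  by rewrite [X in _ = X]mxE eqxx mulr1n => <-; rewrite /a trmx_mul trmxK mulmxA.
have /continuousP h : continuous (fun y : sphere R n => dot a (val y)).
  move=> y; apply: (@continuous_comp _ _ _ (val : sphere R n -> vec)); last exact: continuous_dot.
  exact: initial_continuous.
rewrite (_ : [set y | _] = (fun y : sphere R n => dot a (val y)) @^-1` [set t | (2 - e) / 2 < t]).
  by apply: h; exact: open_gt.
by apply/seteqP; split=> y; rewrite /= dE; move: (dot _ _) => t; lra.
Qed.

Section Cocycle.
Variable kap : lens -> lens -> nat.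
Hypothesis kapP : forall u v, close eps u v -> sqdist (repr u : sphere R n) (act (kap u v) (repr v)) < eps.

(** The transition between nearby fibres of the covering, with values in the roots of unity;
    [trans_mul] is the cocycle condition. *)
Definition trans u v := zeta ^+ kap u v.

Lemma trans_neq0 u v : trans u v != 0.
Proof. by apply: expf_neq0; exact: zeta_neq0. Qed.

Lemma trans_refl u : trans u u = 1.
Proof.
rewrite /trans -[RHS](expr0 zeta); apply/esym.
apply: (close_acts q2 pq); rewrite [X in sqdist X _]act0.
by apply: (lt_trans (kapP (close_refl u))); rewrite -eps10; have := eps_gt0; lra.
Qed.

Lemma trans_mul u v w : close eps u v -> close eps v w -> close eps u w ->
  trans u v * trans v w = trans u w.
Proof.
move=> /kapP uv /kapP vw /kapP uw; rewrite /trans -exprD.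
apply: (@close_acts R n q p q2 pq _ _ (repr w)); rewrite -eps10.
have h1 := sqdist_triangle (act (kap u v + kap v w) (repr w)) (repr u) (act (kap u w) (repr w)).
have h2 := sqdist_triangle (repr u) (act (kap u v) (repr v)) (act (kap u v + kap v w) (repr w)).
rewrite [X in _ <= 2 * X + _]sqdistC in h1; rewrite -{2}actD sqdist_act in h2.
apply: (le_lt_trans h1); lra.
Qed.

Section Grid.
Variables (M : nat) (h : nat -> nat -> lens).
Hypothesis hclose : forall i j i' j', (i <= M)%N -> (j <= M)%N -> (i' <= M)%N -> (j' <= M)%N ->
  (i <= i' <= i.+1)%N -> (j <= j' <= j.+1)%N -> close eps (h i j) (h i' j').

Definition row i m := \prod_(j < m) trans (h i j) (h i j.+1).

Lemma row_step i m : (i < M)%N -> (m <= M)%N ->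
  row i m * trans (h i m) (h i.+1 m) = trans (h i 0%N) (h i.+1 0%N) * row i.+1 m.
Proof.
move=> iM; elim: m => [|m IH] mM; first by rewrite /row !big_ord0 mul1r mulr1.
rewrite /row !big_ord_recr /= -/(row i m) -/(row i.+1 m).
have e1 : trans (h i m) (h i m.+1) * trans (h i m.+1) (h i.+1 m.+1) = trans (h i m) (h i.+1 m.+1).
  by apply: trans_mul; apply: hclose; lia.
have e2 : trans (h i m) (h i.+1 m) * trans (h i.+1 m) (h i.+1 m.+1) = trans (h i m) (h i.+1 m.+1).
  by apply: trans_mul; apply: hclose; lia.
by rewrite -mulrA e1 -e2 mulrA IH ?mulrA // ltnW.
Qed.

(** By [row_step] adjacent rows differ by the transitions at their two ends. On a loop the ends
    coincide, and since the values commute the two transitions cancel. *)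
Lemma row_const : (forall i, (i <= M)%N -> h i 0%N = h i M) -> row 0 M = row M M.
Proof.
move=> per; have st i : (i < M)%N -> row i M = row i.+1 M.
  move=> iM; apply: (mulIf (trans_neq0 (h i M) (h i.+1 M))); rewrite row_step // mulrC.
  by rewrite (per i) ?(per i.+1) // ltnW.
have H i : (i <= M)%N -> row 0 M = row i M.
  elim: i => [|i IH] iM; first by [].
  rewrite (IH (ltnW iM)); exact: st.
exact: H.
Qed.
End Grid.
End Cocycle.

Lemma dot_circle (s t : R) : dot (@circle R n s) (circle t) = cos (s - t).
Proof.
rewrite dot_zc [LHS](bigD1 ord0 isT) [X in _ + X = _]big1 ?addr0 => [|i i0].
  by rewrite !zc_circle eqxx expi_conj -expiD.
by rewrite zc_circle (negPf i0) mul0r.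
Qed.

(** A Lebesgue number of the compact rectangle. Nearness within [eps / 4] to a common centre becomes
    nearness within [eps] by [close_trans]. *)
Lemma mesh (H : R * R -> lens) (l : R) : {within `[0, 1] `*` `[0, l], continuous H} ->
  exists2 e : R, 0 < e & forall x x', (`[0, 1] `*` `[0, l]) x -> (`[0, 1] `*` `[0, l]) x' ->
    `|x.1 - x'.1| < e -> `|x.2 - x'.2| < e -> close eps (H x) (H x').
Proof.
set K := (_ `*` _) => /subspace_continuousP cH.
have cK : compact K by apply: compact_setX; exact: segment_compact.
have e4 : 0 < eps / 4 by rewrite divr_gt0 // eps_gt0.
pose P (e : R) (x : R * R) := K x -> forall x', K x' -> ball x e x' -> close eps (H x) (H x').
have : \forall e \near 0^'+, K `<=` P e.
  move/compact_near_coveringP : cK; apply => x Kx.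
  have oW : open_nbhs (H x) [set v | close (eps / 4) (H x) v].
    split; first exact: open_close.
    by exists 0%N; rewrite act0 sqdist0.
  have hn : nbhs x [set t | K t -> close (eps / 4) (H x) (H t)] := cH x Kx _ (open_nbhs_nbhs oW).
  move/nbhs_ballP : hn => [r /= r0 hr].
  have r2 : 0 < r / 2 by exact: divr_gt0.
  exists (ball x (r / 2), [set e | e < r / 2]).
    by split; [exact: nbhsx_ballx | exact: nbhs_right_lt].
  move=> [x' e] /= [bx' er] Kx' x'' Kx'' bx''.
  have h1 : close (eps / 4) (H x) (H x').
    by apply: hr Kx'; apply: le_ball bx'; rewrite ler_pdivrMr // ler_peMr // ?ler1n // ltW.
  have h2 : close (eps / 4) (H x) (H x'').
    apply: hr Kx''; rewrite [r]splitr; apply: ball_triangle bx' _.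
    by apply: le_ball bx''; exact: ltW.
  by have := close_trans (closeC h1) h2; congr close; rewrite mulrC divfK.
move=> [e0 /= e00 he]; exists (e0 / 2); first exact: divr_gt0.
move=> x x' Kx Kx' h1 h2; apply: (he (e0 / 2)) => //=.
- by rewrite sub0r normrN ger0_norm ?divr_ge0 ?ltW // ltr_pdivrMr // ltr_pMr // ltr1n.
- exact: divr_gt0.
Qed.

Theorem circle_noncontractible : ~ contractible_loop (proj \o @great_circle R n) ell.
Proof.
move=> [H [y0 [cH H0 H1 Hper]]].
have [e e0 he] := mesh cH.
have ell0 := ell_gt0 (R := R) q2.
have [d d0 hd] : exists2 d : R, 0 < d & forall x, `|x| < d -> 1 - cos x < eps / 2.
  have /cvgrPdist_lt /(_ (eps / 2)) h := @continuous_cos R 0.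
  have [|d /= d0 hd] := h; first by rewrite divr_gt0 // eps_gt0.
  exists d => // x xd; have := hd x; rewrite /= sub0r normrN cos0 => /(_ xd).
  by move=> /(le_lt_trans (ler_norm _)).
pose mn := Num.min (Num.min e d) (Num.min e d / ell).
have mn0 : 0 < mn by rewrite lt_min divr_gt0 ?lt_min ?e0 ?d0.
(* Fine enough for [mesh] in both variables and for consecutive points of the circle to be closer
   than [d]. *)
pose M := (Num.bound mn^-1).+1.
have M0 : 0 < M%:R :> R by rewrite ltr0n.
have Mmn : M%:R^-1 < mn.
  rewrite -[ltRHS]invrK ltf_pV2 ?posrE ?invr_gt0 //.
  apply: lt_trans (archi_boundP _) _; first by rewrite invr_ge0 ltW.
  by rewrite ltr_nat.
have s1 : M%:R^-1 < e /\ M%:R^-1 * ell < Num.min e d.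
  move: Mmn; rewrite lt_min => /andP[h1 h2]; split; first by move: h1; rewrite lt_min => /andP[].
  by rewrite -ltr_pdivlMr.
have [s1e s2ed] := s1; move: (s2ed); rewrite lt_min => /andP[s2e s2d].
pose pt (i j : nat) : R * R := (i%:R / M%:R, j%:R / M%:R * ell).
pose h i j := H (pt i j).
have frac k : (k <= M)%N -> 0 <= k%:R / M%:R :> R /\ k%:R / M%:R <= 1 :> R.
  by move=> kM; rewrite divr_ge0 // ler_pdivrMr // mul1r ler_nat.
have in_ell k : (k <= M)%N -> 0 <= k%:R / M%:R * ell <= ell.
  move=> /frac[c g]; rewrite mulr_ge0 ?(ltW ell0) //= ler_piMl // ltW //.
have inK i j : (i <= M)%N -> (j <= M)%N -> (`[0, 1] `*` `[0, ell]) (pt i j).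
  move=> iM jM; split; rewrite /= in_itv /=; last exact: in_ell.
  by have [-> ->] := frac i iM.
have step (i i' : nat) : (i <= i' <= i.+1)%N -> `|i%:R / M%:R - i'%:R / M%:R| <= M%:R^-1 :> R.
  move=> /andP[]; rewrite [(i' <= _)%N]leq_eqVlt ltnS => i1 /orP[/eqP ->|i2].
    by rewrite -mulrBl -natr1 opprD addrA subrr sub0r mulN1r normrN ger0_norm ?invr_ge0.
  have -> : i' = i by apply/eqP; rewrite eqn_leq i1 i2.
  by rewrite subrr normr0 invr_ge0.
have hclose i j i' j' : (i <= M)%N -> (j <= M)%N -> (i' <= M)%N -> (j' <= M)%N ->
    (i <= i' <= i.+1)%N -> (j <= j' <= j.+1)%N -> close eps (h i j) (h i' j').
  move=> a1 a2 a3 a4 a5 a6; apply: he; [exact: inK|exact: inK|exact: le_lt_trans (step _ _ a5) s1e|].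
  rewrite /= -mulrBl normrM (ger0_norm (ltW ell0)); apply: le_lt_trans s2e.
  by rewrite ler_wpM2r ?(ltW ell0) // step.
have [kap kapP] : exists kap : lens -> lens -> nat, forall u v, close eps u v ->
    sqdist (repr u : sphere R n) (act (kap u v) (repr v)) < eps.
  have ex (uv : lens * lens) : exists k, close eps uv.1 uv.2 ->
      sqdist (repr uv.1 : sphere R n) (act k (repr uv.2)) < eps.
    by have [[k hk]|nk] := pselect (close eps uv.1 uv.2); [exists k | exists 0%N].
  have [f hf] := choice ex.
  by exists (fun u v => f (u, v)) => u v; exact: (hf (u, v)).
(* The last row is constant because the homotopy ends at a point. *)
have rE : row kap h 0 M = 1.
  rewrite (row_const kapP hclose) => [|i iM].
    rewrite /row big1 // => j _; rewrite /h /pt (divff (lt0r_neq0 M0)).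
    by rewrite !H1 ?trans_refl // in_ell // ltnW.
  by rewrite /h /pt (divff (lt0r_neq0 M0)) mul0r mul0r mul1r; apply: Hper; have [] := frac i iM => -> ->.
pose th j : R := j%:R / M%:R * ell.
have lift j : exists m, (repr (proj (great_circle (th j))) : sphere R n) = act m (great_circle (th j)).
  by apply: proj_eqP; rewrite projK.
have [m hm] := choice lift.
have hc j : (j <= M)%N -> h 0%N j = proj (great_circle (th j)).
  by move=> jM; rewrite /h /pt mul0r H0 ?in_ell.
have th_step j : sqdist (great_circle (th j)) (great_circle (th j.+1) : sphere R n) < eps.
  have -> : sqdist (great_circle (th j)) (great_circle (th j.+1) : sphere R n) = 2 * (1 - cos (th j - th j.+1)).
    by rewrite sqdistE [dot _ _]dot_circle mulrBr mulr1.
  rewrite mulrC -ltr_pdivlMr //; apply: hd; apply: le_lt_trans s2d.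
  by rewrite /th -mulrBl normrM (ger0_norm (ltW ell0)) ler_wpM2r ?(ltW ell0) // step // leqnn leqnSn.
(* [m j] compares the chosen representative with the lift along the great circle, and its powers of
   [zeta] trivialize the transitions along the first row. *)
have rowE j : (j <= M)%N -> row kap h 0 j * zeta ^+ m j = zeta ^+ m 0%N.
  elim: j => [|j IH] jM; first by rewrite /row big_ord0 mul1r.
  rewrite /row big_ord_recr /= -/(row kap h 0 j) -mulrA.
  rewrite -(IH (ltnW jM)); congr (_ * _).
  rewrite /trans -exprD !hc //; last exact: ltnW.
  have hcl : close eps (proj (great_circle (th j))) (proj (great_circle (th j.+1))).
    by rewrite -!hc //; [apply: hclose => //; rewrite ?leqnSn ?leqnn // ltnW|exact: ltnW].
  have := kapP _ _ hcl; rewrite !hm actD; move: (kap _ _) => k hk.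
  apply: (@close_acts R n q p q2 pq _ _ (great_circle (th j.+1))); rewrite -eps10.
  have h1 := sqdist_triangle (act (k + m j.+1) (great_circle (th j.+1))) (act (m j) (great_circle (th j)))
    (act (m j) (great_circle (th j.+1)) : sphere R n).
  rewrite sqdist_act [X in _ <= 2 * X + _]sqdistC in h1; have := th_step j; have := eps_gt0.
  by move: h1 hk; lra.
have := rowE M (leqnn M); rewrite rE mul1r => e1.
have thM : th M = th 0%N + ell by rewrite /th divff ?gt_eqF // mul0r mul0r add0r mul1r.
(* The lift ends at the generator applied to its start, so the exponents at the two ends differ by
   one, which contradicts the trivial holonomy of the row. *)
have e2 : act (m M + 1) (great_circle (th 0%N)) = act (m 0%N) (great_circle (th 0%N)) :> sphere R n.
  by rewrite -actD (act1_circle q2 p1) -thM -!hm thM -(act1_circle q2 p1) proj_act.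
have : zeta ^+ (m M + 1) = zeta ^+ m 0%N.
  apply: (@close_acts R n q p q2 pq _ _ (great_circle (th 0%N))); rewrite e2 sqdist0 -eps10.
  by have := eps_gt0; lra.
rewrite exprD e1 expr1 => e3; have z0 : zeta ^+ m 0%N != 0 by apply: expf_neq0; exact: zeta_neq0.
have : zeta = 1 by apply: (mulfI z0); rewrite e3 mulr1.
by move/(congr1 (@complex.Re R)); rewrite Re_om1 => ce; have := cos_ell_lt1 (R := R) q2; rewrite ce ltxx.
Qed.

Theorem systole_ell : is_systole q p ell.
Proof.
split; last by move=> l [c cg _]; exact: closed_geodesic_ge cg.
by exists (proj \o great_circle); [exact: closed_circle|exact: circle_noncontractible].
Qed.

End Noncontractible.

Theorem theorem4 (R : realType) (n q : nat) (p : 'I_n.+1 -> int)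
    (q_gt2 : (2 < q)%N) (p1 : p ord0 = 1)
    (p_coprime : forall i, coprimez (p i) q%:Z)
    (lam : nat -> R) (lam_spectrum : is_spectrum q p lam) :
  exists2 ell : R, is_systole q p ell & singular_support (wave_trace lam) ell.
Proof.
exists (2 * trigo.pi / q%:R); first exact: systole_ell.
exact: wave_trace_singular p_coprime lam_spectrum.
Qed.
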